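(* Let $n\ge1$, $s\in(0,1)$, and let $A$ be a Young function with $A\in\Delta_2$ satisfying $$\int^\infty \left(\frac{t}{A(t)}\right)^{\frac{s}{n-s}}\,dt<\infty .$$ Let $\Omega\subset\mathbb{R}^n$ be an open bounded domain with inner radius $r_\Omega$, and let $\omega\in L^1(\mathbb{R}^n)$ be a positive weight function. For $\alpha>0$ let $\lambda_{1,\alpha}^s$ be the critical value and $\Lambda_{1,\alpha}^s$ the eigenvalue defined in the context, and let $\alpha_0>0$ be the unique number satisfying $\alpha_0\lambda_{1,\alpha_0}^s=r_\Omega^n$. Then there exists a positive constant $C=C(n,s,A)$ (depending only on $n,s,A$) such that for $\alpha>0$, assuming that $i_0(A)>\frac ns$ when $\alpha\le\alpha_0$, or that $i_\infty(A)>\frac ns$ when $\alpha>\alpha_0$, one has $$\frac{C}{p_A\,\|\omega\|_{L^1(\Omega)}}\,\frac{r_\Omega^n}{M_A(r_\Omega^s)}\le\Lambda_{1,\alpha}^s,\qquad\text{where } p_A=\sup_{\beta>0}\frac{a(\beta)\beta}{A(\beta)} .$$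
   Context: A Young function is a convex, non-constant, left-continuous function $A\colon[0,\infty)\to[0,\infty]$ with $A(0)=0$; it is written $A(t)=\int_0^t a(\tau)\,d\tau$ with $a=A'$ non-decreasing and left-continuous. $\tilde A(t)=\sup_{\tau\ge0}\{\tau t-A(\tau)\}$ is its complementary function. $A\in\Delta_2$ means that there exists $c\ge2$ such that $A(2t)\le cA(t)$ for all $t>0$. The notation $\int^\infty$ refers to convergence of the integral at infinity. Inner radius: $r_\Omega=\max\{\operatorname{dist}(x,\partial\Omega)\colon x\in\Omega\}$. Matuszewska-Orlicz functions and indices (values in $[0,\infty]$ allowed): $M_A(t)=\sup_{\beta>0}\frac{A(\beta t)}{A(\beta)}$, $M_0(t,A)=\liminf_{\beta\to0^+}\frac{A(\beta t)}{A(\beta)}$, $M_\infty(t,A)=\liminf_{\beta\to\infty}\frac{A(\beta t)}{A(\beta)}$, $i_0(A)=\lim_{t\to\infty}\frac{\log M_0(t,A)}{\log t}$, $i_\infty(A)=\lim_{t\to\infty}\frac{\log M_\infty(t,A)}{\log t}$. $D^su(x,y)=\frac{u(x)-u(y)}{|x-y|^s}$ and $d\nu_n=|x-y|^{-n}\,dx\,dy$ on $\mathbb{R}^{2n}$; functions on $\Omega$ are extended by zero to $\mathbb{R}^n$. $L^A$ is the Orlicz space (functions $u$ with $\int A(|u|/k)<\infty$ for some $k>0$) and $E^A$ its subspace of functions with $\int A(|u|/k)<\infty$ for all $k>0$. $W^sL^A(\mathbb{R}^n)=\{u\in L^A(\mathbb{R}^n)\colon D^su\in L^A(\mathbb{R}^{2n},d\nu_n)\}$,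 $W^sE^A(\mathbb{R}^n)$ is defined likewise with $E^A$ in place of $L^A$, and $W^s_0L^A(\Omega)$ is the closure of $C_c^\infty(\Omega)$ in the topology $\sigma(W^sL^A(\mathbb{R}^n),W^sE^{\tilde A}(\mathbb{R}^n))$. Critical value: $\lambda_{1,\alpha}^s=\inf\{\frac1\alpha\iint_{\mathbb{R}^{2n}}A(|D^su|)\,d\nu_n\colon u\in C_c^\infty(\Omega),\ \int_\Omega\omega A(|u|)\,dx=\alpha\}$. It is known that there is a minimizer $u_\alpha^s\in W^s_0L^A(\Omega)$, i.e. $\int_\Omega\omega A(|u_\alpha^s|)\,dx=\alpha$ and $\iint_{\mathbb{R}^{2n}}A(|D^su_\alpha^s|)\,d\nu_n=\alpha\lambda_{1,\alpha}^s$, and that this minimizer is an eigenfunction: $\Lambda_{1,\alpha}^s$ denotes the corresponding eigenvalue, i.e. the number such that for all $v\in C_c^\infty(\Omega)$ $$\iint_{\mathbb{R}^{2n}}a(|D^su_\alpha^s|)\frac{D^su_\alpha^s\,D^sv}{|D^su_\alpha^s|}\,d\nu_n=\Lambda_{1,\alpha}^s\int_\Omega\omega\,a(|u_\alpha^s|)\frac{u_\alpha^s\,v}{|u_\alpha^s|}\,dx .$$ It is also known that, under the first set of hypotheses on $A$, $\Omega$, $\omega$, there is a unique $\alpha_0>0$ with $\alpha_0\lambda_{1,\alpha_0}^s=r_\Omega^n$. *)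

(* Defs.v *)
From HB Require Import structures.
From mathcomp Require Import all_boot all_order all_algebra.
From mathcomp Require Import all_classical all_reals all_analysis.
From mathcomp Require Import measurable_realfun.
Set Implicit Arguments.
Unset Strict Implicit.
Unset Printing Implicit Defensive.
Import Order.TTheory GRing.Theory Num.Theory.
Import numFieldNormedType.Exports.
Local Open Scope classical_set_scope.
Local Open Scope ring_scope.

Definition rV_display : measure_display.
Proof. exact: default_measure_display. Qed.

Section rV_measurable.
Context {R : realType} (n : nat).

Definition rV_coord (i : 'I_n) (x : 'rV[R]_n) : measurableTypeR R := x ord0 i.

Let rV_set0 : g_sigma_preimage rV_coord set0.
Proof. exact: sigma_algebra0. Qed.

Let rV_setC A : g_sigma_preimage rV_coord A -> g_sigma_preimage rV_coord (~` A).
Proof. exact: sigma_algebraC. Qed.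

Let rV_bigcup (F : (set 'rV[R]_n)^nat) :
  (forall i, g_sigma_preimage rV_coord (F i)) ->
  g_sigma_preimage rV_coord (\bigcup_i (F i)).
Proof. exact: sigma_algebra_bigcup. Qed.

(* The sigma-algebra generated by the coordinates, i.e. the Borel one. *)
HB.instance Definition _ := @isMeasurable.Build rV_display
  'rV[R]_n (g_sigma_preimage rV_coord) rV_set0 rV_setC rV_bigcup.

End rV_measurable.

Section rV_measurable_theory.
Context {R : realType}.

Lemma measurable_rV_coord n (i : 'I_n) :
  measurable_fun [set: 'rV[R]_n] (@rV_coord R n i).
Proof.
move=> _ Y mY; rewrite setTI; apply: sub_sigma_algebra => /=.
rewrite -bigcup_seq/=; exists i => /=; first by rewrite mem_index_enum.
by exists Y => //; rewrite setTI.
Qed.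

Lemma measurable_fun_rVP d (T : measurableType d) n (f : T -> 'rV[R]_n) :
  (forall i, measurable_fun setT (@rV_coord R n i \o f)) ->
  measurable_fun setT f.
Proof.
move=> mf.
suff H : g_sigma_preimage (fun i => @rV_coord R n i \o f)
    `<=` measurable.
  move: H; rewrite g_sigma_preimage_comp => H _ A mA.
  by apply: H; exists A.
apply: smallest_sub; first exact: sigma_algebra_measurable.
case: n => [|n] in f mf *; first by rewrite big_ord0.
rewrite -bigcup_mkord_ord; apply: bigcup_sub => i Ii.
by move=> A [B mB <-]; exact: mf.
Qed.

Lemma coord_rV_cons n (p : R * 'rV[R]_n) (i : 'I_n.+1) :
  row_mx (const_mx p.1 : 'rV_1) p.2 ord0 i =
  if unlift ord0 i is Some j then p.2 ord0 j else p.1.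
Proof.
rewrite mxE; case: unliftP => [j|] ->.
  case: splitP => [k /= |k /=]; first by rewrite ord1.
  rewrite /bump/= add1n => -[jk]; congr (p.2 _ _); exact/val_inj.
case: splitP => [k _|k //]; by rewrite mxE.
Qed.

Definition rV_cons n (p : measurableTypeR R * 'rV[R]_n) : 'rV[R]_n.+1 :=
  row_mx (const_mx (p.1 : R) : 'rV_1) p.2.

Definition rV_uncons n (x : 'rV[R]_n.+1) : measurableTypeR R * 'rV[R]_n :=
  (x ord0 ord0, \row_j x ord0 (lift ord0 j)).

Lemma rV_consK n : cancel (@rV_cons n) (@rV_uncons n).
Proof.
move=> [x y]; rewrite /rV_uncons /rV_cons; congr pair.
  by rewrite coord_rV_cons unlift_none.
by apply/rowP => j; rewrite mxE coord_rV_cons liftK.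
Qed.

Lemma measurable_rV_cons n : measurable_fun setT (@rV_cons n).
Proof.
apply: measurable_fun_rVP => i.
rewrite (_ : _ \o _ = fun p => if unlift ord0 i is Some j
    then rV_coord j p.2 else p.1); last first.
  by apply/funext => p /=; rewrite /rV_coord coord_rV_cons.
case: unliftP => [j|] _; last exact: measurable_fst.
by apply: (@measurableT_comp _ _ _ _ _ _ (rV_coord j)) => //;
  exact: measurable_rV_coord.
Qed.

Lemma measurable_rV_uncons n : measurable_fun setT (@rV_uncons n).
Proof.
apply/measurable_fun_pairP; split.
  exact: (@measurable_rV_coord n.+1 ord0).
apply: measurable_fun_rVP => i.
rewrite (_ : _ \o _ = rV_coord (lift ord0 i)); last first.
  by apply/funext => p /=; rewrite /rV_coord mxE.
exact: measurable_rV_coord.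
Qed.

End rV_measurable_theory.

Lemma product_sigma_finite d1 d2 (T1 : measurableType d1)
    (T2 : measurableType d2) (R : realType)
    (m1 : {sigma_finite_measure set T1 -> \bar R})
    (m2 : {sigma_finite_measure set T2 -> \bar R}) :
  sigma_finite setT (m1 \x m2)%E.
Proof.
have /sigma_finiteP[F [TF ndF Foo]] := sigma_finiteT m1.
have /sigma_finiteP[G [TG ndG Goo]] := sigma_finiteT m2.
exists (fun n => F n `*` G n).
  rewrite -setXTT TF TG predeqE => -[x y]; split.
    move=> [/= [n _ Fnx] [k _ Gky]]; exists (maxn n k) => //; split.
    - by move: x Fnx; exact/subsetPset/ndF/leq_maxl.
    - by move: y Gky; exact/subsetPset/ndG/leq_maxr.
  by move=> [n _ []/= ? ?]; split; exists n.
move=> k; have [? ?] := Foo k; have [? ?] := Goo k.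
split; first exact: measurableX.
by rewrite product_measure1E// lte_mul_pinfty// ge0_fin_numE.
Qed.

Section rV_lebesgue_succ.
Context {R : realType} (n : nat)
  (m : {sigma_finite_measure set 'rV[R]_n -> \bar R}).
Local Open Scope ereal_scope.

Definition rV_lebesgueS : set 'rV[R]_n.+1 -> \bar R :=
  pushforward (@lebesgue_measure R \x m) (@rV_cons R n).

Let rV_lebesgueS0 : rV_lebesgueS set0 = 0.
Proof. by rewrite /rV_lebesgueS /pushforward preimage_set0 measure0. Qed.

Let rV_lebesgueS_ge0 A : 0 <= rV_lebesgueS A.
Proof. by rewrite /rV_lebesgueS /pushforward; exact: measure_ge0. Qed.

Let rV_lebesgueS_sigma_additive : semi_sigma_additive rV_lebesgueS.
Proof.
move=> F mF tF mUF; rewrite /rV_lebesgueS /pushforward preimage_bigcup.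
have mpre B : measurable B -> measurable (@rV_cons R n @^-1` B).
  by move=> mB; rewrite -[X in measurable X]setTI; exact: measurable_rV_cons.
apply: measure_semi_sigma_additive.
- by move=> k; exact: mpre.
- apply/trivIsetP => /= i j _ _ ij; rewrite -preimage_setI.
  by move/trivIsetP : tF => /(_ _ _ _ _ ij) ->//; rewrite preimage_set0.
- by rewrite -preimage_bigcup; exact: mpre.
Qed.

HB.instance Definition _ := isMeasure.Build _ _ _ rV_lebesgueS
  rV_lebesgueS0 rV_lebesgueS_ge0 rV_lebesgueS_sigma_additive.

Let rV_lebesgueS_sigma_finite : sigma_finite setT rV_lebesgueS.
Proof.
have [F TF mF] : sigma_finite setT (@lebesgue_measure R \x m).
  exact: product_sigma_finite.
exists (fun k => @rV_uncons R n @^-1` F k).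
  by rewrite -preimage_bigcup -TF preimage_setT.
move=> k; have [mFk Fkoo] := mF k; split.
  by rewrite -[X in measurable X]setTI; exact: measurable_rV_uncons.
rewrite /rV_lebesgueS /pushforward -comp_preimage.
by rewrite (_ : _ \o _ = id) ?preimage_id//; apply/funext => x; exact: rV_consK.
Qed.

HB.instance Definition _ := Measure_isSigmaFinite.Build _ _ _
  rV_lebesgueS rV_lebesgueS_sigma_finite.

End rV_lebesgue_succ.

(* Lebesgue measure on R^n: the image of the n-fold product of the Lebesgue
   measure on R. *)
Fixpoint rV_lebesgue {R : realType} (n : nat) :
    {sigma_finite_measure set 'rV[R]_n -> \bar R} :=
  if n is k.+1 then rV_lebesgueS (rV_lebesgue k) else @dirac _ 'rV[R]_0 0 R.

(* The library norm on 'rV[R]_n is the sup norm, not the Euclidean one. *)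
Definition enorm {R : realType} n (x : 'rV[R]_n) : R :=
  Num.sqrt (\sum_i x ord0 i ^+ 2).

Lemma measurable_enorm {R : realType} n :
  measurable_fun setT (@enorm R n : 'rV[R]_n -> R).
Proof.
apply: (@measurableT_comp _ _ _ _ _ _ (@Num.sqrt R)).
  by apply: continuous_measurable_fun; exact: sqrt_continuous.
apply: measurable_sum => i; apply: measurable_funX.
exact: measurable_rV_coord.
Qed.

Definition boundary {R : realType} n (Om : set 'rV[R]_n) : set 'rV[R]_n :=
  closure Om `\` interior Om.

Definition edistance {R : realType} n (x : 'rV[R]_n) (D : set 'rV[R]_n) : R :=
  inf [set enorm (x - y) | y in D].

(* For Om nonempty, open and bounded the supremum is attained, so it is the
   maximum of the distance to the boundary. *)
Definition inner_radius {R : realType} n (Om : set 'rV[R]_n) : R :=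
  sup [set edistance x (boundary Om) | x in Om].

Definition partial {R : realType} n (i : 'I_n) (u : 'rV[R]_n -> R) :
  'rV[R]_n -> R := fun x => 'D_(delta_mx ord0 i) u x.

(* l = [::] gives u itself, a longer l an iterated partial derivative. *)
Definition smooth {R : realType} n (u : 'rV[R]_n -> R) : Prop :=
  forall l : seq 'I_n, let w := foldr (@partial R n) u l in
    continuous w /\ forall i x, derivable w x (delta_mx ord0 i).

Definition test_functions {R : realType} n (Om : set 'rV[R]_n) :
    set ('rV[R]_n -> R) :=
  [set u | [/\ smooth u, compact (closure [set x | u x != 0]) &
               closure [set x | u x != 0] `<=` Om]].

(* A Young function on [0, oo) is represented by a function on R, of which only
   the values on [0, oo) are used. *)

Section young.
Context {R : realType}.
Implicit Types (A a : R -> \bar R) (t : R).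
Local Open Scope ereal_scope.

Definition young_function A : Prop :=
  [/\ A 0%R = 0,
      (forall t, (0 <= t)%R -> 0 <= A t),
      (forall x y th : R, (0 <= x)%R -> (0 <= y)%R -> (0 <= th <= 1)%R ->
         A (th * x + (1 - th) * y)%R <= th%:E * A x + (1 - th)%:E * A y),
      (exists t, (0 <= t)%R /\ A t != 0) &
      (forall t, (0 < t)%R -> A x @[x --> t^'-] --> A t)].

(* This determines a on (0, oo); a 0 is irrelevant. *)
Definition young_derivative A a : Prop :=
  [/\ (forall t, (0 <= t)%R -> 0 <= a t),
      (forall x y : R, (0 <= x <= y)%R -> a x <= a y),
      (forall t, (0 < t)%R -> a x @[x --> t^'-] --> a t) &
      (forall t, (0 <= t)%R ->
         A t = \int[lebesgue_measure]_(x in `[0%R, t]) a x)].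

Definition Delta2 A : Prop :=
  exists2 c : R, (2 <= c)%R &
    forall t, (0 < t)%R -> A (2 * t)%R <= c%:E * A t.

Definition complementary A : R -> \bar R := fun t =>
  ereal_sup [set (tau * t)%:E - A tau | tau in [set tau : R | (0 <= tau)%R]].

Definition growth_condition A (p : R) : Prop :=
  exists2 t0 : R, (0 < t0)%R &
    \int[lebesgue_measure]_(t in `[t0, +oo[) poweR (t%:E / A t) p < +oo.

Definition p_index A a : \bar R :=
  ereal_sup [set a b * b%:E / A b | b in [set b : R | (0 < b)%R]].

Definition M_sup A t : \bar R :=
  ereal_sup [set A (b * t)%R / A b | b in [set b : R | (0 < b)%R]].

Definition M_zero A t : \bar R :=
  limf_einf (fun b : R => A (b * t)%R / A b) (0%R : R)^'+.

Definition M_infty A t : \bar R :=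
  limf_einf (fun b : R => A (b * t)%R / A b) (pinfty_nbhs R).

Definition i_zero A : \bar R :=
  lim ((lne (M_zero A t) / (ln t)%:E) @[t --> +oo%R]).

Definition i_infty A : \bar R :=
  lim ((lne (M_infty A t) / (ln t)%:E) @[t --> +oo%R]).

End young.

Section nu.
Context {R : realType} (n : nat).
Local Open Scope ereal_scope.

(* On the diagonal, which is a null set, the value is 0 ^ (- n) = 0 for n > 0. *)
Definition nu_density (z : 'rV[R]_n * 'rV[R]_n) : R :=
  (enorm (z.1 - z.2)%R `^ (- n%:R))%R.

Lemma measurable_nu_density : measurable_fun setT nu_density.
Proof.
apply: (@measurableT_comp _ _ _ _ _ _ (@powR R ^~ (- n%:R)%R)).
  exact: measurable_powR.
apply: (@measurableT_comp _ _ _ _ _ _ (@enorm R n)).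
  exact: measurable_enorm.
apply: measurable_fun_rVP => i.
rewrite (_ : _ \o _ = fun z => (rV_coord i z.1 - rV_coord i z.2)%R); last first.
  by apply/funext => z; rewrite /= /rV_coord !mxE.
by apply: measurable_funB;
  apply: (@measurableT_comp _ _ _ _ _ _ (rV_coord i)) => //;
  exact: measurable_rV_coord.
Qed.

Definition nu (B : set ('rV[R]_n * 'rV[R]_n)) : \bar R :=
  \int[@rV_lebesgue R n \x @rV_lebesgue R n]_(z in B) (nu_density z)%:E.

Let nu0 : nu set0 = 0.
Proof. exact: integral_set0. Qed.

Let nu_ge0 B : 0 <= nu B.
Proof. by apply: integral_ge0 => z _; rewrite lee_fin powR_ge0. Qed.

Let nu_sigma_additive : semi_sigma_additive nu.
Proof.
move=> /= F mF tF mUF; rewrite /nu; apply: cvg_toP.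
  apply: ereal_nondecreasing_is_cvgn => k m km.
  by apply: lee_sum_nneg_natr => // *; exact: nu_ge0.
rewrite ge0_integral_bigcup//=.
- by apply/measurable_funTS/measurableT_comp => //; exact: measurable_nu_density.
- by move=> z _; rewrite lee_fin powR_ge0.
Qed.

HB.instance Definition _ := isMeasure.Build _ _ _ nu
  nu0 nu_ge0 nu_sigma_additive.

End nu.
Arguments nu {R} n.

Section orlicz.
Context d (T : measurableType d) (R : realType).
Variable m : {measure set T -> \bar R}.
Implicit Types (A : R -> \bar R) (f : T -> R).
Local Open Scope ereal_scope.

Definition modular A f : \bar R := \int[m]_x A `|f x|%R.

Definition orlicz_L A : set (T -> R) :=
  [set f : T -> R | measurable_fun setT f /\
    exists2 k : R, (0 < k)%R & modular A (fun x => f x / k)%R < +oo].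

Definition orlicz_E A : set (T -> R) :=
  [set f : T -> R | measurable_fun setT f /\
    forall k : R, (0 < k)%R -> modular A (fun x => f x / k)%R < +oo].

End orlicz.

Section fractional.
Context {R : realType} {n : nat}.
Implicit Types (s al Lam : R) (A a : R -> \bar R) (Om : set 'rV[R]_n)
  (om u v : 'rV[R]_n -> R).

Definition Ds s u (z : 'rV[R]_n * 'rV[R]_n) : R :=
  (u z.1 - u z.2) / enorm (z.1 - z.2) `^ s.

Definition WsL s A : set ('rV[R]_n -> R) :=
  [set u | orlicz_L (rV_lebesgue n) A u /\ orlicz_L (nu n) A (Ds s u)].

Definition WsE s A : set ('rV[R]_n -> R) :=
  [set u | orlicz_E (rV_lebesgue n) A u /\ orlicz_E (nu n) A (Ds s u)].

(* The two spaces are identified with subspaces of products of Orlicz spaces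
   through u |-> (u, D^s u), and the pairing is the one of these products. *)
Definition Ws_pairing s u v : R :=
  (\int[rV_lebesgue n]_x (u x * v x) + \int[nu n]_z (Ds s u z * Ds s v z))%R.

(* The initial topology for this map is sigma(W^s L^A, W^s E^B), where B is the
   complementary function of A. It is put on all functions, but both u and the
   test functions are in W^s L^A in the closure below (for A in Delta2). *)
Definition Ws_eval s A u :
    {ptws {v : 'rV[R]_n -> R | WsE s (complementary A) v} -> R} :=
  fun w => Ws_pairing s u (proj1_sig w).

Definition Ws0 s A Om : set ('rV[R]_n -> R) :=
  WsL s A `&`
  closure (test_functions Om : set (initial_topology (@Ws_eval s A))).

Local Open Scope ereal_scope.

Definition weighted_modular A Om om u : \bar R :=
  \int[rV_lebesgue n]_(x in Om) ((om x)%:E * A `|u x|%R).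

Definition critical_value s A Om om al : \bar R :=
  ereal_inf [set (al^-1)%:E * modular (nu n) A (Ds s u) | u in
    [set u | test_functions Om u /\ weighted_modular A Om om u = al%:E]].

Definition minimizer s A Om om al u : Prop :=
  [/\ Ws0 s A Om u,
      weighted_modular A Om om u = al%:E &
      modular (nu n) A (Ds s u) = al%:E * critical_value s A Om om al].

(* x y / |x| is 0 for x = 0, by the convention 0^-1 = 0. *)
Definition eigenvalue_of s a Om om u Lam : Prop :=
  forall v, test_functions Om v ->
    \int[nu n]_z (a `|Ds s u z|%R * (Ds s u z * Ds s v z / `|Ds s u z|)%:E) =
    Lam%:E * \int[rV_lebesgue n]_(x in Om)
      ((om x)%:E * a `|u x|%R * (u x * v x / `|u x|)%:E).

End fractional.

(* Main.v *)
Require Import Defs.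
From HB Require Import structures.
From mathcomp Require Import all_boot all_order all_algebra.
From mathcomp Require Import all_classical all_reals all_analysis.
From mathcomp Require Import measurable_realfun ring lra zify.
Set Implicit Arguments.
Unset Strict Implicit.
Unset Printing Implicit Defensive.
Import Order.TTheory GRing.Theory Num.Theory.
Import numFieldNormedType.Exports.
Local Open Scope classical_set_scope.
Local Open Scope ring_scope.

(* Delta_2 makes A a finite function B (or identically +oo on (0, oo), which the
   constraint of a minimizer excludes).
   Lower bound for the critical value: averages of a test function v over dyadic
   shells around two points, one of them off Omega, are compared by Jensen's
   inequality, and the increments are summed with the integral
   int min(1, (y t / B t)^q) dt, q = s / (n - s). This Morrey estimate reads
   |v| <= C r^s T when the energy of v is at most B(T) r^n, and the index
   conditions are what keeps C independent of T in the range of T at hand.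
   Elements of W^s_0 vanish off Omega: the same estimate gives a continuous
   representative, and evaluation at a point x0 is the pairing with a kernel w in
   W^s E^{~A}, w = int_0^oo rho(t) gauss_t(. - x0) dt, where rho solves a renewal
   equation (truncated Marchaud derivative of order s). Hence evaluation is
   continuous for the weak topology, and vanishes at x0 outside Omega.
   Eigenvalue versus critical value: the eigenvalue equation is tested with
   mollified truncations of the minimizer, and Fatou's lemma with Young's inequality
   b(t) r <= p B(t) + B(r) gives energy(u) <= Lambda p alpha. *)

Local Notation mEFinP := measurable_EFinP.
Local Notation mcomp := measurableT_comp.
Local Notation mfunM := measurable_funM.
Local Notation mcst := measurable_cst.
Local Notation emfunM := emeasurable_funM.
Local Notation mfunTS := measurable_funTS.
Local Notation mfst := measurable_fst.
Local Notation msnd := measurable_snd.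
Local Notation mid := measurable_id.
Local Notation mfunB := measurable_funB.
Local Notation mfunD := measurable_funD.
Local Notation emfunD := emeasurable_funD.
Local Notation mpowR := measurable_powR.
Local Notation mtonF := measurable_fun_fubini_tonelli_F.
Local Notation mtonG := measurable_fun_fubini_tonelli_G.
Local Notation intZlE := ge0_integralZl_EFin.
Local Notation intZl := ge0_integralZl.
Local Notation intZr := ge0_integralZr.
Local Notation le_int := ge0_le_integral.
Local Notation ae_filt := ae_filter_ringOfSetsType.
Local Notation eqint := eq_integral.
Local Notation int_ge0 := integral_ge0.
Local Notation intD := ge0_integralD.
Local Notation mifT := measurable_fun_ifT.
Local Notation sub_int := ge0_subset_integral.
Local Notation int_mkcond := integral_mkcond.
Local Notation mltr := measurable_fun_ltr.
Local Notation mpair1 := pair1_measurable.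
Local Notation mpair2 := pair2_measurable.
Local Notation mitv := measurable_itv.
Local Notation fin_numE0 := ge0_fin_numE.
Local Notation leb_itvE := lebesgue_measure_itv.
Local Notation ldivMr := ler_pdivrMr.
Local Notation mindic := measurable_indic.
Local Notation mnormr := normr_measurable.
Local Notation int_fin := integrable_fin_num.
Local Notation mTT := measurableT.
Local Notation lee_pM2l := lee_wpmul2l.
Local Notation mfun := (measurable_fun setT).

(** The closure in [Ws0] is for a weak topology and may involve unbounded nets, so neither
    compactness nor a norm estimate survives the limit; only pairings with elements of W^s E^{~A}
    do. Point evaluation must therefore be such a pairing. Since [Ws_pairing] is the bilinear form
    of I plus a multiple of (-Delta)^s, the kernel has to be the Green function of that operator.
    Subordination yields it without Fourier analysis: |z|^(-n-2s) is a mixture of Gaussians with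
    jump density t^(-1-s), the heat semigroup reduces the spatial equation to one in t, and rho is
    the potential density of a killed s-stable subordinator. It is built from the parametrix t^(s-1)
    exp(-t^s/c), whose defect is nonnegative with mass below 1, so that a Neumann series converges.
    That the kernel lies in E^{~A} uses the growth condition once more: like the Morrey estimate, it
    rests on sums of 2^(-s k) t_k with B(t_k) <= 2^((n-s) k) y t_k, and q = s/(n-s) is the exponent
    that links the two dyadic rates. *)

Lemma eq_imp_le d (T : porderType d) (x y : T) : x = y -> (x <= y)%O.
Proof. by move=> ->. Qed.

(** * Affine changes of variables and iterated integrals on R^n *)

Section lebesgue_affine.
Context {R : realType}.
Local Notation mu := (@lebesgue_measure R).
Local Open Scope ereal_scope.

Let aff (a b : R) : measurableTypeR R -> measurableTypeR R :=
 fun x : R => (a * x + b)%R.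

Let measurable_aff a b : mfun (aff a b).
Proof.
apply: mfunD => //; apply: mfunM => //.
Qed.

(** Uniqueness of Lebesgue measure: the rescaled push-forward agrees with it on half-open intervals,
    whose preimages are closed on the other side when a < 0. *)
Lemma lebesgue_measure_affine (a b : R) (A : set (measurableTypeR R)) :
 (a != 0)%R -> measurable A ->
 mu A = (`|a|%R)%:E * mu [set x | A (a * x + b)%R].
Proof.
move=> a0 mA.
have := @lebesgue_measure_unique R
 (mscale (NngNum (normr_ge0 a)) (pushforward mu (aff a b))) _ A mA.
apply.
move=> _ [[c d]] /= cd <-.
rewrite /mscale /pushforward /=.
have [a_gt0|a_lt0|/esym/eqP] := ltgtP 0%R a; last by rewrite (negPf a0).
- rewrite [X in _ * lebesgue_measure X](_ : _ = `](c - b) / a, (d - b) / a]%classic%R); last first.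
 apply/seteqP; split => x /=; rewrite !in_itv /aff/= ltr_pdivrMr// ler_pdivlMr// ?(mulrC x);
 by rewrite ltrBlDr lerBrDr.
 rewrite !leb_itvE/= !lte_fin ltr_pM2r ?invr_gt0// ltrD2r.
 case: ifP => _; last by rewrite mule0.
 by rewrite gtr0_norm// -!EFinB -EFinM -mulrBl opprB addrA subrK mulrC divfK// gt_eqF.
- rewrite [X in _ * lebesgue_measure X](_ : _ = `[(d - b) / a, (c - b) / a[%classic%R); last first.
 apply/seteqP; split => x /=; rewrite !in_itv /aff/= ltr_ndivlMr// ler_ndivrMr// ?(mulrC x);
 by rewrite ltrBlDr lerBrDr andbC.
 rewrite !leb_itvE/= !lte_fin ltr_nM2r ?invr_lt0// ltrD2r.
 case: ifP => _; last by rewrite mule0.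
 by rewrite ltr0_norm// -!EFinB -EFinM; congr (_%:E); field.
Qed.

Lemma integral_affine (a b : R) (f : R -> \bar R) : (a != 0)%R ->
 mfun (f : measurableTypeR R -> _) -> (forall x, 0 <= f x) ->
 \int[mu]_x f x = (`|a|%R)%:E * \int[mu]_x f (a * x + b)%R.
Proof.
move=> a0 mf f0.
have -> : \int[mu]_x f (a * x + b)%R =
 \int[pushforward mu (aff a b)]_x f x.
 by rewrite ge0_integral_pushforward// preimage_setT.
rewrite -(ge0_integral_mscale _ _ (NngNum (normr_ge0 a)))//.
apply: eq_measure_integral => A mA _.
by rewrite /mscale/= /pushforward; exact: lebesgue_measure_affine.
Qed.

End lebesgue_affine.

Section rV_integral.
Context {R : realType}.
Local Open Scope ereal_scope.

Lemma ge0_integral_rV0 (f : 'rV[R]_0 -> \bar R) :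
 \int[rV_lebesgue 0]_x f x = f 0%R.
Proof.
have mf (g : 'rV[R]_0 -> \bar R) : mfun g.
 rewrite (_ : g = cst (g 0%R)); first exact: mcst.
 by apply/funext => x /=; rewrite thinmx0.
rewrite (@integral_dirac _ _ (0 : 'rV[R]_0)%R R setT mTT f (mf f)).
by rewrite diracT mul1e.
Qed.

Lemma ge0_integral_rVS n (f : 'rV[R]_n.+1 -> \bar R) :
 mfun f -> (forall x, 0 <= f x) ->
 \int[rV_lebesgue n.+1]_x f x =
 \int[lebesgue_measure]_a \int[rV_lebesgue n]_y f (rV_cons (a, y)).
Proof.
move=> mf f0 /=.
rewrite ge0_integral_pushforward//; last exact: measurable_rV_cons.
rewrite preimage_setT fubini_tonelli1//; last by move=> x; exact: f0.
by apply: mcomp => //; exact: measurable_rV_cons.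
Qed.

Lemma m_fun_rVcomp n m (g : 'rV[R]_n -> 'rV[R]_m) :
 (forall i, exists (j : 'I_n) (a b : R), forall x, g x ord0 i = a * x ord0 j + b)%R ->
 mfun g.
Proof.
move=> Hg; apply: measurable_fun_rVP => i; have [j [a [b H]]] := Hg i.
rewrite (_ : _ \o _ = (fun x => (a * rV_coord j x + b)%R)); last first.
 by apply/funext => x /=; rewrite /rV_coord H.
by apply: mfunD => //; apply: mfunM => //; exact: measurable_rV_coord.
Qed.

Lemma m_rV_affine n (a : R) (b : 'rV[R]_n) :
 mfun (fun x : 'rV[R]_n => a *: x + b)%R.
Proof.
apply: m_fun_rVcomp => i; exists i, a, (b ord0 i) => x.
by rewrite !mxE.
Qed.

Lemma rV_consE n (p : measurableTypeR R * 'rV[R]_n) i :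
 rV_cons p ord0 i = if unlift ord0 i is Some j then p.2 ord0 j else p.1.
Proof. exact: coord_rV_cons. Qed.

Lemma rV_cons_affine n (a c : R) (b : 'rV[R]_n.+1) (y : 'rV[R]_n) :
 (a *: rV_cons (c : measurableTypeR R, y) + b =
 rV_cons ((a * c + (rV_uncons b).1 : R) : measurableTypeR R, a *: y + (rV_uncons b).2))%R.
Proof.
apply/rowP => i; rewrite mxE [in LHS]mxE !rV_consE.
by case: unliftP => [j|] ->; rewrite ?mxE.
Qed.

Lemma integral_rV_affine n (a : R) (b : 'rV[R]_n) (f : 'rV[R]_n -> \bar R) :
 (a != 0)%R -> mfun f -> (forall x, 0 <= f x) ->
 \int[rV_lebesgue n]_x f x =
 ((`|a| ^+ n)%R)%:E * \int[rV_lebesgue n]_x f (a *: x + b)%R.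
Proof.
elim: n => [|n IH] in b f *; move=> a0 mf f0.
 by rewrite !ge0_integral_rV0 expr0 mul1e thinmx0; congr f; rewrite [RHS]thinmx0.
rewrite !ge0_integral_rVS//; last first.
 by apply: mcomp => //; exact: m_rV_affine.
set b1 := (rV_uncons b).1; set b2 := (rV_uncons b).2.
have mfc : mfun (f \o @rV_cons R n).
 by apply: mcomp => //; exact: measurable_rV_cons.
have H c : \int[rV_lebesgue n]_y f (rV_cons (c, y)) =
 (`|a| ^+ n)%:E * \int[rV_lebesgue n]_y f (rV_cons (c, a *: y + b2)%R).
 apply: IH => //; apply: (mcomp mfc).
 exact: measurable_pair1.
under eqint do rewrite H.
have mG : mfun
 (fun c : measurableTypeR R => \int[rV_lebesgue n]_y f (rV_cons (c, a *: y + b2)%R)).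
 apply: (@mtonF _ _ _ _ _ (rV_lebesgue n)
 (fun p : measurableTypeR R * 'rV_n => f (rV_cons (p.1, a *: p.2 + b2)%R))) => //.
 apply: (mcomp mfc); apply/measurable_fun_pairP; split => //=.
 exact: mfst.
 exact: (mcomp (m_rV_affine a b2) msnd).
rewrite intZlE => [|||//|]; [|exact: mTT|by move=> c _; exact: int_ge0|by rewrite exprn_ge0].
rewrite [X in _ * X = _](integral_affine b1 a0)//; last by move=> x; exact: int_ge0.
rewrite muleA -EFinM -exprSr; congr (_ * _).
apply: eqint => c _; apply: eqint => y _.
by rewrite rV_cons_affine.
Qed.

Lemma integral_rV_prod n (f : 'I_n -> R -> R) :
 (forall i, mfun (f i)) -> (forall i x, (0 <= f i x)%R) ->
 \int[rV_lebesgue n]_x (\prod_i f i (x ord0 i))%:E =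
 \prod_i \int[lebesgue_measure]_x (f i x)%:E.
Proof.
elim: n => [|n IH] in f *; move=> mf f0.
 by rewrite ge0_integral_rV0 !big_ord0.
rewrite ge0_integral_rVS; last 2 first.
- apply/mEFinP; apply: measurable_prod => i _.
 by apply: (mcomp (mf i)); exact: (measurable_rV_coord i).
- by move=> x; rewrite lee_fin prodr_ge0.
rewrite big_ord_recl -IH//.
have mP : mfun (fun y : 'rV[R]_n =>
 (\prod_(i < n) f (lift ord0 i) (y ord0 i))%:E).
 apply/mEFinP; apply: measurable_prod => i _.
 by apply: (mcomp (mf (lift ord0 i))); exact: (measurable_rV_coord i).
rewrite -intZr//; last 2 first.
- by move=> x _; rewrite lee_fin.
- by apply: int_ge0 => y _; rewrite lee_fin prodr_ge0.
 apply: eqint => a _.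
 rewrite -intZl//; [|by move=> y _; rewrite lee_fin prodr_ge0|by rewrite lee_fin].
 apply: eqint => y _; rewrite -EFinM big_ord_recl rV_consE unlift_none.
 congr (_ * _)%:E; apply: eq_bigr => i _.
 by rewrite rV_consE liftK.
by apply/mEFinP; exact: mf.
Qed.

End rV_integral.

(** * Open sets of R^n, and the density of [nu] *)

Section rV_topology.
Context {R : realType} {n : nat}.

Lemma near_rVP (x : 'rV[R]_n) (P : 'rV[R]_n -> Prop) :
 (\forall y \near x, P y) <->
 exists2 e : R, 0 < e & forall y : 'rV[R]_n, (forall i, `|x ord0 i - y ord0 i| < e) -> P y.
Proof.
split.
 move=> /nbhs_ballP[e /= e0 He]; exists e => // y xy.
 by apply: He; split => // i j; rewrite (ord1 i); exact: xy.
move=> [e e0 He]; apply/nbhs_ballP; exists e => //= y [_ xy].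
by apply: He => i; exact: xy.
Qed.

Let box (p : 'rV[rat]_n * nat) : set 'rV[R]_n :=
 [set x | forall i, `|x ord0 i - ratr (p.1 ord0 i)| < p.2.+1%:R^-1].

Let measurable_box p : measurable (box p).
Proof.
have -> : box p = \bigcap_(i in [set: 'I_n])
 (@rV_coord R n i @^-1` [set t | `|t - ratr (p.1 ord0 i)| < p.2.+1%:R^-1]).
 by apply/seteqP; split => [x Hx i _|x Hx i]; [exact: Hx|exact: (Hx i)].
apply: fin_bigcap_measurable => // i _.
rewrite -[X in measurable X]setTI; apply: measurable_rV_coord => //.
rewrite (_ : [set t | _] = ball (ratr (p.1 ord0 i) : R) p.2.+1%:R^-1); last first.
 by apply/seteqP; split => t; rewrite /ball/= distrC.
exact: measurable_ball.
Qed.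

(** The boxes with rational centre and radius 1/(m+1) are countably many and form a base, so the
    sigma-algebra of the coordinates contains every open set. *)
Lemma m_open_rV (U : set 'rV[R]_n) : open U -> measurable U.
Proof.
move=> oU.
have -> : U = \bigcup_p (if pselect (box p `<=` U) then box p else set0).
 apply/seteqP; split => [x Ux|x [p _]]; last by case: pselect => // pU /pU.
 have /near_rVP[e e0 He] : \forall y \near x, U y by exact: open_nbhs_nbhs.
 have [m Hm] : exists m : nat, m.+1%:R^-1 < e / 2.
 have e20 : 0 < e / 2 by rewrite divr_gt0.
 have [m _ Hm] := near_infty_natSinv_lt (PosNum e20); exists m; exact: (Hm m (leqnn m)).
 have /choice[q Hq] : forall i, exists q : rat, `|x ord0 i - ratr q| < m.+1%:R^-1.
 move=> i; have : x ord0 i - m.+1%:R^-1 < x ord0 i by rewrite gtrBl invr_gt0.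
 move=> /rat_in_itvoo[q]; rewrite in_itv/= => /andP[q1 q2].
 by exists q; rewrite ger0_norm ?subr_ge0 1?ltW// ltrBlDr -ltrBlDl.
 exists (\row_i q i, m) => //; case: pselect => [_ i|]; first by rewrite mxE.
 case=> y Hy; apply: He => i.
 have -> : x ord0 i - y ord0 i = (x ord0 i - ratr (q i)) - (y ord0 i - ratr (q i)) by ring.
 rewrite (le_lt_trans (ler_normB _ _))// (splitr e) ltrD// (lt_trans _ Hm)//.
 by have := Hy i; rewrite mxE.
apply: countable_bigcupT_measurable => // p; case: pselect => [?|?] //=; exact: measurable_box.
Qed.

Lemma cont_meas (f : 'rV[R]_n -> R) :
 continuous f -> mfun f.
Proof.
move=> cf; apply: (measurability _ (RGenOInfty.measurableE R)) => //.
move=> _ [B [a aB] <-]; rewrite aB setTI; apply: m_open_rV.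
by apply: open_comp => // *; exact: cf.
Qed.

Import HBNNSimple.

(** [nu] is given by its density on sets only; simple approximations and monotone convergence carry
    the density over to nonnegative functions. *)
Lemma int_nu (f : 'rV[R]_n * 'rV[R]_n -> \bar R) :
 mfun f -> (forall x, (0 <= f x)%E) ->
 (\int[nu n]_z f z =
 \int[rV_lebesgue n \x rV_lebesgue n]_z (f z * (nu_density z)%:E))%E.
Proof.
move=> mf f0; pose f_ := nnsfun_approx mTT mf.
have mden : mfun (fun z : 'rV[R]_n * 'rV[R]_n => (nu_density z)%:E).
 by apply/mEFinP; exact: measurable_nu_density.
have den0 (z : 'rV[R]_n * 'rV[R]_n) : 0 <= nu_density z by exact: powR_ge0.
have ap0 k z : 0 <= f_ k z by [].
have mf_ k : mfun (fun z => (f_ k z)%:E) by exact/mEFinP.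
have cvf z : ((f_ k z)%:E @[k --> \oo] --> f z)%E by exact: cvg_nnsfun_approx.
transitivity (limn (fun k => \int[nu n]_z (f_ k z)%:E)%E).
 rewrite -monotone_convergence//=.
 - by apply: eqint => z _; apply/esym/cvg_lim => //; exact: cvf.
 - by move=> k z _; rewrite lee_fin.
 - by move=> z _ a b ab; rewrite lee_fin//; exact/lefP/nd_nnsfun_approx.
transitivity (limn (fun k =>
 \int[rV_lebesgue n \x rV_lebesgue n]_z ((f_ k z)%:E * (nu_density z)%:E)%E)%E); last first.
 rewrite -monotone_convergence//=.
 - apply: eqint => z _; apply/cvg_lim => //.
 apply: cvgeZr => //; exact: cvf.
 - by move=> k; apply: emfunM.
 - by move=> k z _; rewrite mule_ge0 ?lee_fin.
 - move=> z _ a b ab; rewrite -!EFinM lee_fin// ler_wpM2r//.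
 exact/lefP/nd_nnsfun_approx.
congr (limn _); apply/funext => k /=.
under eqint do rewrite fimfunE -fsumEFin//.
rewrite ge0_integral_fsum//; last 2 first.
 - by move=> r; exact/mEFinP/mcomp.
 - by move=> r z _; rewrite EFinM nnfun_muleindic_ge0.
transitivity (\sum_(i \in range (f_ k)) \int[rV_lebesgue n \x rV_lebesgue n]_x
 (((i * \1_(f_ k @^-1` [set i]) x)%:E * (nu_density x)%:E)%E))%E; last first.
 rewrite -ge0_integral_fsum//; last 2 first.
 - move=> r; apply: emfunM => //; exact/mEFinP/mcomp.
 - by move=> r z _; apply: mule_ge0; [rewrite EFinM nnfun_muleindic_ge0|rewrite lee_fin].
 apply: eqint => z _; rewrite [in RHS]fimfunE -fsumEFin// ge0_mule_fsuml//.
 by move=> r; rewrite EFinM nnfun_muleindic_ge0.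
apply: eq_fsbigr => r; rewrite inE => -[z0 _ fz0].
have r0 : 0 <= r by rewrite -fz0.
under [RHS]eqint do rewrite EFinM -muleA.
rewrite [RHS]intZl//; last 2 first.
- by apply: emfunM => //; exact/mEFinP.
- by move=> z _; rewrite mule_ge0 ?lee_fin.
rewrite integralZl_indic_nnsfun//= integral_indic// setIT; congr (_ * _)%E.
rewrite /nu [LHS]int_mkcond; apply: eqint => z _.
rewrite /patch indicE; case: ifPn; first by move=> _; rewrite mul1e.
by rewrite mul0e.
Qed.

End rV_topology.

(** * The Euclidean norm *)

Lemma continuous_bigsum {R : realType} (T : topologicalType) I (r : seq I)
 (f : I -> T -> R) :
 (forall i, continuous (f i)) -> continuous (fun x => \sum_(i <- r) f i x).
Proof.
move=> cf; elim: r => [|i r IH] x.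
 rewrite (_ : (fun x => _) = cst 0); first exact: cvg_cst.
 by apply/funext => y; rewrite big_nil.
rewrite (_ : (fun x => _) = (fun x => f i x + \sum_(j <- r) f j x)); last first.
 by apply/funext => y; rewrite big_cons.
by apply: continuousD; [exact: cf|exact: IH].
Qed.

Section enorm_theory.
Context {R : realType} {n : nat}.
Implicit Types x y : 'rV[R]_n.

Lemma enorm_ge0 x : 0 <= enorm x.
Proof. exact: sqrtr_ge0. Qed.

Lemma sqr_enorm x : enorm x ^+ 2 = \sum_i x ord0 i ^+ 2.
Proof. by rewrite sqr_sqrtr// sumr_ge0// => i _; exact: sqr_ge0. Qed.

Lemma enormN x : enorm (- x) = enorm x.
Proof. by congr Num.sqrt; apply: eq_bigr => i _; rewrite mxE sqrrN. Qed.

Lemma enormBC x y : enorm (x - y) = enorm (y - x).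
Proof. by rewrite -enormN opprB. Qed.

Lemma enormZ (a : R) x : enorm (a *: x) = `|a| * enorm x.
Proof.
rewrite /enorm -sqrtr_sqr -sqrtrM ?sqr_ge0// mulr_sumr.
by congr Num.sqrt; apply: eq_bigr => i _; rewrite mxE exprMn.
Qed.

Lemma coord_le_enorm x i : `|x ord0 i| <= enorm x.
Proof.
rewrite -sqrtr_sqr ler_wsqrtr// (bigD1 i)//= lerDl.
by rewrite sumr_ge0// => j _; exact: sqr_ge0.
Qed.

Lemma enorm_le x (h : R) : 0 <= h -> (forall i, `|x ord0 i| <= h) ->
 enorm x <= n%:R * h.
Proof.
move=> h0 xh; have nh0 : 0 <= n%:R * h by rewrite mulr_ge0.
rewrite -(ger0_norm nh0) -sqrtr_sqr ler_wsqrtr//.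
apply: (@le_trans _ _ (\sum_(i < n) h ^+ 2)).
 by apply: ler_sum => i _; rewrite -ler_sqrt ?sqr_ge0// !sqrtr_sqr (ger0_norm h0).
rewrite sumr_const card_ord exprMn -[leLHS]mulr_natl ler_wpM2r ?sqr_ge0//.
by rewrite -natrX ler_nat; nia.
Qed.

Lemma enorm0_eq0 x : enorm x = 0 -> x = 0.
Proof.
move=> x0; apply/rowP => i; rewrite mxE; apply/eqP; rewrite -normr_eq0.
by rewrite eq_le normr_ge0 andbT -x0 coord_le_enorm.
Qed.

Lemma enorm0 : enorm (0 : 'rV[R]_n) = 0.
Proof. by rewrite -(scale0r 0) enormZ normr0 mul0r. Qed.

Lemma enorm_gt0 x : x != 0 -> 0 < enorm x.
Proof.
by move=> x0; rewrite lt_def enorm_ge0 andbT; apply: contra x0 => /eqP/enorm0_eq0 ->.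
Qed.

(** Cauchy-Schwarz, from T (T S - P^2) = sum (T x_i - P y_i)^2; T = 0 is treated apart because the
    identity is then empty. *)
Lemma dot_le_enorm x y : \sum_i x ord0 i * y ord0 i <= enorm x * enorm y.
Proof.
set P := \sum_i _; set S := \sum_i x ord0 i ^+ 2; set T := \sum_i y ord0 i ^+ 2.
have S0 : 0 <= S by rewrite sumr_ge0// => i _; exact: sqr_ge0.
have T0 : 0 <= T by rewrite sumr_ge0// => i _; exact: sqr_ge0.
have key : 0 <= T * (T * S - P ^+ 2).
 have -> : T * (T * S - P ^+ 2) = \sum_i (T * x ord0 i - P * y ord0 i) ^+ 2.
 transitivity (\sum_i (T ^+ 2 * x ord0 i ^+ 2 + (- (2 * T * P)) * (x ord0 i * y ord0 i)
 + P ^+ 2 * y ord0 i ^+ 2)); last by apply: eq_bigr => i _; ring.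
 by rewrite !big_split/= -!mulr_sumr -/P -/S -/T; ring.
 by rewrite sumr_ge0// => i _; exact: sqr_ge0.
have PST : P ^+ 2 <= S * T.
 have [T00|T1] := eqVneq T 0.
 suff -> : P = 0 by rewrite expr0n/= mulr_ge0.
 rewrite /P big1// => i _.
 have : `|y ord0 i| <= 0.
 by rewrite -[leRHS](sqrtr0 R) -T00 -/(enorm y); exact: coord_le_enorm.
 by rewrite normr_le0 => /eqP ->; rewrite mulr0.
 have Tp : 0 < T by rewrite lt_def T1.
 by move: key; rewrite pmulr_rge0// subr_ge0 mulrC.
rewrite /enorm -sqrtrM// -/S -/T (le_trans (ler_norm P))// -sqrtr_sqr ler_wsqrtr//.
Qed.

Lemma enormD x y : enorm (x + y) <= enorm x + enorm y.
Proof.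
rewrite -(@ler_pXn2r _ 2)// ?nnegrE ?addr_ge0 ?enorm_ge0//.
rewrite sqr_enorm sqrrD !sqr_enorm.
have -> : \sum_i (x + y) ord0 i ^+ 2 =
 \sum_i x ord0 i ^+ 2 + (\sum_i x ord0 i * y ord0 i) *+ 2 + \sum_i y ord0 i ^+ 2.
 rewrite -sumrMnl -!big_split/=; apply: eq_bigr => i _; rewrite mxE.
 by rewrite sqrrD.
by rewrite lerD2r lerD2l lerMn2r/= dot_le_enorm.
Qed.

Lemma ler_dist_enorm x y : `|enorm x - enorm y| <= enorm (x - y).
Proof.
rewrite ler_norml; apply/andP; split.
 by rewrite lerNl opprB lerBlDr enormBC -{1}(subrK x y) enormD.
by rewrite lerBlDr -{1}(subrK y x) enormD.
Qed.

Lemma enorm_continuous : continuous (@enorm R n).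
Proof.
move=> x; apply: (@continuous_comp _ _ _ (fun z : 'rV[R]_n => \sum_i z ord0 i ^+ 2)).
 apply: continuous_bigsum => i {}x.
 apply: (@continuous_comp _ _ _ (fun z : 'rV[R]_n => z ord0 i) (fun t => t ^+ 2)).
 exact: coord_continuous.
 exact: exprn_continuous.
exact: sqrt_continuous.
Qed.

End enorm_theory.

(** * Cubes and dyadic shells *)

Section cubes.
Context {R : realType} {n : nat}.
Implicit Types (x y : 'rV[R]_n) (h : R).

Definition cube x h : set 'rV[R]_n := [set y | forall i, `|x ord0 i - y ord0 i| <= h].

(** Shells of radii h, h/2, h/4, ... around one point are disjoint, which lets the energies over
    products of consecutive shells be added up; full cubes would be counted repeatedly. *)
Definition shell x h : set 'rV[R]_n := cube x h `\` cube x (h / 2).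

Lemma m_cube x h : measurable (cube x h).
Proof.
have -> : cube x h = \bigcap_(i in [set: 'I_n])
 (@rV_coord R n i @^-1` [set t | `|x ord0 i - t| <= h]).
 by apply/seteqP; split => [y Hy i _|y Hy i]; [exact: Hy|exact: (Hy i)].
apply: fin_bigcap_measurable => // i _.
rewrite -[X in measurable X]setTI; apply: measurable_rV_coord => //.
rewrite (_ : [set t | _] = `[x ord0 i - h, x ord0 i + h]%classic); last first.
 by apply/seteqP; split => t; rewrite /= in_itv/= ler_distlC.
exact: mitv.
Qed.

Lemma m_shell x h : measurable (shell x h).
Proof. by apply: measurableD; exact: m_cube. Qed.

Lemma rV_lebesgue_cube x h : 0 <= h ->
 rV_lebesgue n (cube x h) = ((2 * h) ^+ n)%:E.
Proof.
move=> h0; rewrite -(setIT (cube x h)) -integral_indic//; last exact: m_cube.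
pose f i t : R := \1_(`[x ord0 i - h, x ord0 i + h]%classic) t.
transitivity (\int[rV_lebesgue n]_y (\prod_i f i (y ord0 i))%:E)%E.
 apply: eqint => y _; congr EFin; rewrite indicE.
 case: (pselect (cube x h y)) => [cy|ncy].
 rewrite mem_set//= big1// => i _; rewrite /f indicE mem_set//=.
 by rewrite in_itv/= -ler_distlC; exact: cy.
 rewrite memNset//=; have /existsNP[i Hi] := ncy.
 apply/esym/eqP; rewrite prodf_seq_eq0; apply/hasP; exists i; first exact: mem_index_enum.
 rewrite /f indicE memNset//= in_itv/= -ler_distlC; exact: Hi.
rewrite integral_rV_prod => [|i|i t]; [|exact: mindic|by rewrite /f indicE].
rewrite (eq_bigr (fun=> (2 * h)%:E)).
 by rewrite prodEFin prodr_const card_ord.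
move=> i _; rewrite /f integral_indic// setIT.
rewrite /= leb_itvE/= lte_fin; case: ltP => [_|].
 by rewrite -EFinB; congr EFin; ring.
rewrite lerD2l => hh; have h00 : h = 0 by apply/eqP; rewrite eq_le; apply/andP; split; lra.
by rewrite h00 mulr0.
Qed.

Lemma rV_lebesgue_shell x h : 0 <= h ->
 rV_lebesgue n (shell x h) = ((2 * h) ^+ n - h ^+ n)%:E.
Proof.
move=> h0; have fin : (rV_lebesgue n (cube x h) < +oo)%E by rewrite rV_lebesgue_cube// ltry.
rewrite (measureD (m_cube _ _) (m_cube _ _) fin).
rewrite setIidr; last first.
 by move=> y Hy i; apply: (le_trans (Hy i)); rewrite ldivMr//; lra.
rewrite [X in (X - _)%E]rV_lebesgue_cube// [X in (_ - X)%E]rV_lebesgue_cube ?divr_ge0//.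
by rewrite -EFinB; congr (_ - _)%:E; congr (_ ^+ _); lra.
Qed.

Lemma shell_dist x x' h h' y y' : 0 <= h -> 0 <= h' ->
 shell x h y -> shell x' h' y' -> enorm (y - y') <= enorm (x - x') + n%:R * (h + h').
Proof.
move=> h0 h'0 [xy _] [x'y' _].
have -> : y - y' = (x - x') + ((y - x) + (x' - y')) by apply/rowP => i; rewrite !mxE; ring.
rewrite (le_trans (enormD _ _))// lerD2l (le_trans (enormD _ _))// mulrDr lerD//.
 by apply: enorm_le => // i; rewrite !mxE distrC; exact: xy.
by apply: enorm_le => // i; rewrite !mxE; exact: x'y'.
Qed.

End cubes.

(** * Finite Young functions of class Delta_2 *)

Lemma near_dist_lt {R : realType} (t e : R) : 0 < e ->
 \forall y \near t, `|t - y| < e.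
Proof. by move=> e0; exact: (nbhsx_ballx t). Qed.

Section young_real.
Context {R : realType}.

(** The real-valued form of a finite Young function in Delta_2. Positivity off zero is itself a
    consequence of Delta_2, see [young_function_cases]. *)
Record nyoung (B : R -> R) : Prop := NYoung {
 nyoung0 : B 0 = 0;
 nyoung_gt0 : forall t, 0 < t -> 0 < B t;
 nyoung_convex : forall x y th, 0 <= x -> 0 <= y -> 0 <= th <= 1 ->
 B (th * x + (1 - th) * y) <= th * B x + (1 - th) * B y;
 nyoung_Delta2 : exists2 c, 0 < c & forall t, 0 <= t -> B (2 * t) <= c * B t }.

Context (B : R -> R) (HB : nyoung B).

Lemma nyoung_ge0 t : 0 <= t -> 0 <= B t.
Proof.
by rewrite le_eqVlt => /predU1P[<-|t0]; [rewrite nyoung0|exact/ltW/nyoung_gt0].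
Qed.

Lemma nyoung_scale_le l t : 0 <= l <= 1 -> 0 <= t -> B (l * t) <= l * B t.
Proof.
move=> l01 t0; have := nyoung_convex HB t0 (lexx 0) l01.
by rewrite !mulr0 (nyoung0 HB) mulr0 !addr0.
Qed.

(** Convexity and B 0 = 0 make B t / t nondecreasing; this product form is the one behind every
    comparison of slopes below. *)
Lemma nyoung_slope x y : 0 < x -> x <= y -> B x * y <= B y * x.
Proof.
move=> x0 xy; have y0 : 0 < y := lt_le_trans x0 xy.
have xy01 : 0 <= x / y <= 1.
 by apply/andP; split; [rewrite divr_ge0// ltW|rewrite ldivMr// mul1r].
have := nyoung_scale_le xy01 (ltW y0).
rewrite divfK ?gt_eqF// => H.
rewrite -ler_pdivlMr//.
by have -> : B y * x / y = x / y * B y by ring.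
Qed.

Lemma nyoung_le x y : 0 <= x -> x <= y -> B x <= B y.
Proof.
rewrite le_eqVlt => /predU1P[<- y0|x0 xy]; first by rewrite nyoung0// nyoung_ge0.
have y0 : 0 < y := lt_le_trans x0 xy.
have := nyoung_slope x0 xy; rewrite -ler_pdivlMr// => /le_trans; apply.
by rewrite ldivMr// ler_wpM2l// nyoung_ge0// ltW.
Qed.

(** Delta_2 iterated until a power of 2 exceeds K. *)
Lemma nyoung_scale K : 0 <= K ->
 exists2 D : R, 0 < D & forall t, 0 <= t -> B (K * t) <= D * B t.
Proof.
move=> K0; have [c c0 Hc] := nyoung_Delta2 HB.
have H2 m t : 0 <= t -> B (2 ^+ m * t) <= c ^+ m * B t.
 elim: m t => [t _|m IH t t0]; first by rewrite !expr0 !mul1r.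
 rewrite exprS -mulrA (le_trans (Hc _ _))// ?mulr_ge0// exprS -mulrA.
 by rewrite ler_wpM2l ?IH// ltW.
have [m Km] : exists m : nat, K <= 2 ^+ m.
 exists (Num.bound K); apply/ltW/(lt_le_trans (archi_boundP K0)).
 by rewrite -natrX ler_nat ltnW// ltn_expl.
exists (c ^+ m); first exact: exprn_gt0.
move=> t t0; apply: le_trans (H2 m t t0).
by apply: nyoung_le; rewrite ?mulr_ge0// ler_wpM2r.
Qed.

(** y is a convex combination of x and y + 1, so the chord up to y + 1 bounds the increment. *)
Lemma nyoung_lip M x y : 0 <= x -> x <= y -> y <= M ->
 B y - B x <= (y - x) * B (M + 1).
Proof.
move=> x0 xy yM; have y0 : 0 <= y := le_trans x0 xy.
have d1 : 0 < y + 1 - x by lra.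
pose l := (y - x) / (y + 1 - x).
have l01 : 0 <= l <= 1.
 by apply/andP; split; [rewrite divr_ge0 ?subr_ge0//; lra|rewrite ldivMr//; lra].
have y10 : 0 <= y + 1 by lra.
have := nyoung_convex HB y10 x0 l01.
have -> : l * (y + 1) + (1 - l) * x = y.
 have -> : l * (y + 1) + (1 - l) * x = l * (y + 1 - x) + x by ring.
 by rewrite divfK ?gt_eqF// subrK.
move=> H; have ly : l <= y - x.
 rewrite ldivMr// -[leLHS]mulr1 ler_wpM2l ?subr_ge0//; lra.
have By1 : 0 <= B (y + 1) by exact: nyoung_ge0.
have BM : B (y + 1) <= B (M + 1) by apply: nyoung_le => //; lra.
have Bx : 0 <= B x by exact: nyoung_ge0.
have l0 : 0 <= l by case/andP: l01.
have h1 : l * B (y + 1) <= (y - x) * B (M + 1) by apply: ler_pM.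
have h2 : 0 <= l * B x by apply: mulr_ge0.
lra.
Qed.

Lemma nyoung_continuous : continuous (fun t : R => B `|t|).
Proof.
move=> t; apply/cvgrPdist_lt => e e0.
set M := `|t| + 1.
have BM : 0 < B (M + 1) by apply: nyoung_gt0 => //; rewrite /M; have := normr_ge0 t; lra.
near=> y.
have yM : `|y| <= M.
 have ty1 : `|t - y| < 1 by near: y; apply: near_dist_lt.
 by have := lerB_dist y t; rewrite distrC /M; lra.
have ty : `|t - y| < e / B (M + 1).
 by near: y; apply: near_dist_lt; rewrite divr_gt0.
have tM : `|t| <= M by rewrite /M; lra.
rewrite ltr_pdivlMr// in ty; apply: le_lt_trans ty.
have [xy|yx] := leP `|t| `|y|.
 rewrite distrC ger0_norm ?subr_ge0 ?nyoung_le//.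
 rewrite (le_trans (nyoung_lip _ xy yM))// ler_wpM2r ?(ltW BM)//.
 by rewrite distrC lerB_dist.
rewrite ger0_norm ?subr_ge0 ?nyoung_le ?(ltW yx)//.
rewrite (le_trans (nyoung_lip _ (ltW yx) tM))// ler_wpM2r ?(ltW BM)//.
exact: lerB_dist.
Unshelve. all: by end_near. Qed.

Lemma nyoung_surj v : 0 < v -> exists2 t, 0 < t & B t = v.
Proof.
move=> v0; have B1 : 0 < B 1 by apply: nyoung_gt0.
pose M := 1 + v / B 1.
have M0 : 0 <= M by rewrite /M addr_ge0// divr_ge0// ltW.
have BMv : v <= B M.
 have M1 : 1 <= M by rewrite lerDl divr_ge0// ltW.
 have := nyoung_slope ltr01 M1; rewrite mulr1; apply: le_trans.
 by rewrite mulrDr mulr1 mulrC divfK ?gt_eqF// lerDr ltW.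
have [||t] := @IVT R (fun t => B `|t|) 0 M v M0.
- by apply: continuous_subspaceT => x; exact: nyoung_continuous.
- by rewrite normr0 (ger0_norm M0) (nyoung0 HB) min_l ?nyoung_ge0// max_r ?nyoung_ge0// ltW.
rewrite in_itv/= => /andP[t0 _]; rewrite ger0_norm// => Bt.
exists t => //; rewrite lt_def t0 andbT; apply/eqP => tt.
by move: v0; rewrite -Bt tt nyoung0// ltxx.
Qed.

(** The slope is the right derivative, obtained as the infimum of the right difference quotients; by
    convexity every left quotient is a lower bound for these. *)
Lemma nyoung_support t0 : 0 <= t0 ->
 exists2 b : R, 0 <= b & forall t, 0 <= t -> B t0 + b * (t - t0) <= B t.
Proof.
rewrite le_eqVlt => /predU1P[<-|t0p].
 by exists 0 => // t tp; rewrite nyoung0// mul0r addr0 nyoung_ge0.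
pose S := [set (B t - B t0) / (t - t0) | t in [set t | t0 < t]].
have slope x y : 0 <= x -> x < t0 -> t0 < y ->
 (B t0 - B x) / (t0 - x) <= (B y - B t0) / (y - t0).
 move=> x0 xt ty; rewrite ldivMr ?subr_gt0// mulrAC ler_pdivlMr ?subr_gt0//.
 have yx : 0 < y - x by lra.
 have l01 : 0 <= (t0 - x) / (y - x) <= 1.
 by apply/andP; split; [rewrite divr_ge0//|rewrite ldivMr//]; lra.
 have y0 : 0 <= y by lra.
 have := nyoung_convex HB y0 x0 l01.
 set l := _ / _; have lE : l * (y - x) = t0 - x by rewrite divfK ?gt_eqF.
 have -> : l * y + (1 - l) * x = t0.
 rewrite (_ : l * y + (1 - l) * x = l * (y - x) + x); last by ring.
 by rewrite lE subrK.
 move=> H; have : B t0 * (y - x) <= (l * B y + (1 - l) * B x) * (y - x).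
 by rewrite ler_wpM2r// ltW.
 have -> : (l * B y + (1 - l) * B x) * (y - x) =
 (l * (y - x)) * B y + (y - x - l * (y - x)) * B x by ring.
 rewrite lE; lra.
have Slb x : 0 <= x -> x < t0 -> lbound S ((B t0 - B x) / (t0 - x)).
 by move=> x0 xt _ [y ty <-]; exact: slope.
have S0 : S !=set0 by exists ((B (t0 + 1) - B t0) / (t0 + 1 - t0)); exists (t0 + 1) => //=; lra.
exists (inf S).
 apply: lb_le_inf => // _ [y ty <-]; rewrite divr_ge0// subr_ge0 ?(ltW ty)//.
 by apply: nyoung_le; rewrite ?ltW.
move=> t tp; have [tt|tt|->] := ltgtP t t0; last by rewrite subrr mulr0 addr0.
 have : (B t0 - B t) / (t0 - t) <= inf S by apply: lb_le_inf => //; exact: Slb.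
 rewrite ldivMr ?subr_gt0//; lra.
have : inf S <= (B t - B t0) / (t - t0).
 apply: ge_inf; last by exists t.
 by exists ((B t0 - B 0) / (t0 - 0)); exact: Slb.
rewrite ler_pdivlMr ?subr_gt0//; lra.
Qed.

End young_real.

(** * Power integrals, and dyadic sums bounded by the slope integral *)

Section powR_integrals.
Context {R : realType}.
Local Notation mu := (@lebesgue_measure R).

Lemma continuous_powRl (r t : R) : 0 < t -> {for t, continuous (fun x : R => x `^ r)}.
Proof.
move=> t0; apply: differentiable_continuous; apply/derivable1_diffP.
by apply: derivable_powR; rewrite in_itv/= t0.
Qed.

Lemma integral_powRN (e T : R) : 1 < e -> 0 < T ->
 (\int[mu]_(t in `[T, +oo[) (t `^ (- e))%:E = (T `^ (1 - e) / (e - 1))%:E)%E.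
Proof.
move=> e1 T0; have e10 : e - 1 != 0 by lra.
pose F t : R := - ((e - 1)^-1 * t `^ (1 - e)).
have dF x : T <= x -> is_derive x 1 F (x `^ (- e)).
 move=> Tx; have x0 : 0 < x := lt_le_trans T0 Tx.
 have dx : is_derive x 1 (fun t : R => t `^ (1 - e)) ((1 - e) * x `^ (- e)).
 by have := is_derive1_powR (1 - e) x0; rewrite (_ : 1 - e - 1 = - e)//; ring.
 rewrite /F (_ : x `^ (- e) = - ((e - 1)^-1 *: ((1 - e) * x `^ (- e)))).
 exact: is_deriveN.
 by rewrite /GRing.scale/=; field.
rewrite (@ge0_continuous_FTC2y R (fun t => t `^ (- e)) F T 0).
- by rewrite -EFinB sub0r /F opprK mulrC.
- by move=> x _; exact: powR_ge0.
- apply: continuous_in_subspaceT => x; rewrite inE/= in_itv/= andbT => Tx.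
 by apply: continuous_powRl; exact: lt_le_trans Tx.
- rewrite -[X in _ --> X]oppr0; apply: cvgN; rewrite -(mulr0 (e - 1)^-1).
 apply: cvgMr; apply/cvgr0Pnorm_lt => d d0; near=> t.
 have t0 : 0 < t by near: t; exact: nbhs_pinfty_gt.
 rewrite ger0_norm ?powR_ge0// -(opprB e 1) powRN invf_plt ?posrE ?powR_gt0//.
 have e1i : 0 < (e - 1)^-1 by rewrite invr_gt0; lra.
 have -> : d^-1 = (d^-1 `^ (e - 1)^-1) `^ (e - 1).
 by rewrite -powRrM mulVf// powRr1// invr_ge0 ltW.
 apply: gt0_ltr_powR; [lra|by rewrite nnegrE powR_ge0|by rewrite nnegrE ltW|].
 by near: t; apply: nbhs_pinfty_gt.
- by move=> x Tx; have [] := dF x (ltW Tx).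
- have /derivable1_diffP/differentiable_continuous : derivable F T 1 by have [] := dF T (lexx _).
 exact: cvg_at_right_filter.
- by move=> x; rewrite in_itv/= andbT => Tx; rewrite derive1E; have [_ ->] := dF x (ltW Tx).
Unshelve. all: by end_near. Qed.

End powR_integrals.

Section chain_sum.
Context {R : realType} (B : R -> R) (HB : nyoung B) (eta q : R).
Local Notation mu := (@lebesgue_measure R).

(** Integrand of a layer-cake formula: 1 and (y t / B t)^q are the two bounds for theta^k that hold
    whenever the layer t < t_k is active, see [chain_sum]. *)
Definition slope_weight (y t : R) : R := Num.min 1 ((y * t / B t) `^ q).

Definition slope_integral (y : R) : \bar R :=
 (\int[mu]_(t in `]0%R, +oo[) (slope_weight y t)%:E)%E.

Lemma slope_weight_ge0 y t : 0 <= slope_weight y t.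
Proof. by rewrite le_min ler01 powR_ge0. Qed.

Lemma m_slope_weight y : measurable_fun (`]0%R, +oo[%classic : set R) (slope_weight y).
Proof.
apply: measurable_minr => //; apply: (@mcomp _ _ _ _ _ _ (@powR R ^~ q)).
 exact: mpowR.
apply: mfunM => //.
apply: open_continuous_measurable_fun => // t; rewrite inE/= in_itv/= andbT => t0.
apply: cvgV; first by rewrite gt_eqF// (nyoung_gt0 HB).
have := @nyoung_continuous _ _ HB t; rewrite /continuous_at ger0_norm ?ltW// => H.
apply: cvg_trans H; apply: near_eq_cvg; near=> x.
by rewrite ger0_norm// ltW//; near: x; exact: lt_nbhsr.
Unshelve. all: by end_near. Qed.

Lemma geometric_le (a : R) K : 0 < a < 1 -> \sum_(k < K) a ^+ k <= (1 - a)^-1.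
Proof.
move=> /andP[a0 a1]; elim: K => [|K IH]; first by rewrite big_ord0 invr_ge0; lra.
rewrite big_ord_recl expr0.
under eq_bigr do rewrite lift0 exprS.
rewrite -mulr_sumr (le_trans (lerD (lexx _) (ler_wpM2l (ltW a0) IH)))//.
have -> : 1 + a * (1 - a)^-1 = (1 - a)^-1 by field; rewrite subr_eq0 gt_eqF.
by [].
Qed.

(** A geometric sum over any set of exponents is at most (1 - a)^-1 times its largest term, and w
    dominates that term. *)
Lemma geometric_pred_le (a w : R) K (p : nat -> bool) : 0 < a < 1 -> 0 <= w ->
 (forall k, (k < K)%N -> p k -> a ^+ k <= w) ->
 \sum_(k < K) a ^+ k * (p k)%:R <= (1 - a)^-1 * w.
Proof.
move=> a01; have /andP[a0 a1] := a01; elim: K p w => [|K IH] p w w0 H.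
 by rewrite big_ord0 mulr_ge0// invr_ge0; lra.
rewrite big_ord_recl expr0 mul1r.
have [p0|np0] := boolP (p 0%N).
 have w1 : 1 <= w by rewrite -(expr0 a) H.
 have ia : 0 <= (1 - a)^-1 by rewrite invr_ge0; lra.
 apply: (@le_trans _ _ ((1 - a)^-1 * 1)); last by rewrite ler_wpM2l.
 rewrite mulr1; apply: le_trans (geometric_le K.+1 a01).
 rewrite big_ord_recl expr0 lerD2l; apply: ler_sum => k _.
 by case: (p _); rewrite ?mulr1// mulr0 exprn_ge0// ltW.
rewrite add0r; under eq_bigr do rewrite lift0 exprS -mulrA.
rewrite -mulr_sumr.
have := IH (fun k => p k.+1) (w / a); rewrite divr_ge0 ?(ltW a0)// => /(_ isT).
have H' k : (k < K)%N -> p k.+1 -> a ^+ k <= w / a.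
 by move=> kK pk; rewrite ler_pdivlMr// -exprSr H.
move=> /(_ H') /(ler_wpM2l (ltW a0)) /le_trans; apply.
by rewrite mulrCA (mulrC w) mulVKf ?gt_eqF.
Qed.

Context (eta1 : 1 < eta) (q0 : 0 < q).
Local Notation theta := (eta^-1 `^ q).

Lemma theta01 : 0 < theta < 1.
Proof.
have e0 : 0 < eta := lt_trans ltr01 eta1.
have ei1 : eta^-1 < 1 by rewrite invf_lt1.
rewrite powR_gt0 ?invr_gt0//= (_ : 1 = 1 `^ q :> R); last by rewrite powR1.
by apply: gt0_ltr_powR => //; rewrite nnegrE ?invr_ge0 ?ltW.
Qed.

Lemma theta_expr k : theta ^+ k = ((eta ^+ k)^-1) `^ q.
Proof.
have e0 : 0 <= eta := ltW (lt_trans ltr01 eta1).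
rewrite -powR_mulrn ?powR_ge0// powRAC powR_mulrn ?invr_ge0//.
by rewrite exprVn.
Qed.

(** Layer cake: the sum is the integral over t of the theta^k with t < t_k. For such k, monotonicity
    of B t / t gives B t / t <= B(t_k) / t_k <= eta^k y, so theta^k = eta^(-k q) is at most the
    weight at t, and the geometric sum is controlled by its largest term. *)
Lemma chain_sum (t_ : nat -> R) (y : R) K : 0 < y ->
 (forall k, (k < K)%N -> 0 <= t_ k /\ B (t_ k) <= eta ^+ k * y * t_ k) ->
 ((\sum_(k < K) theta ^+ k * t_ k)%:E <= ((1 - theta)^-1)%:E * slope_integral y)%E.
Proof.
move=> y0 Ht; have /andP[th0 th1] := theta01.
have ->: ((\sum_(k < K) theta ^+ k * t_ k)%:E = \int[mu]_(t in `]0%R, +oo[)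
 (\sum_(k < K) theta ^+ k * (t < t_ k)%R%:R)%:E)%E.
 under [RHS]eqint do rewrite -sumEFin.
 rewrite ge0_integral_sum//; last 2 first.
 - move=> k; apply/mEFinP; apply: mfunM => //.
 rewrite (_ : (fun _ => _) = \1_(`]-oo, t_ k[%classic)); first exact: mindic.
 by apply/funext => t; rewrite indicE mem_setE in_itv.
 - by move=> k t _; rewrite lee_fin mulr_ge0// exprn_ge0// ltW.
 rewrite -sumEFin; apply: eq_bigr => k _.
 under [RHS]eqint do rewrite EFinM.
 rewrite intZlE//; last 2 first.
 - apply/mEFinP.
 rewrite (_ : (fun _ => _) = \1_(`]-oo, t_ k[%classic)); first exact: mindic.
 by apply/funext => t; rewrite indicE mem_setE in_itv.
 - by rewrite exprn_ge0// ltW.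
 rewrite EFinM; congr (_ * _)%E.
 transitivity (\int[mu]_(t in `]0%R, +oo[) (\1_(`]-oo, t_ k[%classic) t)%:E)%E; last first.
 by apply: eqint => t _; rewrite indicE mem_setE in_itv.
 rewrite integral_indic//.
 have -> : `]-oo, (t_ k)[%classic `&` `]0, +oo[%classic = `]0, (t_ k)[%classic :> set R.
 by apply/seteqP; split => t; rewrite /= !in_itv/= andbT; [move=> [-> ->]|move=> /andP[-> ->]].
 rewrite [RHS]leb_itvE/= lte_fin; have [t0 _] := Ht k (ltn_ord k).
 case: ifPn => [_|]; first by rewrite sube0.
 by rewrite -leNgt => t1; congr EFin; apply/eqP; rewrite eq_le t1.
rewrite -intZlE//; last 3 first.
- by move=> t _; rewrite lee_fin slope_weight_ge0.
- by apply/mEFinP; exact: m_slope_weight.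
- by rewrite invr_ge0; lra.
apply: le_int => //.
- move=> t _; rewrite lee_fin sumr_ge0// => k _; rewrite mulr_ge0// exprn_ge0// ltW//.
- apply/mEFinP; apply: measurable_sum => k; apply: mfunM => //.
 rewrite (_ : (fun _ => _) = \1_(`]-oo, t_ k[%classic)); first exact: mindic.
 by apply/funext => t; rewrite indicE mem_setE in_itv.
- by apply/mEFinP; apply: mfunM => //; exact: m_slope_weight.
move=> t; rewrite /= in_itv/= andbT => t0; rewrite lee_fin.
apply: (@geometric_pred_le _ _ K (fun k => t < t_ k) theta01 (slope_weight_ge0 _ _)) => k kK tk.
rewrite le_min; apply/andP; split.
 by rewrite exprn_ile1// ltW.
have Bt : 0 < B t by exact: nyoung_gt0.
have tk0 : 0 < t_ k := lt_trans t0 tk.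
have ek0 : 0 < eta ^+ k by rewrite exprn_gt0// (lt_trans ltr01 eta1).
rewrite theta_expr ge0_ler_powR ?(ltW q0) ?nnegrE ?invr_ge0 ?(ltW ek0)//.
 by rewrite divr_ge0 ?mulr_ge0 ?(ltW y0) ?(ltW t0) ?(ltW Bt).
rewrite ler_pdivlMr// mulrC ldivMr//.
have H1 := nyoung_slope HB t0 (ltW tk).
have [_ H2] := Ht k kK.
rewrite -(ler_pM2r tk0) (le_trans H1)// (le_trans (ler_wpM2r (ltW t0) H2))//.
by apply: eq_imp_le; ring.
Qed.

End chain_sum.

(** * Finiteness and linear bounds for the slope integral *)

Lemma powRDp {R : realType} (x a b : R) : 0 < x -> x `^ (a + b) = x `^ a * x `^ b.
Proof. by move=> x0; rewrite powRD// (gt_eqF x0) implybT. Qed.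

Lemma powR_le1 {R : realType} (x p : R) : 0 <= x -> x <= 1 -> 0 <= p -> x `^ p <= 1.
Proof.
move=> x0 x1 p0; have -> : 1 = 1 `^ p :> R by rewrite powR1.
by apply: ge0_ler_powR; rewrite ?nnegrE.
Qed.

Lemma powRV {R : realType} (x a : R) : 0 <= x -> x^-1 `^ a = (x `^ a)^-1.
Proof. by move=> x0; rewrite -powR_inv1// -powRrM mulN1r powRN. Qed.

Section slope_integral_bounds.
Context {R : realType} (B : R -> R) (HB : nyoung B) (q : R) (q0 : 0 < q).
Local Notation mu := (@lebesgue_measure R).
Local Notation slope_integral := (slope_integral B q).

Lemma m_slope_powR y :
 measurable_fun (`]0%R, +oo[%classic : set R) (fun t => (y * t / B t) `^ q).
Proof.
apply: (@mcomp _ _ _ _ _ _ (@powR R ^~ q)); first exact: mpowR.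
apply: mfunM => //.
apply: open_continuous_measurable_fun => // t; rewrite inE/= in_itv/= andbT => t0.
apply: cvgV; first by rewrite gt_eqF// (nyoung_gt0 HB).
have := @nyoung_continuous _ _ HB t; rewrite /continuous_at ger0_norm ?(ltW t0)// => H.
apply: cvg_trans H; apply: near_eq_cvg; near=> x.
by rewrite ger0_norm// ltW//; near: x; exact: lt_nbhsr.
Unshelve. all: by end_near. Qed.

(** The weight is at most 1 below T and at most the power beyond it. *)
Lemma slope_integral_split (T y : R) : 0 < T ->
 (slope_integral y <= T%:E + \int[mu]_(t in `[T, +oo[) ((y * t / B t) `^ q)%:E)%E.
Proof.
move=> T0.
have -> : (`[T, +oo[%classic = `[T, T]%classic `|` `]T, +oo[%classic :> set R).
 by rewrite -itv_bndbnd_setU// bnd_simp.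
have sub : (`]T, +oo[%classic : set R) `<=` `]0%R, +oo[%classic.
 by move=> t /=; rewrite !in_itv/= !andbT; exact: lt_trans.
have mS : measurable_fun (`]T, +oo[%classic : set R) (fun t => ((y * t / B t) `^ q)%:E).
 apply/mEFinP; apply: measurable_funS (m_slope_powR y) => //.
rewrite /slope_integral.
have -> : (`]0%R, +oo[%classic = `]0%R, T]%classic `|` `]T, +oo[%classic :> set R).
 by rewrite -itv_bndbnd_setU// bnd_simp ltW.
have sub1 : (`]0%R, T]%classic : set R) `<=` `]0%R, +oo[%classic.
 by move=> t /=; rewrite !in_itv/= andbT => /andP[].
have mw (S : set R) : measurable S -> S `<=` `]0%R, +oo[%classic ->
 measurable_fun S (EFin \o slope_weight B q y).
 move=> mS' SS; apply/mEFinP.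
 exact: measurable_funS (m_slope_weight HB q y).
rewrite ge0_integral_setU//=; last 3 first.
- by apply: mw => [|t]; [exact: measurableU|move=> [/sub1|/sub]].
- by move=> t _; rewrite lee_fin slope_weight_ge0.
- by apply: lt_disjoint => a b; rewrite !in_itv/= andbT => /andP[_ aT]; exact: le_lt_trans.
apply: leeD.
 apply: (@le_trans _ _ (\int[mu]_(t in `]0%R, T]) (cst 1%E t))%E).
 apply: le_int => //=.
 - by move=> t _; rewrite lee_fin slope_weight_ge0.
 - exact: mw.
 - by move=> t _; rewrite lee_fin ge_min lexx.
 rewrite integral_cst// mul1e /= leb_itvE/= lte_fin T0.
 by rewrite sube0.
apply: (@le_trans _ _ (\int[mu]_(t in `]T, +oo[) ((y * t / B t) `^ q)%:E)%E).
 apply: le_int => //=.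
 - by move=> t _; rewrite lee_fin slope_weight_ge0.
 - exact: mw.
 - by move=> t _; rewrite lee_fin ge_min lexx orbT.
apply: sub_int => //=.
- exact: measurableU.
- rewrite set_itv1; apply/measurable_funU => //; split => //.
 exact: measurable_fun_set1.
- by move=> t _; rewrite lee_fin powR_ge0.
Qed.

Lemma slope_integral_lty t0 y : 0 < t0 -> 0 < y ->
 (\int[mu]_(t in `[t0, +oo[) ((t / B t) `^ q)%:E < +oo)%E ->
 (slope_integral y < +oo)%E.
Proof.
move=> t00 y0 H; apply: le_lt_trans (slope_integral_split y t00) _.
apply: lte_add_pinfty; first exact: ltry.
have sub : (`[t0, +oo[%classic : set R) `<=` `]0%R, +oo[%classic.
 by move=> t /=; rewrite !in_itv/= !andbT; exact: lt_le_trans.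
have -> : (\int[mu]_(t in `[t0, +oo[) ((y * t / B t) `^ q)%:E =
 (y `^ q)%:E * \int[mu]_(t in `[t0, +oo[) ((t / B t) `^ q)%:E)%E.
 rewrite -intZlE ?powR_ge0//.
 - apply: eqint => t; rewrite inE/= in_itv/= andbT => tt.
 rewrite -EFinM -powRM ?(ltW y0)// ?mulrA//.
 have t0' : 0 < t by exact: lt_le_trans tt.
 by rewrite divr_ge0// ?(ltW t0')// (nyoung_ge0 HB)// ltW.
 - by move=> t _; rewrite lee_fin powR_ge0.
 - apply/mEFinP.
 have := measurable_funS (mitv _) sub (m_slope_powR 1).
 by apply: eq_measurable_fun => t _; rewrite mul1r.
by rewrite lte_mul_pinfty// ?lee_fin ?powR_ge0// int_ge0.
Qed.

(** At the slope B T / T the integrand is at most a multiple of (t/T)^(-(p-1) q), which is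
    integrable on [T, oo) as (p-1) q > 1; scaling by T produces the factor T. *)
Lemma slope_tail_le (T c p : R) (S : set R) : 0 < T -> 0 < c -> 1 < (p - 1) * q ->
 measurable S -> S `<=` `[T, +oo[%classic ->
 (forall t, S t -> c * (t / T) `^ p * B T <= B t) ->
 (\int[mu]_(t in S) ((B T / T * t / B t) `^ q)%:E <=
 (c^-1 `^ q / ((p - 1) * q - 1) * T)%:E)%E.
Proof.
move=> T0 c0 pq mS ST H; set e := (p - 1) * q.
have BT : 0 < B T by exact: nyoung_gt0.
have -> : c^-1 `^ q / (e - 1) * T = c^-1 `^ q * T `^ e * (T `^ (1 - e) / (e - 1)).
 have TE : T `^ e * T `^ (1 - e) = T by rewrite -powRDp// addrC subrK powRr1// ltW.
 by transitivity (c^-1 `^ q * (T `^ e * T `^ (1 - e)) / (e - 1)); [rewrite TE; ring|ring].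
rewrite EFinM -(integral_powRN pq T0) -intZlE//; last 3 first.
- by move=> t _; rewrite lee_fin powR_ge0.
- by apply/mEFinP; apply: mfunTS; exact: mpowR.
- by rewrite mulr_ge0 ?powR_ge0.
have sub : S `<=` `]0%R, +oo[%classic.
 by move=> t /ST /=; rewrite !in_itv/= !andbT; exact: lt_le_trans.
apply: (@le_trans _ _ (\int[mu]_(t in S) ((c^-1 `^ q * T `^ e)%:E * (t `^ (- e))%:E))%E).
 apply: le_int => //.
 - by move=> t _; rewrite lee_fin powR_ge0.
 - apply/mEFinP; exact: measurable_funS (m_slope_powR _).
 - apply/mEFinP; apply: mfunM => //; apply: mfunTS; exact: mpowR.
 move=> t St; rewrite -EFinM lee_fin.
 have t0 : 0 < t by have := sub t St; rewrite /= in_itv/= andbT.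
 have Bt : 0 < B t by exact: nyoung_gt0.
 have tT0 : 0 < t / T by rewrite divr_gt0.
 have -> : c^-1 `^ q * T `^ e * t `^ (- e) = (c^-1 * (t / T) `^ (1 - p)) `^ q.
 rewrite [RHS]powRM ?invr_ge0 ?powR_ge0 ?(ltW c0)// -mulrA; congr (_ * _).
 rewrite -powRrM -/e (_ : (1 - p) * q = - e); last by rewrite /e; ring.
 rewrite powRM ?invr_ge0 ?(ltW T0) ?(ltW t0)// mulrC; congr (_ * _).
 by rewrite powRN -powRN -[T^-1]powR_inv1 ?(ltW T0)// -powRrM mulN1r opprK.
 apply: ge0_ler_powR; rewrite ?nnegrE ?(ltW q0)//.
 - by rewrite !(divr_ge0, mulr_ge0) ?(ltW BT) ?(ltW T0) ?(ltW t0) ?(ltW Bt).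
 - by rewrite mulr_ge0 ?invr_ge0 ?powR_ge0 ?(ltW c0).
 rewrite ldivMr//; have := H t St.
 set r := t / T in tT0 *; have -> : B T / T * t = B T * r by rewrite /r; ring.
 move=> Hr; have -> : B T * r = (c^-1 * r `^ (1 - p)) * (c * r `^ p * B T).
 have rr : r `^ (1 - p) * r `^ p = r by rewrite -powRDp// subrK powRr1// ltW.
 rewrite -[in LHS]rr; field; exact: lt0r_neq0.
 by rewrite ler_wpM2l// mulr_ge0 ?invr_ge0 ?powR_ge0 ?(ltW c0).
apply: sub_int => //.
- by apply/mEFinP; apply: mfunM => //; apply: mfunTS; exact: mpowR.
- by move=> t _; rewrite -EFinM lee_fin !mulr_ge0 ?powR_ge0.
Qed.

Lemma exprn_unbounded (a x : R) : 1 < a -> exists m : nat, x < a ^+ m.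
Proof.
move=> a1; pose d := a - 1; have d0 : 0 < d by rewrite subr_gt0.
have H m : 1 + m%:R * d <= a ^+ m.
 elim: m => [|m IH]; first by rewrite mul0r addr0 expr0.
 have md : 0 <= m%:R * d * d by rewrite !mulr_ge0// ltW.
 have a0 : 0 <= a by lra.
 rewrite exprS; apply: le_trans (ler_wpM2l a0 IH).
 have -> : a = 1 + d by rewrite /d; ring.
 rewrite -natr1; lra.
exists (Num.bound (x / d)); apply: lt_le_trans (H _).
have [x0|x0] := leP 0 x.
 have := archi_boundP (divr_ge0 x0 (ltW d0)); rewrite ltr_pdivrMr//; lra.
by rewrite (lt_le_trans x0)// addr_ge0// mulr_ge0// ltW.
Qed.

(** The one-step inequality is iterated along T, T t0, T t0^2, ... as long as the points stay below
    t. The last incomplete step costs the factor t0^(-p). The predicate [D] records where the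
    one-step inequality holds, near 0 or near infinity. *)
Lemma power_growth (t0 p T t : R) (D : R -> Prop) : 1 < t0 -> 0 <= p ->
 (forall b, 0 < b -> D b -> t0 `^ p * B b <= B (b * t0)) ->
 0 < T -> T <= t -> (forall x, T <= x <= t -> D x) ->
 (t0 `^ p)^-1 * (t / T) `^ p * B T <= B t.
Proof.
move=> t01 p0 HD; have t00 : 0 < t0 := lt_trans ltr01 t01.
have [m Hm] := exprn_unbounded (t / T) t01.
elim: m T Hm => [|m IH] T Hm T0 Tt DT.
 move: Hm; rewrite expr0 ltr_pdivrMr// mul1r => /lt_le_trans/(_ Tt).
 by rewrite ltxx.
have BT : 0 < B T by exact: nyoung_gt0.
have tp0 : 0 < t0 `^ p by rewrite powR_gt0.
have tT0 : 0 <= t / T by rewrite divr_ge0// ?(ltW T0)// (le_trans (ltW T0)).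
have [tt|tt] := leP t (T * t0).
 apply: (@le_trans _ _ (B T)); last by apply: nyoung_le => //; exact: ltW.
 rewrite -{2}(mul1r (B T)) ler_wpM2r ?(ltW BT)// mulrC ldivMr// mul1r.
 apply: ge0_ler_powR; rewrite ?nnegrE ?(ltW t00)//.
 by rewrite ldivMr// mulrC.
have Tt00 : 0 < T * t0 by rewrite mulr_gt0.
have H : (t0 `^ p)^-1 * (t / (T * t0)) `^ p * B (T * t0) <= B t.
 apply: IH => //.
 - rewrite invfM mulrA ltr_pdivrMr// -exprSr//.
 - exact: ltW.
 - move=> x /andP[x1 x2]; apply: DT; rewrite x2 andbT (le_trans _ x1)//.
 by rewrite ler_pMr// ltW.
have tE : (t / (T * t0)) `^ p = (t / T) `^ p / t0 `^ p.
 by rewrite invfM mulrA powRM ?invr_ge0 ?(ltW t00)// powRV ?(ltW t00).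
apply: le_trans H; rewrite tE.
set Z := (t / T) `^ p; set x := t0 `^ p.
have -> : x^-1 * (Z / x) * B (T * t0) = x^-1 * Z * (B (T * t0) / x) by ring.
rewrite ler_wpM2l ?mulr_ge0 ?invr_ge0 ?powR_ge0// ler_pdivlMr// mulrC.
by apply: HD => //; apply: DT; rewrite lexx Tt.
Qed.

(** Both terms of [slope_integral_split] at T are O(T), the tail by [slope_tail_le], once B grows
    like the power p above T with a constant that does not depend on T. *)
Lemma slope_integral_large (t0 p b1 T2 : R) : 1 < t0 -> 1 < (p - 1) * q -> 0 < b1 ->
 0 < T2 -> (forall b, b1 <= b -> t0 `^ p * B b <= B (b * t0)) ->
 exists2 C : R, 0 < C & forall T, T2 <= T -> (slope_integral (B T / T) <= (C * T)%:E)%E.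
Proof.
move=> t01 pq b10 T20 H.
have p1 : 0 < p - 1.
 by rewrite -(pmulr_lgt0 _ q0) (lt_trans ltr01).
have p0 : 0 <= p by lra.
have tp0 : 0 < t0 `^ p by rewrite powR_gt0// (lt_trans ltr01).
pose b := Num.max b1 T2; have bT2 : T2 <= b by rewrite le_max lexx orbT.
have b0 : 0 < b := lt_le_trans T20 bT2.
have Hb T t : b <= T -> T <= t -> (t0 `^ p)^-1 * (t / T) `^ p * B T <= B t.
 move=> bT Tt; apply: (@power_growth t0 p T t (fun x => b1 <= x)) => //.
 - by move=> ? _; exact: H.
 - exact: lt_le_trans bT.
 - by move=> x /andP[Tx _]; rewrite (le_trans _ Tx)// (le_trans _ bT)// le_max lexx.
(* The factor (T2/b)^p pays for the part of [T, t] below b, where the growth hypothesis is silent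
   and B is merely monotone. *)
pose c := Num.min 1 (t0 `^ p)^-1 * (T2 / b) `^ p.
have c0 : 0 < c by rewrite mulr_gt0 ?powR_gt0 ?divr_gt0// lt_min ltr01 invr_gt0.
have Hc T t : T2 <= T -> T <= t -> c * (t / T) `^ p * B T <= B t.
 move=> T2T Tt; have T0 : 0 < T := lt_le_trans T20 T2T.
 have t0' : 0 < t := lt_le_trans T0 Tt.
 have BT : 0 < B T by exact: nyoung_gt0.
 have -> : c * (t / T) `^ p = Num.min 1 (t0 `^ p)^-1 * (T2 / b * (t / T)) `^ p.
 by rewrite /c -mulrA [in RHS]powRM// divr_ge0 ?(ltW T20) ?(ltW b0) ?(ltW T0) ?(ltW t0').
 have [tb|bt] := leP t b.
 apply: (@le_trans _ _ (B T)); last by apply: nyoung_le => //; exact: ltW.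
 rewrite -{2}(mul1r (B T)) ler_wpM2r ?(ltW BT)// -[leRHS]mulr1 ler_pM ?powR_ge0//.
 - by rewrite le_min ler01 invr_ge0 ltW.
 apply: powR_le1 => //; first by rewrite mulr_ge0// divr_ge0 ?(ltW T20) ?(ltW b0) ?(ltW T0) ?(ltW t0').
 by rewrite mulrACA -invfM ldivMr ?mulr_gt0// mul1r mulrC ler_pM ?(ltW T20) ?(ltW t0').
 pose T' := Num.max T b; have T'b : b <= T' by rewrite le_max lexx orbT.
 have T'0 : 0 < T' := lt_le_trans b0 T'b.
 have T't : T' <= t by rewrite ge_max Tt ltW.
 apply: le_trans (Hb _ _ T'b T't).
 have BT' : B T <= B T' by apply: nyoung_le => //; rewrite ?(ltW T0)// le_max lexx.
 rewrite ler_pM ?(ltW BT)// ?mulr_ge0 ?powR_ge0 ?le_min ?ler01 ?invr_ge0 ?(ltW tp0)//.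
 rewrite ler_pM ?powR_ge0 ?le_min ?ler01 ?invr_ge0 ?(ltW tp0)//; first by rewrite ge_min lexx orbT.
 have r0 : 0 <= T2 / b * (t / T).
 by rewrite mulr_ge0// divr_ge0 ?(ltW T20) ?(ltW b0) ?(ltW T0) ?(ltW t0').
 have r'0 : 0 <= t / T' by rewrite divr_ge0 ?(ltW t0') ?(ltW T'0).
 apply: ge0_ler_powR; rewrite ?nnegrE//.
 have TT : T2 * T' <= b * T.
 by rewrite /T' maxr_pMr ?(ltW T20)// ge_max ler_pM2r// bT2 mulrC ler_pM2l.
 have -> : T2 / b * (t / T) = T2 / (b * T) * t by field; rewrite !gt_eqF.
 rewrite mulrC ler_pM2l// ldivMr ?mulr_gt0// mulrC ler_pdivlMr//.
exists (1 + c^-1 `^ q / ((p - 1) * q - 1)).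
 by rewrite addr_gt0// divr_gt0 ?powR_gt0 ?invr_gt0// subr_gt0.
move=> T T2T; have T0 : 0 < T := lt_le_trans T20 T2T.
apply: (le_trans (slope_integral_split _ T0)); rewrite mulrDl mul1r EFinD leeD2l//.
by apply: slope_tail_le => // t; rewrite /= in_itv/= andbT; exact: Hc.
Qed.

(** The growth hypothesis is available near 0 only, and extends to a fixed M by monotonicity. The
    tail beyond M comes from the integrability at infinity and has to be shown O(T) as T tends to
    0. *)
Lemma slope_integral_small (t0 p b0 T1 t1 : R) : 1 < t0 -> 1 < (p - 1) * q -> 0 < b0 ->
 0 < T1 -> (forall b, 0 < b -> b < b0 -> t0 `^ p * B b <= B (b * t0)) ->
 0 < t1 -> (\int[mu]_(t in `[t1, +oo[) ((t / B t) `^ q)%:E < +oo)%E ->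
 exists2 C : R, 0 < C &
 forall T, 0 < T -> T <= T1 -> (slope_integral (B T / T) <= (C * T)%:E)%E.
Proof.
move=> t01 pq b00 T10 H t10 G.
have p1 : 0 < p - 1.
 by rewrite -(pmulr_lgt0 _ q0) (lt_trans ltr01).
have p0 : 0 <= p by lra.
have tp0 : 0 < t0 `^ p by rewrite powR_gt0// (lt_trans ltr01).
set e := (p - 1) * q in pq.
pose b := b0 / 2; have bb0 : 0 < b by rewrite divr_gt0.
have bb : b < b0 by rewrite /b; lra.
have Hb T t : 0 < T -> T <= t -> t <= b -> (t0 `^ p)^-1 * (t / T) `^ p * B T <= B t.
 move=> T0 Tt tb; apply: (@power_growth t0 p T t (fun x => x < b0)) => //.
 by move=> x /andP[_ xt]; rewrite (le_lt_trans xt)// (le_lt_trans tb).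
pose M := Num.max b (Num.max T1 t1).
have bM : b <= M by rewrite le_max lexx.
have T1M : T1 <= M by rewrite !le_max lexx orbT.
have t1M : t1 <= M by rewrite !le_max lexx !orbT.
have M0 : 0 < M := lt_le_trans T10 T1M.
(* (b/M)^p pays for the range between b and M, where B is only known to be monotone. *)
pose c := Num.min 1 (t0 `^ p)^-1 * (b / M) `^ p.
have c0 : 0 < c by rewrite mulr_gt0 ?powR_gt0 ?divr_gt0// lt_min ltr01 invr_gt0.
have Hc T t : 0 < T -> T <= t -> t <= M -> c * (t / T) `^ p * B T <= B t.
 move=> T0 Tt tM.
 have t0' : 0 < t := lt_le_trans T0 Tt.
 have BT : 0 < B T by exact: nyoung_gt0.
 have -> : c * (t / T) `^ p = Num.min 1 (t0 `^ p)^-1 * (b / M * (t / T)) `^ p.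
 by rewrite /c -mulrA [in RHS]powRM// divr_ge0 ?(ltW bb0) ?(ltW M0) ?(ltW T0) ?(ltW t0').
 have r0 : 0 <= b / M * (t / T).
 by rewrite mulr_ge0// divr_ge0 ?(ltW bb0) ?(ltW M0) ?(ltW T0) ?(ltW t0').
 have [bT|Tb] := leP b T.
 apply: (@le_trans _ _ (B T)); last by apply: nyoung_le => //; exact: ltW.
 rewrite -{2}(mul1r (B T)) ler_wpM2r ?(ltW BT)// -[leRHS]mulr1 ler_pM ?powR_ge0//.
 - by rewrite le_min ler01 invr_ge0 ltW.
 apply: powR_le1 => //.
 by rewrite mulrACA -invfM ldivMr ?mulr_gt0// mul1r (mulrC M) ler_pM ?(ltW bb0) ?(ltW t0').
 pose t' := Num.min t b; have t'b : t' <= b by rewrite ge_min lexx orbT.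
 have Tt' : T <= t' by rewrite le_min Tt ltW.
 have t't : t' <= t by rewrite ge_min lexx.
 have t'0 : 0 < t' := lt_le_trans T0 Tt'.
 apply: (@le_trans _ _ (B t')); last by apply: nyoung_le => //; exact: ltW.
 apply: le_trans (Hb _ _ T0 Tt' t'b).
 rewrite ler_wpM2r ?(ltW BT)// ler_pM ?powR_ge0 ?le_min ?ler01 ?invr_ge0 ?(ltW tp0)//.
 by rewrite ge_min lexx orbT.
 apply: ge0_ler_powR; rewrite ?nnegrE ?divr_ge0 ?(ltW t'0) ?(ltW T0)//.
 have -> : b / M * (t / T) = b * t / M / T by field; rewrite !gt_eqF.
 rewrite ler_pM2r ?invr_gt0// ldivMr//.
 by rewrite /t' minr_pMl ?(ltW M0)// le_min ler_pM2l// tM mulrC ler_pM2l// bM.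
pose Gr := fine (\int[mu]_(t in `[t1, +oo[) ((t / B t) `^ q)%:E)%E.
have G0 : (0 <= \int[mu]_(t in `[t1, +oo[) ((t / B t) `^ q)%:E)%E.
 by apply: int_ge0 => t _; rewrite lee_fin powR_ge0.
have Gr0 : 0 <= Gr by rewrite fine_ge0.
have GrE : (\int[mu]_(t in `[t1, +oo[) ((t / B t) `^ q)%:E)%E = Gr%:E.
 by rewrite fineK// fin_numE0.
(* The power growth from T to M gives B T / T = O(T^(p-1)), so the factor (B T / T)^q of the tail is
   O(T^e) with e > 1; then T^e <= T1^(e-1) T. *)
pose K := (c^-1 * M `^ (- p) * B M) `^ q * T1 `^ (e - 1) * Gr.
have K0 : 0 <= K by rewrite !mulr_ge0 ?powR_ge0.
exists (1 + c^-1 `^ q / (e - 1) + K).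
 by rewrite ltr_wpDr// addr_gt0// divr_gt0 ?powR_gt0 ?invr_gt0// subr_gt0.
move=> T T0 TT1; have BT : 0 < B T by exact: nyoung_gt0.
have TM : T <= M := le_trans TT1 T1M.
have y0 : 0 <= B T / T by rewrite divr_ge0 ?(ltW BT) ?(ltW T0).
apply: (le_trans (slope_integral_split _ T0)).
rewrite -addrA mulrDl mul1r mulrDl EFinD leeD2l// EFinD.
have -> : (`[T, +oo[%classic = `[T, M]%classic `|` `]M, +oo[%classic :> set R).
 by rewrite -itv_bndbnd_setU// bnd_simp.
have sub : `[T, M]%classic `|` `]M, +oo[%classic `<=` (`]0%R, +oo[%classic : set R).
 move=> t /= [|]; rewrite !in_itv/= ?andbT; first by move=> /andP[Tt _]; exact: lt_le_trans Tt.
 exact: lt_trans.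
have mf y : measurable_fun (`[T, M]%classic `|` `]M, +oo[%classic : set R)
 (fun t => ((y * t / B t) `^ q)%:E).
 by apply/mEFinP; apply: measurable_funS (m_slope_powR y).
rewrite ge0_integral_setU//=; last 2 first.
- by move=> t _; rewrite lee_fin powR_ge0.
- by apply: lt_disjoint => x y; rewrite !in_itv/= andbT => /andP[_ aT]; exact: le_lt_trans.
apply: leeD.
 apply: slope_tail_le => //.
 - by move=> t; rewrite /= !in_itv/= => /andP[->].
 - by move=> t; rewrite /= in_itv/= => /andP[Tt tM]; exact: Hc.
apply: (@le_trans _ _ (\int[mu]_(t in `]M, +oo[) (((B T / T) `^ q)%:E * ((1 * t / B t) `^ q)%:E))%E).
 apply: le_int => //.
 - by move=> t _; rewrite lee_fin powR_ge0.
 - by apply: measurable_funS (mf _) => //; exact: measurableU.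
 - apply: emfunM => //.
 by apply: measurable_funS (mf _) => //; exact: measurableU.
 move=> t; rewrite /= in_itv/= andbT => Mt.
 have t0' : 0 < t := lt_trans M0 Mt.
 rewrite mul1r -EFinM lee_fin -powRM ?mulrA//.
 by rewrite divr_ge0 ?(ltW t0')// (nyoung_ge0 HB)// ltW.
rewrite intZlE ?powR_ge0//; last 2 first.
- by move=> t _; rewrite lee_fin powR_ge0.
- by apply: measurable_funS (mf _) => //; exact: measurableU.
apply: (@le_trans _ _ (((B T / T) `^ q)%:E * Gr%:E)%E).
 rewrite lee_pM2l ?lee_fin ?powR_ge0// -GrE.
 under eqint do rewrite mul1r.
 apply: sub_int => //.
 - apply/mEFinP.
 rewrite (_ : (fun t => _) = (fun t : R => (1 * t / B t) `^ q)); last first.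
 by apply/funext => t; rewrite mul1r.
 apply: measurable_funS (m_slope_powR 1) => // t /=.
 by rewrite !in_itv/= !andbT; exact: lt_le_trans.
 - by move=> t _; rewrite lee_fin powR_ge0.
 - by move=> t /=; rewrite !in_itv/= !andbT => Mt; rewrite (le_trans t1M)// ltW.
rewrite -EFinM lee_fin /K [leRHS]mulrAC ler_wpM2r//.
have -> : (c^-1 * M `^ (- p) * B M) `^ q * T1 `^ (e - 1) * T =
 (c^-1 * M `^ (- p) * B M) `^ q * (T1 `^ (e - 1) * T) by ring.
have TeE : T `^ (e - 1) * T = T `^ e by rewrite -{2}(powRr1 (ltW T0)) -powRDp// subrK.
have BM0 : 0 <= B M by apply: nyoung_ge0 => //; exact: ltW.
have cMB : 0 <= c^-1 * M `^ (- p) * B M by rewrite !mulr_ge0 ?powR_ge0 ?invr_ge0 ?(ltW c0).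
apply: (@le_trans _ _ ((c^-1 * M `^ (- p) * B M) `^ q * T `^ e)).
 rewrite /e powRrM -powRM ?powR_ge0//.
 apply: ge0_ler_powR; rewrite ?nnegrE ?(ltW q0)//; first by rewrite mulr_ge0 ?powR_ge0.
 have := Hc T M T0 TM (lexx _).
 rewrite powRM ?(ltW M0) ?invr_ge0 ?(ltW T0)// powRV ?(ltW T0)// => HH.
 rewrite powRN ldivMr//.
 have TpE : T `^ (p - 1) * T = T `^ p by rewrite -{2}(powRr1 (ltW T0)) -powRDp// subrK.
 rewrite -[leRHS]mulrA TpE.
 have Tp : 0 < T `^ p by rewrite powR_gt0.
 have Mp : 0 < M `^ p by rewrite powR_gt0.
 have -> : c^-1 / M `^ p * B M * T `^ p = B M * (T `^ p / (c * M `^ p)).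
 by field; rewrite !gt_eqF.
 have -> : B T = c * (M `^ p / T `^ p) * B T * (T `^ p / (c * M `^ p)).
 by field; rewrite !gt_eqF.
 have k0 : 0 <= T `^ p / (c * M `^ p).
 by apply: divr_ge0; [exact: ltW|apply: mulr_ge0; exact: ltW].
 exact: (ler_wpM2r k0 HH).
rewrite ler_wpM2l ?powR_ge0// -TeE ler_wpM2r ?(ltW T0)//.
by apply: ge0_ler_powR; rewrite ?nnegrE ?(ltW T0) ?(ltW T10)// subr_ge0 ltW.
exact: mf.
Qed.

End slope_integral_bounds.

(** * Jensen's inequality and oscillation of averages *)

Section jensen.
Context d (T : measurableType d) (R : realType) (m : {measure set T -> \bar R}).
Context (B : R -> R) (HB : nyoung B).
Local Open Scope ereal_scope.

Lemma m_young (D : set T) (f : T -> R) : measurable_fun D f ->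
 measurable_fun D (fun x => (B `|f x|)%:E).
Proof.
move=> mf; apply/mEFinP.
apply: (@mcomp _ _ _ _ _ _ (fun t : R => B `|t|)%R) => //.
by apply: continuous_measurable_fun; exact: nyoung_continuous.
Qed.

Lemma young_norm_ge0 (t : R) : 0 <= (B `|t|)%:E.
Proof. by rewrite lee_fin nyoung_ge0. Qed.

(** The supporting line at t0, the argument of B on the left, is integrated over S. Its slope b is
    nonnegative and the mean of |u - c| / D is at least t0 by the triangle inequality. *)
Lemma jensen_average (S : set T) (V c D : R) (u : T -> R) :
 measurable S -> (0 < V)%R -> m S = V%:E -> (0 < D)%R ->
 m.-integrable S (EFin \o u) ->
 (B (`|V^-1 * (\int[m]_(x in S) u x)%R - c| / D))%:E <=
 (V^-1)%:E * \int[m]_(x in S) (B `|(u x - c) / D|)%:E.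
Proof.
move=> mS V0 mSV D0 iu.
have mu : measurable_fun S u by apply/mEFinP; exact: measurable_int iu.
have iuc : m.-integrable S (fun x => (u x - c)%:E).
 apply: (@eq_integrable _ _ _ _ _ mS (fun x => (u x)%:E - (cst c%:E) x)) => //.
 apply: integrableB => //; apply/integrableP; split; first exact: mcst.
 by rewrite integral_cst// mSV -EFinM ltry.
set t0 := (_ / D)%R; have t00 : (0 <= t0)%R by rewrite divr_ge0// ltW.
have [b b0 Hb] := nyoung_support HB t00.
pose f x := `|(u x - c) / D|%R.
have mf : measurable_fun S f.
 apply: mcomp => //; apply: mfunM => //; exact: mfunB.
have f0 x : (0 <= f x)%R by exact: normr_ge0.
have If : \int[m]_(x in S) (f x)%:E = (D^-1)%:E * \int[m]_(x in S) `|(u x - c)%:E|.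
 rewrite -intZlE//.
 - apply: eqint => x _; rewrite /f abse_EFin -EFinM normrM.
 by rewrite [X in (_ * X)%R]ger0_norm ?invr_ge0 ?(ltW D0)// mulrC.
 - by apply/mEFinP/mcomp => //; exact: mfunB.
 - by rewrite invr_ge0 ltW.
have /integrableP[_ iuoo] := iuc.
have Ifoo : \int[m]_(x in S) (f x)%:E < +oo.
 by rewrite If lte_mul_pinfty ?lee_fin ?invr_ge0 ?(ltW D0).
have If0 : 0 <= \int[m]_(x in S) (f x)%:E by apply: int_ge0 => x _; rewrite lee_fin.
pose I := fine (\int[m]_(x in S) (f x)%:E).
have IE : \int[m]_(x in S) (f x)%:E = I%:E by rewrite fineK// fin_numE0.
have t0I : (V * t0 <= I)%R.
 rewrite -lee_fin -IE If /t0.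
 have -> : (V * (`|V^-1 * (\int[m]_(x in S) u x)%R - c| / D))%R =
 (D^-1 * `|(\int[m]_(x in S) (u x - c))%R|)%R.
 have -> : (\int[m]_(x in S) (u x - c))%R = (V * (V^-1 * (\int[m]_(x in S) u x)%R - c))%R.
 rewrite RintegralB//; last first.
 apply/integrableP; split; first exact: mcst.
 by rewrite integral_cst// mSV -EFinM ltry.
 rewrite Rintegral_cst// mSV/= mulrBr mulVKf ?gt_eqF//; congr (_ - _)%R; exact: mulrC.
 rewrite normrM (ger0_norm (ltW V0)); ring.
 rewrite EFinM lee_pM2l ?lee_fin ?invr_ge0 ?(ltW D0)//.
 rewrite EFin_normr_Rintegral//; apply: le_abse_integral => //.
 exact: measurable_int iuc.
have mB : measurable_fun S (fun x => (B (f x))%:E).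
 have := @m_young S (fun x => (u x - c) / D)%R; apply.
 by apply: mfunM => //; exact: mfunB.
have B0 x : (0 <= B (f x))%R by exact: nyoung_ge0.
have key : (V * B t0 + b * I)%:E <= \int[m]_(x in S) (B (f x))%:E + (b * t0 * V)%:E.
 have -> : (V * B t0 + b * I)%:E = \int[m]_(x in S) ((B t0)%:E + b%:E * (f x)%:E).
 rewrite intD//; first last.
 - by apply: emfunM => //; exact/mEFinP.
 - by move=> x _; rewrite mule_ge0 ?lee_fin.
 - by move=> x _; rewrite lee_fin nyoung_ge0.
 rewrite intZlE//; last first.
 - exact/mEFinP.
 - by move=> x _; rewrite lee_fin.
 by rewrite integral_cst// mSV IE -!EFinM -EFinD mulrC.
 have -> : (b * t0 * V)%:E = \int[m]_(x in S) (cst (b * t0)%:E) x.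
 by rewrite integral_cst// mSV EFinM.
 rewrite -intD//; last by move=> x _; rewrite lee_fin mulr_ge0.
 apply: le_int => //.
 - by move=> x _; rewrite -EFinM -EFinD lee_fin addr_ge0 ?(mulr_ge0 b0)// nyoung_ge0.
 - by apply: emfunD => //; apply: emfunM => //; exact/mEFinP.
 - exact: emfunD.
 - move=> x _; rewrite -EFinM -EFinD /= -EFinD lee_fin.
 by have := Hb _ (f0 x); rewrite mulrBr; lra.
 - by move=> x _; rewrite lee_fin.
rewrite lee_pdivlMl// -EFinM.
rewrite -(@leeD2rE _ (b * t0 * V)%:E)//; apply: le_trans key.
by rewrite -EFinD lee_fin lerD2l -mulrA ler_wpM2l// mulrC.
Qed.

End jensen.

Section oscillation.
Context {R : realType} {n : nat} (B : R -> R) (HB : nyoung B) (s : R) (hs : 0 < s).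
Local Notation mu := (@rV_lebesgue R n).
Local Open Scope ereal_scope.

Definition energy (u : 'rV[R]_n -> R) : \bar R :=
 \int[nu n]_z (B `|Ds s u z|%R)%:E.

Lemma m_Ds (u : 'rV[R]_n -> R) : mfun u ->
 mfun (Ds s u).
Proof.
move=> mu_; rewrite (_ : Ds s u = fun z => (u z.1 - u z.2) *
 ((enorm (z.1 - z.2) `^ s) `^ (-1)))%R; last first.
 by apply/funext => z; rewrite /Ds powR_inv1// powR_ge0.
apply: mfunM.
 by apply: mfunB; [exact: (mcomp mu_)|exact: (mcomp mu_)].
apply: (@mcomp _ _ _ _ _ _ (@powR R ^~ (-1)%R)); first exact: mpowR.
apply: (@mcomp _ _ _ _ _ _ (@powR R ^~ s)); first exact: mpowR.
apply: (@mcomp _ _ _ _ _ _ (@enorm R n)); first exact: measurable_enorm.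
apply: measurable_fun_rVP => i.
rewrite (_ : _ \o _ = fun z => (rV_coord i z.1 - rV_coord i z.2)%R); last first.
 by apply/funext => z; rewrite /= /rV_coord !mxE.
by apply: mfunB; apply: (@mcomp _ _ _ _ _ _ (rV_coord i)) => //;
 exact: measurable_rV_coord.
Qed.

Lemma m_energy (u : 'rV[R]_n -> R) : mfun u ->
 mfun (fun z => (B `|Ds s u z|%R)%:E).
Proof. by move=> mu_; apply: m_young => //; exact: m_Ds. Qed.

Lemma ge0_integral_nuD (D : set ('rV[R]_n * 'rV[R]_n)) (f : 'rV[R]_n * 'rV[R]_n -> \bar R) :
 measurable D -> measurable_fun D f -> (forall x, D x -> 0 <= f x) ->
 \int[nu n]_(z in D) f z = \int[mu \x mu]_(z in D) (f z * (nu_density z)%:E).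
Proof.
move=> mD mf f0; rewrite int_mkcond int_nu; last 2 first.
- exact/(measurable_restrictT _ mD).
- by move=> x; apply: erestrict_ge0.
rewrite [RHS]int_mkcond; apply: eqint => z _; rewrite /patch.
by case: ifP => //; rewrite mul0e.
Qed.

Definition average (S : set 'rV[R]_n) (V : R) (u : 'rV[R]_n -> R) : R :=
 V^-1 * (\int[mu]_(x in S) u x)%R.

(** Replacing |y - z| by the larger d lowers the quotient, and d^n |y - z|^(-n) >= 1 pays for the
    density of [nu]. On the diagonal both sides are 0. *)
Lemma nyoung_osc_le (u : 'rV[R]_n -> R) (d : R) y z : (0 < d)%R -> (0 < n)%N ->
 (enorm (y - z) <= d)%R ->
 (B `|(u y - u z) / d `^ s| <= d ^+ n * (B `|Ds s u (y, z)| * nu_density (y, z)))%R.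
Proof.
move=> d0 n0 yzd; rewrite /Ds /nu_density /=.
have [<-|yz] := eqVneq y z.
 by rewrite !(subrr, mul0r, normr0, nyoung0 HB, mulr0).
have e0 : (0 < enorm (y - z))%R by apply: enorm_gt0; rewrite subr_eq0.
rewrite powRN powR_mulrn ?(ltW e0)//.
have es : (0 < enorm (y - z) `^ s)%R by rewrite powR_gt0.
have ds : (0 < d `^ s)%R by rewrite powR_gt0.
apply: (@le_trans _ _ (B `|(u y - u z) / enorm (y - z) `^ s|)%R).
 apply: nyoung_le => //; rewrite !normrM ler_wpM2l//.
 rewrite !normfV (gtr0_norm es) (gtr0_norm ds) lef_pV2 ?posrE//.
 by apply: ge0_ler_powR; rewrite ?nnegrE ?(ltW hs) ?(ltW e0) ?(ltW d0).
rewrite mulrCA; apply: ler_peMr; first exact: nyoung_ge0.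
rewrite ler_pdivlMr ?exprn_gt0// mul1r.
by apply: lerXn2r => //; rewrite nnegrE ltW.
Qed.

(** Jensen in each variable: first on S against the constant average over S', then on S' for each
    fixed point of S. *)
Lemma average_osc_le (u : 'rV[R]_n -> R) (S S' : set 'rV[R]_n) (V V' d : R) :
 (0 < n)%N -> mfun u ->
 measurable S -> measurable S' -> (0 < V)%R -> (0 < V')%R ->
 mu S = V%:E -> mu S' = V'%:E ->
 mu.-integrable S (EFin \o u) -> mu.-integrable S' (EFin \o u) -> (0 < d)%R ->
 (forall y z, S y -> S' z -> (enorm (y - z) <= d)%R) ->
 (B (`|average S V u - average S' V' u| / d `^ s))%:E <=
 (d ^+ n / (V * V'))%:E * \int[nu n]_(z in S `*` S') (B `|Ds s u z|%R)%:E.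
Proof.
move=> n0 mu_ mS mS' V0 V'0 mSV mSV' iS iS' d0 yzd.
have ds : (0 < d `^ s)%R by rewrite powR_gt0.
have mD := m_energy mu_.
apply: (le_trans (jensen_average HB _ mS V0 mSV ds iS)).
rewrite (ge0_integral_nuD (measurableX mS mS')) => [||z _]; last 2 first.
- by apply: mfunTS.
- exact: young_norm_ge0.
pose P (z : 'rV[R]_n * 'rV[R]_n) := (B `|Ds s u z|%R)%:E * (nu_density z)%:E.
rewrite -[X in _ <= _ * X]/(\int[mu \x mu]_(z in S `*` S') P z).
have mP : mfun P.
 by apply: emfunM => //; apply/mEFinP; exact: measurable_nu_density.
have P0 z : 0 <= P z by rewrite mule_ge0 ?young_norm_ge0// lee_fin powR_ge0.
rewrite [X in _ <= _ * X]int_mkcond.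
have mPS : mfun (P \_ (S `*` S')).
 by apply/(measurable_restrictT _ (measurableX mS mS')); exact: mfunTS.
have PS0 z : 0 <= (P \_ (S `*` S')) z by apply: erestrict_ge0.
rewrite fubini_tonelli1//.
set G := fubini_F _ _.
have mG : mfun G by exact: mtonF.
have GE y : S y -> G y = \int[mu]_(z in S') P (y, z).
 move=> Sy; rewrite /G /fubini_F [RHS]int_mkcond; apply: eqint => z _.
 rewrite /patch; congr (if _ then _ else _); apply/idP/idP; rewrite !inE; first by case.
 by move=> ?; split.
have G0 y : 0 <= G y by apply: int_ge0 => z _.
have -> : (d ^+ n / (V * V'))%:E = (V^-1)%:E * (V'^-1 * d ^+ n)%:E.
 by rewrite -EFinM; congr EFin; rewrite invfM; ring.
have k0 : (0 <= V'^-1 * d ^+ n)%R by rewrite mulr_ge0 ?invr_ge0 ?(ltW V'0)// exprn_ge0// ltW.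
rewrite -muleA lee_pM2l ?lee_fin ?invr_ge0 ?(ltW V0)//.
rewrite -intZlE//.
apply: (@le_trans _ _ (\int[mu]_(y in S) ((V'^-1 * d ^+ n)%:E * G y))); last first.
 apply: sub_int => //.
 - by apply: emfunM.
 - by move=> y _; rewrite mule_ge0.
apply: le_int => //.
- by move=> y _; exact: young_norm_ge0.
- apply: m_young => //; apply: mfunM => //.
 by apply: mfunB => //; exact: mfunTS.
- by apply: emfunM => //; exact: mfunTS.
move=> y Sy; rewrite GE//.
have -> : (B `|(u y - average S' V' u) / d `^ s|)%:E =
 (B (`|V'^-1 * (\int[mu]_(x in S') u x)%R - u y| / d `^ s))%:E.
 by rewrite normrM normfV (gtr0_norm ds) distrC.
apply: (le_trans (jensen_average HB _ mS' V'0 mSV' ds iS')).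
rewrite EFinM -muleA lee_pM2l ?lee_fin ?invr_ge0 ?(ltW V'0)//.
have msec : mfun (fun z => P (y, z)).
 exact: (mcomp mP (measurable_pair1 y)).
have dn0 : (0 <= d ^+ n)%R by rewrite exprn_ge0// ltW.
rewrite -(intZlE mu mS' (fun z _ => P0 (y, z)) (mfunTS msec) dn0).
apply: (le_int _ mS').
- by move=> z _; exact: young_norm_ge0.
- apply: m_young => //; apply: mfunM => //.
 by apply: mfunB => //; exact: mfunTS.
- by apply: emfunM; [exact: mcst|exact: mfunTS].
move=> z S'z; rewrite -!EFinM lee_fin.
have -> : (`|(u z - u y) / d `^ s| = `|(u y - u z) / d `^ s|)%R.
 by rewrite !normrM distrC.
by apply: nyoung_osc_le => //; exact: yzd.
Qed.

End oscillation.

(** * Morrey estimates through dyadic chains of shells *)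

Section morrey.
Context {R : realType} {n : nat} (B : R -> R) (HB : nyoung B) (s : R).
Context (n0 : (0 < n)%N) (s01 : 0 < s < 1).
Local Notation mu := (@rV_lebesgue R n).
Local Notation q := (s / (n%:R - s)).
Local Notation eta := (2 `^ (n%:R - s) : R).
Local Notation theta := (eta^-1 `^ q : R).
Local Notation slope := (slope_integral B q).

Let s0 : 0 < s. Proof. by case/andP: s01. Qed.

Let ns0 : 0 < n%:R - s.
Proof.
rewrite subr_gt0; case/andP: s01 => _ s1; apply: (lt_le_trans s1).
by rewrite (ler_nat R 1).
Qed.

Lemma exponent_gt0 : 0 < q.
Proof. by rewrite divr_gt0. Qed.

Lemma dyadic_eta_gt1 : 1 < eta.
Proof.
have H : 1 `^ (n%:R - s) < eta.
 by apply: gt0_ltr_powR; rewrite ?nnegrE// ltr1n.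
by move: H; rewrite powR1.
Qed.

(** The exponent q = s/(n-s) is chosen for this: with slopes growing by eta = 2^(n-s), the weights
    of the chain decay like r^s over dyadic radii r. *)
Lemma dyadic_thetaE : theta = 2 `^ (- s).
Proof.
rewrite powRV ?powR_ge0// -powRrM mulrC divfK ?gt_eqF// powRN.
by rewrite -powRN.
Qed.

Lemma dyadic_theta_eta : theta / eta = (2 ^+ n)^-1.
Proof.
rewrite dyadic_thetaE -powRN -powRDp// (_ : - s - (n%:R - s) = - n%:R); last by ring.
by rewrite powRN powR_mulrn.
Qed.

Local Notation C1 := ((1 - theta)^-1).

Lemma C1_gt0 : 0 < C1.
Proof.
by have /andP[_ t1] := theta01 dyadic_eta_gt1 exponent_gt0; rewrite invr_gt0 subr_gt0.
Qed.

(** The indices are split by whether B(t_k) <= eta^k y t_k. Those that satisfy it are summed by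
    [chain_sum]. For the others t_k < B(t_k) / (eta^k y), and since theta 2^n = eta the term theta^k
    t_k is at most c e_k / y, summable through the energies. *)
Lemma chain_bound (t_ e_ : nat -> R) (c tau y : R) K : 0 < y -> 0 <= c ->
 (forall k, (k < K)%N ->
 [/\ 0 <= t_ k, 0 <= e_ k & B (t_ k) <= c * (2 ^+ n) ^+ k * e_ k]) ->
 \sum_(k < K) e_ k <= tau ->
 ((\sum_(k < K) theta ^+ k * t_ k)%:E <= (c * tau / y)%:E + C1%:E * slope y)%E.
Proof.
move=> y0 c0 H Hs.
have eta0 : 0 < eta by rewrite powR_gt0.
have th0 : 0 < theta by rewrite powR_gt0// invr_gt0.
pose b k := B (t_ k) <= eta ^+ k * y * t_ k.
pose t' k := if b k then t_ k else 0.
have H' k : (k < K)%N -> 0 <= t' k /\ B (t' k) <= eta ^+ k * y * t' k.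
 move=> kK; have [? ? ?] := H k kK; rewrite /t' /b; case: ifP => // _.
 by rewrite (nyoung0 HB) mulr0.
have := chain_sum HB dyadic_eta_gt1 exponent_gt0 y0 H'.
move=> H1; apply: le_trans (leeD2l _ H1).
rewrite -EFinD lee_fin.
apply: (@le_trans _ _ (\sum_(k < K) (c * e_ k / y + theta ^+ k * t' k))).
 apply: ler_sum => k _; have [tk0 ek0 Bk] := H k (ltn_ord k).
 rewrite /t' /b; case: ifPn => [_|]; first by rewrite lerDr divr_ge0 ?mulr_ge0 ?(ltW y0).
 rewrite -ltNge mulr0 addr0 => Hk; rewrite ler_pdivlMr//.
 have ek : 0 < eta ^+ k by rewrite exprn_gt0.
 rewrite -(ler_pM2l ek).
 have -> : eta ^+ k * (theta ^+ k * t_ k * y) = theta ^+ k * (eta ^+ k * y * t_ k) by ring.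
 have thk : 0 < theta ^+ k by rewrite exprn_gt0.
 apply: (le_trans (ler_wpM2l (ltW thk) (ltW Hk))).
 apply: (le_trans (ler_wpM2l (ltW thk) Bk)).
 have -> : theta ^+ k * (c * (2 ^+ n) ^+ k * e_ k) =
 (theta * 2 ^+ n) ^+ k * (c * e_ k) by rewrite exprMn; ring.
 have -> : theta * 2 ^+ n = eta.
 have := dyadic_theta_eta; move/(congr1 (fun x => x * (eta * 2 ^+ n))).
 have -> : theta / eta * (eta * 2 ^+ n) = theta * 2 ^+ n by field; rewrite gt_eqF.
 by move=> ->; rewrite mulrCA mulVf ?mulr1// expf_neq0.
 by [].
rewrite big_split/= lerD2r -mulr_suml -mulr_sumr.
by rewrite ler_wpM2r ?invr_ge0 ?(ltW y0)// ler_wpM2l.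
Qed.

(** Common hypothesis for the two uses of the averages: bounded functions, and functions of finite
    modular. *)
Definition cube_int (u : 'rV[R]_n -> R) :=
 mfun u /\ forall x h, mu.-integrable (cube x h) (EFin \o u).

Definition savg (u : 'rV[R]_n -> R) (x : 'rV[R]_n) (h : R) : R :=
 average (shell x h) ((2 * h) ^+ n - h ^+ n) u.

Local Notation c0 := (((4 * n)%:R : R) ^+ n).

Lemma shell_volume_ge (h : R) : 0 < h -> h ^+ n <= (2 * h) ^+ n - h ^+ n.
Proof.
move=> h0; rewrite exprMn lerBrDr -mulr2n -[leLHS]mulr_natl ler_wpM2r ?exprn_ge0 ?(ltW h0)//.
by rewrite -{1}(expr1 2) ler_eXn2l// ltr1n.
Qed.

Lemma shell_osc_le u x x' h h' (d : R) : cube_int u -> 0 < h -> 0 < h' -> 0 < d ->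
 (forall y z, shell x h y -> shell x' h' z -> enorm (y - z) <= d) ->
 ((B (`|savg u x h - savg u x' h'| / d `^ s))%:E <=
 (d ^+ n / (h ^+ n * h' ^+ n))%:E *
 \int[nu n]_(z in shell x h `*` shell x' h') (B `|Ds s u z|%R)%:E)%E.
Proof.
move=> [mu_ iu] h0 h'0 d0 Hd.
have V0 (k : R) : 0 < k -> 0 < (2 * k) ^+ n - k ^+ n.
 by move=> k0; apply: lt_le_trans (shell_volume_ge k0); rewrite exprn_gt0.
have iS y k : mu.-integrable (shell y k) (EFin \o u).
 apply: integrableS (iu y k) => //; first exact: m_cube.
 - exact: m_shell.
 - by move=> ? [].
have := @average_osc_le _ _ _ HB _ s0 u _ _ _ _ d n0 mu_ (m_shell x h)
 (m_shell x' h') (V0 _ h0) (V0 _ h'0) (rV_lebesgue_shell x (ltW h0))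
 (rV_lebesgue_shell x' (ltW h'0)) (iS _ _) (iS _ _) d0 Hd.
move=> /le_trans; apply; apply: lee_wpmul2r.
 by apply: int_ge0 => z _; exact: young_norm_ge0.
rewrite lee_fin ler_wpM2l ?exprn_ge0 ?(ltW d0)// lef_pV2 ?posrE ?mulr_gt0 ?exprn_gt0 ?V0//.
by apply: ler_pM; rewrite ?exprn_ge0 ?(ltW h0) ?(ltW h'0)//; exact: shell_volume_ge.
Qed.

Lemma energy_ge0 u : (0 <= energy (n := n) B s u)%E.
Proof. by apply: int_ge0 => z _; exact: young_norm_ge0. Qed.

Lemma chain_oscillation u x h y E K : cube_int u -> 0 < h -> 0 < y ->
 (energy B s u <= E%:E)%E ->
 (`|savg u x h - savg u x (h / 2 ^+ K)|%:E <=
 ((4 * n%:R * h) `^ s)%:E * ((c0 * (E / h ^+ n) / y)%:E + C1%:E * slope y))%E.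
Proof.
move=> Lu h0 y0 HE; have [mu_ iu] := Lu.
have nR : 0 < n%:R :> R by rewrite ltr0n.
pose r k := h / 2 ^+ k; have r0 k : 0 < r k by rewrite divr_gt0// exprn_gt0.
have rS k : r k.+1 = r k / 2 by rewrite /r exprS invfM mulrA mulrAC.
pose m k := savg u x (r k).
(* Consecutive shells around one point only need the distance 2 n r; 4 n r is the distance for two
   centres, used here too so that both estimates have the same right-hand side. *)
pose d k := 4 * n%:R * r k; have d0 k : 0 < d k by rewrite !mulr_gt0.
pose S k := shell x (r k) `*` shell x (r k.+1).
have mS k : measurable (S k) by apply: measurableX; exact: m_shell.
have mD := m_energy HB s mu_.
have intS k : (0 <= \int[nu n]_(z in S k) (B `|Ds s u z|%R)%:E <= E%:E)%E.
 apply/andP; split; first by apply: int_ge0 => z _; exact: young_norm_ge0.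
 apply: le_trans HE; apply: sub_int => //.
 by move=> z _; exact: young_norm_ge0.
pose e k := fine (\int[nu n]_(z in S k) (B `|Ds s u z|%R)%:E)%E.
have eE k : (\int[nu n]_(z in S k) (B `|Ds s u z|%R)%:E)%E = (e k)%:E.
 have /andP[i0 iE] := intS k.
 by rewrite fineK// fin_numE0// (le_lt_trans iE)// ltry.
have e0 k : 0 <= e k by rewrite fine_ge0//; case/andP: (intS k).
pose t k := `|m k - m k.+1| / d k `^ s.
have dE k : d k `^ s = (4 * n%:R * h) `^ s * theta ^+ k.
 rewrite dyadic_thetaE -powR_mulrn ?powR_ge0// -powRrM.
 rewrite /d /r mulrA powRM ?invr_ge0 ?exprn_ge0 ?mulr_ge0 ?(ltW h0) ?(ltW nR)//; congr (_ * _).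
 by rewrite powRV ?exprn_ge0// -powR_mulrn// -powRrM mulNr powRN mulrC.
(* The first coordinate already decides the scale: it lies outside the cube of half the radius,
   which contains all later shells. *)
have disj : trivIset setT S.
 apply/trivIsetP => i j _ _; wlog ij : i j / (i < j)%N.
 move=> W; rewrite neq_ltn => /orP[ij|ji]; first by apply: W => //; rewrite lt_eqF.
 by rewrite setIC; apply: W => //; rewrite lt_eqF.
 move=> _; rewrite -subset0 => z [[[_ z1] _] [[z2 _] _]]; apply: z1 => a.
 apply: (le_trans (z2 a)); rewrite -rS /r ler_wpM2l ?(ltW h0)//.
 by rewrite lef_pV2 ?posrE ?exprn_gt0// ler_eXn2l// ltr1n.
have sume : \sum_(k < K) e k <= E.
 rewrite -lee_fin; apply: le_trans HE; rewrite -sumEFin.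
 rewrite (eq_bigr (fun k : 'I_K => \int[nu n]_(z in S k) (B `|Ds s u z|%R)%:E)%E);
 last by move=> k _; rewrite eE.
 rewrite -(big_mkord xpredT (fun k => \int[nu n]_(z in S k) (B `|Ds s u z|%R)%:E)%E).
 rewrite -ge0_integral_bigsetU//.
 - apply: sub_int => //; first exact: bigsetU_measurable.
 by move=> z _; exact: young_norm_ge0.
 - exact: iota_uniq.
 - exact: sub_trivIset disj.
 - exact: mfunTS.
 - by move=> z _; exact: young_norm_ge0.
have Ht k : (k < K)%N -> [/\ 0 <= t k, 0 <= e k / h ^+ n &
 B (t k) <= c0 * (2 ^+ n) ^+ k * (e k / h ^+ n)].
 move=> _; split; first by rewrite divr_ge0 ?powR_ge0.
 by rewrite divr_ge0// exprn_ge0 ?(ltW h0).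
 have Hd y' z : shell x (r k) y' -> shell x (r k.+1) z -> enorm (y' - z) <= 2 * n%:R * r k.
 move=> Hy Hz; have := shell_dist (ltW (r0 k)) (ltW (r0 k.+1)) Hy Hz.
 rewrite subrr enorm0 add0r => /le_trans; apply.
 rewrite (mulrC 2) -mulrA ler_wpM2l ?(ltW nR)// rS; have := r0 k; lra.
 have d2 : 0 < 2 * n%:R * r k by rewrite !mulr_gt0.
 have := shell_osc_le Lu (r0 k) (r0 k.+1) d2 Hd.
 rewrite eE -EFinM lee_fin => H.
 apply: (@le_trans _ _ (B (`|m k - m k.+1| / (2 * n%:R * r k) `^ s))).
 apply: nyoung_le => //; first by rewrite divr_ge0 ?powR_ge0.
 rewrite ler_wpM2l// lef_pV2 ?posrE ?powR_gt0//.
 apply: ge0_ler_powR; rewrite ?nnegrE ?(ltW s0) ?(ltW d2) ?(ltW (d0 k))//.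
 by rewrite /d ler_wpM2r ?(ltW (r0 k))// ler_wpM2r ?(ltW nR)// ler_nat.
 apply: (le_trans H); rewrite mulrA (mulrC (e k)) mulrA ler_wpM2r//.
 rewrite rS natrM exprMn /r.
 apply: eq_imp_le.
 rewrite !exprMn !exprVn -!exprM (mulnC n k) (_ : 4%:R = 2 * 2 :> R); last by rewrite -natrM.
 rewrite exprMn; field.
 by rewrite !expf_neq0// ?gt_eqF.
have sum_e : \sum_(k < K) e k / h ^+ n <= E / h ^+ n.
 by rewrite -mulr_suml ler_wpM2r// invr_ge0 exprn_ge0// ltW.
have cc0 : 0 <= c0 by rewrite exprn_ge0.
have := chain_bound y0 cc0 Ht sum_e.
move=> H2; have P0 : 0 <= (4 * n%:R * h) `^ s by exact: powR_ge0.
apply: le_trans (lee_pM2l _ H2); last by rewrite lee_fin.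
rewrite -EFinM lee_fin mulr_sumr.
have -> : savg u x h = m 0%N by rewrite /m /r expr0 divr1.
have -> : savg u x (h / 2 ^+ K) = m K by [].
have -> : \sum_(i < K) (4 * n%:R * h) `^ s * (theta ^+ i * t i) =
 \sum_(i < K) `|m i - m i.+1|.
 by apply: eq_bigr => i _; rewrite mulrA -dE /t mulrC divfK// gt_eqF// powR_gt0.
elim: (K) => [|K' IH]; first by rewrite subrr normr0 big_ord0.
rewrite big_ord_recr/= (le_trans _ (lerD IH (lexx _)))//.
by rewrite (le_trans _ (ler_normD _ _))// addrA subrK.
Qed.

(** A chain of length one, passed through [chain_bound] only to obtain the same bound as for the
    dyadic chain. *)
Lemma two_center_oscillation u x x' h y E : cube_int u -> 0 < h -> 0 < y ->
 (energy B s u <= E%:E)%E -> enorm (x - x') <= 2 * h ->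
 (`|savg u x h - savg u x' h|%:E <=
 ((4 * n%:R * h) `^ s)%:E * ((c0 * (E / h ^+ n) / y)%:E + C1%:E * slope y))%E.
Proof.
move=> Lu h0 y0 HE xx'; have [mu_ iu] := Lu.
have n1 : 1 <= n%:R :> R by rewrite (ler_nat R 1).
have nR : 0 < n%:R :> R by rewrite ltr0n.
have d0 : 0 < 4 * n%:R * h by rewrite !mulr_gt0.
pose t := `|savg u x h - savg u x' h| / (4 * n%:R * h) `^ s.
have Hd y' z : shell x h y' -> shell x' h z -> enorm (y' - z) <= 4 * n%:R * h.
 move=> Hy Hz; have := shell_dist (ltW h0) (ltW h0) Hy Hz.
 move=> /le_trans; apply; apply: (le_trans (lerD xx' (lexx _))).
 have := ler_wpM2r (ltW h0) n1; lra.
have := shell_osc_le Lu h0 h0 d0 Hd; rewrite -/t => H.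
have Bt : B t <= c0 * (2 ^+ n) ^+ 0 * (E / h ^+ n).
 rewrite -lee_fin; apply: (le_trans H).
 have -> : c0 * (2 ^+ n) ^+ 0 * (E / h ^+ n) = (4 * n%:R * h) ^+ n / (h ^+ n * h ^+ n) * E.
 rewrite expr0 mulr1 natrM [in RHS]exprMn; field; by rewrite expf_neq0// gt_eqF.
 rewrite [in leRHS]EFinM; apply: lee_pM2l.
 by rewrite lee_fin divr_ge0 ?mulr_ge0 ?exprn_ge0 ?(ltW d0) ?(ltW h0).
 apply: le_trans HE; apply: sub_int => //.
 - by apply: measurableX; exact: m_shell.
 - exact: m_energy.
 - by move=> z _; exact: young_norm_ge0.
have E0 : 0 <= E by rewrite -lee_fin (le_trans (energy_ge0 u)).
have cc0 : 0 <= c0 by rewrite exprn_ge0.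
have Ht k : (k < 1)%N -> [/\ 0 <= t, 0 <= E / h ^+ n &
 B t <= c0 * (2 ^+ n) ^+ k * (E / h ^+ n)].
 case: k => // _; split => //; first by rewrite divr_ge0 ?powR_ge0.
 by rewrite divr_ge0// exprn_ge0 ?(ltW h0).
have sE : \sum_(k < 1) E / h ^+ n <= E / h ^+ n by rewrite big_ord1.
have := @chain_bound (fun=> t) (fun=> E / h ^+ n) c0 _ y 1 y0 cc0 Ht sE.
rewrite big_ord1 expr0 mul1r => H2.
have P0 : 0 <= (4 * n%:R * h) `^ s by exact: powR_ge0.
apply: le_trans (lee_pM2l _ H2); last by rewrite lee_fin.
by rewrite -EFinM lee_fin /t mulrC divfK// gt_eqF// powR_gt0.
Qed.

End morrey.

(** * Pointwise Morrey bound and decay of the dyadic error *)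

Section morrey_consequences.
Context {R : realType} {n : nat} (B : R -> R) (HB : nyoung B) (s : R).
Context (n0 : (0 < n)%N) (s01 : 0 < s < 1).
Local Notation mu := (@rV_lebesgue R n).
Local Notation q := (s / (n%:R - s)).
Local Notation eta := (2 `^ (n%:R - s) : R).
Local Notation theta := (eta^-1 `^ q : R).
Local Notation slope := (slope_integral B q).
Local Notation C1 := ((1 - theta)^-1).
Local Notation c0 := (((4 * n)%:R : R) ^+ n).

Let s0 : 0 < s. Proof. by case/andP: s01. Qed.
Let nR : 0 < n%:R :> R. Proof. by rewrite ltr0n. Qed.

Lemma bounded_cube_integrable (u : 'rV[R]_n -> R) M : mfun u ->
 (forall x, `|u x| <= M) -> cube_int u.
Proof.
move=> mu_ uM; split => // x h.
apply: measurable_bounded_integrable => //; first exact: m_cube.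
- have [h0|h0] := leP 0 h; first by rewrite [X in (X < _)%E]rV_lebesgue_cube// ltry.
 rewrite (_ : cube x h = set0) ?measure0//.
 rewrite -subset0 => y /(_ (Ordinal n0)) Hy.
 by have := le_lt_trans (le_trans (normr_ge0 _) Hy) h0; rewrite ltxx.
- exact: mfunTS.
- exists M; split; first exact: num_real.
 by move=> y My z _; rewrite /= (le_trans (uM z))// ltW.
Qed.

Lemma average_near (S : set 'rV[R]_n) (V c e : R) (u : 'rV[R]_n -> R) :
 measurable S -> 0 < V -> mu S = V%:E -> mu.-integrable S (EFin \o u) ->
 (forall y, S y -> `|u y - c| <= e) -> `|average S V u - c| <= e.
Proof.
move=> mS V0 mSV iu H.
have ic (k : R) : mu.-integrable S (EFin \o cst k).
 apply/integrableP; split; first by apply/mEFinP; exact: mcst.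
 rewrite (eqint (cst `|k|%:E)); last by [].
 by rewrite integral_cst// [X in (_ * X)%E]mSV -EFinM ltry.
have cstE (k : R) : \int[mu]_(x in S) (cst k x) = k * V by rewrite Rintegral_cst// [X in fine X]mSV.
rewrite /average ler_distl; apply/andP; split.
 rewrite ler_pdivlMl// mulrC -cstE; apply: le_Rintegral => // y Sy.
 by have := H y Sy; rewrite ler_distl => /andP[].
rewrite ler_pdivrMl// mulrC -cstE; apply: le_Rintegral => // y Sy.
by have := H y Sy; rewrite ler_distl => /andP[].
Qed.

Lemma shell_integrable (u : 'rV[R]_n -> R) x h : cube_int u ->
 mu.-integrable (shell x h) (EFin \o u).
Proof.
move=> [_ iu]; apply: integrableS (iu x h); first exact: m_cube.
- exact: m_shell.
- by move=> ? [].
Qed.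

Lemma shell_volume_gt0 (h : R) : 0 < h -> 0 < (2 * h) ^+ n - h ^+ n.
Proof.
by move=> h0; apply: lt_le_trans (shell_volume_ge n0 h0); rewrite exprn_gt0.
Qed.

Lemma shell_average_cvg (u : 'rV[R]_n -> R) x : cube_int u -> {for x, continuous u} ->
 forall e h, 0 < e -> 0 < h ->
 exists K, forall k, (K <= k)%N -> `|savg u x (h / 2 ^+ k) - u x| <= e.
Proof.
move=> Lu cu e h e0 h0.
have /near_rVP[d d0 Hd] : \forall y \near x, `|u y - u x| < e.
 by move/cvgrPdist_lt : cu => /(_ _ e0); apply: filterS => y; rewrite distrC.
have [K HK] := exprn_unbounded (h / d) (ltr1n R 2).
exists K => k Kk.
have hk : 0 < h / 2 ^+ k by rewrite divr_gt0// exprn_gt0.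
have hd : h / 2 ^+ k < d.
 rewrite ltr_pdivrMr ?exprn_gt0// -ltr_pdivrMl// mulrC (lt_le_trans HK)//.
 by rewrite ler_eXn2l// ltr1n.
apply: average_near.
- exact: m_shell.
- exact: shell_volume_gt0.
- by rewrite rV_lebesgue_shell// ltW.
- exact: shell_integrable.
move=> y [xy _]; apply/ltW/Hd => i; exact: le_lt_trans (xy i) hd.
Qed.

Lemma morrey_bound (C0 : R) v x x' h T : continuous v -> cube_int v ->
 0 < h -> 0 < T -> (energy (n := n) B s v <= (B T * h ^+ n)%:E)%E ->
 (slope (B T / T) <= (C0 * T)%:E)%E -> enorm (x - x') <= 2 * h -> v x' = 0 ->
 `|v x| <= 3 * ((4 * n%:R) `^ s * (c0 + C1 * C0)) * (h `^ s * T).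
Proof.
move=> cv Lv h0 T0 HE HS xx' vx'.
have BT : 0 < B T by exact: nyoung_gt0.
have y0 : 0 < B T / T by rewrite divr_gt0.
have hn : 0 < h ^+ n by rewrite exprn_gt0.
pose W := (4 * n%:R) `^ s * (c0 + C1 * C0) * (h `^ s * T).
have HW : (((4 * n%:R * h) `^ s)%:E *
 ((c0 * (B T * h ^+ n / h ^+ n) / (B T / T))%:E + C1%:E * slope (B T / T)) <= W%:E)%E.
 apply: (@le_trans _ _ (((4 * n%:R * h) `^ s)%:E * ((c0 * T)%:E + (C1 * (C0 * T))%:E))%E).
 apply: lee_pM2l; first by rewrite lee_fin powR_ge0.
 apply: leeD.
 rewrite lee_fin; apply: eq_imp_le; field.
 by rewrite !gt_eqF.
 by rewrite EFinM lee_pM2l// lee_fin ltW// C1_gt0.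
 rewrite -EFinD -EFinM lee_fin powRM ?mulr_ge0 ?(ltW h0) ?(ltW nR)// /W.
 by apply: eq_imp_le; ring.
have near0 z : `|v z - savg v z h| <= W.
 apply/ler_addgt0Pr => e e0.
 have [K HK] := shell_average_cvg Lv (cv z) e0 h0.
 have := HK K (leqnn K).
 have := le_trans (chain_oscillation HB n0 s01 z K Lv h0 y0 HE) HW.
 rewrite lee_fin => H1 H2.
 have -> : v z - savg v z h = - (savg v z h - savg v z (h / 2 ^+ K))
 - (savg v z (h / 2 ^+ K) - v z) by ring.
 by rewrite (le_trans (ler_normB _ _))// normrN lerD.
have := le_trans (two_center_oscillation HB n0 s01 Lv h0 y0 HE xx') HW.
rewrite lee_fin => H2.
have H1 := near0 x; have H3 := near0 x'.
have -> : v x = (v x - savg v x h) + (savg v x h - savg v x' h)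
 - (v x' - savg v x' h) by rewrite vx'; ring.
have -> : 3 * ((4 * n%:R) `^ s * (c0 + C1 * C0)) * (h `^ s * T) = W + W + W.
 by rewrite /W; ring.
by rewrite (le_trans (ler_normB _ _))// lerD// (le_trans (ler_normD _ _))// lerD.
Qed.

Context (slope_lty : forall y, 0 < y -> (slope y < +oo)%E).

(** Dominated convergence: theta^k times the weight at slope eta^k y is at most theta^k, and also at
    most the weight at slope y, because theta = eta^(-q). *)
Lemma slope_scale_small y e : 0 < y -> 0 < e ->
 exists K, forall k, (K <= k)%N -> ((theta ^+ k)%:E * slope (eta ^+ k * y) <= e%:E)%E.
Proof.
move=> y0 e0.
have eta1 := dyadic_eta_gt1 n0 s01; have q0 := exponent_gt0 n0 s01.
have /andP[th0 th1] := theta01 eta1 q0.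
have eta0 : 0 < eta by rewrite powR_gt0.
pose D : set R := `]0, +oo[%classic.
pose f k t := ((theta ^+ k)%:E * (slope_weight B q (eta ^+ k * y) t)%:E)%E.
have mD : measurable D by exact: mitv.
have mw z : measurable_fun D (EFin \o slope_weight B q z).
 by apply/mEFinP; exact: m_slope_weight.
have mf k : measurable_fun D (f k).
 by apply: emfunM; [exact: mcst|exact: mw].
have w0 z t : 0 <= slope_weight B q z t := slope_weight_ge0 B q z t.
have f0 k t : (0 <= f k t)%E by rewrite mule_ge0 ?lee_fin ?exprn_ge0 ?(ltW th0).
have intf k : (\int[lebesgue_measure]_(t in D) f k t = (theta ^+ k)%:E * slope (eta ^+ k * y))%E.
 rewrite /f intZlE//; first by move=> t _; rewrite lee_fin.
 exact: mw.
have thk k : theta ^+ k <= 1 by rewrite exprn_ile1 ?(ltW th0) ?(ltW th1).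
have dom k t : D t -> (`|f k t| <= (slope_weight B q y t)%:E)%E.
 rewrite /D /= in_itv/= andbT => t0.
 rewrite ger0_norm ?mulr_ge0 ?exprn_ge0 ?(ltW th0)// lee_fin /slope_weight le_min; apply/andP; split.
 apply: mulr_ile1 => //; rewrite ?exprn_ge0 ?(ltW th0) ?le_min ?ler01 ?powR_ge0//.
 have Bt : 0 < B t by exact: nyoung_gt0.
 apply: (@le_trans _ _ (theta ^+ k * (eta ^+ k * y * t / B t) `^ q)).
 by rewrite ler_wpM2l ?exprn_ge0 ?(ltW th0)// ge_min lexx orbT.
 rewrite theta_expr// -powRM.
 - apply: eq_imp_le; congr (_ `^ _).
 by field; rewrite (gt_eqF Bt) expf_neq0// gt_eqF.
 - by rewrite invr_ge0 exprn_ge0// ltW.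
 - by rewrite divr_ge0 ?mulr_ge0 ?exprn_ge0 ?(ltW eta0) ?(ltW y0) ?(ltW t0) ?(ltW Bt).
have [||||_ _ H] := @dominated_convergence _ _ _ lebesgue_measure D mD f (cst 0%E)
 (EFin \o slope_weight B q y) mf.
- exact: mcst.
- apply: aeW => t Dt.
 have H0 : (theta ^+ k * slope_weight B q (eta ^+ k * y) t) @[k --> \oo] --> (0 : R).
 apply: (@squeeze_cvgr _ _ _ _ (cst 0) (fun k => theta ^+ k)).
 - near=> k; rewrite mulr_ge0 ?exprn_ge0 ?(ltW th0)//= ler_piMr ?exprn_ge0 ?(ltW th0)//.
 by rewrite ge_min lexx.
 - exact: cvg_cst.
 - by apply: cvg_expr; rewrite ger0_norm ?(ltW th0).
 by apply: cvg_EFin; [exact: nearW|exact: H0].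
- apply/integrableP; split; first exact: mw.
 by under eqint do rewrite /= ger0_norm//; exact: slope_lty.
- by apply: aeW => t k; exact: dom.
move: H; rewrite integral0 => /fine_cvgP[_ /cvgrPdist_lt /(_ _ e0)] [K _ HK].
exists K => k Kk; have := HK k Kk; rewrite /= intf sub0r normrN => /ltW.
have i0 : (0 <= (theta ^+ k)%:E * slope (eta ^+ k * y))%E.
 by rewrite -intf; apply: int_ge0 => t _.
have fi : (((theta ^+ k)%:E * slope (eta ^+ k * y))%E \is a fin_num).
 by rewrite fin_numM// fin_numE0 ?slope_lty ?mulr_gt0 ?exprn_gt0// int_ge0// => t _; rewrite lee_fin.
by rewrite ger0_norm ?fine_ge0// -lee_fin fineK.
Unshelve. all: by end_near.
Qed.

End morrey_consequences.

(** * Continuous representatives of functions of finite energy *)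

Section continuous_representative.
Context {R : realType} {n : nat} (B : R -> R) (HB : nyoung B) (s : R).
Context (n0 : (0 < n)%N) (s01 : 0 < s < 1).
Local Notation mu := (@rV_lebesgue R n).
Local Notation q := (s / (n%:R - s)).
Local Notation eta := (2 `^ (n%:R - s) : R).
Local Notation theta := (eta^-1 `^ q : R).
Local Notation slope := (slope_integral B q).
Local Notation C1 := ((1 - theta)^-1).
Local Notation c0 := (((4 * n)%:R : R) ^+ n).
Context (slope_lty : forall y, 0 < y -> (slope y < +oo)%E).

Let s0 : 0 < s. Proof. by case/andP: s01. Qed.
Let nR : 0 < n%:R :> R. Proof. by rewrite ltr0n. Qed.
Let p2 k : 0 < 2 ^+ k :> R. Proof. by rewrite exprn_gt0. Qed.

Lemma osc_small E e : 0 <= E -> 0 < e -> exists K, forall k, (K <= k)%N ->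
 exists2 y, 0 < y & (((4 * n%:R * (1 / 2 ^+ k)) `^ s)%:E *
 ((c0 * (E / (1 / 2 ^+ k) ^+ n) / y)%:E + C1%:E * slope y) <= e%:E)%E.
Proof.
move=> E0 e0; pose a : R := (4 * n%:R) `^ s.
have a0 : 0 < a by rewrite powR_gt0// mulr_gt0.
have C10 : 0 < C1 := C1_gt0 n0 s01.
have c00 : 0 < c0 by rewrite exprn_gt0// natrM mulr_gt0.
have eta0 : 0 < eta by rewrite powR_gt0.
(* With y = eta^k Y the energy term does not depend on k, because theta 2^n = eta; Y is chosen so
   that it is at most e/2. *)
pose Y := 2 * (a * c0 * (E + 1)) / e.
have Y0 : 0 < Y by rewrite divr_gt0// !mulr_gt0//; lra.
have e2 : 0 < e / (2 * (a * C1)) by rewrite divr_gt0// !mulr_gt0.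
have [K HK] := slope_scale_small HB n0 s01 slope_lty Y0 e2.
exists K => k Kk; exists (eta ^+ k * Y); first by rewrite mulr_gt0// exprn_gt0.
have aE : (4 * n%:R * (1 / 2 ^+ k)) `^ s = a * theta ^+ k.
 rewrite powRM ?mulr_ge0 ?(ltW nR)//.
 congr (_ * _); rewrite dyadic_thetaE// -powR_mulrn ?powR_ge0// -powRrM.
 by rewrite div1r powRV ?(ltW (p2 _))// -powR_mulrn// -powRrM mulNr powRN mulrC.
have th0 : 0 < theta by rewrite powR_gt0// invr_gt0.
have thE : theta * 2 ^+ n = eta.
 have H := dyadic_theta_eta n0 s01.
 have -> : theta = eta * (theta / eta) by field; rewrite gt_eqF.
 by rewrite H mulfVK// expf_neq0.
rewrite aE muleDr//.
rewrite muleA -EFinM [X in (X%:E + _)%E](_ : _ = e / 2 * (E / (E + 1))); last first.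
 have -> : (1 / 2 ^+ k : R) ^+ n = ((2 ^+ n) ^+ k)^-1.
 by rewrite div1r exprVn -!exprM mulnC.
 rewrite /Y; move: (theta) th0 thE => th th0 <-; rewrite exprMn; field.
 rewrite !(gt_eqF a0) (gt_eqF e0) (gt_eqF c00) !expf_neq0 ?(gt_eqF th0)//.
 by rewrite gt_eqF//; lra.
rewrite [X in (_ + X)%E](_ : _ = (a * C1)%:E * ((theta ^+ k)%:E * slope (eta ^+ k * Y)))%E;
 last by rewrite !muleA -!EFinM mulrAC.
have aC : 0 < a * C1 by rewrite mulr_gt0.
have -> : e%:E = ((e / 2)%:E + (a * C1)%:E * (e / (2 * (a * C1)))%:E)%E.
 move: (a * C1) aC => w w0.
 by rewrite -EFinM -EFinD; congr EFin; field; rewrite gt_eqF.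
apply: leeD; last by apply: lee_pM2l; [rewrite lee_fin ltW|exact: HK].
rewrite lee_fin ler_piMr//; first by rewrite divr_ge0// ltW.
by rewrite ldivMr ?mul1r; lra.
Qed.

Lemma averages_cauchy E e : 0 <= E -> 0 < e -> exists K, forall k, (K <= k)%N ->
 forall u : 'rV[R]_n -> R, cube_int u -> (energy B s u <= E%:E)%E ->
 (forall x j, `|savg u x (1 / 2 ^+ k) - savg u x (1 / 2 ^+ (k + j))| <= e) /\
 (forall x x', enorm (x - x') <= 2 * (1 / 2 ^+ k) ->
 `|savg u x (1 / 2 ^+ k) - savg u x' (1 / 2 ^+ k)| <= e).
Proof.
move=> E0 e0; have [K HK] := osc_small E0 e0; exists K => k Kk u Lu HE.
have [y y0 Hy] := HK k Kk.
have k0 : 0 < 1 / 2 ^+ k :> R by rewrite divr_gt0.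
split=> [x j|x x' xx']; rewrite -lee_fin; apply: le_trans Hy.
 have -> : 1 / 2 ^+ (k + j) = 1 / 2 ^+ k / 2 ^+ j :> R by rewrite exprD invfM mulrA.
 exact: (chain_oscillation HB n0 s01 x j Lu k0 y0 HE).
exact: (two_center_oscillation HB n0 s01 Lu k0 y0 HE xx').
Qed.

Lemma nyoung_ge_linear t : 0 <= t -> t <= 1 + B t / B 1.
Proof.
move=> t0; have B1 : 0 < B 1 by exact: nyoung_gt0.
have Bt : 0 <= B t / B 1 by rewrite divr_ge0 ?(ltW B1)// nyoung_ge0.
have [t1|t1] := leP t 1; first lra.
apply: (@le_trans _ _ (B t / B 1)); last lra.
rewrite ler_pdivlMr// mulrC; have := nyoung_slope HB ltr01 (ltW t1); lra.
Qed.

Lemma modular_average (u : 'rV[R]_n -> R) (S : set 'rV[R]_n) (V : R) :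
 mfun u -> measurable S -> mu S = V%:E ->
 (\int[mu]_x (B `|u x|)%:E < +oo)%E ->
 mu.-integrable S (EFin \o u) /\
 (0 < V -> `|average S V u| <= 1 + fine (\int[mu]_x (B `|u x|)%:E) / (V * B 1)).
Proof.
move=> mu_ mS mSV Iu; have B1 : 0 < B 1 by exact: nyoung_gt0.
set I := (\int[mu]_x (B `|u x|)%:E)%E in Iu *.
have I0 : (0 <= I)%E by apply: int_ge0 => x _; exact: young_norm_ge0.
have If : I \is a fin_num by rewrite fin_numE0.
have mB : mfun (fun x : 'rV[R]_n => (B `|u x|)%:E).
 exact: m_young.
have bound : (\int[mu]_(x in S) `|(u x)%:E| <= (V + fine I / B 1)%:E)%E.
 apply: (@le_trans _ _ (\int[mu]_(x in S) (1%:E + (B 1)^-1%:E * (B `|u x|)%:E))%E).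
 apply: (le_int _ mS).
 - by move=> x _; rewrite abse_ge0.
 - by apply: mcomp => //; apply/mEFinP; exact: mfunTS.
 - apply: emfunD; first exact: mcst.
 by apply: emfunM; [exact: mcst|exact: mfunTS].
 - move=> x _; rewrite -EFinM -EFinD lee_fin mulrC.
 by have := nyoung_ge_linear (normr_ge0 (u x)).
 rewrite intD//.
 - rewrite (eqint (cst 1%:E))// integral_cst// [X in (_ * X + _)%E]mSV mul1e.
 rewrite intZlE//.
 + rewrite EFinD leeD2l// mulrC EFinM fineK//; apply: lee_pM2l.
 by rewrite lee_fin invr_ge0 ltW.
 by apply: sub_int => // x _; exact: young_norm_ge0.
 + by move=> x _; exact: young_norm_ge0.
 + exact: mfunTS.
 + by rewrite invr_ge0 ltW.
 - by move=> x _; rewrite mule_ge0 ?young_norm_ge0// lee_fin invr_ge0 ltW.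
 - by apply: emfunM; [exact: mcst|exact: mfunTS].
have iu : mu.-integrable S (EFin \o u).
 apply/integrableP; split; first by apply/mEFinP; exact: mfunTS.
 by apply: (le_lt_trans bound); rewrite ltry.
split=> // V0; rewrite /average normrM ger0_norm ?invr_ge0 ?(ltW V0)//.
rewrite ler_pdivrMl//.
have -> : V * (1 + fine I / (V * B 1)) = V + fine I / B 1.
 by field; rewrite !gt_eqF.
rewrite -lee_fin EFin_normr_Rintegral//; apply: le_trans bound.
apply: le_abse_integral => //; exact: measurable_int iu.
Qed.

Lemma modular_cube_integrable (u : 'rV[R]_n -> R) : mfun u ->
 (\int[mu]_x (B `|u x|)%:E < +oo)%E -> cube_int u.
Proof.
move=> mu_ Iu; split => // x h; have [h0|h0] := leP 0 h.
 by have [] := modular_average mu_ (m_cube x h) (rV_lebesgue_cube x h0) Iu.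
rewrite (_ : cube x h = set0); first exact: integrable_set0.
rewrite -subset0 => y /(_ (Ordinal n0)) Hy.
by have := le_lt_trans (le_trans (normr_ge0 _) Hy) h0; rewrite ltxx.
Qed.

Lemma enorm_uniform_continuous (v : 'rV[R]_n -> R) :
 (forall e, 0 < e -> exists2 d : R, 0 < d &
 forall x y, enorm (x - y) <= d -> `|v x - v y| <= e) -> continuous v.
Proof.
move=> Hv x; apply/(cvgrPdist_le (FF := nbhs_filter x)) => e e0.
have [d d0 Hd] := Hv e e0.
apply/near_rVP; exists (d / n%:R); first by rewrite divr_gt0.
move=> y Hy; apply: Hd; apply: (@le_trans _ _ (n%:R * (d / n%:R))).
 apply: enorm_le; first by rewrite divr_ge0// ltW.
 by move=> i; rewrite !mxE ltW.
by rewrite mulrCA mulfV ?mulr1// gt_eqF.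
Qed.

Definition point_energy (u : 'rV[R]_n -> R) (x : 'rV[R]_n) : \bar R :=
 (\int[mu]_y ((B `|Ds s u (x, y)|)%:E * (nu_density (x, y))%:E))%E.

Lemma point_energy_ae u : mfun u -> (energy (n := n) B s u < +oo)%E ->
 {ae mu, forall x, (point_energy u x < +oo)%E}.
Proof.
move=> mu_ HE; pose f (z : 'rV[R]_n * 'rV[R]_n) := ((B `|Ds s u z|)%:E * (nu_density z)%:E)%E.
have mf : mfun f.
 apply: emfunM; first exact: m_energy.
 by apply/mEFinP; exact: measurable_nu_density.
have f0 z : (0 <= f z)%E.
 by rewrite mule_ge0 ?young_norm_ge0// lee_fin powR_ge0.
have HI : (\int[mu]_x (point_energy u x) = energy B s u)%E.
 rewrite /energy int_nu//; last by move=> ?; exact: young_norm_ge0.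
 by rewrite (fubini_tonelli1 _ mf f0).
 exact: m_energy.
have mp : mfun (point_energy u) by exact: (mtonF f mf f0).
have p0 x : (0 <= point_energy u x)%E by apply: int_ge0 => y _; exact: f0.
have ip : mu.-integrable setT (point_energy u).
 apply/integrableP; split=> //; rewrite (eqint (point_energy u)) ?HI//.
 by move=> x _; rewrite gee0_abs.
have := integrable_ae mTT ip; apply: filterS => x /(_ I).
by rewrite fin_numE0.
Qed.

(** Plays the role of Lebesgue differentiation: where the inner energy integral is finite, which is
    almost everywhere by [point_energy_ae], Jensen on one shell shows that the average differs from
    u x by O(h^s). *)
Lemma shell_average_point (u : 'rV[R]_n -> R) x k : cube_int u ->
 (point_energy u x < +oo)%E ->
 B (`|savg u x (1 / 2 ^+ k) - u x| / (n%:R * (1 / 2 ^+ k)) `^ s) <=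
 n%:R ^+ n * fine (point_energy u x).
Proof.
move=> Lu Gx; have [mu_ _] := Lu; set h : R := 1 / 2 ^+ k.
have h0 : 0 < h by rewrite divr_gt0.
set d := n%:R * h; have d0 : 0 < d by rewrite mulr_gt0.
have ds0 : 0 < d `^ s by rewrite powR_gt0.
have G0 : (0 <= point_energy u x)%E.
 by apply: int_ge0 => y _; rewrite mule_ge0 ?young_norm_ge0// lee_fin powR_ge0.
set V := (2 * h) ^+ n - h ^+ n; have V0 : 0 < V := shell_volume_gt0 n0 h0.
rewrite -lee_fin.
have := @jensen_average _ _ _ mu B HB (shell x h) V (u x) (d `^ s) u (m_shell x h) V0
 (rV_lebesgue_shell x (ltW h0)) ds0 (shell_integrable x h Lu).
move=> /le_trans; apply.
apply: (@le_trans _ _ ((V^-1)%:E * ((d ^+ n)%:E * point_energy u x))%E); last first.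
 rewrite -[X in ((_ * (_ * X)) <= _)%E](@fineK _ (point_energy u x)); last by rewrite fin_numE0.
 rewrite -!EFinM lee_fin mulrA ler_wpM2r ?fine_ge0//.
 rewrite ler_pdivrMl// /d exprMn mulrC ler_wpM2r ?exprn_ge0//.
 exact: shell_volume_ge.
apply: lee_pM2l; first by rewrite lee_fin invr_ge0 ltW.
have mE : mfun (fun y => ((B `|Ds s u (x, y)|)%:E * (nu_density (x, y))%:E)%E).
 have mf : mfun (fun z => ((B `|Ds s u z|)%:E * (nu_density z)%:E)%E).
 apply: emfunM; first exact: m_energy.
 by apply/mEFinP; exact: measurable_nu_density.
 exact: (mcomp mf (mpair1 x)).
have E0 y : (0 <= (B `|Ds s u (x, y)|)%:E * (nu_density (x, y))%:E)%E.
 by rewrite mule_ge0 ?young_norm_ge0// lee_fin powR_ge0.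
rewrite -(intZlE _ mTT)// ?exprn_ge0 ?(ltW d0)//.
apply: (@le_trans _ _ (\int[mu]_(y in shell x h)
 ((d ^+ n)%:E * ((B `|Ds s u (x, y)|)%:E * (nu_density (x, y))%:E)))%E).
 apply: (le_int _ (m_shell x h)).
 - by move=> y _; exact: young_norm_ge0.
 - apply: (@m_young _ _ _ B HB); apply: mfunTS.
 by apply: mfunM => //; apply: mfunB.
 - by apply: mfunTS; apply: emfunM => //; exact: mcst.
 - move=> y [xy _]; rewrite -!EFinM lee_fin.
 have -> : `|(u y - u x) / d `^ s| = `|(u x - u y) / d `^ s|.
 by rewrite -normrN -mulNr opprB.
 apply: nyoung_osc_le => //; rewrite /d; apply: enorm_le; first exact: ltW.
 by move=> i; rewrite !mxE.
apply: sub_int => //; first exact: m_shell.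
- by apply: emfunM => //; exact: mcst.
- by move=> y _; rewrite mule_ge0// lee_fin exprn_ge0// ltW.
Qed.

Lemma dyadic_small (a e : R) : 0 < a -> 0 < e -> exists K, forall k, (K <= k)%N ->
 (n%:R * (1 / 2 ^+ k)) `^ s * a <= e.
Proof.
move=> a0 e0; have ea : 0 < e / a by rewrite divr_gt0.
pose w := (e / a) `^ s^-1; have w0 : 0 < w by rewrite powR_gt0.
have [K HK] := exprn_unbounded (n%:R / w) (ltr1n R 2).
exists K => k Kk; rewrite -ler_pdivlMr//.
have -> : e / a = w `^ s by rewrite /w -powRrM mulVf ?gt_eqF// powRr1// ltW.
have k2 : n%:R * (1 / 2 ^+ k) <= w.
 rewrite mulrA mulr1 ldivMr// -ler_pdivrMl// mulrC.
 by rewrite (le_trans (ltW HK))// ler_eXn2l// ltr1n.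
by apply: ge0_ler_powR; rewrite ?nnegrE ?(ltW s0) ?(ltW w0)// mulr_ge0 ?(ltW nR).
Qed.

Lemma ler_dist3 (a b c d e : R) : `|b - a| <= e / 3 -> `|b - c| <= e / 3 ->
 `|c - d| <= e / 3 -> `|a - d| <= e.
Proof.
rewrite !ler_norml => /andP[h1 h2] /andP[h3 h4] /andP[h5 h6].
apply/andP; split; lra.
Qed.

(** By [averages_cauchy] the dyadic averages converge uniformly and vary little at their own scale,
    so the limit is bounded and uniformly continuous although u is only measurable;
    [shell_average_point] identifies it with u almost everywhere. *)
Lemma continuous_representative (u : 'rV[R]_n -> R) : mfun u ->
 (\int[mu]_x (B `|u x|)%:E < +oo)%E -> (energy (n := n) B s u < +oo)%E ->
 exists v : 'rV[R]_n -> R, [/\ continuous v, exists M, forall x, `|v x| <= M,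
 forall e, 0 < e -> exists2 d : R, 0 < d &
 forall x y, enorm (x - y) <= d -> `|v x - v y| <= e &
 {ae mu, forall x, u x = v x}].
Proof.
move=> mu_ Iu HE; have Lu := modular_cube_integrable mu_ Iu.
have Eu : energy (n := n) B s u \is a fin_num.
 by rewrite fin_numE0//; exact: (energy_ge0 HB).
have E0 : 0 <= fine (energy (n := n) B s u) by rewrite fine_ge0//; exact: (energy_ge0 HB).
have HE' : (energy (n := n) B s u <= (fine (energy (n := n) B s u))%:E)%E by rewrite fineK.
pose m k x := savg u x (1 / 2 ^+ k).
have C e : 0 < e -> exists K, forall k, (K <= k)%N ->
 (forall x j, `|m k x - m (k + j)%N x| <= e) /\
 (forall x x', enorm (x - x') <= 2 * (1 / 2 ^+ k) -> `|m k x - m k x'| <= e).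
 move=> e0; have [K HK] := averages_cauchy E0 e0.
 by exists K => k Kk; exact: HK.
have cm x : cvgn (fun k => m k x).
 apply: cauchy_cvg; apply/cauchy_exP => e e0.
 have e2 : 0 < e / 2 by lra.
 have [K HK] := C _ e2; have [H _] := HK K (leqnn K).
 exists (m K x), K => // j /= Kj.
 have := H x (j - K)%N; rewrite subnKC// /ball/=; lra.
pose v x := limn (fun k => m k x).
have vm e : 0 < e -> exists K, forall k, (K <= k)%N ->
 (forall x, `|m k x - v x| <= e) /\
 (forall x x', enorm (x - x') <= 2 * (1 / 2 ^+ k) -> `|m k x - m k x'| <= e).
 move=> e0; have [K HK] := C e e0; exists K => k Kk; have [H1 H2] := HK k Kk.
 split=> // x.
 have cn : (fun j => `|m k x - m j x|) @ \oo --> `|m k x - v x|.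
 by apply: cvg_norm; apply: cvgB; [exact: cvg_cst|exact: cm].
 have <- := cvg_lim (@Rhausdorff R) cn; apply: limr_le; first by apply/cvg_ex; eexists; exact: cn.
 near=> j; have kj : (k <= j)%N by near: j; exists k.
 by rewrite -(subnKC kj); exact: H1.
have uc e : 0 < e -> exists2 d : R, 0 < d &
 forall x y, enorm (x - y) <= d -> `|v x - v y| <= e.
 move=> e0; have e3 : 0 < e / 3 by lra.
 have [K HK] := vm _ e3; have [H1 H2] := HK K (leqnn K).
 exists (2 * (1 / 2 ^+ K)); first by rewrite !mulr_gt0// invr_gt0.
 move=> x y /H2 h; have h1 := H1 x; have h2 := H1 y.
 exact: ler_dist3 h1 h h2.
exists v; split; [exact: enorm_uniform_continuous| |exact: uc|].
- have [K HK] := vm 1 ltr01; have [H1 _] := HK K (leqnn K).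
 have h0 : 0 < 1 / 2 ^+ K :> R by rewrite divr_gt0.
 set V := (2 * (1 / 2 ^+ K : R)) ^+ n - (1 / 2 ^+ K) ^+ n.
 exists (1 + (1 + fine (\int[mu]_x (B `|u x|)%:E)%E / (V * B 1))) => x.
 have [_ H] := modular_average mu_ (m_shell x _) (rV_lebesgue_shell x (ltW h0)) Iu.
 have := H (shell_volume_gt0 n0 h0); have := H1 x; rewrite distrC /m /savg => h1 h2.
 rewrite -(subrK (average (shell x (1 / 2 ^+ K)) V u) (v x)) (le_trans (ler_normD _ _))//.
 exact: lerD.
- have := point_energy_ae mu_ HE; apply: filterS => x Gx.
 have G0 : (0 <= point_energy u x)%E.
 by apply: int_ge0 => y _; rewrite mule_ge0 ?young_norm_ge0// lee_fin powR_ge0.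
 set g := n%:R ^+ n * fine (point_energy u x).
 have g0 : 0 <= g by rewrite mulr_ge0 ?exprn_ge0 ?(ltW nR)// fine_ge0.
 have g1 : 0 < g + 1 by lra.
 (* B T = g + 1 exceeds the bound g of [shell_average_point], so the argument of B there stays below
    T, for every scale. *)
 have [T T0 BT] := nyoung_surj HB g1.
 apply/eqP; rewrite -subr_eq0 -normr_le0; apply/ler_addgt0Pr => e e0; rewrite add0r.
 have e2 : 0 < e / 2 by lra.
 have [K HK] := vm _ e2; have [K' HK'] := dyadic_small T0 e2.
 pose k := maxn K K'.
 have [H1 _] := HK k (leq_maxl _ _); have H2 := HK' k (leq_maxr _ _).
 set d := (n%:R * (1 / 2 ^+ k)) `^ s in H2.
 have d0 : 0 < d by rewrite powR_gt0// mulr_gt0// divr_gt0.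
 have H3 : `|m k x - u x| <= d * T.
 rewrite mulrC -ldivMr// leNgt; apply/negP => Tt.
 have := shell_average_point k Lu Gx; rewrite -/d -/g -/(m k x) => H.
 have := nyoung_le HB (ltW T0) (ltW Tt); rewrite BT => /le_trans /(_ H); lra.
 have := H1 x => H4.
 rewrite (_ : u x - v x = (m k x - v x) - (m k x - u x)); last by ring.
 rewrite (le_trans (ler_normB _ _))//; lra.
Unshelve. all: by end_near.
Qed.

End continuous_representative.

(** * Integrals with endpoint singularities *)

Section singular_ftc.
Context {R : realType}.
Local Notation mu := (@lebesgue_measure R).

Lemma is_derive_cvg (F : R -> R) (x d : R) : is_derive x 1 F d -> F y @[y --> x] --> F x.
Proof.
by case=> dF _; apply: differentiable_continuous; apply/derivable1_diffP.
Qed.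

(** The integrand may blow up at both ends: the theorem for closed intervals is applied on [S k],
    and monotone convergence meets the one-sided limits of F. *)
Lemma ge0_FTC2_oo (f F : R -> R) (a b : R) : a < b ->
 (forall x, a < x < b -> 0 <= f x) -> (forall x, a < x < b -> {for x, continuous f}) ->
 (forall x : R, a < x < b -> is_derive x 1 F (f x)) ->
 F x @[x --> a^'+] --> F a -> F x @[x --> b^'-] --> F b ->
 (\int[mu]_(x in `]a, b[) (f x)%:E = (F b - F a)%:E)%E.
Proof.
move=> ab f0 cf dF Fa Fb.
pose d := (b - a) / 4; have d0 : 0 < d by rewrite /d; lra.
pose e (k : nat) : R := d * (1 / 2) ^+ k.
have e0 k : 0 < e k by rewrite mulr_gt0// exprn_gt0.
have h1 : (1 / 2 : R) <= 1 by lra.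
have h0 : 0 <= (1 / 2 : R) by lra.
have ed k : e k <= d by rewrite ler_piMr ?(ltW d0)// exprn_ile1.
have emono i j : (i <= j)%N -> e j <= e i.
 by move=> ij; rewrite ler_wpM2l ?(ltW d0)// ler_wiXn2l.
have ecvg : e k @[k --> \oo] --> (0 : R).
 rewrite -(mulr0 d); apply: cvgMr; apply: cvg_expr; rewrite ger0_norm//; lra.
pose S k : set R := `[a + e k, b - e k]%classic.
have SE : \bigcup_k S k = `]a, b[%classic.
 apply/seteqP; split => [x [k _]|x].
 rewrite /S /= !in_itv/= => /andP[]; have := e0 k; move=> *; apply/andP; split; lra.
 rewrite /= in_itv/= => /andP[ax xb].
 pose w := Num.min (x - a) (b - x); have w0 : 0 < w by rewrite lt_min !subr_gt0 ax.
 have [k Hk] := exprn_unbounded (d / w) (ltr1n R 2).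
 exists k => //; rewrite /S /= in_itv/=.
 have ew : e k <= w.
 rewrite /e div1r exprVn ldivMr ?exprn_gt0// -ler_pdivrMl// mulrC; exact: ltW.
 have /andP[h3 h4] : (w <= x - a) && (w <= b - x) by rewrite /w !ge_min !lexx orbT.
 apply/andP; split; lra.
have IS k : (\int[mu]_(x in S k) (f x)%:E = (F (b - e k) - F (a + e k))%:E)%E.
 have abk : a + e k < b - e k by have := ed k; rewrite /d; lra.
 have inn x : a + e k <= x <= b - e k -> a < x < b.
 by have := e0 k => ? /andP[h3 h4]; apply/andP; split; lra.
 have cF x : a < x < b -> F y @[y --> x] --> F x.
 by move=> xab; exact: is_derive_cvg (dF x xab).
 rewrite EFinB; apply: continuous_FTC2 => //.
 - apply: continuous_in_subspaceT => x; rewrite inE/= in_itv/= => xk.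
 exact/cf/inn.
 - split.
 + move=> x; rewrite in_itv/= => /andP[h3 h4].
 by have [] : is_derive x 1 F (f x) by apply: dF; apply: inn; rewrite !ltW.
 + by apply: cvg_at_right_filter; apply: cF; apply: inn; rewrite lexx ltW.
 + by apply: cvg_at_left_filter; apply: cF; apply: inn; rewrite lexx ltW.
 - move=> x; rewrite in_itv/= => /andP[h3 h4]; rewrite derive1E.
 by have [_ ->] : is_derive x 1 F (f x) by apply: dF; apply: inn; rewrite !ltW.
have := @ge0_nondecreasing_set_cvg_integral _ (measurableTypeR R) R S (EFin \o f) mu.
rewrite SE => H.
have {H} C1 : (\int[mu]_(x in S i) (f x)%:E @[i --> \oo] -->
 \int[mu]_(x in `]a, b[) (f x)%:E)%E.
 apply: H.
 - move=> i j ij; apply/subsetPset => x; rewrite /S /= !in_itv/= => /andP[h3 h4].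
 by have := emono _ _ ij => h5; apply/andP; split; lra.
 - by move=> i; exact: mitv.
 - move=> i; have cw : {within S i, continuous f}.
 apply: continuous_in_subspaceT => x; rewrite inE /S/= in_itv/= => /andP[h3 h4].
 by apply: cf; have := e0 i => h5; apply/andP; split; lra.
 by apply/mEFinP; exact: subspace_continuous_measurable_fun (mitv _) cw.
 - move=> i x; rewrite /S /= in_itv/= lee_fin => /andP[h3 h4].
 by apply: f0; have := e0 i => h5; apply/andP; split; lra.
have C2 : ((F (b - e i) - F (a + e i))%:E @[i --> \oo] --> (F b - F a)%:E)%E.
 apply: cvg_EFin; first exact: nearW.
 apply: cvgB.
 - apply: (cvg_at_leftP F b (F b)).1 => //; split; first by move=> k; rewrite gtrBl.
 by rewrite -[X in _ --> X]subr0; apply: cvgB => //; exact: cvg_cst.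
 - apply: (cvg_at_rightP F a (F a)).1 => //; split; first by move=> k; rewrite ltrDl.
 by rewrite -[X in _ --> X]addr0; apply: cvgD => //; exact: cvg_cst.
apply: (cvg_unique _ C1); first exact: ereal_hausdorff.
by rewrite (funext IS).
Qed.

Context (s : R) (s01 : 0 < s < 1).
Let s0 : 0 < s. Proof. by case/andP: s01. Qed.

Lemma cvg_powR_seq (v : R^nat) : (forall k, 0 < v k) -> v k @[k --> \oo] --> (0 : R) ->
 v k `^ s @[k --> \oo] --> (0 : R).
Proof.
move=> v0 cv.
by have /cvg_at_rightP H := powR_cvg0 s0; apply: (H v); split.
Qed.

Lemma is_derive_powRV (x : R) : 0 < x ->
 is_derive x 1 (fun x : R => x `^ s / s) (x `^ (s - 1)).
Proof.
move=> x0; have D : is_derive x 1 (fun x : R => x `^ s) (s * x `^ (s - 1)).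
 exact: is_derive1_powR.
rewrite (_ : (fun x => _) = (fun x : R => s^-1 *: (x `^ s))); last first.
 by apply/funext => y; rewrite /GRing.scale/= mulrC.
rewrite (_ : x `^ (s - 1) = s^-1 *: (s * x `^ (s - 1))); first exact: is_deriveZ.
by rewrite /GRing.scale/= mulKf// gt_eqF.
Qed.

Lemma integral_powR0 T : 0 < T ->
 (\int[mu]_(x in `]0%R, T[) (x `^ (s - 1))%:E = (T `^ s / s)%:E)%E.
Proof.
move=> T0.
apply: etrans; [apply: (@ge0_FTC2_oo (fun x : R => x `^ (s - 1)) (fun x : R => x `^ s / s) 0 T) => //|].
- by move=> x _; exact: powR_ge0.
- by move=> x /andP[x0 _]; exact: continuous_powRl.
- by move=> x /andP[x0 _]; exact: is_derive_powRV.
- rewrite powR0 ?gt_eqF//; apply: cvgMl; exact: powR_cvg0.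
- apply: cvg_at_left_filter; apply: cvgMl; exact: continuous_powRl.
- by rewrite /= powR0 ?gt_eqF// mul0r subr0.
Qed.

(** For r = (t - x)/x one has dr = -(t/x^2) dx and x^(-1-s) (t-x)^(s-1) = r^(s-1) / x^2, so the
    integrand is -r^(s-1) dr / t. *)
Lemma is_derive_ratio (t x : R) : 0 < x < t ->
 is_derive x 1 (fun y : R => - (((t - y) / y) `^ s / (s * t)))
 (x `^ (- 1 - s) * (t - x) `^ (s - 1)).
Proof.
move=> /andP[x0 xt]; have t0 : 0 < t := lt_trans x0 xt.
have tx : 0 < t - x by rewrite subr_gt0.
have D1 : is_derive x 1 (fun y : R => (t - y) / y) (- (t / x ^+ 2)).
 have D0 : is_derive x 1 (fun y : R => y^-1) (- x ^- 2).
 rewrite (_ : - x ^- 2 = - x ^- 2 *: 1); last by rewrite /GRing.scale/= mulr1.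
 exact: (@is_deriveV R id x 1 1 (lt0r_neq0 x0)).
 rewrite (_ : (fun y => _) = (fun y : R => t - y) * (fun y : R => y^-1)); last by [].
 have D2 : is_derive x 1 (fun y : R => t - y) (- 1).
 rewrite -[X in is_derive _ _ _ X]add0r; exact: is_deriveB.
 have := is_deriveM D2 D0; rewrite /GRing.scale/=.
 rewrite (_ : _ + _ = - (t / x ^+ 2))//; field; exact: lt0r_neq0.
have r0 : 0 < (t - x) / x by rewrite divr_gt0.
have D3 := is_derive_powRV r0.
have D4 := @is_derive1_comp _ (fun x : R => x `^ s / s) (fun y : R => (t - y) / y) _ _ _ D3 D1.
rewrite (_ : (fun y => _) = (fun y : R => - t^-1 *: (((t - y) / y) `^ s / s))); last first.
 by apply/funext => y; rewrite /GRing.scale/=; field; rewrite !gt_eqF.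
rewrite (_ : _ * _ = - t^-1 *: (- (t / x ^+ 2) * ((t - x) / x) `^ (s - 1))).
 by apply: is_deriveZ; rewrite mulrC.
rewrite (_ : _ *: _ = ((t - x) / x) `^ (s - 1) / x ^+ 2); last first.
 by rewrite /GRing.scale/=; field; rewrite !gt_eqF.
rewrite powRM ?invr_ge0 ?(ltW x0) ?(ltW tx)// powRV ?(ltW x0)// -mulrA mulrC; congr (_ * _).
rewrite -powR_mulrn ?(ltW x0)// -!powRN -powRDp//; congr (_ `^ _); lra.
Qed.

Lemma integral_beta_truncated (e t : R) : 0 < e < t ->
 (\int[mu]_(x in `]e, t[) (x `^ (- 1 - s) * (t - x) `^ (s - 1))%:E =
 (((t - e) / e) `^ s / (s * t))%:E)%E.
Proof.
move=> /andP[e0 et]; have t0 : 0 < t := lt_trans e0 et.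
apply: etrans; [apply: (@ge0_FTC2_oo (fun x => x `^ (- 1 - s) * (t - x) `^ (s - 1))
 (fun y : R => - (((t - y) / y) `^ s / (s * t))) e t) => //|].
- by move=> x _; rewrite mulr_ge0 ?powR_ge0.
- move=> x /andP[ex xt]; have x0 : 0 < x := lt_trans e0 ex.
 apply: cvgM; first exact: continuous_powRl.
 apply: (@continuous_comp _ _ _ (fun x : R => t - x) (fun x : R => x `^ (s - 1))).
 by apply: continuousB; [exact: cvg_cst|exact: cvg_id].
 by apply: continuous_powRl; rewrite subr_gt0.
- by move=> x /andP[ex xt]; apply: is_derive_ratio; rewrite xt (lt_trans e0 ex).
- apply: cvg_at_right_filter.
 apply: (is_derive_cvg (F := fun y : R => - (((t - y) / y) `^ s / (s * t)))).
 by apply: is_derive_ratio; rewrite e0.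
- rewrite subrr mul0r powR0 ?gt_eqF// mul0r.
 apply: cvgN; rewrite -(mul0r (s * t)^-1); apply: cvgMl.
 (* The maximum with t/2 keeps the quotient positive along every sequence below t, and changes
    nothing near t. *)
 pose G (x : R) := ((t - Num.max x (t / 2)) / Num.max x (t / 2)) `^ s.
 have H : G x @[x --> t^'-] --> (0 : R).
 apply/cvg_at_leftP => u [ut cu]; rewrite /G; apply: cvg_powR_seq => [k|].
 have := ut k; case: (leP (u k) (t / 2)) => h h'; apply: divr_gt0; lra.
 have cm : Num.max (u k) (t / 2) @[k --> \oo] --> t.
 rewrite -[X in _ --> X](_ : Num.max t (t / 2) = t); last by apply/max_idPl; lra.
 apply: (cvg_comp u (fun x : R => Num.max x (t / 2)) cu).
 by apply: (@continuous_max R R^o (fun x : R => x) (cst (t / 2))); [exact: cvg_id|exact: cvg_cst].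
 rewrite -(mul0r t^-1); apply: cvgM.
 by rewrite -(subrr t); apply: cvgB => //; exact: cvg_cst.
 by apply: cvgV => //; rewrite gt_eqF.
 apply: cvg_trans H; apply: near_eq_cvg; near=> x; rewrite /G.
 suff -> : Num.max x (t / 2) = x by [].
 apply/max_idPl; near: x; apply: nbhs_left_ge; lra.
- by rewrite /= subrr mul0r powR0 ?gt_eqF// mul0r oppr0 sub0r opprK.
Unshelve. all: by end_near.
Qed.

Lemma integral_powRB (t : R) : 0 < t ->
 (\int[mu]_(x in `]0%R, t[) ((t - x) `^ (s - 1))%:E = (t `^ s / s)%:E)%E.
Proof.
move=> t0; rewrite -(integral_powR0 t0) int_mkcond [RHS]int_mkcond.
have m1 : (-1 : R) != 0 by rewrite oppr_eq0 oner_eq0.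
rewrite [RHS](integral_affine t m1); last 2 first.
- apply/(measurable_restrictT _ (mitv _)); apply/mEFinP.
 by apply: mfunTS; exact: mpowR.
- by move=> x; apply: erestrict_ge0 => y _; rewrite lee_fin powR_ge0.
rewrite normrN1 mul1e; apply: eqint => x _; rewrite /patch.
rewrite mulN1r addrC; congr (if _ then _ else _).
by apply/idP/idP; rewrite !inE/= !in_itv/= => /andP[h1 h2]; apply/andP; split; lra.
Qed.

Context (c : R) (c0 : 0 < c).

(** The integrand is the derivative of -(c/s) exp(-x^s/c). *)
Lemma integral_exp_powR_le :
 (\int[mu]_(x in `]0%R, +oo[) (x `^ (s - 1) * expR (- (x `^ s / c)))%:E <= (c / s)%:E)%E.
Proof.
pose f (x : R) := x `^ (s - 1) * expR (- (x `^ s / c)).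
pose S (k : nat) : set R := `]0, k.+1%:R[%classic.
have SE : \bigcup_k S k = `]0%R, +oo[%classic.
 apply/seteqP; split => [x [k _]|x]; rewrite /S /= !in_itv/= ?andbT.
 by case/andP.
 move=> x0; exists (Num.bound x) => //=; rewrite in_itv/= x0/=.
 have := archi_boundP (ltW x0) => /lt_le_trans; apply.
 by rewrite ler_nat.
have Df (x : R) : 0 < x -> is_derive x 1 (fun x : R => - (c / s) * expR (- (x `^ s / c))) (f x).
 move=> x0; have D : is_derive x 1 (fun x : R => - (s / c) *: (x `^ s / s)) (- (s / c) *: x `^ (s - 1)).
 by apply: is_deriveZ; exact: is_derive_powRV.
 have E : (fun x : R => - (x `^ s / c)) = (fun x : R => - (s / c) *: (x `^ s / s)).
 by apply/funext => y; rewrite /GRing.scale/=; field; rewrite !gt_eqF.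
 rewrite -E in D.
 have D2 := @is_derive1_comp _ expR (fun x : R => - (x `^ s / c)) _ _ _ (is_derive_expR (- (x `^ s / c))) D.
 have D3 := @is_deriveZ _ _ _ _ (- (c / s)) _ _ _ D2.
 rewrite (_ : f x = - (c / s) *: (expR (- (x `^ s / c)) *: (- (s / c) *: x `^ (s - 1)))).
 exact: D3.
 by rewrite /GRing.scale/= /f; field; rewrite !gt_eqF.
have cf (x : R) : 0 < x -> {for x, continuous f}.
 move=> x0; apply: cvgM; first exact: continuous_powRl.
 apply: (@continuous_comp _ _ _ (fun x : R => - (x `^ s / c)) expR).
 by apply: cvgN; apply: cvgMl; exact: continuous_powRl.
 exact: continuous_expR.
have IS k : (\int[mu]_(x in S k) (f x)%:E <= (c / s)%:E)%E.
 apply: (@le_trans _ _ (- (c / s) * expR (- ((k.+1%:R : R) `^ s / c)) -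
 - (c / s) * expR (- ((0 : R) `^ s / c)))%:E).
 apply: eq_imp_le.
 apply: (@ge0_FTC2_oo f (fun x : R => - (c / s) * expR (- (x `^ s / c))) 0 k.+1%:R).
 + by [].
 + by move=> x _; rewrite mulr_ge0 ?powR_ge0 ?expR_ge0.
 + by move=> x /andP[x0 _]; exact: cf.
 + by move=> x /andP[x0 _]; exact: Df.
 + apply: cvgMr; apply: (@cvg_comp _ _ _ (fun x : R => - (x `^ s / c)) expR); last exact: continuous_expR.
 rewrite powR0 ?gt_eqF//; apply: cvgN; apply: cvgMl; exact: powR_cvg0.
 + apply: cvg_at_left_filter; apply: cvgMr.
 apply: (@continuous_comp _ _ _ (fun x : R => - (x `^ s / c)) expR); last exact: continuous_expR.
 by apply: cvgN; apply: cvgMl; exact: continuous_powRl.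
 have p0 : 0 `^ s = 0 :> R by rewrite powR0 // gt_eqF.
 rewrite lee_fin p0 mul0r oppr0 expR0 mulr1 opprK mulNr.
 set E := expR _; have E0 : 0 <= E := expR_ge0 _.
 have cs : 0 < c / s by rewrite divr_gt0.
 by rewrite gerDr oppr_le0; apply: mulr_ge0; [exact: ltW|exact: E0].
have := @ge0_nondecreasing_set_cvg_integral _ (measurableTypeR R) R S (EFin \o f) mu.
rewrite SE => H.
have {H} C1 : (\int[mu]_(x in S i) (f x)%:E @[i --> \oo] -->
 \int[mu]_(x in `]0%R, +oo[) (f x)%:E)%E.
 apply: H.
 - move=> i j ij; apply/subsetPset => x; rewrite /S /= !in_itv/= => /andP[h3 h4].
 by rewrite h3/= (lt_le_trans h4)// ler_nat.
 - by move=> i; exact: mitv.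
 - move=> i; have cw : {within S i, continuous f}.
 by apply: continuous_in_subspaceT => x; rewrite inE /S/= in_itv/= => /andP[h3 h4]; exact: cf.
 by apply/mEFinP; exact: subspace_continuous_measurable_fun (mitv _) cw.
 - by move=> i x _; rewrite lee_fin mulr_ge0 ?powR_ge0 ?expR_ge0.
rewrite -(cvg_lim (@ereal_hausdorff R) C1); apply: lime_le; first by apply/cvg_ex; eexists; exact: C1.
by apply: nearW.
Qed.

End singular_ftc.

(** * Truncated Marchaud derivative of the damped power *)

Section dpow.
Context {R : realType} (s c : R) (s01 : 0 < s < 1) (c0 : 0 < c).
Local Notation mu := (@lebesgue_measure R).

Let s0 : 0 < s. Proof. by case/andP: s01. Qed.
Let s1 : s < 1. Proof. by case/andP: s01. Qed.

Definition damp (t : R) : R := expR (- (t `^ s / c)).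

(** t^(s-1) is, up to a constant, the fundamental solution of the Marchaud derivative of order s;
    the damping makes its mass finite. *)
Definition dpow (t : R) : R := if 0 < t then t `^ (s - 1) * damp t else 0.

(** Jump density of the s-stable subordinator, with the jumps below e removed so that its mass is
    finite when e > 0. *)
Definition jdens (e x : R) : R := if e < x then x `^ (- 1 - s) else 0.

(** The excess of [dpow (t - x)] over the same power damped by [damp t]: the contribution of the
    damping to the jump integral. *)
Definition drop (t x : R) : R :=
 if (0 < x) && (x < t) then (t - x) `^ (s - 1) * (damp (t - x) - damp t) else 0.

Definition drate (e t : R) : \bar R :=
 (\int[mu]_x (jdens e x * drop t x)%:E)%E.

(** The truncated Marchaud derivative of the undamped power. Its mass does not depend on e and
    concentrates at 0 as e tends to 0, see [rn_bump_scale]: it approximates a multiple of the unit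
    mass at 0. *)
Definition bump (e t : R) : R :=
 if 0 < t then e `^ (- s) * (t `^ s - (Num.max (t - e) 0) `^ s) / (s * t) else 0.

Lemma dpowE t : dpow t = if 0 < t then t `^ (s - 1) * damp t else 0.
Proof. by []. Qed.

Lemma jumpE e x : jdens e x = if e < x then x `^ (- 1 - s) else 0.
Proof. by []. Qed.

Lemma bumpE e t : bump e t =
 if 0 < t then e `^ (- s) * (t `^ s - (Num.max (t - e) 0) `^ s) / (s * t) else 0.
Proof. by []. Qed.

Lemma damping_gt0 t : 0 < damp t. Proof. exact: expR_gt0. Qed.

Lemma damping_le1 t : damp t <= 1.
Proof. by rewrite /damp -expR0 ler_expR oppr_le0 divr_ge0 ?powR_ge0 ?ltW. Qed.

Lemma damping_le x y : 0 <= x -> x <= y -> damp y <= damp x.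
Proof.
move=> x0 xy; rewrite /damp ler_expR lerN2 ler_wpM2r ?invr_ge0 ?(ltW c0)//.
by apply: ge0_ler_powR; rewrite ?nnegrE ?(ltW s0)// (le_trans x0).
Qed.

Lemma m_damping : mfun damp.
Proof.
apply: (@mcomp _ _ _ _ _ _ expR); first exact: measurable_expR.
apply: mcomp; first exact: oppr_measurable.
apply: mfunM; last exact: mcst.
exact: mpowR.
Qed.

Lemma dpow_ge0 t : 0 <= dpow t.
Proof.
by rewrite /dpow; case: ifP => // _; rewrite mulr_ge0 ?powR_ge0 ?ltW ?damping_gt0.
Qed.

Lemma m_dpow : mfun dpow.
Proof.
apply: mifT.
- by apply: mltr; [exact: mcst|exact: mid].
- by apply: mfunM; [exact: mpowR|exact: m_damping].
- exact: mcst.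
Qed.

Lemma jump_ge0 e x : 0 <= jdens e x.
Proof. by rewrite /jdens; case: ifP => // _; exact: powR_ge0. Qed.

Lemma m_jump e : mfun (jdens e).
Proof.
apply: mifT.
- by apply: mltr; [exact: mcst|exact: mid].
- exact: mpowR.
- exact: mcst.
Qed.

Lemma jump_mass e : 0 < e -> (\int[mu]_x (jdens e x)%:E = (e `^ (- s) / s)%:E)%E.
Proof.
move=> e0; have s11 : 1 < 1 + s by rewrite ltrDl.
have := integral_powRN s11 e0.
rewrite (_ : 1 - (1 + s) = - s); last by ring.
rewrite (_ : 1 + s - 1 = s); last by ring.
move=> <-; rewrite -integral_itv_obnd_cbnd; last first.
 by apply/mEFinP; apply: mfunTS; exact: mpowR.
rewrite [RHS]int_mkcond; apply: eqint => x _.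
rewrite /patch mem_setE in_itv/= andbT /jdens (_ : - (1 + s) = - 1 - s); last by ring.
by case: ifP.
Qed.

Lemma drop_ge0 t x : 0 <= drop t x.
Proof.
rewrite /drop; case: ifP => // /andP[x0 xt].
rewrite mulr_ge0 ?powR_ge0// subr_ge0; apply: damping_le; lra.
Qed.

Lemma m_drop : mfun (fun z : R * R => drop z.1 z.2).
Proof.
apply: mifT.
- by apply: measurable_and; apply: mltr => //; exact: mcst.
- apply: mfunM.
 apply: (@mcomp _ _ _ _ _ _ (fun x : R => x `^ (s - 1))); first exact: mpowR.
 by apply: mfunB; [exact: mfst|exact: msnd].
 apply: mfunB; apply: (@mcomp _ _ _ _ _ _ damp); try exact: m_damping.
 by apply: mfunB; [exact: mfst|exact: msnd].
 exact: mfst.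
- exact: mcst.
Qed.

Lemma drate_ge0 e t : (0 <= drate e t)%E.
Proof.
by apply: int_ge0 => x _; rewrite lee_fin mulr_ge0 ?jump_ge0 ?drop_ge0.
Qed.

Lemma m_drop_rate e : mfun (drate e).
Proof.
pose f (z : R * R) := (jdens e z.2 * drop z.1 z.2)%:E.
have mf : mfun f.
 apply/mEFinP; apply: mfunM; last exact: m_drop.
 by apply: (@mcomp _ _ _ _ _ _ (jdens e)) => //; exact: m_jump.
have f0 z : (0 <= f z)%E.
 by rewrite lee_fin mulr_ge0 ?jump_ge0 ?drop_ge0.
exact: (mtonF (m2 := mu) f mf f0).
Qed.

Lemma bump_ge0 e t : 0 < e -> 0 <= bump e t.
Proof.
move=> e0; rewrite /bump; case: ifP => // t0.
rewrite divr_ge0 ?mulr_ge0 ?powR_ge0 ?(ltW s0) ?(ltW t0)// subr_ge0.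
apply: ge0_ler_powR; rewrite ?nnegrE ?(ltW s0) ?(ltW t0) ?le_max ?lexx ?orbT//.
by rewrite ge_max (ltW t0) andbT; lra.
Qed.

Lemma m_bump e : mfun (bump e).
Proof.
have mp : mfun (fun x : R => x `^ s) by exact: mpowR.
apply: mifT.
- by apply: mltr; [exact: mcst|exact: mid].
- apply: mfunM.
 apply: mfunM; first exact: mcst.
 apply: mfunB; first exact: mp.
 apply: (@mcomp _ _ _ _ _ _ (fun x : R => x `^ s)); first exact: mp.
 by apply: measurable_maxr; [apply: mfunB; [exact: mid|exact: mcst]|exact: mcst].
 (* The inverse is split by sign into powers of exponent -1, which are measurable. *)
 rewrite (_ : (fun x => _) = (fun x : R => s^-1 * x `^ (-1) * (if 0 <= x then 1 else 0) +
 (if 0 <= x then 0 else (s * x)^-1))); last first.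
 apply/funext => x; case: ifPn => [x0|_]; last by rewrite mulr0 add0r.
 by rewrite mulr1 addr0 invfM powR_inv1.
 apply: mfunD.
 apply: mfunM.
 by apply: mfunM; [exact: mcst|exact: mpowR].
 apply: mifT; [|exact: mcst|exact: mcst].
 by apply: measurable_fun_ler; [exact: mcst|exact: mid].
 rewrite (_ : (fun x => _) = (fun x : R => if 0 <= x then 0 else - s^-1 * (- x) `^ (-1))); last first.
 apply/funext => x; case: ifPn => // x0; rewrite powR_inv1 ?invfM ?invrN ?mulrNN//.
 by rewrite oppr_ge0 ltW// ltNge.
 apply: mifT; first by apply: measurable_fun_ler; [exact: mcst|exact: mid].
 exact: mcst.
 apply: mfunM; first exact: mcst.
 apply: (@mcomp _ _ _ _ _ _ (fun x : R => x `^ (-1))); first exact: mpowR.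
 exact: oppr_measurable.
- exact: mcst.
Qed.

(* The incomplete beta integral [integral_beta_truncated] makes the truncated Marchaud
 derivative of [t ^ (s - 1)] equal to [bump]; the exponential factor adds [drate]. *)
Lemma truncated_marchaud e t : 0 < e ->
 ((e `^ (- s) / s * dpow t)%:E + drate e t =
 (damp t * bump e t)%:E +
 \int[mu]_x ((jdens e x)%:E * (dpow (t - x))%:E))%E.
Proof.
move=> e0; rewrite /drate /dpow /bump; case: ifPn => t0; last first.
 rewrite !mulr0 !integral0_eq// => x _.
 rewrite /jdens; case: ifPn => ex; last by rewrite mul0e.
 case: ifPn; last by rewrite mule0.
 by rewrite subr_gt0 => xt; rewrite (lt_trans (lt_trans e0 ex) xt) in t0.
 rewrite /drop; case: ifPn => [/andP[x0 xt]|_]; last by rewrite mulr0.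
 by rewrite (lt_trans x0 xt) in t0.
pose W x := if (e < x) && (x < t) then x `^ (- 1 - s) * (t - x) `^ (s - 1) else 0.
have W0 x : 0 <= W x by rewrite /W; case: ifP => // _; rewrite mulr_ge0 ?powR_ge0.
have mW : mfun W.
 apply: mifT.
 - by apply: measurable_and; apply: mltr; rewrite //; exact: mcst.
 - apply: mfunM; first exact: mpowR.
 apply: (@mcomp _ _ _ _ _ _ (fun x : R => x `^ (s - 1))); first exact: mpowR.
 by apply: mfunB; [exact: mcst|exact: mid].
 - exact: mcst.
have Wint : (\int[mu]_x (W x)%:E = (if e < t then ((t - e) / e) `^ s / (s * t) else 0)%:E)%E.
 case: ifPn => et.
 rewrite -integral_beta_truncated ?e0// [RHS]int_mkcond; apply: eqint => x _.
 by rewrite /patch mem_setE in_itv/= /W; case: ifP.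
 apply: integral0_eq => x _; rewrite /W; case: ifP => // /andP[ex xt].
 by rewrite (lt_trans ex xt) in et.
have E x : ((jdens e x)%:E * (dpow (t - x))%:E)%E =
 ((jdens e x * drop t x)%:E + (damp t)%:E * (W x)%:E)%E.
 rewrite -!EFinM -EFinD; congr EFin.
 rewrite /jdens /dpow /drop /W subr_gt0; case: ifPn => ex /=; last first.
 by rewrite !mul0r mulr0 addr0.
 rewrite (lt_trans e0 ex)/=; case: ifPn => xt; last by rewrite !mulr0 addr0.
 ring.
under [in RHS]eqint => x _ do rewrite E.
have md : mfun (fun x => (jdens e x * drop t x)%:E).
 apply/mEFinP; apply: mfunM; first exact: m_jump.
 exact: (mcomp m_drop (mpair1 t)).
rewrite [in RHS]intD//; last 3 first.
- by move=> x _; rewrite lee_fin mulr_ge0 ?jump_ge0 ?drop_ge0.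
- by move=> x _; rewrite mule_ge0 ?lee_fin ?(ltW (damping_gt0 t)).
- by apply: emfunM; [exact: mcst|exact/mEFinP].
rewrite intZlE//; last 3 first.
- by move=> x _; rewrite lee_fin.
- exact/mEFinP.
- exact: (ltW (damping_gt0 t)).
rewrite Wint [RHS]addeCA [LHS]addeC; congr (_ + _)%E; rewrite -EFinM -EFinD; congr EFin.
have -> : t `^ (s - 1) = t `^ s / t.
 by rewrite powRDp// -powR_inv1 ?(ltW t0).
have [et|te] := ltP e t.
 have te0 : 0 <= t - e by lra.
 rewrite (max_idPl te0) powRM ?invr_ge0 ?(ltW e0)// powRV ?(ltW e0)// powRN.
 by field; rewrite !gt_eqF ?powR_gt0.
rewrite (_ : Num.max (t - e) 0 = 0); last by apply/max_idPr; lra.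
by rewrite powR0 ?gt_eqF// subr0 mulr0 addr0; field; rewrite !gt_eqF.
Qed.

(** Concavity as y^s <= s y + (1 - s) with y = 1 - x/t, which is Young's inequality for y^s and 1
    with exponents 1/s and 1/(1-s). *)
Lemma powR_concave_drop t x : 0 < x -> x < t -> s * t `^ (s - 1) * x <= t `^ s - (t - x) `^ s.
Proof.
move=> x0 xt; have t0 : 0 < t := lt_trans x0 xt.
have tx : 0 <= t - x by lra.
pose y := 1 - x / t.
have y0 : 0 <= y by rewrite /y subr_ge0 ldivMr// mul1r ltW.
have Hy : y `^ s <= s * y + (1 - s).
 have p0 : 0 < s^-1 by rewrite invr_gt0.
 have q0 : 0 < (1 - s)^-1 by rewrite invr_gt0 subr_gt0.
 have := @conjugate_powR R (y `^ s) 1 s^-1 (1 - s)^-1 (powR_ge0 _ _) ler01 p0 q0.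
 rewrite !invrK mulr1 => H; have := H (_ : s + (1 - s) = 1).
 by rewrite -powRrM mulfV ?gt_eqF// powRr1// powR1 mul1r mulrC; apply; ring.
have -> : t - x = t * y by rewrite /y; field; rewrite gt_eqF.
rewrite powRM ?(ltW t0)// (_ : t `^ s - t `^ s * y `^ s = t `^ s * (1 - y `^ s)); last by ring.
have -> : t `^ (s - 1) = t `^ s / t by rewrite powRDp// -powR_inv1 ?(ltW t0).
have ts : 0 < t `^ s by rewrite powR_gt0.
have -> : s * (t `^ s / t) * x = t `^ s * (s * (x / t)) by ring.
rewrite ler_wpM2l ?(ltW ts)//; move: Hy; rewrite /y; lra.
Qed.

(** Makes the step of the renewal equation nonnegative. By e^x >= 1 + x and concavity,
    [damp (t - x) - damp t] is at least damp t times s t^(s-1) x / c; with x^(-s) >= t^(-s) what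
    remains is the integral of (t-x)^(s-1), that is t^s / s, and the constants cancel. *)
Lemma drop_rate_ge t : ((dpow t)%:E <= c%:E * drate 0 t)%E.
Proof.
rewrite /dpow; case: ifPn => t0; last first.
 by rewrite mule_ge0 ?drate_ge0// lee_fin ltW.
pose K := damp t / c * s * t `^ (s - 1) * t `^ (- s).
have gt := damping_gt0 t.
have K0 : 0 <= K.
 by rewrite /K !mulr_ge0 ?powR_ge0 ?invr_ge0 ?(ltW s0) ?(ltW c0) ?(ltW gt).
have : (K%:E * \int[mu]_(x in `]0%R, t[) ((t - x) `^ (s - 1))%:E <= drate 0 t)%E.
 have mB : mfun (fun x : R => ((t - x) `^ (s - 1))%:E).
 apply/mEFinP.
 apply: (@mcomp _ _ _ _ _ _ (fun x : R => x `^ (s - 1))); first exact: mpowR.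
 by apply: mfunB; [exact: mcst|exact: mid].
 have md : mfun (fun x => (jdens 0 x * drop t x)%:E).
 apply/mEFinP; apply: mfunM; first exact: m_jump.
 exact: (mcomp m_drop (mpair1 t)).
 rewrite -intZlE//; last 2 first.
 - by move=> x _; rewrite lee_fin powR_ge0.
 - exact: mfunTS.
 rewrite /drate; apply: (@le_trans _ _
 (\int[mu]_(x in `]0%R, t[) (jdens 0 x * drop t x)%:E)%E); last first.
 apply: sub_int => // x _.
 by rewrite lee_fin mulr_ge0 ?jump_ge0 ?drop_ge0.
 have mI : measurable (`]0%R, t[%classic : set R) by exact: mitv.
 apply: le_int; first exact: mI.
 - by move=> x _; rewrite mule_ge0 ?lee_fin ?powR_ge0.
 - by apply: emfunM; [exact: mcst|exact: mfunTS].
 - exact: mfunTS.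
 - move=> x; rewrite /= in_itv/= => /andP[x0 xt]; rewrite -EFinM lee_fin.
 rewrite /jdens /drop x0 xt/=.
 have tx : 0 < t - x by lra.
 have P0 : 0 < (t - x) `^ (s - 1) by rewrite powR_gt0.
 rewrite mulrCA [leLHS]mulrC ler_wpM2l ?(ltW P0)//.
 have H1 : damp t * (s * t `^ (s - 1) * x / c) <= damp (t - x) - damp t.
 have -> : damp (t - x) - damp t =
 damp t * (expR ((t `^ s - (t - x) `^ s) / c) - 1).
 rewrite mulrBr mulr1 /damp -expRD; congr (expR _ - _); ring.
 rewrite ler_wpM2l ?(ltW gt)// lerBrDr addrC.
 apply: le_trans (expR_ge1Dx _); rewrite lerD2l ler_wpM2r ?invr_ge0 ?(ltW c0)//.
 exact: powR_concave_drop.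
 apply: le_trans (ler_wpM2l (powR_ge0 _ _) H1).
 have -> : x `^ (- 1 - s) = x^-1 * x `^ (- s) by rewrite powRDp// powR_inv1// ltW.
 have xs : t `^ (- s) <= x `^ (- s).
 rewrite !powRN lef_pV2 ?posrE ?powR_gt0//.
 by apply: ge0_ler_powR; rewrite ?nnegrE ?(ltW s0) ?(ltW x0) ?(ltW t0) ?(ltW xt).
 have -> : x^-1 * x `^ (- s) * (damp t * (s * t `^ (s - 1) * x / c)) =
 damp t / c * s * t `^ (s - 1) * x `^ (- s) by field; rewrite !gt_eqF.
 rewrite ler_wpM2l// !mulr_ge0 ?powR_ge0 ?invr_ge0 ?(ltW s0) ?(ltW c0) ?(ltW gt)//.
rewrite integral_powRB// => H.
have c0' : (0 <= c%:E)%E by rewrite lee_fin ltW.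
apply: le_trans (lee_pM2l c0' H); rewrite -!EFinM lee_fin.
have -> : c * (K * (t `^ s / s)) = damp t * t `^ (s - 1) * (t `^ (- s) * t `^ s).
 by rewrite /K; field; rewrite !gt_eqF.
by rewrite powRN mulVf ?gt_eqF ?powR_gt0// mulr1 mulrC.
Qed.

Lemma rn_bump_scale e r : 0 < e -> bump e (e * r) = e^-1 * bump 1 r.
Proof.
move=> e0; rewrite /bump pmulr_rgt0//; case: ifP => r0; last by rewrite mulr0.
have -> : Num.max (e * r - e) 0 = e * Num.max (r - 1) 0.
 by rewrite maxr_pMr ?(ltW e0)// mulr0 mulrBr mulr1.
have m0 : 0 <= Num.max (r - 1) 0 by rewrite le_max lexx orbT.
rewrite !powRM ?(ltW e0) ?(ltW r0)// powR1 mul1r powRN.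
field; rewrite !gt_eqF ?powR_gt0//.
Qed.

Lemma rn_bump_small r : 0 < r -> r < 1 -> bump 1 r = r `^ (s - 1) / s.
Proof.
move=> r0 r1; rewrite /bump r0 powR1 mul1r (_ : Num.max (r - 1) 0 = 0); last first.
 by apply/max_idPr; lra.
rewrite powR0 ?gt_eqF// subr0 powRDp// powR_inv1 ?(ltW r0)//; field.
by rewrite !gt_eqF.
Qed.

(** Since s < 1 one has 1 - 1/r <= (1 - 1/r)^s, so r^s - (r-1)^s <= r^(s-1); the resulting decay
    r^(s-2) is integrable at infinity. *)
Lemma rn_bump_large r : 1 <= r -> bump 1 r <= r `^ (- (2 - s)) / s.
Proof.
move=> r1; have r0 : 0 < r by lra.
rewrite /bump r0 powR1 mul1r (_ : Num.max (r - 1) 0 = r - 1); last first.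
 by apply/max_idPl; lra.
have h : 0 <= 1 - r^-1 by rewrite subr_ge0 invf_le1.
have -> : (r - 1) `^ s = r `^ s * (1 - r^-1) `^ s.
 by rewrite -powRM ?(ltW r0)// mulrBr mulr1 mulfV ?gt_eqF.
have h2 : 1 - r^-1 <= (1 - r^-1) `^ s.
 have [->|hn] := eqVneq (1 - r^-1) 0; first exact: powR_ge0.
 have h3 : 0 < 1 - r^-1 by rewrite lt_def hn.
 rewrite -[leLHS]powRr1//; apply: (ger_powR _ (ltW s1)); rewrite h3/=.
 by rewrite gerBl invr_ge0 ltW.
have rs : 0 < r `^ s by rewrite powR_gt0.
apply: (@le_trans _ _ ((r `^ s - r `^ s * (1 - r^-1)) / (s * r))).
 rewrite ler_wpM2r ?invr_ge0 ?mulr_ge0 ?(ltW s0) ?(ltW r0)// lerD2l lerN2.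
 by rewrite ler_wpM2l ?(ltW rs).
have -> : - (2 - s) = s - 2 by ring.
rewrite powRDp// (_ : r `^ (-2) = r^-1 * r^-1); last first.
 by rewrite powRN powR_mulrn ?(ltW r0)// expr2 invfM.
by apply: eq_imp_le; field; rewrite !gt_eqF.
Qed.

End dpow.

(** * Monotone limits and convolution on the line *)

Lemma cvg_int_ge0 d (T : measurableType d) (R : realType) (m : {measure set T -> \bar R})
 (f_ : nat -> T -> \bar R) (f : T -> \bar R) :
 (forall k, mfun (f_ k)) -> (forall k x, (0 <= f_ k x)%E) ->
 (forall x i j, (i <= j)%N -> (f_ i x <= f_ j x)%E) ->
 (forall x, f_ k x @[k --> \oo] --> f x) ->
 (\int[m]_x f_ k x @[k --> \oo] --> \int[m]_x f x)%E.
Proof.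
move=> mf f0 nd cf.
rewrite (_ : f = fun x => limn (f_ ^~ x)); last first.
 by apply/funext => x; apply/esym/cvg_lim => //; exact: cf.
by apply: cvg_monotone_convergence => // x _ i j; exact: nd.
Qed.

Section convolution_line.
Context {R : realType}.
Local Notation mu := (@lebesgue_measure R).
Implicit Types p f F : R -> \bar R.
Local Open Scope ereal_scope.

Definition line_conv p f (t : R) : \bar R := \int[mu]_x (p x * f (t - x)%R).

Lemma m_shift f (b : R) : mfun f ->
 mfun (fun x : R => f (x + b)%R).
Proof.
move=> mf; apply: (mcomp mf).
by apply: mfunD; [exact: mid|exact: mcst].
Qed.

Lemma ge0_integral_shift f (b : R) : mfun f -> (forall x, 0 <= f x) ->
 \int[mu]_x f (x + b)%R = \int[mu]_x f x.
Proof.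
move=> mf f0; rewrite (integral_affine b (oner_neq0 R) mf f0) normr1 mul1e.
by apply: eqint => x _; rewrite mul1r.
Qed.

Let mconv2 p f : mfun p -> mfun f ->
 mfun (fun z : R * R => p z.2 * f (z.1 - z.2)%R).
Proof.
move=> mp mf; apply: emfunM; first exact: (mcomp mp).
apply: (mcomp mf).
by apply: mfunB; [exact: mfst|exact: msnd].
Qed.

Lemma m_line_conv p f : mfun p -> mfun f ->
 (forall x, 0 <= p x) -> (forall x, 0 <= f x) -> mfun (line_conv p f).
Proof.
move=> mp mf p0 f0.
apply: (mtonF (m2 := mu) _ (mconv2 mp mf)) => z.
exact: mule_ge0.
Qed.

Lemma line_conv_ge0 p f t : (forall x, 0 <= p x) -> (forall x, 0 <= f x) ->
 0 <= line_conv p f t.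
Proof. by move=> p0 f0; apply: int_ge0 => x _; exact: mule_ge0. Qed.

Lemma line_conv_tonelli p f F : mfun p -> mfun f ->
 mfun F -> (forall x, 0 <= p x) -> (forall x, 0 <= f x) ->
 (forall x, 0 <= F x) ->
 \int[mu]_t (line_conv p f t * F t) =
 \int[mu]_x (p x * \int[mu]_t (f t * F (t + x)%R)).
Proof.
move=> mp mf mF p0 f0 F0.
pose G (z : R * R) := p z.2 * f (z.1 - z.2)%R * F z.1.
have mG : mfun G.
 by apply: emfunM; [exact: mconv2|exact: (mcomp mF)].
have G0 z : 0 <= G z by rewrite !mule_ge0.
transitivity (\int[mu]_t \int[mu]_x G (t, x)).
 apply: eqint => t _; rewrite /line_conv -intZr//.
 - exact: (mcomp (mconv2 mp mf) (mpair1 t)).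
 - by move=> x _; exact: mule_ge0.
rewrite (fubini_tonelli (m1 := mu) (m2 := mu) G mG G0); apply: eqint => x _.
have mfx : mfun (fun t : R => f t * F (t + x)%R).
 by apply: emfunM => //; exact: m_shift.
rewrite -intZl//; last by move=> t _; exact: mule_ge0.
rewrite -(@ge0_integral_shift (fun t => G (t, x)) x).
- by apply: eqint => t _; rewrite /G/= addrK muleA.
- exact: (mcomp mG (mpair2 x)).
- by move=> t.
Qed.

End convolution_line.

(** * Masses of the bump and of the drop rate *)

Section rn_bump_theory.
Context {R : realType} (s c : R) (s01 : 0 < s < 1) (c0 : 0 < c).
Local Notation mu := (@lebesgue_measure R).
Local Notation damp := (damp s c).
Local Notation dpow := (dpow s c).
Local Notation jdens := (jdens s).
Local Notation drate := (drate s c).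
Local Notation bump := (bump s).
Local Notation ek k := ((1 / 2 : R) ^+ k).

Let s0 : 0 < s. Proof. by case/andP: s01. Qed.
Let s1 : s < 1. Proof. by case/andP: s01. Qed.
Let bump0 r : 0 <= bump 1 r. Proof. exact: bump_ge0. Qed.
Let mbump : mfun (EFin \o bump 1).
Proof. by apply/mEFinP; exact: m_bump. Qed.

Lemma dyadic_gt0 k : 0 < ek k. Proof. by rewrite exprn_gt0//; lra. Qed.

Lemma dyadic_le i j : (i <= j)%N -> ek j <= ek i.
Proof. by move=> ij; apply: ler_wiXn2l => //; lra. Qed.

Lemma cvg_dyadic : ek k @[k --> \oo] --> (0 : R).
Proof. by apply: cvg_expr; rewrite ger0_norm; lra. Qed.

Lemma rn_bump_tail T : 1 <= T ->
 (\int[mu]_(r in `[T, +oo[) (bump 1 r)%:E <= (T `^ (s - 1) / (1 - s) / s)%:E)%E.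
Proof.
move=> T1; have T0 : 0 < T by lra.
have s2 : 1 < 2 - s by have := s1; lra.
have := integral_powRN s2 T0.
rewrite (_ : 1 - (2 - s) = s - 1); last by ring.
rewrite (_ : 2 - s - 1 = 1 - s); last by ring.
move=> H; rewrite mulrC EFinM -H -intZlE//.
- apply: le_int => //.
 + by move=> r _; rewrite lee_fin.
 + exact: mfunTS.
 + apply: emfunM; first exact: mcst.
 by apply/mEFinP; apply: mfunTS; exact: mpowR.
 + move=> r; rewrite /= in_itv/= andbT => Tr; rewrite -EFinM lee_fin mulrC.
 by apply: rn_bump_large => //; lra.
- by move=> r _; rewrite lee_fin powR_ge0.
- by apply/mEFinP; apply: mfunTS; exact: mpowR.
- by rewrite invr_ge0 ltW.
Qed.

Lemma rn_bump_mass : exists2 m : R, 0 < m & (\int[mu]_r (bump 1 r)%:E = m%:E)%E.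
Proof.
have I1 : (\int[mu]_(r in `]0%R, 1%R[) (bump 1 r)%:E = (s^-1 * s^-1)%:E)%E.
 have := integral_powR0 s01 (@ltr01 R); rewrite powR1 div1r => H.
 rewrite EFinM -[X in (_ * X)%E]H -intZlE//.
 - apply: eqint => r; rewrite inE/= in_itv/= => /andP[r0 r1].
 by rewrite rn_bump_small// mulrC -EFinM mulrC.
 - by move=> r _; rewrite lee_fin powR_ge0.
 - by apply/mEFinP; apply: mfunTS; exact: mpowR.
 - by rewrite invr_ge0 ltW.
have I2 := rn_bump_tail (lexx 1).
set J := (\int[mu]_(r in `[1%R, +oo[) (bump 1 r)%:E)%E in I2.
have E : (\int[mu]_r (bump 1 r)%:E = (s^-1 * s^-1)%:E + J)%E.
 rewrite -I1 /J [X in (_ = X + _)%E]int_mkcond [X in (_ = _ + X)%E]int_mkcond.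
 rewrite -intD//.
 - apply: eqint => r _; rewrite /patch !mem_setE !in_itv/= andbT.
 have [r0|r0] := leP r 0.
 rewrite (_ : (1 <= r) = false); last by apply/negbTE; rewrite -ltNge; lra.
 by rewrite adde0 /bump ltNge r0.
 by have [r1|r1] := ltP r 1; rewrite /= ?adde0 ?add0e.
 - by move=> r _; apply: erestrict_ge0 => x _; rewrite lee_fin.
 - by apply/(measurable_restrictT _ (mitv _)); exact: mfunTS.
 - by move=> r _; apply: erestrict_ge0 => x _; rewrite lee_fin.
 - by apply/(measurable_restrictT _ (mitv _)); exact: mfunTS.
have J0 : (0 <= J)%E by apply: int_ge0 => r _; rewrite lee_fin.
have Jf : J \is a fin_num by rewrite fin_numE0// (le_lt_trans I2)// ltry.
exists (s^-1 * s^-1 + fine J); last by rewrite EFinD fineK.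
by rewrite ltr_pwDl ?fine_ge0// mulr_gt0 ?invr_gt0.
Qed.

Section with_mass.
Context (m : R) (m0 : 0 < m) (mE : (\int[mu]_r (bump 1 r)%:E = m%:E)%E).

Lemma rn_bump_integral_scale e (F : R -> \bar R) : 0 < e -> mfun F ->
 (forall x, 0 <= F x)%E ->
 (\int[mu]_t ((damp t * bump e t)%:E * F t) =
 \int[mu]_r ((damp (e * r) * bump 1 r)%:E * F (e * r)%R))%E.
Proof.
move=> e0 mF F0; have e1 : e != 0 by rewrite gt_eqF.
pose f t := ((damp t * bump e t)%:E * F t)%E.
have mf : mfun f.
 apply: emfunM => //; apply/mEFinP; apply: mfunM.
 exact: m_damping.
 exact: m_bump.
have b0 x : 0 <= damp x * bump e x.
 by rewrite mulr_ge0 ?bump_ge0// ltW// damping_gt0.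
have f0 x : (0 <= f x)%E by rewrite mule_ge0 ?lee_fin.
rewrite (integral_affine 0 e1 mf f0) -intZlE//.
- apply: eqint => r _; rewrite addr0 /f rn_bump_scale// ger0_norm ?(ltW e0)//.
 by rewrite muleA -EFinM; congr (_%:E * _)%E; field.
- have := @m_shift R (fun y => f y) 0 mf => H.
 apply: (mcomp mf); apply: mfunD; last exact: mcst.
 by apply: mfunM; [exact: mcst|exact: mid].
Qed.

(** [truncated_marchaud] integrated against F, with the jumps transferred to F: only translates of F
    appear on the right. *)
Lemma truncated_marchaud_integral e (F : R -> \bar R) : 0 < e -> mfun F ->
 (forall x, 0 <= F x)%E ->
 ((e `^ (- s) / s)%:E * \int[mu]_t ((dpow t)%:E * F t) +
 \int[mu]_t (drate e t * F t) =
 \int[mu]_r ((damp (e * r) * bump 1 r)%:E * F (e * r)%R) +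
 \int[mu]_x ((jdens e x)%:E *
 \int[mu]_t ((dpow t)%:E * F (t + x)%R)))%E.
Proof.
move=> e0 mF F0.
have md : mfun (EFin \o dpow).
 by apply/mEFinP; exact: m_dpow.
have d0 x : (0 <= (EFin \o dpow) x)%E by rewrite lee_fin dpow_ge0.
have mj : mfun (EFin \o jdens e).
 by apply/mEFinP; exact: m_jump.
have j0 x : (0 <= (EFin \o jdens e) x)%E by rewrite lee_fin jump_ge0.
have a0 : 0 <= e `^ (- s) / s by rewrite divr_ge0 ?powR_ge0 ?ltW.
rewrite -(rn_bump_integral_scale e0 mF F0).
rewrite -(line_conv_tonelli mj md mF j0 d0 F0).
have b0 x : 0 <= damp x * bump e x.
 by rewrite mulr_ge0 ?bump_ge0// ltW// damping_gt0.
have mdF : mfun (fun t => (dpow t)%:E * F t)%E by exact: emfunM.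
have dF0 x : setT x -> (0 <= (dpow x)%:E * F x)%E by move=> _; apply: mule_ge0 => //; exact: d0.
rewrite -(@intZl _ _ _ mu _ mTT _ mdF _ dF0 (a0 : (0 <= (e `^ (- s) / s)%:E)%E)).
rewrite -intD//; last 4 first.
- by move=> x _; apply: mule_ge0 => //; exact: dF0.
- by apply: emfunM; [exact: mcst|exact: mdF].
- by move=> x _; rewrite mule_ge0// drate_ge0.
- by apply: emfunM => //; exact: m_drop_rate.
have mb : mfun (fun t => (damp t * bump e t)%:E * F t)%E.
 apply: emfunM => //; apply/mEFinP; apply: mfunM.
 exact: m_damping.
 exact: m_bump.
have bF0 x : setT x -> (0 <= (damp x * bump e x)%:E * F x)%E.
 by move=> _; apply: mule_ge0 => //; rewrite lee_fin.
have mc : mfun (fun t =>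
 line_conv (EFin \o jdens e) (EFin \o dpow) t * F t)%E.
 by apply: emfunM => //; exact: m_line_conv.
have lc0 t : (0 <= line_conv (EFin \o jdens e) (EFin \o dpow) t)%E.
 exact: line_conv_ge0.
have cF0 x : setT x -> (0 <= line_conv (EFin \o jdens e) (EFin \o dpow) x * F x)%E.
 by move=> _; apply: mule_ge0.
rewrite -(@intD _ _ _ mu _ mTT _ _ bF0 mb cF0 mc).
apply: eqint => t _; have := truncated_marchaud s01 c0 t e0.
rewrite -[X in (_ = _ + X)%E]/(line_conv (EFin \o jdens e) (EFin \o dpow) t) => H.
rewrite muleA -EFinM -!ge0_muleDl ?lee_fin ?H//.
- by rewrite mulr_ge0// dpow_ge0.
- exact: drate_ge0.
Qed.

Lemma damped_power_mass_fin : (\int[mu]_t (dpow t)%:E \is a fin_num)%E.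
Proof.
rewrite fin_numE0; last by apply: int_ge0 => x _; rewrite lee_fin dpow_ge0.
apply: le_lt_trans (_ : _ <= (c / s)%:E)%E (ltry _).
apply: le_trans (integral_exp_powR_le s01 c0).
rewrite [leRHS]int_mkcond; apply: eq_imp_le; apply: eqint => x _.
by rewrite /patch mem_setE in_itv/= andbT /dpow; case: ifP.
Qed.

(** F = 1 in [truncated_marchaud_integral]: the two terms carrying e^(-s)/s are equal and finite,
    hence cancel. *)
Lemma drop_rate_integral e : 0 < e ->
 (\int[mu]_t drate e t = \int[mu]_r (damp (e * r) * bump 1 r)%:E)%E.
Proof.
move=> e0; have o0 (x : R) : (0 <= (cst 1 : R -> \bar R) x)%E by rewrite lee_fin ler01.
have := @truncated_marchaud_integral e (cst 1%E) e0 (mcst _) o0.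
under eqint do rewrite mule1.
under [X in (_ + X)%E = _ -> _]eqint do rewrite mule1.
under [X in _ = (X + _)%E -> _]eqint do rewrite mule1.
set I := (\int[mu]_t (dpow t)%:E)%E.
have -> : (\int[mu]_x ((jdens e x)%:E * I) = (e `^ (- s) / s)%:E * I)%E.
 rewrite -jump_mass// -intZr//.
 - by apply/mEFinP; exact: m_jump.
 - by move=> x _; rewrite lee_fin jump_ge0.
 - by apply: int_ge0 => x _; rewrite lee_fin dpow_ge0.
have If : ((e `^ (- s) / s)%:E * I \is a fin_num)%E by rewrite fin_numM// damped_power_mass_fin.
by rewrite addeC => H; rewrite -[LHS](addeK _ If) H addeK.
Qed.

Lemma drop_rate_cvg t : (drate (ek k) t @[k --> \oo] --> drate 0 t)%E.
Proof.
apply: (@cvg_int_ge0 _ _ _ mu).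
- move=> k; apply/mEFinP; apply: mfunM; first exact: m_jump.
 exact: (mcomp (m_drop s c) (mpair1 t)).
- by move=> k x; rewrite lee_fin mulr_ge0 ?jump_ge0 ?drop_ge0.
- move=> x i j ij; rewrite lee_fin ler_wpM2r ?drop_ge0//.
 rewrite /jdens; case: ifPn => ix; last by case: ifP => // _; exact: powR_ge0.
 by rewrite (le_lt_trans (dyadic_le ij) ix).
- move=> x; apply: cvg_EFin; first exact: nearW.
 apply: cvgMl; have [x0|x0] := leP x 0.
 rewrite (_ : (fun k => _) = cst (jdens 0 x)); first exact: cvg_cst.
 apply/funext => k; rewrite /jdens (ltNge 0) x0/= ltNge.
 by rewrite (le_trans x0)// ltW// dyadic_gt0.
 apply: cvg_near_cst; have /cvgrPdist_lt/(_ _ x0) := cvg_dyadic.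
 apply: filterS => k; rewrite sub0r normrN ger0_norm ?(ltW (dyadic_gt0 _))// => kx.
 by rewrite /jdens kx x0.
Qed.

Lemma drop_rate_integral_cvg :
 (\int[mu]_t drate (ek k) t @[k --> \oo] --> \int[mu]_t drate 0 t)%E.
Proof.
apply: (@cvg_int_ge0 _ _ _ mu).
- by move=> k; exact: m_drop_rate.
- by move=> k x; exact: drate_ge0.
- move=> t i j ij; apply: le_int => //.
 + by move=> x _; rewrite lee_fin mulr_ge0 ?jump_ge0 ?drop_ge0.
 + apply/mEFinP; apply: mfunM; first exact: m_jump.
 exact: (mcomp (m_drop s c) (mpair1 t)).
 + apply/mEFinP; apply: mfunM; first exact: m_jump.
 exact: (mcomp (m_drop s c) (mpair1 t)).
 + move=> x _; rewrite lee_fin ler_wpM2r ?drop_ge0//.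
 rewrite /jdens; case: ifPn => ix; last by case: ifP => // _; exact: powR_ge0.
 by rewrite (le_lt_trans (dyadic_le ij) ix).
- by move=> t; exact: drop_rate_cvg.
Qed.

Lemma damped_bump_cvg :
 (\int[mu]_r (damp (ek k * r) * bump 1 r)%:E @[k --> \oo] --> m%:E)%E.
Proof.
rewrite -mE; apply: (@cvg_int_ge0 _ _ _ mu).
- move=> k; apply/mEFinP; apply: mfunM; last exact: m_bump.
 apply: (@mcomp _ _ _ _ _ _ damp); first exact: m_damping.
 by apply: mfunM; [exact: mcst|exact: mid].
- by move=> k x; rewrite lee_fin mulr_ge0// ltW// damping_gt0.
- move=> r i j ij; have [r0|r0] := leP r 0; first by rewrite /bump (ltNge 0) r0/= !mulr0.
 rewrite lee_fin ler_wpM2r//; apply: damping_le => //.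
 by rewrite mulr_ge0 ?(ltW r0)// ltW// dyadic_gt0.
 by rewrite ler_wpM2r ?(ltW r0)// dyadic_le.
- move=> r; apply: cvg_EFin; first exact: nearW.
 have [r0|r0] := leP r 0.
 rewrite /bump (ltNge 0) r0/= (_ : (fun k => _) = cst 0); first exact: cvg_cst.
 by apply/funext => k; rewrite mulr0.
 rewrite -[X in _ --> X]mul1r; apply: cvgMl.
 have H : - ((ek k * r) `^ s / c) @[k --> \oo] --> - (0 / c).
 apply: cvgN; apply: cvgMl; apply: (cvg_powR_seq s01) => [k|].
 by rewrite mulr_gt0// dyadic_gt0.
 by rewrite -(mul0r r); apply: cvgMl; exact: cvg_dyadic.
 have := cvg_comp _ _ H (@continuous_expR R (- (0 / c))).
 by rewrite mul0r oppr0 expR0; apply.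
Qed.

(** Both sides of [drop_rate_integral] converge along e = 2^(-k): the left one monotonically as the
    truncation is removed, the right one to the mass of [bump 1] as the damping factor tends to
    1. *)
Lemma drop_rate_mass : (\int[mu]_t drate 0 t = m%:E)%E.
Proof.
apply: (cvg_unique _ drop_rate_integral_cvg); first exact: ereal_hausdorff.
rewrite (_ : (fun k => _) = (fun k => \int[mu]_r (damp (ek k * r) * bump 1 r)%:E)%E).
 exact: damped_bump_cvg.
by apply/funext => k; rewrite drop_rate_integral// dyadic_gt0.
Qed.

End with_mass.
End rn_bump_theory.

Lemma ge0_le_EFinP (R : realType) (x : \bar R) (M : R) : (0 <= x)%E -> (x <= M%:E)%E ->
 exists2 r, x = r%:E & 0 <= r <= M.
Proof.
by case: x => [r| |]//; rewrite !lee_fin => r0 rM; exists r => //; rewrite r0.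
Qed.

(** The factor [k] may be +oo, because [rn_step] takes extended values; by monotonicity the products
    are then eventually +oo, unless the limit is 0. *)
Lemma ge0_cvgeMl (R : realType) (k l : \bar R) (u : nat -> \bar R) : (0 <= k)%E ->
 (forall i, (0 <= u i)%E) -> (forall i j, (i <= j)%N -> (u i <= u j)%E) ->
 u i @[i --> \oo] --> l -> (k * u i)%E @[i --> \oo] --> (k * l)%E.
Proof.
move=> k0 u0 nd cu; have ul i : (u i <= l)%E.
 rewrite -(cvg_lim (@ereal_hausdorff R) cu); apply: lime_ge; first by apply/cvg_ex; exists l.
 by exists i => // j /= ij; exact: nd.
case: k k0 => [r| |]// k0; first exact: cvgeZl.
have [l0|l0] := eqVneq l 0%E.
 rewrite l0 mule0 (_ : (fun i => _) = cst 0%E); first exact: cvg_cst.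
 apply/funext => i; have : (u i <= 0)%E by rewrite -l0.
 by move=> ui; rewrite (_ : u i = 0%E) ?mule0//; apply/eqP; rewrite eq_le ui u0.
have [i ui] : exists i, (0 < u i)%E.
 apply: contrapT => /forallNP H; move/eqP : l0; apply.
 apply: (cvg_unique _ cu); first exact: ereal_hausdorff.
 rewrite (_ : u = cst 0%E); first exact: cvg_cst.
 by apply/funext => i; apply/eqP; rewrite eq_le u0 andbT leNgt; apply/negP/H.
have lp : (0 < l)%E := lt_le_trans ui (ul i).
rewrite gt0_mulye//; apply: cvg_near_cst; exists i => // j /= ij.
by rewrite gt0_mulye// (lt_le_trans ui)// nd.
Qed.

(** * The renewal density as a Neumann series *)

Section rn_density.
Context {R : realType} (s c m : R) (s01 : 0 < s < 1) (c0 : 0 < c) (m0 : 0 < m).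
Local Notation mu := (@lebesgue_measure R).
Local Notation damp := (damp s c).
Local Notation dpow := (dpow s c).
Local Notation jdens := (jdens s).
Local Notation drate := (drate s c).
Local Notation bump := (bump s).
Local Notation ek k := ((1 / 2 : R) ^+ k).
Context (mE : (\int[mu]_r (bump 1 r)%:E = m%:E)%E).

Let s0 : 0 < s. Proof. by case/andP: s01. Qed.
Let s1 : s < 1. Proof. by case/andP: s01. Qed.
Let b := (c * m)^-1.
Let b0 : 0 < b. Proof. by rewrite invr_gt0 mulr_gt0. Qed.
Let mi0 : 0 < m^-1. Proof. by rewrite invr_gt0. Qed.

Definition rn_init (t : R) : R := b * dpow t.

(** Defect of the parametrix. With D the Marchaud derivative and b = 1/(c m), the operator 1 + c D
    sends [rn_init] to the unit mass at 0 minus [rn_step]: D of the damped power is m times the unit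
    mass minus [drate 0]. *)
Definition rn_step (t : R) : \bar R :=
 ((m^-1)%:E * drate 0 t - (rn_init t)%:E)%E.

(** Partial sums of the Neumann series, as Picard iterates of the renewal equation [rn_equation].
    Values are extended reals since finiteness only holds almost everywhere. *)
Fixpoint rn_iter (J : nat) : R -> \bar R :=
 if J is J'.+1 then
 fun t => ((rn_init t)%:E + line_conv rn_step (rn_iter J') t)%E
 else cst 0%E.

Definition rn_density_e (t : R) : \bar R := limn (fun J => rn_iter J t).

Lemma rn_init_ge0 t : 0 <= rn_init t.
Proof. by rewrite mulr_ge0 ?dpow_ge0// ltW. Qed.

Lemma m_rn_init : mfun (EFin \o rn_init).
Proof.
apply/mEFinP; apply: mfunM; first exact: mcst.
exact: m_dpow.
Qed.

Lemma rn_stepE t : (rn_step t + (rn_init t)%:E = (m^-1)%:E * drate 0 t)%E.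
Proof. by rewrite /rn_step subeK. Qed.

(** [drop_rate_ge] divided by c m. This is where the damping must carry the same constant c as the
    renewal equation. *)
Lemma rn_step_ge0 t : (0 <= rn_step t)%E.
Proof.
rewrite /rn_step sube_ge0// /rn_init /b.
have H := drop_rate_ge s01 c0 t.
have mc : (0 <= (m^-1 * c^-1)%:E)%E by rewrite lee_fin mulr_ge0 ?invr_ge0 ?ltW.
have := lee_pM2l mc H; rewrite -EFinM muleA -EFinM.
by rewrite mulfVK ?gt_eqF// (_ : m^-1 / c = (c * m)^-1)// invfM mulrC.
Qed.

Lemma m_rn_step : mfun rn_step.
Proof.
apply: emeasurable_funB; last exact: m_rn_init.
by apply: emfunM; [exact: mcst|exact: m_drop_rate].
Qed.

Lemma rn_step_le0 t : t <= 0 -> rn_step t = 0%E.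
Proof.
move=> t0; have d0 : drate 0 t = 0%E.
 apply: integral0_eq => x _; rewrite /drop; case: ifPn => [/andP[x0 xt]|_]; last by rewrite mulr0.
 by have := lt_le_trans (lt_trans x0 xt) t0; rewrite ltxx.
by rewrite /rn_step d0 mule0 /rn_init !dpowE ltNge t0/= mulr0 sube0.
Qed.

Lemma rn_init_mass : exists2 q1 : R, 0 < q1 & (\int[mu]_t (rn_init t)%:E = q1%:E)%E.
Proof.
have If := damped_power_mass_fin s01 c0.
exists (b * fine (\int[mu]_t (dpow t)%:E)%E); last first.
 rewrite EFinM fineK// -intZlE//.
 - by move=> x _; rewrite lee_fin dpow_ge0.
 - by apply/mEFinP; exact: m_dpow.
 - exact: ltW.
rewrite mulr_gt0// -lte_fin fineK//.
have d1 : 0 < damp 1 := damping_gt0 _ _ _.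
apply: (@lt_le_trans _ _ (damp 1 * s^-1)%:E); first by rewrite lte_fin mulr_gt0// invr_gt0.
have := integral_powR0 s01 (@ltr01 R); rewrite powR1 div1r => H.
rewrite EFinM -[X in (_ * X <= _)%E]H -intZlE//; last 3 first.
- by move=> r _; rewrite lee_fin powR_ge0.
- by apply/mEFinP; apply: mfunTS; exact: mpowR.
- exact: ltW.
have mI : measurable (`]0%R, 1%R[%classic : set R) by exact: mitv.
apply: (@le_trans _ _ (\int[mu]_(x in `]0%R, 1%R[) (dpow x)%:E)%E); last first.
 apply: sub_int => //.
 - by apply/mEFinP; exact: m_dpow.
 - by move=> x _; rewrite lee_fin dpow_ge0.
apply: le_int; first exact: mI.
- by move=> x _; rewrite mule_ge0 ?lee_fin ?powR_ge0// ltW.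
- apply: emfunM; first exact: mcst.
 by apply/mEFinP; apply: mfunTS; exact: mpowR.
- by apply/mEFinP; apply: mfunTS; exact: m_dpow.
- move=> x; rewrite /= in_itv/= => /andP[x0 x1]; rewrite -EFinM lee_fin !dpowE x0 mulrC.
 by apply: ler_wpM2l; [exact: powR_ge0|apply: damping_le => //; exact: ltW].
Qed.

(** [drate 0] has mass m, so the two masses add up to 1; as [rn_init] has mass q1 > 0, convolution
    with [rn_step] is a strict contraction. *)
Lemma rn_masses : (\int[mu]_t rn_step t + \int[mu]_t (rn_init t)%:E = 1)%E.
Proof.
rewrite -intD//; last 4 first.
- by move=> x _; exact: rn_step_ge0.
- exact: m_rn_step.
- by move=> x _; rewrite lee_fin rn_init_ge0.
- exact: m_rn_init.
under eqint do rewrite rn_stepE.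
rewrite intZlE//; last 3 first.
- by move=> x _; exact: drate_ge0.
- exact: m_drop_rate.
- exact: ltW.
by rewrite (drop_rate_mass s01 c0 mE) -EFinM mulVf// gt_eqF.
Qed.

Lemma rn_iter_prop J : mfun (rn_iter J) /\
 (forall t, 0 <= rn_iter J t)%E.
Proof.
elim: J => [|J [mJ J0]]; first by split => [|t]; [exact: mcst|].
have st0 := rn_step_ge0; have mst := m_rn_step.
split => [|t] /=.
 apply: emfunD; first exact: m_rn_init.
 exact: m_line_conv.
by rewrite adde_ge0 ?lee_fin ?rn_init_ge0// line_conv_ge0.
Qed.

Lemma m_rn_iter J : mfun (rn_iter J).
Proof. by case: (rn_iter_prop J). Qed.

Lemma rn_iter_ge0 J t : (0 <= rn_iter J t)%E.
Proof. by case: (rn_iter_prop J). Qed.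

Let mconv J t : mfun (fun x => rn_step x * rn_iter J (t - x)%R)%E.
Proof.
apply: emfunM; first exact: m_rn_step.
apply: (mcomp (m_rn_iter J)).
by apply: mfunB; [exact: mcst|exact: mid].
Qed.

Lemma rn_iter_leS J t : (rn_iter J t <= rn_iter J.+1 t)%E.
Proof.
elim: J t => [|J IH] t; first exact: (rn_iter_ge0 1).
rewrite [leLHS]/= [leRHS]/= leeD2l//; apply: le_int => //.
- by move=> x _; rewrite mule_ge0 ?rn_step_ge0 ?rn_iter_ge0.
- exact: mconv.
- exact: (mconv J.+1).
- by move=> x _; apply: lee_pM2l; [exact: rn_step_ge0|exact: IH].
Qed.

Lemma rn_iter_le t i j : (i <= j)%N -> (rn_iter i t <= rn_iter j t)%E.
Proof.
move=> /subnKC <-; elim: (j - i)%N => [|k IH]; first by rewrite addn0.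
by rewrite addnS (le_trans IH)// rn_iter_leS.
Qed.

Lemma rn_iter_cvg t : rn_iter J t @[J --> \oo] --> rn_density_e t.
Proof. by apply: ereal_nondecreasing_is_cvgn => i j; exact: rn_iter_le. Qed.

Lemma rn_density_e_ge0 t : (0 <= rn_density_e t)%E.
Proof.
apply: lime_ge; first by apply/cvg_ex; eexists; exact: rn_iter_cvg.
by apply: nearW => J; exact: rn_iter_ge0.
Qed.

Lemma m_rn_density_e : mfun rn_density_e.
Proof.
apply: (emeasurable_fun_cvg (fun J => rn_iter J)).
 by move=> J; exact: m_rn_iter.
by move=> t _; exact: rn_iter_cvg.
Qed.

Lemma rn_equation t :
 (rn_density_e t = (rn_init t)%:E + line_conv rn_step rn_density_e t)%E.
Proof.
have C1 : (rn_iter J.+1 t @[J --> \oo] --> rn_density_e t)%E.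
 have := @rn_iter_cvg t.
 by rewrite -[X in X -> _]cvg_shiftS.
apply: (cvg_unique _ C1); first exact: ereal_hausdorff.
have H : (line_conv rn_step (rn_iter J) t @[J --> \oo] -->
 line_conv rn_step rn_density_e t)%E.
 apply: (@cvg_int_ge0 _ _ _ mu).
 - by move=> J; exact: mconv.
 - by move=> J x; rewrite mule_ge0 ?rn_step_ge0 ?rn_iter_ge0.
 - move=> x i j ij; apply: lee_pM2l; first exact: rn_step_ge0.
 exact: rn_iter_le.
 - move=> x; apply: ge0_cvgeMl => //; first exact: rn_step_ge0.
 + by move=> J; exact: rn_iter_ge0.
 + by move=> i j; exact: rn_iter_le.
 + exact: rn_iter_cvg.
apply: cvgeD => //; exact: cvg_cst.
Qed.

Lemma rn_iter_le0 J t : t <= 0 -> rn_iter J t = 0%E.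
Proof.
elim: J t => [//|J IH] t t0 /=.
rewrite /rn_init !dpowE ltNge t0/= mulr0 add0e.
apply: integral0_eq => x _; have [x0|x0] := leP x 0; first by rewrite rn_step_le0// mul0e.
by rewrite IH ?mule0//; lra.
Qed.

Lemma rn_density_e_le0 t : t <= 0 -> rn_density_e t = 0%E.
Proof.
move=> t0; apply: cvg_lim => //.
rewrite (_ : (fun J => _) = cst 0%E); first exact: cvg_cst.
by apply/funext => J; exact: rn_iter_le0.
Qed.

Context (q1 : R) (q10 : 0 < q1) (q1E : (\int[mu]_t (rn_init t)%:E = q1%:E)%E).

Lemma rn_step_mass : (\int[mu]_t rn_step t = (1 - q1)%:E)%E.
Proof.
have H := rn_masses; rewrite q1E in H.
by rewrite -[LHS](@addeK _ q1%:E)// H.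
Qed.

Lemma rn_step_mass_lt1 : 0 <= 1 - q1 < 1.
Proof.
apply/andP; split; last by have := q10; lra.
rewrite -lee_fin -rn_step_mass; apply: int_ge0 => x _; exact: rn_step_ge0.
Qed.

(** The constant is the fixed point of K = b/s + (1 - q1) K: [rn_init] contributes at most b T^s /
    s, and [rn_step] shifts the mass of the previous iterate to the right with total weight 1 -
    q1. *)
Lemma rn_iter_cumulative J T : 0 < T ->
 (\int[mu]_t (rn_iter J t * (if t < T then 1 else 0)%:E) <= (b / (s * q1) * T `^ s)%:E)%E.
Proof.
move=> T0; pose H (t : R) : \bar R := (if t < T then 1 else 0)%:E.
have mH : mfun H.
 apply/mEFinP; apply: mifT; [|exact: mcst|exact: mcst].
 by apply: mltr; [exact: mid|exact: mcst].
have H0 t : (0 <= H t)%E by rewrite lee_fin; case: ifP.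
have Ts : 0 < T `^ s by rewrite powR_gt0.
have X0 : 0 <= b / (s * q1) * T `^ s.
 by rewrite !mulr_ge0 ?(ltW b0) ?(ltW Ts)// invr_ge0 mulr_ge0 ?ltW.
have I0 : (\int[mu]_t ((rn_init t)%:E * H t) <= (b * (T `^ s / s))%:E)%E.
 rewrite [leRHS]EFinM -(integral_powR0 s01 T0) -intZlE//; last 3 first.
 - by move=> x _; rewrite lee_fin powR_ge0.
 - by apply/mEFinP; apply: mfunTS; exact: mpowR.
 - exact: ltW.
 rewrite [leRHS]int_mkcond; apply: le_int => //.
 - by move=> x _; rewrite mule_ge0// lee_fin rn_init_ge0.
 - by apply: emfunM => //; exact: m_rn_init.
 - apply/(measurable_restrictT _ (mitv _)); apply: emfunM; first exact: mcst.
 by apply/mEFinP; apply: mfunTS; exact: mpowR.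
 - move=> t _; rewrite /patch mem_setE in_itv/= /H /rn_init !dpowE.
 have [t0|t0] := ltP 0 t; last by rewrite mulr0 mul0e.
 case: ifPn => tT /=; last by rewrite mule0.
 rewrite mule1 -EFinM lee_fin ler_wpM2l ?(ltW b0)//.
 by rewrite ler_piMr ?powR_ge0// damping_le1.
elim: J => [|J IH].
 rewrite (eqint (cst 0%E)) ?integral0 ?lee_fin//.
 by move=> t _; rewrite mul0e.
have st0 := rn_step_ge0; have mst := m_rn_step.
have mJ := m_rn_iter J; have J0 := rn_iter_ge0 J.
have lc0 t : (0 <= line_conv rn_step (rn_iter J) t)%E by exact: line_conv_ge0.
have -> : (\int[mu]_t (rn_iter J.+1 t * H t) = \int[mu]_t ((rn_init t)%:E * H t +
 line_conv rn_step (rn_iter J) t * H t))%E.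
 by apply: eqint => t _; rewrite /= ge0_muleDl// lee_fin rn_init_ge0.
rewrite intD//; last 4 first.
- by move=> x _; rewrite mule_ge0// lee_fin rn_init_ge0.
- by apply: emfunM => //; exact: m_rn_init.
- by move=> x _; rewrite mule_ge0.
- by apply: emfunM => //; exact: m_line_conv.
rewrite (line_conv_tonelli mst mJ mH st0 J0 H0).
have E : b / (s * q1) * T `^ s = b * (T `^ s / s) + (1 - q1) * (b / (s * q1) * T `^ s).
 by field; rewrite !gt_eqF.
rewrite E EFinD; apply: leeD; first exact: I0.
rewrite EFinM -rn_step_mass -intZr//; last first.
apply: le_int => //.
- by move=> x _; rewrite mule_ge0//; apply: int_ge0 => t _; rewrite mule_ge0.
- apply: emfunM => //.
 have mf : mfun (fun z : R * R => rn_iter J z.2 * H (z.2 + z.1)%R)%E.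
 apply: emfunM; first exact: (mcomp mJ).
 by apply: (mcomp mH); apply: mfunD; [exact: msnd|exact: mfst].
 apply: (mtonF (m2 := mu) _ mf) => z; exact: mule_ge0.
- by apply: emfunM => //; exact: mcst.
- move=> x _; have [x0|x0] := leP x 0; first by rewrite rn_step_le0// !mul0e.
 apply: lee_pM2l => //; apply: le_trans IH.
 apply: le_int => //.
 + by move=> t _; rewrite mule_ge0.
 + by apply: emfunM => //; exact: m_shift.
 + by apply: emfunM.
 + move=> t _; apply: lee_pM2l => //; rewrite lee_fin.
 case: ifPn => [tx|_]; last by case: ifP.
 by rewrite (_ : t < T)//; lra.
Qed.

Lemma rn_iter_mass J : (\int[mu]_t rn_iter J t <= 1)%E.
Proof.
elim: J => [|J IH]; first by rewrite integral0 lee_fin.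
have st0 := rn_step_ge0; have mst := m_rn_step.
have mJ := m_rn_iter J; have J0 := rn_iter_ge0 J.
rewrite /= intD//; last 4 first.
- by move=> x _; rewrite lee_fin rn_init_ge0.
- exact: m_rn_init.
- by move=> x _; exact: line_conv_ge0.
- exact: m_line_conv.
have o0 (x : R) : (0 <= (cst 1 : R -> \bar R) x)%E by rewrite lee_fin ler01.
have H := line_conv_tonelli mst mJ (mcst 1%E) st0 J0 o0.
have -> : (\int[mu]_t line_conv rn_step (rn_iter J) t =
 \int[mu]_x (rn_step x * \int[mu]_t rn_iter J t))%E.
 transitivity (\int[mu]_t (line_conv rn_step (rn_iter J) t * cst 1 t))%E.
 by apply: eqint => x _; rewrite mule1.
 rewrite H; apply: eqint => x _; congr (_ * _)%E; apply: eqint => t _.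
 by rewrite mule1.
rewrite [X in (X + _)%E]q1E intZr//; last by apply: int_ge0.
rewrite rn_step_mass -(_ : q1%:E + (1 - q1)%:E * 1 = 1)%E; last first.
 by rewrite mule1 -EFinD addrC subrK.
rewrite leeD2l//; apply: lee_pM2l => //.
by rewrite lee_fin; case/andP: rn_step_mass_lt1.
Qed.

End rn_density.

(** * The renewal density solves the Marchaud equation weakly *)

Section rn_limit.
Context {R : realType} (s c m : R) (s01 : 0 < s < 1) (c0 : 0 < c) (m0 : 0 < m).
Local Notation mu := (@lebesgue_measure R).
Local Notation damp := (damp s c).
Local Notation dpow := (dpow s c).
Local Notation jdens := (jdens s).
Local Notation drate := (drate s c).
Local Notation bump := (bump s).
Local Notation init := (rn_init s c m).
Local Notation step := (rn_step s c m).
Local Notation rhoe := (rn_density_e s c m).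
Local Notation ek k := ((1 / 2 : R) ^+ k).
Context (mE : (\int[mu]_r (bump 1 r)%:E = m%:E)%E).
Context (q1 : R) (q10 : 0 < q1) (q1E : (\int[mu]_t (init t)%:E = q1%:E)%E).

Let s0 : 0 < s. Proof. by case/andP: s01. Qed.
Let s1 : s < 1. Proof. by case/andP: s01. Qed.
Let mrho := m_rn_density_e s01 c0 m0.
Let rho0 := rn_density_e_ge0 s01 c0 m0.

Lemma rn_density_mass : (\int[mu]_t rhoe t <= 1)%E.
Proof.
have H : (\int[mu]_t rn_iter s c m J t @[J --> \oo] --> \int[mu]_t rhoe t)%E.
 apply: (@cvg_int_ge0 _ _ _ mu).
 - by move=> J; exact: m_rn_iter.
 - by move=> J t; exact: rn_iter_ge0.
 - by move=> t i j; exact: rn_iter_le.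
 - by move=> t; exact: rn_iter_cvg.
rewrite -(cvg_lim (@ereal_hausdorff R) H); apply: lime_le; first by apply/cvg_ex; eexists; exact: H.
by apply: nearW => J; exact: rn_iter_mass mE _ q10 q1E J.
Qed.

Lemma rn_density_cumulative T : 0 < T ->
 (\int[mu]_t (rhoe t * (if (t < T)%R then 1%R else 0%R)%:E) <=
 ((c * m)^-1 / (s * q1) * T `^ s)%:E)%E.
Proof.
move=> T0.
have mH : mfun (fun t : R => (if t < T then 1 else 0)%:E : \bar R).
 apply/mEFinP; apply: mifT; [|exact: mcst|exact: mcst].
 by apply: mltr; [exact: mid|exact: mcst].
have H0 (t : R) : (0 <= ((if t < T then 1 else 0)%:E : \bar R))%E by rewrite lee_fin; case: ifP.
have H : (\int[mu]_t (rn_iter s c m J t * (if (t < T)%R then 1%R else 0%R)%:E) @[J --> \oo] -->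
 \int[mu]_t (rhoe t * (if (t < T)%R then 1%R else 0%R)%:E))%E.
 apply: (@cvg_int_ge0 _ _ _ mu).
 - by move=> J; apply: emfunM => //; exact: m_rn_iter.
 - by move=> J t; rewrite mule_ge0 ?rn_iter_ge0.
 - by move=> t i j ij; rewrite lee_wpmul2r//; exact: rn_iter_le.
 - by move=> t; apply: cvgeZr => //; exact: rn_iter_cvg.
rewrite -(cvg_lim (@ereal_hausdorff R) H); apply: lime_le; first by apply/cvg_ex; eexists; exact: H.
by apply: nearW => J; exact: rn_iter_cumulative mE _ q10 q1E J _ T0.
Qed.

(** Bounds and modulus are common to the class and invariant under translation. This invariance lets
    the defect be estimated by a contraction over the whole class. *)
Definition tclass (M : R) (dlt : R -> R) (F : R -> R) : Prop :=
 [/\ mfun F, forall x, 0 <= F x <= M &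
 forall e, 0 < e -> forall x t, 0 <= t <= dlt e -> `|F (x + t) - F x| <= e].

Context (M : R) (dlt : R -> R) (M0 : 0 < M) (dlt0 : forall e, 0 < e -> 0 < dlt e).

Lemma time_class_shift F x : tclass M dlt F -> tclass M dlt (fun t => F (t + x)).
Proof.
move=> [mF F0 uF]; split => [||e e0 y t te]; last by rewrite addrAC; exact: uF.
 apply: (mcomp mF).
 by apply: mfunD; [exact: mid|exact: mcst].
by move=> y; exact: F0.
Qed.

Let mEF F : tclass M dlt F -> mfun (EFin \o F).
Proof. by case=> mF _ _; apply/mEFinP. Qed.

Let F0 F x : tclass M dlt F -> (0 <= (EFin \o F) x)%E.
Proof. by case=> _ H _; rewrite lee_fin; case/andP: (H x). Qed.

Let FM F x : tclass M dlt F -> ((F x)%:E <= M%:E)%E.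
Proof. by case=> _ H _; rewrite lee_fin; case/andP: (H x). Qed.

Lemma class_integral (p : R -> \bar R) F a : mfun p -> (forall t, 0 <= p t)%E ->
 (\int[mu]_t p t <= a%:E)%E -> tclass M dlt F ->
 exists2 r, (\int[mu]_t (p t * (F t)%:E) = r%:E)%E & 0 <= r <= a * M.
Proof.
move=> mp p0 pa cF; apply: ge0_le_EFinP.
 by apply: int_ge0 => t _; rewrite mule_ge0// (F0 t cF).
apply: (@le_trans _ _ (\int[mu]_t (p t * M%:E))%E).
 apply: le_int => //.
 - by move=> t _; rewrite mule_ge0// (F0 t cF).
 - by apply: emfunM => //; exact: mEF cF.
 - by apply: emfunM => //; exact: mcst.
 - by move=> t _; apply: lee_pM2l => //; exact: FM.
rewrite intZr//; last by rewrite lee_fin ltW.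
by rewrite EFinM; apply: lee_wpmul2r => //; rewrite lee_fin ltW.
Qed.

Lemma bump_tail_small e : 0 < e -> exists2 T : R, 0 < T &
 (\int[mu]_(r in `[T, +oo[) (bump 1 r)%:E <= e%:E)%E.
Proof.
move=> e0; pose a := (1 - s) * s * e.
have s1' : 0 < 1 - s by have := s1; lra.
have a0 : 0 < a by rewrite !mulr_gt0.
pose w := a^-1 `^ (1 - s)^-1.
have w0 : 0 <= w by exact: powR_ge0.
exists (1 + w); first lra.
have T1 : 1 <= 1 + w by lra.
have T0 : 0 < 1 + w by lra.
apply: (le_trans (rn_bump_tail s01 T1)).
rewrite lee_fin ldivMr// ldivMr//.
rewrite (_ : s - 1 = - (1 - s)); last by ring.
have -> : e * s * (1 - s) = a by rewrite /a; ring.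
rewrite powRN -[leRHS]invrK lef_pV2 ?posrE ?powR_gt0 ?invr_gt0//.
have -> : a^-1 = w `^ (1 - s).
 by rewrite /w -powRrM mulVf ?gt_eqF// powRr1// invr_ge0 ltW.
by apply: ge0_ler_powR; rewrite ?nnegrE ?(ltW s1') ?(ltW T0)//; lra.
Qed.

(** Uniformly over the class, D0 - Dk is at most M times the mass that [drate (ek k)] is missing,
    and Nk is close to m F 0 because the rescaled bump concentrates at 0, where F has a common
    modulus. *)
Lemma rn_small_step eta : 0 < eta -> exists K, forall k, (K <= k)%N ->
 forall F, tclass M dlt F ->
 let D0 := (\int[mu]_t (drate 0 t * (F t)%:E))%E in
 let Dk := (\int[mu]_t (drate (ek k) t * (F t)%:E))%E in
 let Nk := (\int[mu]_r ((damp (ek k * r) * bump 1 r)%:E * (F (ek k * r))%:E))%E in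
 [/\ (D0 + Nk <= Dk + (m * F 0 + eta)%:E)%E, (Dk + (m * F 0)%:E <= D0 + Nk + eta%:E)%E &
 Nk \is a fin_num].
Proof.
(* Three errors of eta/3 are allotted: m e for the modulus of F, and M times eta/(3 M) for the tail
   of the bump and for the missing mass. *)
move=> eta0; pose e := eta / (3 * m).
have e0 : 0 < e by rewrite divr_gt0// mulr_gt0.
pose d := dlt e; have d0 : 0 < d := dlt0 e0.
have e3 : 0 < eta / (3 * M) by rewrite divr_gt0// mulr_gt0.
have [T T0 HT] := bump_tail_small e3.
have [K1 HK1] : exists K, forall k, (K <= k)%N ->
 (m%:E - (eta / (3 * M))%:E <= \int[mu]_r (damp (ek k * r) * bump 1 r)%:E)%E.
 have := damped_bump_cvg s01 c0 mE => /fine_cvgP[[K2 _ HK2] /cvgrPdist_le/(_ _ e3)[K3 _ HK3]].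
 exists (maxn K2 K3) => k; rewrite geq_max => /andP[k2 k3].
 have := HK3 k k3; rewrite /= ler_norml => /andP[_ h].
 rewrite -(fineK (HK2 k k2)) -EFinB lee_fin; lra.
have [K2 HK2] := exprn_unbounded (T / d) (ltr1n R 2).
exists (maxn K1 K2) => k; rewrite geq_max => /andP[k1 k2] F cF D0 Dk Nk.
have ekT : ek k * T <= d.
 rewrite div1r exprVn mulrC ldivMr ?exprn_gt0// -ler_pdivrMl// mulrC.
 by rewrite (le_trans (ltW HK2))// ler_eXn2l// ltr1n.
have ek0 : 0 < ek k by exact: dyadic_gt0.
have mbump : mfun (EFin \o bump 1).
 by apply/mEFinP; exact: m_bump.
have bump0 r : 0 <= bump 1 r by exact: bump_ge0.
pose db r := damp (ek k * r) * bump 1 r.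
have mdb : mfun (EFin \o db).
 apply/mEFinP; apply: mfunM; last exact: m_bump.
 apply: (@mcomp _ _ _ _ _ _ damp); first exact: m_damping.
 by apply: mfunM; [exact: mcst|exact: mid].
have db0 r : 0 <= db r by rewrite mulr_ge0// ltW// damping_gt0.
have dbb r : db r <= bump 1 r by rewrite ler_piMl// damping_le1.
have dbm : (\int[mu]_r (db r)%:E <= m%:E)%E.
 rewrite -mE; apply: le_int => //.
 - by move=> r _; rewrite lee_fin.
 - by move=> r _; rewrite lee_fin.
have [dm dmE /andP[dm0 dmm]] := ge0_le_EFinP (int_ge0 mu (fun r _ => db0 r : (0 <= (db r)%:E)%E)) dbm.
have dmlow : m - eta / (3 * M) <= dm by have := HK1 k k1; rewrite dmE -EFinB lee_fin.
have DkE : (\int[mu]_t drate (ek k) t = dm%:E)%E by rewrite (drop_rate_integral s01 c0).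
have D0E : (\int[mu]_t drate 0 t = m%:E)%E by rewrite (drop_rate_mass s01 c0 mE).
have mFe : mfun (fun r => F (ek k * r)).
 case: cF => mF _ _; apply: (mcomp mF).
 by apply: mfunM; [exact: mcst|exact: mid].
have Fb x : 0 <= F x <= M by case: cF.
have Fp x : 0 <= F x by case/andP: (Fb x).
have FMx x : F x <= M by case/andP: (Fb x).
have dbF0 r : (0 <= (db r)%:E * (F (ek k * r))%:E)%E by rewrite mule_ge0 ?lee_fin.
have [x0 x0E /andP[x00 _]] : exists2 r, D0 = r%:E & 0 <= r <= m * M.
 apply: class_integral => //; first exact: m_drop_rate.
 by move=> t; exact: drate_ge0.
 by rewrite D0E.
have [xk xkE /andP[xk0 _]] : exists2 r, Dk = r%:E & 0 <= r <= dm * M.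
 apply: class_integral => //; first exact: m_drop_rate.
 by move=> t; exact: drate_ge0.
 by rewrite DkE.
have NkM : (Nk <= (dm * M)%:E)%E.
 rewrite EFinM -dmE -intZr//; last by rewrite lee_fin ltW.
 apply: le_int => //.
 - by move=> r _; exact: dbF0.
 - by apply: emfunM => //; exact/mEFinP.
 - by apply: emfunM => //; exact: mcst.
 - by move=> r _; apply: lee_pM2l; rewrite lee_fin; [exact: db0|exact: FMx].
 by move=> r _; rewrite lee_fin.
have Nk0 : (0 <= Nk)%E.
 by apply: int_ge0 => r _; exact: dbF0.
have [nk nkE /andP[nk0 _]] := ge0_le_EFinP Nk0 NkM.
have M0' : (0 <= M%:E)%E by rewrite lee_fin ltW.
have mD e' : mfun (drate e') by exact: m_drop_rate.
have dr0 e' t : (0 <= drate e' t)%E by exact: drate_ge0.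
have drle t : (drate (ek k) t <= drate 0 t)%E.
 apply: le_int => //.
 - by move=> x _; rewrite lee_fin mulr_ge0 ?jump_ge0 ?drop_ge0.
 - apply/mEFinP; apply: mfunM; first exact: m_jump.
 exact: (mcomp (m_drop s c) (mpair1 t)).
 - apply/mEFinP; apply: mfunM; first exact: m_jump.
 exact: (mcomp (m_drop s c) (mpair1 t)).
 - move=> x _; rewrite lee_fin ler_wpM2r ?drop_ge0//.
 rewrite !jumpE; case: ifPn => ix; last by case: ifP => // _; exact: powR_ge0.
 by rewrite (lt_trans ek0 ix).
have mF := mEF cF.
have F0' t : (0 <= (F t)%:E)%E by rewrite lee_fin.
(* (drate 0 - drate e_k) * (M - F) >= 0, integrated *)
have H1 : x0 + dm * M <= xk + m * M.
 have : (\int[mu]_t (drate 0 t * (F t)%:E + drate (ek k) t * M%:E) <=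
 \int[mu]_t (drate (ek k) t * (F t)%:E + drate 0 t * M%:E))%E.
 apply: le_int => //.
 - by move=> t _; rewrite adde_ge0// mule_ge0.
 - by apply: emfunD; apply: emfunM; try exact: mD; [exact: mF|exact: mcst].
 - by apply: emfunD; apply: emfunM; try exact: mD; [exact: mF|exact: mcst].
 - move=> t _; have := drle t; have := dr0 (ek k) t.
 have /andP[f1 f2] := Fb t.
 case: (drate 0 t) (dr0 0 t) => [u| |]//; last first.
 move=> _ v0 _; rewrite [X in (_ <= _ + X)%E]gt0_mulye ?lte_fin// addey ?leey//.
 by rewrite gt_eqF// (lt_le_trans ltNy0)// mule_ge0.
 move=> u0; case: (drate (ek k) t) => [v| |]// v0 vu.
 rewrite -!EFinM -!EFinD lee_fin; rewrite !lee_fin in u0 v0 vu.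
 nra.
 have aux (f g : R -> \bar R) : mfun f -> mfun g ->
 (forall t, 0 <= f t)%E -> (forall t, 0 <= g t)%E ->
 (\int[mu]_t (f t * (F t)%:E + g t * M%:E) =
 \int[mu]_t (f t * (F t)%:E) + \int[mu]_t g t * M%:E)%E.
 move=> mf mg f0 g0; rewrite -intZr// -intD//.
 - by move=> t _; rewrite mule_ge0.
 - by apply: emfunM.
 - by move=> t _; rewrite mule_ge0.
 - by apply: emfunM => //; exact: mcst.
 rewrite !aux// -/D0 -/Dk x0E xkE DkE D0E -!EFinM -!EFinD lee_fin; lra.
have H2 : xk <= x0.
 rewrite -lee_fin -x0E -xkE; apply: le_int => //.
 - by move=> t _; rewrite mule_ge0.
 - by apply: emfunM; [exact: mD|exact: mF].
 - by apply: emfunM; [exact: mD|exact: mF].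
 - by move=> t _; apply: lee_wpmul2r.
pose tl r : R := if T <= r then 1 else 0.
have tl0 r : 0 <= tl r by rewrite /tl; case: ifP.
have mtl : mfun tl.
 apply: mifT; [|exact: mcst|exact: mcst].
 by apply: measurable_fun_ler; [exact: mcst|exact: mid].
have mtlb : mfun (fun r => (bump 1 r * tl r)%:E).
 by apply/mEFinP; apply: mfunM => //; exact: m_bump.
have tlb0 r : (0 <= (bump 1 r * tl r)%:E)%E by rewrite lee_fin mulr_ge0.
have tlE : (\int[mu]_r (bump 1 r * tl r)%:E <= (eta / (3 * M))%:E)%E.
 apply: le_trans HT; rewrite [leRHS]int_mkcond; apply: eq_imp_le.
 apply: eqint => r _; rewrite /patch mem_setE in_itv/= andbT /tl.
 by case: ifP => _; rewrite ?mulr1// mulr0.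
have [w wE /andP[w0 we]] := ge0_le_EFinP (int_ge0 mu (fun r _ => tlb0 r)) tlE.
have osc r : 0 < r -> `|F (ek k * r) - F 0| <= e + M * tl r.
 move=> r0; rewrite /tl; case: ifPn => [_|].
 rewrite mulr1 (@le_trans _ _ M)//; last by rewrite lerDr ltW.
 have /andP[? ?] := Fb (ek k * r); have /andP[? ?] := Fb 0.
 by rewrite ler_norml; apply/andP; split; lra.
 rewrite -ltNge mulr0 addr0 => rT; case: cF => _ _ /(_ e e0 0 (ek k * r)).
 rewrite add0r; apply; rewrite mulr_ge0 ?(ltW ek0) ?(ltW r0)//=.
 by apply: le_trans ekT; rewrite ler_wpM2l ?(ltW ek0) ?(ltW rT).
have bump_neg r : r <= 0 -> bump 1 r = 0.
 by move=> r0; rewrite !bumpE ltNge r0.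
have emE : e * m = eta / 3 by rewrite /e; field; rewrite gt_eqF.
have eME : eta / (3 * M) * M = eta / 3 by field; rewrite gt_eqF.
have zr (f : R -> R) (a : R) : mfun f -> (forall r, 0 <= f r) -> 0 <= a ->
 (\int[mu]_r (f r * a)%:E = \int[mu]_r (f r)%:E * a%:E)%E.
 move=> mf f0 a0; under eqint do rewrite EFinM.
 rewrite intZr ?lee_fin//; first exact/mEFinP.
 by move=> r _; rewrite lee_fin.
have lin (a a' : R) : 0 <= a -> 0 <= a' ->
 (\int[mu]_r (bump 1 r * a + bump 1 r * tl r * a')%:E = (m * a + w * a')%:E)%E.
 move=> a0 a'0; under eqint do rewrite EFinD.
 have mb1 : mfun (bump 1) by exact: m_bump.
 have mb2 : mfun (fun r => bump 1 r * tl r) by exact: mfunM.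
 rewrite intD//; last 4 first.
 - by move=> r _; rewrite lee_fin mulr_ge0.
 - by apply/mEFinP; apply: mfunM => //; exact: mcst.
 - by move=> r _; rewrite lee_fin !mulr_ge0.
 - by apply/mEFinP; apply: mfunM => //; exact: mcst.
 by rewrite !zr// ?mE ?wE// => r; rewrite mulr_ge0.
have /andP[F00 F0M] := Fb 0.
have H3 : nk <= m * (F 0 + e) + w * M.
 rewrite -lee_fin -nkE -lin ?(ltW M0)//; last by rewrite addr_ge0// ltW.
 apply: le_int => //.
 - by move=> r _; exact: dbF0.
 - by apply: emfunM => //; exact/mEFinP.
 - apply/mEFinP; apply: mfunD.
 by apply: mfunM; [exact: m_bump|exact: mcst].
 by apply: mfunM; [exact/mEFinP|exact: mcst].
 - move=> r _; rewrite -EFinM lee_fin; have [r0|r0] := leP r 0.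
 by rewrite bump_neg// mulr0 !mul0r addr0.
 have := osc r r0; rewrite ler_norml => /andP[_ h].
 have /andP[h1 h2] := Fb (ek k * r).
 have := dbb r; have := db0 r; rewrite /db => h3 h4.
 apply: (@le_trans _ _ (bump 1 r * (F 0 + e + M * tl r))).
 apply: ler_pM => //; lra.
 by apply: eq_imp_le; ring.
(* Replacing the damped bump by the larger undamped one goes in the right direction against M - F,
   not against F; hence the comparison through M. *)
have H4 : m * F 0 + dm * M <= nk + m * (M + e) + w * M.
 have X : (\int[mu]_r ((bump 1 r * F 0)%:E + (db r * M)%:E) <=
 \int[mu]_r ((db r)%:E * (F (ek k * r))%:E +
 (bump 1 r * (M + e) + bump 1 r * tl r * M)%:E))%E.
 apply: le_int => //.
 - by move=> r _; rewrite adde_ge0// lee_fin mulr_ge0// ltW.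
 - apply: emfunD; apply/mEFinP; apply: mfunM; try exact: mcst.
 exact: m_bump.
 exact/mEFinP.
 - apply: emfunD.
 by apply: emfunM => //; exact/mEFinP.
 apply/mEFinP; apply: mfunD.
 by apply: mfunM; [exact: m_bump|exact: mcst].
 by apply: mfunM; [exact/mEFinP|exact: mcst].
 - move=> r _; rewrite -EFinM -!EFinD lee_fin; have [r0|r0] := leP r 0.
 by rewrite /db bump_neg// mulr0 !mul0r !addr0.
 have := osc r r0; rewrite ler_norml => /andP[h _].
 have /andP[h1 h2] := Fb (ek k * r).
 have h3 := dbb r; have h4 := db0 r; have h5 := bump0 r.
 have h6 : db r * (M - F (ek k * r)) <= bump 1 r * (M - F (ek k * r)).
 by rewrite ler_wpM2r ?subr_ge0.
 have h7 : bump 1 r * (F 0) <= bump 1 r * (F (ek k * r) + e + M * tl r).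
 by rewrite ler_wpM2l//; lra.
 move: h6 h7; rewrite !mulrDr !mulrN; lra.
 move: X; rewrite intD//; last 4 first.
 - by move=> r _; rewrite lee_fin mulr_ge0.
 - by apply/mEFinP; apply: mfunM; [exact: m_bump|exact: mcst].
 - by move=> r _; rewrite lee_fin mulr_ge0// ltW.
 - by apply/mEFinP; apply: mfunM; [exact/mEFinP|exact: mcst].
 under eqint do rewrite EFinM.
 rewrite intZr ?lee_fin//; last by move=> r _; rewrite lee_fin.
 under [X in (_ + X <= _)%E -> _]eqint do rewrite EFinM.
 rewrite intZr ?lee_fin ?(ltW M0)//; last by move=> r _; rewrite lee_fin.
 rewrite intD//; last 3 first.
 - by apply: emfunM => //; exact/mEFinP.
 - by move=> r _; rewrite lee_fin addr_ge0// !mulr_ge0 ?addr_ge0 ?(ltW M0) ?(ltW e0).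
 - apply/mEFinP; apply: mfunD.
 by apply: mfunM; [exact: m_bump|exact: mcst].
 by apply: mfunM; [exact/mEFinP|exact: mcst].
 rewrite lin ?addr_ge0 ?(ltW M0) ?(ltW e0)// mE dmE -/Nk nkE -!EFinM -!EFinD lee_fin; lra.
have wM : w * M <= eta / 3 by rewrite -eME ler_wpM2r ?(ltW M0).
have dmM : (m - dm) * M <= eta / 3 by rewrite -eME ler_wpM2r ?(ltW M0)//; lra.
have me : m * e = eta / 3 by rewrite mulrC.
rewrite x0E xkE nkE -!EFinD !lee_fin; move: H3 H4; rewrite !mulrDr me.
have : (m - dm) * M = m * M - dm * M by ring.
split => //; lra.
Qed.

Definition rn_potential (F : R -> R) : \bar R := (\int[mu]_t (rhoe t * (F t)%:E))%E.

Local Notation X := rn_potential.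
Local Notation sh F x := (fun t => F (t + x)).

Definition jump_potential k (F : R -> R) : \bar R :=
 (\int[mu]_x ((jdens (ek k) x)%:E * X (sh F x)))%E.

Local Notation Y := jump_potential.
Local Notation al k := ((ek k) `^ (- s) / s).

Let ek0 k : 0 < ek k. Proof. exact: dyadic_gt0. Qed.

Let al0 k : 0 <= al k. Proof. by rewrite divr_ge0 ?powR_ge0 ?ltW. Qed.

Lemma rn_pot F : tclass M dlt F -> exists2 r, X F = r%:E & 0 <= r <= M.
Proof.
by move=> cF; have := class_integral mrho rho0 rn_density_mass cF; rewrite mul1r.
Qed.

Lemma m_rn_potential F : tclass M dlt F ->
 mfun (fun x => X (sh F x)).
Proof.
move=> cF; pose f (z : R * R) := (rhoe z.2 * (F (z.2 + z.1))%:E)%E.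
have mf : mfun f.
 apply: emfunM; first exact: (mcomp mrho).
 apply: (mcomp (mEF cF)).
 by apply: mfunD; [exact: msnd|exact: mfst].
apply: (mtonF (m2 := mu) _ mf) => z.
by rewrite mule_ge0// (F0 _ cF).
Qed.

Lemma rn_potential_ge0 F : tclass M dlt F -> (0 <= X F)%E.
Proof. by move=> cF; apply: int_ge0 => t _; rewrite mule_ge0// (F0 _ cF). Qed.

Let mjump k : mfun (EFin \o jdens (ek k)).
Proof. by apply/mEFinP; exact: m_jump. Qed.

Let jump0 k x : (0 <= (jdens (ek k) x)%:E)%E.
Proof. by rewrite lee_fin jump_ge0. Qed.

Lemma jump_pot k F : tclass M dlt F ->
 exists2 r, Y k F = r%:E & 0 <= r <= al k * M.
Proof.
move=> cF; have sF x := time_class_shift x cF.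
apply: ge0_le_EFinP; first by apply: int_ge0 => x _; rewrite mule_ge0// rn_potential_ge0.
rewrite EFinM -(jump_mass s01 (ek0 k)) -intZr//; last by rewrite lee_fin ltW.
apply: le_int => //.
- by move=> x _; rewrite mule_ge0// rn_potential_ge0.
- by apply: emfunM; [exact: mjump|exact: m_rn_potential].
- by apply: emfunM; [exact: mjump|exact: mcst].
- move=> x _; apply: lee_pM2l => //.
 by have [r -> /andP[_ rM]] := rn_pot (sF x); rewrite lee_fin.
exact: mjump.
Qed.

Let mstep : mfun step. Proof. exact: m_rn_step. Qed.
Let step0 := rn_step_ge0 s01 c0 m0.
Let minit := m_rn_init s c m.
Let init0 t : (0 <= (init t)%:E)%E.
Proof. by rewrite lee_fin rn_init_ge0. Qed.

Definition init_potential (F : R -> R) : \bar R := (\int[mu]_t ((init t)%:E * (F t)%:E))%E.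

Lemma m_init_potential F : tclass M dlt F ->
 mfun (fun x => init_potential (sh F x)).
Proof.
move=> cF; pose f (z : R * R) := ((init z.2)%:E * (F (z.2 + z.1))%:E)%E.
have mf : mfun f.
 apply: emfunM; first exact: (mcomp minit).
 apply: (mcomp (mEF cF)).
 by apply: mfunD; [exact: msnd|exact: mfst].
apply: (mtonF (m2 := mu) _ mf) => z.
by rewrite mule_ge0// (F0 _ cF).
Qed.

Lemma init_potential_ge0 F : tclass M dlt F -> (0 <= init_potential F)%E.
Proof. by move=> cF; apply: int_ge0 => t _; rewrite mule_ge0// (F0 _ cF). Qed.

Lemma rn_potential_decomp F : tclass M dlt F ->
 X F = (init_potential F + \int[mu]_x (step x * X (sh F x)))%E.
Proof.
move=> cF; have mF := mEF cF.
have p0 t : (0 <= (F t)%:E)%E by exact: (F0 _ cF).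
rewrite -(line_conv_tonelli mstep mrho mF step0 rho0 p0) -intD//.
- apply: eqint => t _.
 by rewrite [in LHS](rn_equation s01 c0 m0) ge0_muleDl// line_conv_ge0.
- by move=> t _; rewrite mule_ge0.
- exact: emfunM.
- by move=> t _; apply: mule_ge0; [exact: line_conv_ge0|exact: p0].
- by apply: emfunM => //; exact: m_line_conv.
Qed.

Lemma m_jump_potential k F : tclass M dlt F ->
 mfun (fun y => Y k (sh F y)).
Proof.
move=> cF; have mg := m_rn_potential cF.
pose f (z : R * R) := ((jdens (ek k) z.2)%:E * X (sh F (z.2 + z.1)))%E.
have mf : mfun f.
 apply: emfunM; first exact: (mcomp (mjump k)).
 apply: (mcomp mg).
 by apply: mfunD; [exact: msnd|exact: mfst].
have f0 z : (0 <= f z)%E.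
 by rewrite mule_ge0// rn_potential_ge0//; exact: time_class_shift.
have H := mtonF (m2 := mu) f mf f0.
suff -> : (fun y => Y k (sh F y)) = fubini_F mu f by exact: H.
apply/funext => y; apply: eqint => x _; congr (_ * X _)%E.
by apply/funext => t; rewrite /= addrA.
Qed.

Lemma jump_potential_decomp k F : tclass M dlt F ->
 Y k F = (\int[mu]_x ((jdens (ek k) x)%:E * init_potential (sh F x)) +
 \int[mu]_y (step y * Y k (sh F y)))%E.
Proof.
move=> cF; have sF x := time_class_shift x cF.
have mg := m_rn_potential cF.
pose G (z : R * R) := ((jdens (ek k) z.1)%:E * (step z.2 * X (sh F (z.2 + z.1))))%E.
have mg2 : mfun (fun z : R * R => X (sh F (z.2 + z.1))).
 by apply: (mcomp mg); apply: mfunD; [exact: msnd|exact: mfst].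
have g20 z : (0 <= X (sh F z))%E by exact: rn_potential_ge0.
have mG : mfun G.
 apply: emfunM; first exact: (mcomp (mjump k)).
 by apply: emfunM; [exact: (mcomp mstep)|exact: mg2].
have G0 z : (0 <= G z)%E by rewrite !mule_ge0.
have shE x y : sh (sh F x) y = sh F (y + x).
 by apply/funext => t; rewrite addrA.
have E2 : (\int[mu]_y (step y * Y k (sh F y)) = \int[mu]_x \int[mu]_y G (x, y))%E.
 rewrite (fubini_tonelli (m1 := mu) (m2 := mu) G mG G0); apply: eqint => y _.
 have m1 : mfun (fun x => (jdens (ek k) x)%:E * X (sh (sh F y) x))%E.
 apply: emfunM; first exact: mjump.
 rewrite (_ : (fun x => _) = fun x => X (sh F (x + y))).
 exact: (m_shift (f := fun x => X (sh F x)) y mg).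
 by apply/funext => x; rewrite shE.
 have n1 x : setT x -> (0 <= (jdens (ek k) x)%:E * X (sh (sh F y) x))%E.
 by move=> _; rewrite shE; apply: mule_ge0.
 rewrite -(@intZl _ _ _ mu _ mTT _ m1 _ n1 (step0 y)).
 by apply: eqint => x _; rewrite /G/= shE addrC muleCA.
rewrite E2 -intD//; last 4 first.
- by move=> x _; rewrite mule_ge0// init_potential_ge0.
- by apply: emfunM; [exact: mjump|exact: m_init_potential].
- by move=> x _; exact: int_ge0.
- exact: (mtonF (m2 := mu) G mG G0).
apply: eqint => x _; rewrite (rn_potential_decomp (sF x)) ge0_muleDr; last 2 first.
- exact: init_potential_ge0.
- by apply: int_ge0 => y _; rewrite mule_ge0// shE.
congr (_ + _)%E.
have m1 : mfun (fun y => step y * X (sh (sh F x) y))%E.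
 apply: emfunM; first exact: mstep.
 rewrite (_ : (fun y => _) = fun y => X (sh F (y + x))).
 exact: (m_shift (f := fun x => X (sh F x)) x mg).
 by apply/funext => y; rewrite shE.
have n1 y : setT y -> (0 <= step y * X (sh (sh F x) y))%E.
 by move=> _; rewrite shE; apply: mule_ge0.
rewrite -(@intZl _ _ _ mu _ mTT _ m1 _ n1 (jump0 k x)).
by apply: eqint => y _; rewrite shE.
Qed.

(** Defect in the weak form of (1 + c D) rho = unit mass at 0, tested against F, with jumps below
    2^(-k) removed from D; al k is the mass of the remaining jumps. *)
Definition rn_error k F := (1 + c * al k) * fine (X F) - c * fine (Y k F) - F 0.

Lemma rn_contraction k eta S : 0 <= S ->
 (forall F, tclass M dlt F ->
 let D0 := (\int[mu]_t (drate 0 t * (F t)%:E))%E in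
 let Dk := (\int[mu]_t (drate (ek k) t * (F t)%:E))%E in
 let Nk := (\int[mu]_r ((damp (ek k * r) * bump 1 r)%:E * (F (ek k * r))%:E))%E in
 [/\ (D0 + Nk <= Dk + (m * F 0 + eta)%:E)%E, (Dk + (m * F 0)%:E <= D0 + Nk + eta%:E)%E &
 Nk \is a fin_num]) ->
 (forall F, tclass M dlt F -> `|rn_error k F| <= S) ->
 forall F, tclass M dlt F -> `|rn_error k F| <= eta / m + (1 - q1) * S.
Proof.
move=> S0 HD HS F cF; have sF x := time_class_shift x cF.
have [h1 h2 Nkf] := HD F cF.
have mF := mEF cF.
have p0 t : (0 <= (F t)%:E)%E by exact: (F0 _ cF).
have mg := m_rn_potential cF.
have mY := m_jump_potential k cF.
have g0 x : (0 <= X (sh F x))%E by exact: rn_potential_ge0.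
have Y0 x : (0 <= Y k (sh F x))%E.
 by have [r -> /andP[r0 _]] := jump_pot k (sF x); rewrite lee_fin.
have q1le : 0 <= 1 - q1 by case/andP: (rn_step_mass_lt1 s01 c0 m0 mE q10 q1E).
have stm := rn_step_mass s01 c0 m0 mE q1E.
have stI (f : R -> \bar R) N : 0 <= N -> mfun f -> (forall x, 0 <= f x)%E ->
 (forall x, f x <= N%:E)%E -> exists2 r, (\int[mu]_x (step x * f x) = r%:E)%E & 0 <= r <= (1 - q1) * N.
 move=> N0 mf f0 fN; apply: ge0_le_EFinP; first by apply: int_ge0 => x _; rewrite mule_ge0.
 rewrite EFinM -stm -intZr//.
 apply: le_int => //.
 - by move=> x _; rewrite mule_ge0.
 - exact: emfunM.
 - by apply: emfunM => //; exact: mcst.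
 - by move=> x _; apply: lee_pM2l.
have [A AE _] := stI (fun x => X (sh F x)) M (ltW M0) mg g0
 (fun x => let: ex_intro2 r e (h) := rn_pot (sF x) in
 eq_ind_r (fun z => z <= M%:E)%E ((andP h).2 : (r%:E <= M%:E)%E) e).
have [Bq BE _] := stI (fun x => Y k (sh F x)) (al k * M) (mulr_ge0 (al0 k) (ltW M0)) mY Y0
 (fun x => let: ex_intro2 r e (h) := jump_pot k (sF x) in
 eq_ind_r (fun z => z <= (al k * M)%:E)%E ((andP h).2 : (r%:E <= (al k * M)%:E)%E) e).
have [f fE _] := stI (EFin \o F) M (ltW M0) mF p0 (fun x => FM x cF).
have S0' : (0 <= S%:E)%E by [].
have c1 : 0 <= 1 + c * al k by rewrite addr_ge0// mulr_ge0 ?al0// ltW.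
have ptw x : ((1 + c * al k)%:E * X (sh F x) <= c%:E * Y k (sh F x) + (F x)%:E + S%:E)%E /\
 (c%:E * Y k (sh F x) + (F x)%:E <= (1 + c * al k)%:E * X (sh F x) + S%:E)%E.
 have := HS _ (sF x); rewrite /rn_error add0r.
 have [r -> _] := jump_pot k (sF x).
 have [r' -> _] := rn_pot (sF x).
 rewrite /= ler_norml => /andP[a1 a2]; rewrite -!EFinM -!EFinD !lee_fin; split; lra.
have lin1 (a : R) (u : R -> \bar R) : 0 <= a -> mfun u -> (forall x, 0 <= u x)%E ->
 (\int[mu]_x (step x * (a%:E * u x)) = a%:E * \int[mu]_x (step x * u x))%E.
 move=> a0 mu_ u0; rewrite -intZl//.
 - by apply: eqint => x _; rewrite muleCA.
 - exact: emfunM.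
 - by move=> x _; rewrite mule_ge0.
have lin2 (u v : R -> \bar R) : mfun u -> (forall x, 0 <= u x)%E ->
 mfun v -> (forall x, 0 <= v x)%E ->
 (\int[mu]_x (step x * (u x + v x)) = \int[mu]_x (step x * u x) + \int[mu]_x (step x * v x))%E.
 move=> mu_ u0 mv v0; rewrite -intD//.
 - by apply: eqint => x _; rewrite ge0_muleDr.
 - by move=> x _; rewrite mule_ge0.
 - exact: emfunM.
 - by move=> x _; rewrite mule_ge0.
 - exact: emfunM.
have monoI (u v : R -> \bar R) : mfun u -> (forall x, 0 <= u x)%E ->
 mfun v -> (forall x, u x <= v x)%E ->
 (\int[mu]_x (step x * u x) <= \int[mu]_x (step x * v x))%E.
 move=> mu_ u0 mv uv; apply: le_int => //.
 - by move=> x _; rewrite mule_ge0.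
 - exact: emfunM.
 - exact: emfunM.
 - by move=> x _; apply: lee_pM2l.
have mcX : mfun (fun x => (1 + c * al k)%:E * X (sh F x))%E.
 by apply: emfunM => //; exact: mcst.
have cX0 x : (0 <= (1 + c * al k)%:E * X (sh F x))%E by rewrite mule_ge0// lee_fin.
have mcY : mfun (fun x => c%:E * Y k (sh F x))%E.
 by apply: emfunM => //; exact: mcst.
have cY0 x : (0 <= c%:E * Y k (sh F x))%E by rewrite mule_ge0// lee_fin ltW.
have mcYF : mfun (fun x => c%:E * Y k (sh F x) + (F x)%:E)%E.
 exact: emfunD.
have cYF0 x : (0 <= c%:E * Y k (sh F x) + (F x)%:E)%E by rewrite adde_ge0.
have stS : (\int[mu]_x (step x * cst S%:E x) = ((1 - q1) * S)%:E)%E.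
 by rewrite EFinM -stm -intZr.
have mS : mfun (cst S%:E : R -> \bar R) by exact: mcst.
have U1 : (1 + c * al k) * A <= c * Bq + f + (1 - q1) * S.
 rewrite -lee_fin !EFinD [in leLHS]EFinM [in leRHS]EFinM -AE -BE -fE -stS.
 rewrite -lin1// -lin1 ?(ltW c0)// -lin2// -lin2//.
 by apply: monoI => //; [exact: emfunD|move=> x; exact: (ptw x).1].
have U2 : c * Bq + f <= (1 + c * al k) * A + (1 - q1) * S.
 rewrite -lee_fin !EFinD [in leLHS]EFinM [in leRHS]EFinM -AE -BE -fE -stS.
 rewrite -lin1 ?(ltW c0)// -lin1// -lin2// -lin2//.
 by apply: monoI => //; [exact: emfunD|move=> x; exact: (ptw x).2].
have DP0 t : (0 <= (dpow t)%:E)%E by rewrite lee_fin dpow_ge0.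
have mDP : mfun (EFin \o dpow).
 by apply/mEFinP; exact: m_dpow.
pose b := (c * m)^-1; have b0 : 0 < b by rewrite invr_gt0 mulr_gt0.
have initE (H : R -> R) : tclass M dlt H ->
 init_potential H = (b%:E * \int[mu]_t ((dpow t)%:E * (H t)%:E))%E.
 move=> cH; rewrite -intZl//; last 3 first.
 - by apply: emfunM => //; exact: mEF.
 - by move=> t _; rewrite mule_ge0// (F0 _ cH).
 - by rewrite lee_fin ltW.
 by apply: eqint => t _; rewrite /rn_init EFinM muleA.
have [P PE /andP[P0 _]] : exists2 r, (\int[mu]_t ((dpow t)%:E * (F t)%:E) = r%:E)%E &
 0 <= r <= fine (\int[mu]_t (dpow t)%:E)%E * M.
 by apply: class_integral => //; rewrite fineK// damped_power_mass_fin.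
have mI2 : mfun (fun x => \int[mu]_t ((dpow t)%:E * (F (t + x))%:E))%E.
 pose h (z : R * R) := ((dpow z.2)%:E * (F (z.2 + z.1))%:E)%E.
 have mh : mfun h.
 apply: emfunM; first exact: (mcomp mDP).
 apply: (mcomp mF).
 by apply: mfunD; [exact: msnd|exact: mfst].
 by apply: (mtonF (m2 := mu) _ mh) => z; rewrite mule_ge0.
have I20 x : (0 <= \int[mu]_t ((dpow t)%:E * (F (t + x))%:E))%E.
 by apply: int_ge0 => t _; rewrite mule_ge0.
have Y1E : (\int[mu]_x ((jdens (ek k) x)%:E * init_potential (sh F x)) =
 b%:E * \int[mu]_x ((jdens (ek k) x)%:E *
 \int[mu]_t ((dpow t)%:E * (F (t + x))%:E)))%E.
 rewrite -intZl//; last 3 first.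
 - by apply: emfunM => //; exact: mjump.
 - by move=> x _; rewrite mule_ge0.
 - by rewrite lee_fin ltW.
 by apply: eqint => x _; rewrite (initE _ (sF x)) muleCA.
have [y yE /andP[y0 _]] := jump_pot k cF.
have [x xE _] := rn_pot cF.
set Q := (\int[mu]_x ((jdens (ek k) x)%:E *
 \int[mu]_t ((dpow t)%:E * (F (t + x))%:E)))%E in Y1E.
have Qf : Q \is a fin_num.
 have Q0 : (0 <= Q)%E by apply: int_ge0 => z _; rewrite mule_ge0.
 rewrite fin_numE0//; have := jump_potential_decomp k cF.
 rewrite yE Y1E BE => H; case: (Q) Q0 H => [r _ _| |]//; first by rewrite ltry.
 by rewrite gt0_muley ?lte_fin.
have QE : Q = (fine Q)%:E by rewrite fineK.
have TM := truncated_marchaud_integral s01 c0 (ek0 k) mF p0.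
rewrite /= PE -/Q QE in TM.
(* [drate 0] is m times the sum of [rn_step] and [rn_init]. *)
have D0E : (\int[mu]_t (drate 0 t * (F t)%:E) = (m * (f + b * P))%:E)%E.
 have : ((m^-1)%:E * \int[mu]_t (drate 0 t * (F t)%:E) = (f + b * P)%:E)%E.
 rewrite EFinD EFinM -fE -PE -(initE F cF) -intD//; last 4 first.
 - by move=> t _; apply: mule_ge0; [exact: step0|exact: p0].
 - exact: emfunM.
 - by move=> t _; apply: mule_ge0; [exact: init0|exact: p0].
 - exact: emfunM.
 rewrite -intZl//; last 3 first.
 - by apply: emfunM => //; exact: m_drop_rate.
 - by move=> t _; rewrite mule_ge0// drate_ge0.
 - by rewrite lee_fin invr_ge0 ltW.
 by apply: eqint => t _; rewrite muleA -(rn_stepE s c m t) ge0_muleDl.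
 move=> E; rewrite EFinM -E muleA -EFinM mulfV ?gt_eqF// mul1e.
 by [].
move: h1 h2 TM; rewrite D0E -(fineK Nkf); set nk := fine _.
have : (0 <= \int[mu]_t (drate (ek k) t * (F t)%:E))%E.
 by apply: int_ge0 => t _; rewrite mule_ge0// drate_ge0.
case: (\int[mu]_t (drate (ek k) t * (F t)%:E))%E => [dk| |]// _.
rewrite -!EFinM -!EFinD !lee_fin => h1 h2 [TM].
have xD : x = b * P + A.
 have := rn_potential_decomp cF; rewrite xE (initE F cF) PE AE -EFinM -EFinD.
 by case.
have yD : y = b * fine Q + Bq.
 have := jump_potential_decomp k cF; rewrite yE Y1E QE BE -EFinM -EFinD.
 by case.
rewrite /rn_error xE yE /= xD yD.
have cb : c * b = m^-1 by rewrite /b invfM mulrA mulfV ?gt_eqF// mul1r.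
have fb : f + b * P = (f + b * P) by [].
have h1' : m * (f + b * P) + nk - dk - m * F 0 <= eta by lra.
have h2' : - eta <= m * (f + b * P) + nk - dk - m * F 0 by lra.
(* The integrated Marchaud identity gives al P - Q = nk - dk, and c b = 1/m: the defect of the
   parametrix is exactly the quantity bounded by [rn_small_step], divided by m. *)
have key : (1 + c * al k) * (b * P) - c * (b * fine Q) + f - F 0 =
 (m * (f + b * P) + nk - dk - m * F 0) / m.
 have -> : (1 + c * al k) * (b * P) - c * (b * fine Q) = b * P + c * b * (al k * P - fine Q) by ring.
 have -> : al k * P - fine Q = nk - dk by lra.
 by rewrite cb; field; rewrite gt_eqF.
have e1 : (m * (f + b * P) + nk - dk - m * F 0) / m <= eta / m.
 by rewrite ler_wpM2r// invr_ge0 ltW.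
have e2 : - (eta / m) <= (m * (f + b * P) + nk - dk - m * F 0) / m.
 by rewrite -mulNr ler_wpM2r// invr_ge0 ltW.
rewrite -key in e1 e2.
have split1 : (1 + c * al k) * (b * P + A) = (1 + c * al k) * (b * P) + (1 + c * al k) * A by ring.
have split2 : c * (b * fine Q + Bq) = c * (b * fine Q) + c * Bq by ring.
rewrite split1 split2 ler_norml; apply/andP; split; lra.
Qed.

(** A crude bound S0 on the defect is improved by iterating the contraction. S0 grows with k, so k
    is fixed before the number of iterations tends to infinity. *)
Lemma rn_error_small eta : 0 < eta -> exists K, forall k, (K <= k)%N ->
 forall F, tclass M dlt F -> `|rn_error k F| <= eta.
Proof.
(* The value m q1 eta/2 makes eta/2 the fixed point of S -> e/m + (1 - q1) S. *)
move=> eta0; have e0 : 0 < m * (q1 * (eta / 2)) by rewrite !mulr_gt0//; lra.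
have [K HK] := rn_small_step e0; exists K => k Kk F cF.
pose S0 := (1 + c * al k) * M + c * (al k * M) + M.
have c1 : 0 <= 1 + c * al k by rewrite addr_ge0// mulr_ge0 ?al0// ltW.
have M0' := ltW M0.
have S00 : 0 <= S0.
 apply: addr_ge0 => //; apply: addr_ge0; apply: mulr_ge0 => //; first exact: ltW.
 exact: mulr_ge0.
have base H : tclass M dlt H -> `|rn_error k H| <= S0.
 move=> cH; rewrite /rn_error.
 have [y -> /andP[y0 yM]] := jump_pot k cH.
 have [x -> /andP[x0 xM]] := rn_pot cH.
 have /andP[H0 HM] : 0 <= H 0 <= M by case: cH.
 rewrite /= ler_norml /S0.
 have a1 : 0 <= (1 + c * al k) * x by exact: mulr_ge0.
 have a2 : (1 + c * al k) * x <= (1 + c * al k) * M by rewrite ler_wpM2l.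
 have a3 : 0 <= c * y by rewrite mulr_ge0// ltW.
 have a4 : c * y <= c * (al k * M) by rewrite ler_wpM2l// ltW.
 apply/andP; split; lra.
have /andP[q0 q1'] := rn_step_mass_lt1 s01 c0 m0 mE q10 q1E.
have iter j : forall H, tclass M dlt H -> `|rn_error k H| <= eta / 2 + (1 - q1) ^+ j * S0.
 elim: j => [|j IH] H cH.
 by rewrite expr0 mul1r (le_trans (base H cH))// lerDr; lra.
 have Sj : 0 <= eta / 2 + (1 - q1) ^+ j * S0.
 by rewrite addr_ge0 ?mulr_ge0 ?exprn_ge0//; lra.
 have := rn_contraction Sj (HK k Kk) IH cH; move=> /le_trans; apply.
 rewrite mulrC mulKf ?gt_eqF// exprS; apply: eq_imp_le; ring.
apply/ler_addgt0Pr => d d0; have d2 : 0 < d / (S0 + 1) by rewrite divr_gt0//; lra.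
have /cvgrPdist_lt/(_ _ d2)[J _ HJ] : (1 - q1) ^+ j @[j --> \oo] --> (0 : R).
 by apply: cvg_expr; rewrite ger0_norm.
have := HJ J (leqnn J); rewrite /= sub0r normrN ger0_norm ?exprn_ge0// => HJ'.
apply: (le_trans (iter J F cF)); apply: lerD; first lra.
have S1 : 0 < S0 + 1 by lra.
apply: (@le_trans _ _ ((1 - q1) ^+ J * (S0 + 1))).
 by rewrite ler_wpM2l ?exprn_ge0//; lra.
by rewrite -ler_pdivlMr// ltW.
Qed.

End rn_limit.

(** * The renewal kernel as a real function *)

Section renewal_kernel.
Context {R : realType} (s c : R) (s01 : 0 < s < 1) (c0 : 0 < c).
Local Notation mu := (@lebesgue_measure R).
Local Notation jdens := (jdens s).
Local Notation ek k := ((1 / 2 : R) ^+ k).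

(** The density becomes real-valued at the price of a null set. The last clause is the equation (1 +
    c D) rho = unit mass at 0 in weak form, with D approached by truncation, uniformly over each
    [tclass]. *)
Lemma renewal_kernel : exists rho : R -> R,
 [/\ mfun rho, forall t, 0 <= rho t, forall t, t <= 0 -> rho t = 0,
 (\int[mu]_t (rho t)%:E <= 1)%E &
 exists2 C : R, 0 < C & forall T, 0 < T ->
 (\int[mu]_t (rho t * (if t < T then 1 else 0))%:E <= (C * T `^ s)%:E)%E] /\
 forall (M : R) (dlt : R -> R), 0 < M -> (forall e, 0 < e -> 0 < dlt e) ->
 forall eta, 0 < eta -> exists K, forall k, (K <= k)%N ->
 forall F, tclass M dlt F ->
 `|(1 + c * ((ek k) `^ (- s) / s)) * fine (\int[mu]_t (rho t * F t)%:E)%E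
 - c * fine (\int[mu]_x ((jdens (ek k) x)%:E * \int[mu]_t (rho t * F (t + x))%:E))%E
 - F 0| <= eta.
Proof.
have [m m0 mE] := rn_bump_mass s01.
have [q1 q10 q1E] := rn_init_mass s01 c0 m0.
pose rhoe := rn_density_e s c m.
have mrho : mfun rhoe := m_rn_density_e s01 c0 m0.
have rho0 : forall t, (0 <= rhoe t)%E := rn_density_e_ge0 s01 c0 m0.
have mass := rn_density_mass s01 c0 m0 mE q10 q1E.
pose rho t := fine (rhoe t).
have rp t : 0 <= rho t by rewrite fine_ge0.
have mr : mfun rho.
 exact: (mcomp (fine_measurable mTT) mrho).
have aefin : {ae mu, forall t, rhoe t \is a fin_num}.
 have irho : mu.-integrable setT rhoe.
 apply/integrableP; split; first exact: mrho.
 under eqint do rewrite gee0_abs//.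
 by rewrite (le_lt_trans mass)// ltry.
 by have := integrable_ae mTT irho; apply: filterS => t; apply.
have rE (f : R -> R) : mfun f -> (forall t, 0 <= f t) ->
 (\int[mu]_t (rho t * f t)%:E = \int[mu]_t (rhoe t * (f t)%:E))%E.
 move=> mf f0; apply: ge0_ae_eq_integral => //.
 - by apply/mEFinP; exact: mfunM.
 - by apply: emfunM => //; exact/mEFinP.
 - by move=> t _; rewrite lee_fin mulr_ge0.
 - by move=> t _; rewrite mule_ge0 ?lee_fin.
 - by apply: (@filterS _ _ (ae_filt mu) _ _ _ aefin) => t ft _; rewrite EFinM /rho fineK.
exists rho; split; last first.
 move=> M dlt M0 dlt0 eta eta0.
 have [K HK] := rn_error_small s01 c0 m0 mE q10 q1E M0 dlt0 eta0.
 exists K => k Kk F cF; have := HK k Kk F cF.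
 have [mF FM _] := cF.
 have F0 t : 0 <= F t by case/andP: (FM t).
 rewrite /rn_error /rn_potential -rE//.
 rewrite (_ : jump_potential s c m k F = (\int[mu]_x ((jdens (ek k) x)%:E *
 \int[mu]_t (rho t * F (t + x))%:E))%E)//.
 apply: eqint => x _; rewrite -/rhoe rE//.
 apply: (mcomp mF).
 by apply: mfunD; [exact: mid|exact: mcst].
split => //.
- by move=> t t0; rewrite /rho /rhoe rn_density_e_le0.
- have o0 (t : R) : 0 <= cst (1 : R) t by [].
 have := rE (cst 1) (mcst _) o0.
 have -> : (\int[mu]_t (rho t * cst 1 t)%:E = \int[mu]_t (rho t)%:E)%E.
 by apply: eqint => t _; rewrite mulr1.
 move=> ->; apply: le_trans mass; apply: eq_imp_le.
 by apply: eqint => t _; rewrite mule1.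
- exists ((c * m)^-1 / (s * q1)).
 by rewrite divr_gt0 ?invr_gt0 ?mulr_gt0//; case/andP: s01.
 move=> T T0; rewrite rE.
 + exact: (rn_density_cumulative s01 c0 m0 mE q10 q1E T0).
 + apply: mifT; [|exact: mcst|exact: mcst].
 by apply: mltr; [exact: mid|exact: mcst].
 + by move=> t; case: ifP.
Qed.

End renewal_kernel.

(** * Gaussian kernels *)

Section gaussian.
Context {R : realType} {n : nat} (n0 : (0 < n)%N).
Local Notation mu := (@rV_lebesgue R n).
Local Notation leb := (@lebesgue_measure R).
Implicit Types (t u : R) (x y z : 'rV[R]_n).

Definition gpeak t : R := (t * (pi * 2)) `^ (- (n%:R / 2)).

(** Gaussian density of variance t in each coordinate. The power of exponent -1 makes joint
    measurability in t and x immediate; for t > 0 it is the usual inverse, see [gaussE]. *)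
Definition gauss t x : R :=
 gpeak t * expR (- (enorm x ^+ 2 * (t * 2) `^ (-1))).

Let pi2 : 0 < (pi : R) * 2. Proof. by rewrite mulr_gt0// pi_gt0. Qed.

Lemma gpeak_gt0 t : 0 < t -> 0 < gpeak t.
Proof. by move=> t0; rewrite powR_gt0// mulr_gt0. Qed.

Lemma gauss_ge0 t x : 0 <= gauss t x.
Proof. by rewrite mulr_ge0 ?powR_ge0 ?expR_ge0. Qed.

Lemma gaussE t x : 0 < t -> gauss t x = gpeak t * expR (- (enorm x ^+ 2 / (t * 2))).
Proof. by move=> t0; rewrite /gauss powR_inv1// mulr_ge0// ltW. Qed.

Lemma gauss_le_peak t x : 0 < t -> gauss t x <= gpeak t.
Proof.
move=> t0; rewrite gaussE// ler_piMr ?(ltW (gpeak_gt0 t0))//.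
by rewrite -expR0 ler_expR oppr_le0 divr_ge0 ?sqr_ge0 ?mulr_ge0 ?(ltW t0).
Qed.

Lemma gaussN t x : gauss t (- x) = gauss t x.
Proof. by rewrite /gauss enormN. Qed.

Lemma gaussBC t x y : gauss t (x - y) = gauss t (y - x).
Proof. by rewrite -gaussN opprB. Qed.

Lemma m_gauss2 d (T : measurableType d) (f : T -> R) (g : T -> 'rV[R]_n) :
 mfun f -> mfun g ->
 mfun (fun w : T => gauss (f w) (g w)).
Proof.
move=> mf mg; apply: mfunM.
 apply: (@mcomp _ _ _ _ _ _ (fun x : R => x `^ (- (n%:R / 2)))); first exact: mpowR.
 by apply: mfunM => //; exact: mcst.
apply: (@mcomp _ _ _ _ _ _ expR); first exact: measurable_expR.
apply: mcomp; first exact: oppr_measurable.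
apply: mfunM.
 by apply: measurable_funX; apply: (mcomp (@measurable_enorm R n)).
apply: (@mcomp _ _ _ _ _ _ (fun x : R => x `^ (-1))); first exact: mpowR.
by apply: mfunM => //; exact: mcst.
Qed.

Lemma m_gauss t : mfun (gauss t).
Proof. by apply: m_gauss2 => //; exact: mcst. Qed.

Lemma integral_gauss t : 0 < t -> (\int[mu]_x (gauss t x)%:E = 1)%E.
Proof.
move=> t0; have st0 : 0 < Num.sqrt t by rewrite sqrtr_gt0.
have sq : Num.sqrt t ^+ 2 = t by rewrite sqr_sqrtr// ltW.
transitivity (\int[mu]_x (\prod_i normal_pdf 0 (Num.sqrt t) (x ord0 i))%:E)%E.
 apply: eqint => x _; congr EFin.
 rewrite (eq_bigr (fun i => normal_peak (Num.sqrt t) * expR (- (x ord0 i ^+ 2) / (t * 2)))); last first.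
 move=> i _; rewrite normal_pdfE ?gt_eqF//= /normal_fun subr0 sq.
 by rewrite -[t *+ 2]mulr_natr.
 rewrite big_split/= prodr_const card_ord -expR_sum gaussE//; congr (_ * expR _).
 rewrite /gpeak /normal_peak sq -mulrnAr -[pi *+ 2]mulr_natr.
 have tp : 0 <= t * (pi * 2) by rewrite mulr_ge0 ?ltW.
 rewrite exprVn -powR12_sqrt// -powR_mulrn ?powR_ge0// -powRrM powRN.
 by congr (_ `^ _)^-1; rewrite mulrC.
 by rewrite sqr_enorm -mulr_suml sumrN mulNr.
rewrite (integral_rV_prod (f := fun _ => normal_pdf 0 (Num.sqrt t))).
- by apply: big1 => i _; exact: integral_normal_pdf.
- by move=> i; exact: measurable_normal_pdf.
- by move=> i x; exact: normal_pdf_ge0.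
Qed.

Lemma integral_rV_shift (f : 'rV[R]_n -> \bar R) y : mfun f ->
 (forall x, 0 <= f x)%E -> (\int[mu]_x f (x + y)%R = \int[mu]_x f x)%E.
Proof.
move=> mf f0; rewrite (integral_rV_affine y (oner_neq0 R) mf f0) normr1 expr1n mul1e.
by apply: eqint => x _; rewrite scale1r.
Qed.

Lemma integral_rV_reflect (f : 'rV[R]_n -> \bar R) y : mfun f ->
 (forall x, 0 <= f x)%E -> (\int[mu]_x f (y - x)%R = \int[mu]_x f x)%E.
Proof.
have m1 : (-1 : R) != 0 by rewrite oppr_eq0 oner_eq0.
move=> mf f0; rewrite (integral_rV_affine y m1 mf f0) normrN1 expr1n mul1e.
by apply: eqint => x _; rewrite scaleN1r addrC.
Qed.

Lemma int_gauss_shift t y : 0 < t -> (\int[mu]_x (gauss t (x - y))%:E = 1)%E.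
Proof.
move=> t0; rewrite -(integral_gauss t0) -[RHS](@integral_rV_shift _ (- y))//.
- by apply/mEFinP; exact: m_gauss.
- by move=> x; rewrite lee_fin gauss_ge0.
Qed.

(** Completing the square in y; the semigroup law follows because the second factor on the right has
    integral 1 in y. *)
Lemma gauss_mul t u x y : 0 < t -> 0 < u ->
 gauss t (x - y) * gauss u y =
 gauss (t + u) x * gauss (t * u / (t + u)) (y - (u / (t + u)) *: x).
Proof.
move=> t0 u0; have tu0 : 0 < t + u by rewrite addr_gt0.
have r0 : 0 < t * u / (t + u) by rewrite divr_gt0// mulr_gt0.
rewrite !gaussE// mulrACA [RHS]mulrACA -!expRD.
congr (_ * expR _).
 have pos (r : R) : 0 < r -> 0 <= r * (pi * 2) by move=> r1; rewrite ltW// mulr_gt0.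
 rewrite /gpeak -(powRM _ (pos _ t0) (pos _ u0)) -(powRM _ (pos _ tu0) (pos _ r0)).
 by congr (_ `^ _); field; rewrite gt_eqF.
rewrite !sqr_enorm !mulr_suml -!sumrN -!big_split/=; apply: eq_bigr => i _.
by rewrite !mxE; field; rewrite !gt_eqF.
Qed.

Lemma gauss_semigroup t u x : 0 < t -> 0 < u ->
 (\int[mu]_y (gauss t (x - y) * gauss u y)%:E = (gauss (t + u) x)%:E)%E.
Proof.
move=> t0 u0; have tu0 : 0 < t + u by rewrite addr_gt0.
have r0 : 0 < t * u / (t + u) by rewrite divr_gt0// mulr_gt0.
under eqint do rewrite gauss_mul// EFinM.
rewrite intZlE ?gauss_ge0//; last 2 first.
- by move=> y _; rewrite lee_fin gauss_ge0.
- apply/mEFinP; apply: m_gauss2; first exact: mcst.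
 rewrite (_ : (fun z => _) = fun z => 1 *: z + - ((u / (t + u)) *: x)).
 exact: m_rV_affine.
 by apply/funext => z; rewrite scale1r.
by rewrite int_gauss_shift// mule1.
Qed.

Lemma gauss_scale t x (a : R) : 0 < t -> 0 < a ->
 gauss (a ^+ 2 * t) (a *: x) = a ^- n * gauss t x.
Proof.
move=> t0 a0; have a2 : 0 < a ^+ 2 by rewrite exprn_gt0.
have at0 : 0 < a ^+ 2 * t by rewrite mulr_gt0.
rewrite !gaussE// mulrA; congr (_ * expR _).
 rewrite /gpeak -mulrA powRM ?(ltW a2)//; last by rewrite mulr_ge0 ?ltW.
 rewrite -(powR_mulrn 2 (ltW a0)) -powRrM mulrN [2%:R * _]mulrC divfK// powRN.
 by rewrite powR_mulrn ?ltW.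
rewrite enormZ exprMn real_normK ?num_real//; field.
by rewrite !gt_eqF.
Qed.

Let exp_lin (a : R) : 0 <= a -> (a + 1) * expR (- (a ^+ 2 / 2)) <= 2 * expR (- (a ^+ 2 / 4)).
Proof.
move=> a0; have -> : expR (- (a ^+ 2 / 2)) = expR (- (a ^+ 2 / 4)) * expR (- (a ^+ 2 / 4)).
 by rewrite -expRD; congr expR; field.
rewrite mulrA ler_wpM2r ?expR_ge0// expRN ldivMr ?expR_gt0//.
have := expR_ge1Dx (a ^+ 2 / 4); have := sqr_ge0 (a - 1); rewrite sqrrB1; lra.
Qed.

(** For |a - b| <= 1 the bound e^x >= 1 + x is applied to the quotient of the exponentials; for
    larger distances the triangle bound suffices. The linear factor a + 1 is absorbed by widening
    the Gaussian. *)
Lemma exp_sqr_lip (a b : R) : 0 <= a -> 0 <= b ->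
 `|expR (- (a ^+ 2 / 2)) - expR (- (b ^+ 2 / 2))| <=
 2 * `|a - b| * (expR (- (a ^+ 2 / 4)) + expR (- (b ^+ 2 / 4))).
Proof.
wlog ab : a b / a <= b.
 move=> W a0 b0; have [ab|ba] := leP a b; first exact: W.
 by rewrite distrC (distrC a) (addrC (expR (- (a ^+ 2 / 4)))); apply: W => //; exact: ltW.
move=> a0 b0; have e0 (r : R) : 0 < expR r := expR_gt0 r.
set d := b - a; have d0 : 0 <= d by rewrite subr_ge0.
have -> : `|a - b| = d by rewrite distrC ger0_norm.
have mon : expR (- (b ^+ 2 / 2)) <= expR (- (a ^+ 2 / 2)).
 by rewrite ler_expR lerN2 ler_wpM2r// ler_sqr ?nnegrE.
rewrite ger0_norm ?subr_ge0//.
apply: (@le_trans _ _ (d * ((a + 1) * expR (- (a ^+ 2 / 2))))); last first.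
 rewrite -[leRHS]mulrA [leRHS]mulrCA ler_wpM2l//; apply: (le_trans (exp_lin a0)).
 rewrite mulrDr lerDl; have := e0 (- (b ^+ 2 / 4)); lra.
have [d1|d1] := leP d 1; last first.
 have := e0 (- (b ^+ 2 / 2)); have := e0 (- (a ^+ 2 / 2)) => h1 h2.
 have : 1 * expR (- (a ^+ 2 / 2)) <= d * (a + 1) * expR (- (a ^+ 2 / 2)).
 rewrite ler_wpM2r ?expR_ge0//; nra.
 rewrite mulrA; lra.
have -> : expR (- (b ^+ 2 / 2)) = expR (- (a ^+ 2 / 2)) * expR (- ((b ^+ 2 - a ^+ 2) / 2)).
 by rewrite -expRD; congr expR; field.
have := expR_ge1Dx (- ((b ^+ 2 - a ^+ 2) / 2)) => h.
have h2 : (b ^+ 2 - a ^+ 2) / 2 <= d * (a + 1).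
 have -> : b = a + d by rewrite /d; ring.
 rewrite sqrrD; nra.
rewrite -{1}[expR (- (a ^+ 2 / 2))]mulr1 -mulrBr mulrA mulrC ler_wpM2r ?(ltW (e0 _))//; lra.
Qed.

(** The ratio of the peaks turns the widened exponential exp(-|x|^2/4) into [gauss 2]. *)
Definition gauss_lip : R := 2 * (gpeak 1 / gpeak 2).

Lemma gauss_lip_gt0 : 0 < gauss_lip.
Proof. by rewrite mulr_gt0// divr_gt0// gpeak_gt0. Qed.

Lemma gauss1_lip x y :
 `|gauss 1 x - gauss 1 y| <= gauss_lip * enorm (x - y) * (gauss 2 x + gauss 2 y).
Proof.
rewrite !gaussE// !mul1r -mulrBr normrM gtr0_norm ?gpeak_gt0//.
rewrite (_ : 2 * 2 = 4 :> R); last by rewrite -natrM.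
apply: (le_trans (ler_wpM2l (ltW (gpeak_gt0 ltr01)) (exp_sqr_lip (enorm_ge0 x) (enorm_ge0 y)))).
have d := ler_dist_enorm x y.
set ex := expR _; set ey := expR _.
have e0 : 0 <= ex + ey by rewrite addr_ge0// expR_ge0.
have p2 : 0 < gpeak 2 by rewrite gpeak_gt0.
have -> : gauss_lip * enorm (x - y) * (gpeak 2 * ex + gpeak 2 * ey) =
 gpeak 1 * (2 * enorm (x - y) * (ex + ey)).
 by rewrite /gauss_lip; field; rewrite gt_eqF.
apply: ler_wpM2l; first exact/ltW/gpeak_gt0.
by apply: ler_wpM2r => //; apply: ler_wpM2l.
Qed.

Lemma gauss_root (a t : R) x : 0 < a -> 0 < t ->
 gauss (a * t) x = (Num.sqrt t) ^- n * gauss a ((Num.sqrt t)^-1 *: x).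
Proof.
move=> a0 t0; have s0 : 0 < Num.sqrt t by rewrite sqrtr_gt0.
have sq : Num.sqrt t ^+ 2 = t by rewrite sqr_sqrtr// ltW.
have := gauss_scale ((Num.sqrt t)^-1 *: x) a0 s0.
by rewrite sq scalerA mulfV ?gt_eqF// scale1r mulrC.
Qed.

Lemma gauss_lipschitz t x y : 0 < t ->
 `|gauss t x - gauss t y| <=
 gauss_lip * (enorm (x - y) / Num.sqrt t) * (gauss (2 * t) x + gauss (2 * t) y).
Proof.
move=> t0; have s0 : 0 < Num.sqrt t by rewrite sqrtr_gt0.
have si : 0 < (Num.sqrt t)^-1 by rewrite invr_gt0.
have two0 : 0 < 2 :> R by [].
have E1 w : gauss t w = (Num.sqrt t) ^- n * gauss 1 ((Num.sqrt t)^-1 *: w).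
 by rewrite -[in LHS](mul1r t) gauss_root.
have E2 w := gauss_root w two0 t0.
rewrite !E1 !E2 -mulrBr -mulrDr normrM ger0_norm ?invr_ge0 ?exprn_ge0 ?(ltW s0)//.
have := gauss1_lip ((Num.sqrt t)^-1 *: x) ((Num.sqrt t)^-1 *: y).
rewrite -(scalerBr _ x y) enormZ (ger0_norm (ltW si)) => H.
rewrite mulrCA ler_wpM2l ?invr_ge0 ?exprn_ge0 ?(ltW s0)//.
by rewrite (mulrC (enorm (x - y))).
Qed.

Lemma gauss1_enorm x : enorm x * gauss 1 x <= gauss_lip * gauss 2 x.
Proof.
rewrite !gaussE// !mul1r (_ : 2 * 2 = 4 :> R); last by rewrite -natrM.
have p1 : 0 < gpeak 1 by rewrite gpeak_gt0.
have p2 : 0 < gpeak 2 by rewrite gpeak_gt0.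
have -> : gauss_lip * (gpeak 2 * expR (- (enorm x ^+ 2 / 4))) =
 gpeak 1 * (2 * expR (- (enorm x ^+ 2 / 4))).
 by rewrite /gauss_lip; field; rewrite gt_eqF.
rewrite mulrCA ler_wpM2l ?(ltW p1)//; apply: le_trans (exp_lin (enorm_ge0 x)).
by rewrite ler_wpM2r ?expR_ge0// lerDl.
Qed.

Lemma gauss_enorm t x : 0 < t -> enorm x * gauss t x <= gauss_lip * Num.sqrt t * gauss (2 * t) x.
Proof.
move=> t0; have s0 : 0 < Num.sqrt t by rewrite sqrtr_gt0.
have si : 0 < (Num.sqrt t)^-1 by rewrite invr_gt0.
have two0 : 0 < 2 :> R by [].
have E1 w : gauss t w = (Num.sqrt t) ^- n * gauss 1 ((Num.sqrt t)^-1 *: w).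
 by rewrite -[in LHS](mul1r t) gauss_root.
have E2 w := gauss_root w two0 t0.
rewrite E1 E2; set w := _ *: x.
have -> : enorm x = Num.sqrt t * enorm w.
 by rewrite /w enormZ (ger0_norm (ltW si)) mulrA mulfV ?gt_eqF// mul1r.
have P : 0 < (Num.sqrt t) ^- n by rewrite invr_gt0 exprn_gt0.
have := gauss1_enorm w => H.
have -> : Num.sqrt t * enorm w * (Num.sqrt t ^- n * gauss 1 w) =
 Num.sqrt t * Num.sqrt t ^- n * (enorm w * gauss 1 w) by ring.
have -> : gauss_lip * Num.sqrt t * (Num.sqrt t ^- n * gauss 2 w) =
 Num.sqrt t * Num.sqrt t ^- n * (gauss_lip * gauss 2 w) by ring.
by rewrite ler_wpM2l// mulr_ge0 ?(ltW s0) ?(ltW P).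
Qed.

End gaussian.

(** * The Riesz kernel as a mixture of Gaussians *)

Section gauss_mixture.
Context {R : realType} {n : nat} (n0 : (0 < n)%N).
Local Notation mu := (@rV_lebesgue R n).
Local Notation leb := (@lebesgue_measure R).
Implicit Types (t u : R) (x y z : 'rV[R]_n).

Let pi2 : 0 < (pi : R) * 2. Proof. by rewrite mulr_gt0// pi_gt0. Qed.

Lemma gauss_peak_le t u : 0 < t -> t <= u -> gpeak (n := n) u <= gpeak (n := n) t.
Proof.
move=> t0 tu; have u0 : 0 < u := lt_le_trans t0 tu.
have t2 : 0 < t * (pi * 2) by exact: mulr_gt0.
have u2 : 0 < u * (pi * 2) by exact: mulr_gt0.
rewrite /gpeak !powRN lef_pV2 ?posrE ?powR_gt0//.
apply: ge0_ler_powR; rewrite ?nnegrE ?(ltW t2) ?(ltW u2)//.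
by rewrite ler_pM2r.
Qed.

(** The substitution v = |z|^2 r extracts the power of |z|; only the finiteness and positivity of
    the remaining constant call for estimates. *)
Lemma gauss_mixture (s : R) : 0 < s < 1 -> exists2 k : R, 0 < k &
 forall z, z != 0 -> (\int[leb]_v (jdens s 0 v * gauss v z)%:E =
 (k * enorm z `^ (- n%:R - 2 * s))%:E)%E.
Proof.
move=> /andP[s0 s1].
pose w (r : R) : R := jdens s 0 r * (gpeak (n := n) r * expR (- (r * 2) `^ (-1))).
have w0 r : 0 <= w r by rewrite !mulr_ge0 ?jump_ge0 ?powR_ge0 ?expR_ge0.
have mw : mfun w.
 apply: mfunM; first exact: m_jump.
 apply: mfunM.
 apply: (@mcomp _ _ _ _ _ _ (fun x : R => x `^ (- (n%:R / 2)))); first exact: mpowR.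
 by apply: mfunM; [exact: mid|exact: mcst].
 apply: (@mcomp _ _ _ _ _ _ expR); first exact: measurable_expR.
 apply: mcomp; first exact: oppr_measurable.
 apply: (@mcomp _ _ _ _ _ _ (fun x : R => x `^ (-1))); first exact: mpowR.
 by apply: mfunM; [exact: mid|exact: mcst].
(* n + 2 exceeds 1 + s + n/2, so r^N, gained from the exponential, compensates the singular powers
   at 0. *)
pose N := n.+2; pose C : R := (pi * 2) `^ (- (n%:R / 2)) * (2 * N%:R) ^+ N.
have C0 : 0 <= C by rewrite mulr_ge0 ?powR_ge0// exprn_ge0// mulr_ge0.
have wsmall r : 0 < r -> r <= 1 -> w r <= C.
 move=> r0 r1; have r2 : 0 <= r * 2 by rewrite mulr_ge0 ?(ltW r0).
 rewrite /w (powR_inv1 r2) /jdens r0 /gpeak (mulrC r) (powRM _ (ltW pi2) (ltW r0)).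
 have N0 : 0 < N%:R :> R by rewrite ltr0n.
 have e1 : expR (- (r * 2)^-1) <= (2 * N%:R) ^+ N * r ^+ N.
 have e2 : ((r * 2)^-1 / N%:R) ^+ N <= expR ((r * 2)^-1).
 have -> : expR ((r * 2)^-1) = expR ((r * 2)^-1 / N%:R) ^+ N.
 by rewrite -expRM_natr divfK// gt_eqF.
 have q0 : 0 <= (r * 2)^-1 / N%:R by rewrite !divr_ge0 ?invr_ge0 ?mulr_ge0 ?(ltW r0).
 rewrite ler_pXn2r ?nnegrE ?expR_ge0//.
 by apply: le_trans (expR_ge1Dx _); rewrite lerDr.
 rewrite expRN -exprMn -[leRHS]invrK lef_pV2 ?posrE ?expR_gt0//; last first.
 by rewrite invr_gt0 exprn_gt0// !mulr_gt0.
 apply: le_trans e2; rewrite -exprVn; apply: eq_imp_le; congr (_ ^+ _).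
 by field; rewrite !gt_eqF.
 have p0 : 0 <= (pi * 2 : R) `^ (- (n%:R / 2)) by exact: powR_ge0.
 have rr : r `^ (- 1 - s) * r `^ (- (n%:R / 2)) * r ^+ N <= 1.
 rewrite -(powR_mulrn N (ltW r0)) -!powRDp//; apply: powR_le1; [exact: ltW|exact: r1|].
 rewrite /N -[n.+2]addn2 natrD; have : 0 <= n%:R :> R by []. lra.
 apply: (@le_trans _ _ (r `^ (- 1 - s) * ((pi * 2) `^ (- (n%:R / 2)) * r `^ (- (n%:R / 2)) *
 ((2 * N%:R) ^+ N * r ^+ N)))).
 by rewrite ler_wpM2l ?powR_ge0// ler_wpM2l ?mulr_ge0 ?powR_ge0.
 rewrite /C; set a := r `^ (- 1 - s) in rr *; set a' := r `^ _ in rr *.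
 set c := (2 * N%:R) ^+ N; have c0 : 0 <= c by rewrite exprn_ge0// mulr_ge0.
 have -> : a * ((pi * 2) `^ (- (n%:R / 2)) * a' * (c * r ^+ N)) =
 (pi * 2) `^ (- (n%:R / 2)) * c * (a * a' * r ^+ N) by ring.
 by rewrite ler_piMr// mulr_ge0.
have wlarge r : 1 < r -> w r <= gpeak (n := n) 1 * jdens s 1 r.
 move=> r1; have r0 : 0 < r by lra.
 rewrite /w /jdens r0 r1 mulrC ler_wpM2r ?powR_ge0//.
 apply: (@le_trans _ _ (gpeak (n := n) r)); last by apply: gauss_peak_le => //; exact: ltW.
 by rewrite ler_piMr ?powR_ge0// -expR0 ler_expR oppr_le0 powR_ge0.
have mI : measurable (`]0%R, 1%R] : set R) by exact: mitv.
have Ifin : (\int[leb]_r (w r)%:E <= (C + gpeak (n := n) 1 * s^-1)%:E)%E.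
 have j1 : (\int[leb]_r (jdens s 1 r)%:E = (s^-1)%:E)%E.
 by rewrite (@jump_mass R s)// ?powR1 ?div1r// s0.
 have p1 : 0 <= gpeak (n := n) (1 : R) by exact: powR_ge0.
 rewrite EFinD (EFinM (gpeak 1) s^-1) -j1 -intZlE//; last 2 first.
 - by move=> r _; rewrite lee_fin jump_ge0.
 - by apply/mEFinP; exact: m_jump.
 have -> : C%:E = (\int[leb]_r (C * \1_(`]0%R, 1%R]) r)%:E)%E.
 under eqint do rewrite EFinM.
 rewrite intZlE//.
 rewrite integral_indic// setIT.
 have l1 : (leb `]0%R, 1%R] = 1)%E by rewrite leb_itvE/= lte_fin ltr01 -EFinB subr0.
 by rewrite -[LHS]mule1 -l1.
 by apply/mEFinP; exact: mindic.
 rewrite -intD//; last 4 first.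
 - by move=> r _; rewrite lee_fin mulr_ge0.
 - by apply/mEFinP; apply: mfunM; [exact: mcst|exact: mindic].
 - by move=> r _; rewrite mule_ge0 ?lee_fin ?jump_ge0.
 - apply: emfunM; first exact: mcst.
 by apply/mEFinP; exact: m_jump.
 apply: le_int => //.
 - by move=> r _; rewrite lee_fin.
 - exact/mEFinP.
 - apply: emfunD.
 by apply/mEFinP; apply: mfunM; [exact: mcst|exact: mindic].
 apply: emfunM; first exact: mcst.
 by apply/mEFinP; exact: m_jump.
 - move=> r _; rewrite -EFinM -EFinD lee_fin indicE mem_setE in_itv/=.
 have [r0|r0] := ltP 0 r; last first.
 by rewrite /w /jdens (ltNge 0) r0/= mul0r mulr0 add0r mulr_ge0// jump_ge0.
 have [r1|r1] := leP r 1.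
 rewrite mulr1 (le_trans (wsmall r r0 r1))// lerDl mulr_ge0// jump_ge0.
 by [].
 by rewrite mulr0 add0r wlarge.
have [k kE /andP[k0 _]] := ge0_le_EFinP (int_ge0 leb (fun r _ => w0 r : (0 <= (w r)%:E)%E)) Ifin.
have kp : 0 < k.
 pose c := (2 : R) `^ (- 1 - s) * (gpeak (n := n) 2 * expR (- 1)).
 have c0 : 0 < c by apply: mulr_gt0; [exact: powR_gt0|apply: mulr_gt0; [exact: gpeak_gt0|exact: expR_gt0]].
 have mJ : measurable (`]1%R, 2%R] : set R) by exact: mitv.
 rewrite -lte_fin -kE; apply: (@lt_le_trans _ _ c%:E); first by rewrite lte_fin.
 have -> : c%:E = (\int[leb]_(r in `]1%R, 2%R]) (cst c%:E r))%E.
 have l1 : (leb `]1%R, 2%R] = 1)%E.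
 by rewrite leb_itvE/= lte_fin ltr1n/= -EFinB; congr EFin; lra.
 by rewrite integral_cst// -[LHS]mule1 -l1.
 apply: (@le_trans _ _ (\int[leb]_(r in `]1%R, 2%R]) (w r)%:E)%E); last first.
 apply: sub_int => //; first exact/mEFinP.
 by move=> r _; rewrite lee_fin.
 apply: le_int; first exact: mJ.
 - by move=> r _; rewrite lee_fin ltW.
 - exact: mcst.
 - by apply/mEFinP; exact: mfunTS.
 - move=> r; rewrite /= in_itv/= => /andP[r1 r2]; have r0 : 0 < r by lra.
 rewrite lee_fin /w /jdens r0 /c; apply: ler_pM.
 + exact: powR_ge0.
 + by rewrite mulr_ge0 ?powR_ge0 ?expR_ge0.
 + rewrite (_ : - 1 - s = - (1 + s)); last by ring.
 rewrite !powRN lef_pV2 ?posrE ?powR_gt0//.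
 apply: ge0_ler_powR; rewrite ?nnegrE ?(ltW r0)//; lra.
 + apply: ler_pM; rewrite ?powR_ge0 ?expR_ge0//; first exact: gauss_peak_le.
 rewrite ler_expR lerN2 powR_inv1 ?mulr_ge0 ?(ltW r0)// invf_le1 ?mulr_gt0//; lra.
exists k => // z z0; have e0 : 0 < enorm z := enorm_gt0 z0.
pose a := enorm z ^+ 2; have a0 : 0 < a by rewrite exprn_gt0.
pose f (v : R) := (jdens s 0 v * gauss v z)%:E.
have f0 v : (0 <= f v)%E by rewrite lee_fin mulr_ge0 ?jump_ge0 ?gauss_ge0.
have mf : mfun f.
 apply/mEFinP; apply: mfunM; first exact: m_jump.
 by apply: m_gauss2; [exact: mid|exact: mcst].
rewrite (integral_affine 0 (negbT (gt_eqF a0)) mf f0).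
have fa0 (r : R) : setT r -> (0 <= f (a * r + 0)%R)%E by [].
have mfa : mfun (fun r => f (a * r + 0)).
 apply: (mcomp mf); apply: mfunD; last exact: mcst.
 by apply: mfunM; [exact: mcst|exact: mid].
have we0 (r : R) : setT r -> (0 <= (w r)%:E)%E by rewrite lee_fin.
have mwe : mfun (fun r => (w r)%:E) by exact/mEFinP.
have a0' : (0 <= `|a|%:E)%E by rewrite lee_fin.
have e0' : (0 <= (enorm z `^ (- n%:R - 2 * s))%:E)%E by rewrite lee_fin powR_ge0.
rewrite mulrC EFinM -kE -(@intZl _ _ _ leb _ mTT _ mfa _ fa0 a0').
rewrite -(@intZl _ _ _ leb _ mTT _ mwe _ we0 e0').
apply: eqint => r _; rewrite -!EFinM; congr EFin; rewrite addr0 ger0_norm ?(ltW a0)//.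
rewrite /w /jdens pmulr_rgt0//; case: ifP => r0; last by rewrite !mul0r !mulr0.
have ar0 : 0 < a * r by rewrite mulr_gt0.
have r2 : 0 <= r * 2 by rewrite mulr_ge0 ?(ltW r0).
have rp2 : 0 <= r * (pi * 2) by rewrite ltW// mulr_gt0.
rewrite gaussE// (powR_inv1 r2) /gpeak -(mulrA a) (powRM _ (ltW a0) (ltW r0)) (powRM _ (ltW a0) rp2).
have -> : enorm z ^+ 2 / (a * r * 2) = (r * 2)^-1 by rewrite /a; field; rewrite !gt_eqF.
have aE q : a `^ q = enorm z `^ (2 * q) by rewrite /a -(powR_mulrn 2 (ltW e0)) -powRrM.
have -> : enorm z `^ (- n%:R - 2 * s) = a * a `^ (- 1 - s) * a `^ (- (n%:R / 2)).
 rewrite -{1}(powRr1 (ltW a0)) !aE -!powRDp//; congr (_ `^ _); by field.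
set p1 := a `^ (- 1 - s); set p2 := a `^ _; set p3 := r `^ _; set p4 := _ `^ _; set p5 := expR _.
by ring.
Qed.

End gauss_mixture.

(** * Sup and L^1 bounds for D^s of a Gaussian *)

Section pair_lebesgue.
Context {R : realType} (n : nat).

(** The product measure under its own name, so that it carries the sigma-finite structure required
    by Tonelli's theorem with a third variable. *)
Definition pair_lebesgue : set ('rV[R]_n * 'rV[R]_n) -> \bar R :=
 (@rV_lebesgue R n \x @rV_lebesgue R n)%E.

HB.instance Definition _ := Measure.copy pair_lebesgue
 (@rV_lebesgue R n \x @rV_lebesgue R n)%E.

HB.instance Definition _ := Measure_isSigmaFinite.Build _ _ _ pair_lebesgue
 (product_sigma_finite (@rV_lebesgue R n) (@rV_lebesgue R n)).

Lemma int_pair f :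
 (\int[pair_lebesgue]_z f z = \int[@rV_lebesgue R n \x @rV_lebesgue R n]_z f z)%E.
Proof. by []. Qed.

End pair_lebesgue.

Section gauss_nu.
Context {R : realType} {n : nat}.
Local Notation mu := (@rV_lebesgue R n).
Local Notation leb := (@lebesgue_measure R).
Local Notation gl := (@gauss_lip R n).
Local Notation rV2 := ('rV[R]_n * 'rV[R]_n)%type.
Implicit Types (t u : R) (z : rV2).

Lemma m_rVB d (T : measurableType d) (f g : T -> 'rV[R]_n) :
 mfun f -> mfun g -> mfun (fun w => f w - g w).
Proof.
move=> mf mg; apply: measurable_fun_rVP => i.
rewrite (_ : _ \o _ = fun w => (@rV_coord R n i (f w) : R) - (@rV_coord R n i (g w) : R)); last first.
 by apply/funext => w; rewrite /= /rV_coord !mxE.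
by apply: mfunB; apply: (@mcomp _ _ _ _ _ _ (@rV_coord R n i)) => //; exact: measurable_rV_coord.
Qed.

Lemma integral_gauss_shiftr t x : 0 < t -> (\int[mu]_y (gauss t (x - y))%:E = 1)%E.
Proof.
move=> t0; rewrite -(int_gauss_shift x t0).
by apply: eqint => y _; rewrite gaussBC.
Qed.

Lemma m_gauss_diff t : mfun (fun z => gauss t (z.1 - z.2)).
Proof.
apply: m_gauss2; first exact: mcst.
by apply: m_rVB; [exact: mfst|exact: msnd].
Qed.

Lemma integral_gauss_pair1 t (f : 'rV[R]_n -> R) : 0 < t -> mfun f ->
 (forall x, 0 <= f x) ->
 (\int[mu \x mu]_z (f z.1 * gauss t (z.1 - z.2))%:E = \int[mu]_x (f x)%:E)%E.
Proof.
move=> t0 mf f0.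
have mg : mfun (fun z => (f z.1 * gauss t (z.1 - z.2))%:E).
 apply/mEFinP; apply: mfunM; last exact: m_gauss_diff.
 exact: (mcomp mf mfst).
have g0 z : (0 <= (f z.1 * gauss t (z.1 - z.2))%:E)%E by rewrite lee_fin mulr_ge0 ?gauss_ge0.
rewrite (fubini_tonelli1 _ mg g0); apply: eqint => x _; rewrite /fubini_F /=.
under eqint do rewrite EFinM.
have mh : mfun (fun y : 'rV[R]_n => (gauss t (x - y))%:E).
 apply/mEFinP; apply: m_gauss2; first exact: mcst.
 by apply: m_rVB; [exact: mcst|exact: mid].
have h0 y : setT y -> (0 <= (gauss t (x - y))%:E)%E by rewrite lee_fin gauss_ge0.
have fx0 : (0 <= (f x)%:E)%E by rewrite lee_fin.
by rewrite (@intZl _ _ _ mu _ mTT _ mh _ h0 fx0) integral_gauss_shiftr// mule1.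
Qed.

Lemma integral_gauss_pair2 t (f : 'rV[R]_n -> R) : 0 < t -> mfun f ->
 (forall x, 0 <= f x) ->
 (\int[mu \x mu]_z (f z.2 * gauss t (z.1 - z.2))%:E = \int[mu]_x (f x)%:E)%E.
Proof.
move=> t0 mf f0.
have mg : mfun (fun z => (f z.2 * gauss t (z.1 - z.2))%:E).
 apply/mEFinP; apply: mfunM; last exact: m_gauss_diff.
 exact: (mcomp mf msnd).
have g0 z : (0 <= (f z.2 * gauss t (z.1 - z.2))%:E)%E by rewrite lee_fin mulr_ge0 ?gauss_ge0.
rewrite (fubini_tonelli2 _ mg g0); apply: eqint => x _; rewrite /fubini_G /=.
under eqint do rewrite EFinM.
have mh : mfun (fun y : 'rV[R]_n => (gauss t (y - x))%:E).
 apply/mEFinP; apply: m_gauss2; first exact: mcst.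
 by apply: m_rVB; [exact: mid|exact: mcst].
have h0 y : setT y -> (0 <= (gauss t (y - x))%:E)%E by rewrite lee_fin gauss_ge0.
have fx0 : (0 <= (f x)%:E)%E by rewrite lee_fin.
by rewrite (@intZl _ _ _ mu _ mTT _ mh _ h0 fx0) int_gauss_shift// mule1.
Qed.

Definition gauss_diff t (x0 : 'rV[R]_n) z : R := `|gauss t (z.1 - x0) - gauss t (z.2 - x0)|.

Lemma m_gauss_at t (x0 : 'rV[R]_n) : mfun (fun x : 'rV[R]_n => gauss t (x - x0)).
Proof.
apply: m_gauss2; first exact: mcst.
by apply: m_rVB; [exact: mid|exact: mcst].
Qed.

Lemma m_gauss_diff_at t x0 : mfun (gauss_diff t x0).
Proof.
apply: mcomp; first exact: mnormr.
by apply: mfunB; apply: (mcomp (m_gauss_at t x0));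
 [exact: mfst|exact: msnd].
Qed.

Let mpair t u x0 : mfun (fun z => (gauss_diff t x0 z * gauss u (z.1 - z.2))%:E).
Proof.
apply/mEFinP; apply: mfunM; last exact: m_gauss_diff.
exact: m_gauss_diff_at.
Qed.

Let pair0 t u x0 z : (0 <= (gauss_diff t x0 z * gauss u (z.1 - z.2))%:E)%E.
Proof. by rewrite lee_fin mulr_ge0 ?gauss_ge0 ?normr_ge0. Qed.

Lemma integral_gauss_pairD t u (x0 : 'rV[R]_n) : 0 < t -> 0 < u ->
 (\int[mu \x mu]_z ((gauss t (z.1 - x0) + gauss t (z.2 - x0)) * gauss u (z.1 - z.2))%:E = 2)%E.
Proof.
move=> t0 u0; under eqint do rewrite mulrDl EFinD.
have m1 : mfun (fun z => (gauss t (z.1 - x0) * gauss u (z.1 - z.2))%:E).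
 apply/mEFinP; apply: mfunM; last exact: m_gauss_diff.
 by apply: (mcomp (m_gauss_at t x0)); exact: mfst.
have m2 : mfun (fun z => (gauss t (z.2 - x0) * gauss u (z.1 - z.2))%:E).
 apply/mEFinP; apply: mfunM; last exact: m_gauss_diff.
 by apply: (mcomp (m_gauss_at t x0)); exact: msnd.
have p1 z : setT z -> (0 <= (gauss t (z.1 - x0) * gauss u (z.1 - z.2))%:E)%E by rewrite lee_fin mulr_ge0 ?gauss_ge0.
have p2 z : setT z -> (0 <= (gauss t (z.2 - x0) * gauss u (z.1 - z.2))%:E)%E by rewrite lee_fin mulr_ge0 ?gauss_ge0.
have g0 x : 0 <= gauss t (x - x0) by exact: gauss_ge0.
rewrite (@intD _ _ _ (mu \x mu)%E _ mTT _ _ p1 m1 p2 m2).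
rewrite (integral_gauss_pair1 u0 (m_gauss_at t x0) g0).
by rewrite (integral_gauss_pair2 u0 (m_gauss_at t x0) g0) int_gauss_shift.
Qed.

Lemma gauss_diff_pair_le2 t u x0 : 0 < t -> 0 < u ->
 (\int[mu \x mu]_z (gauss_diff t x0 z * gauss u (z.1 - z.2))%:E <= 2)%E.
Proof.
move=> t0 u0; rewrite -(integral_gauss_pairD x0 t0 u0); apply: le_int => //.
- apply/mEFinP; apply: mfunM; last exact: m_gauss_diff.
 by apply: mfunD; apply: (mcomp (m_gauss_at t x0));
 [exact: mfst|exact: msnd].
- move=> z _; rewrite lee_fin ler_wpM2r ?gauss_ge0//.
 by rewrite (le_trans (ler_normB _ _))// !ger0_norm ?gauss_ge0.
Qed.

(** The Lipschitz bound for [gauss t] brings |x - y| / sqrt t, and the first moment of [gauss u]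
    turns |x - y| into sqrt u; each costs a doubling of time, and the final 2 is the mass of the
    resulting pair. *)
Lemma gauss_diff_pair_small t u x0 : 0 < t -> 0 < u ->
 (\int[mu \x mu]_z (gauss_diff t x0 z * gauss u (z.1 - z.2))%:E <=
 (gl ^+ 2 * (Num.sqrt u / Num.sqrt t) * 2)%:E)%E.
Proof.
move=> t0 u0; have st0 : 0 < Num.sqrt t by rewrite sqrtr_gt0.
have su0 : 0 < Num.sqrt u by rewrite sqrtr_gt0.
have gl0 := @gauss_lip_gt0 R n.
set K := _ ^+ 2 * _; have K0 : 0 <= K by rewrite mulr_ge0 ?divr_ge0 ?sqr_ge0 ?(ltW st0) ?(ltW su0).
have tt0 : 0 < 2 * t by rewrite mulr_gt0.
have uu0 : 0 < 2 * u by rewrite mulr_gt0.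
have m1 : mfun (fun z => ((gauss (2 * t) (z.1 - x0) + gauss (2 * t) (z.2 - x0)) * gauss (2 * u) (z.1 - z.2))%:E).
 apply/mEFinP; apply: mfunM; last exact: m_gauss_diff.
 by apply: mfunD; apply: (mcomp (m_gauss_at (2 * t) x0));
 [exact: mfst|exact: msnd].
have p1 z : setT z -> (0 <= ((gauss (2 * t) (z.1 - x0) + gauss (2 * t) (z.2 - x0)) * gauss (2 * u) (z.1 - z.2))%:E)%E.
 by rewrite lee_fin mulr_ge0 ?addr_ge0 ?gauss_ge0.
have K0' : (0 <= K%:E)%E by rewrite lee_fin.
rewrite EFinM -[X in (_ * X)%E](integral_gauss_pairD x0 tt0 uu0).
rewrite -(@intZl _ _ _ (mu \x mu)%E _ mTT _ m1 _ p1 K0').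
apply: le_int; [exact: mTT|by move=> z _; exact: pair0|exact: mpair|..].
- by apply: emfunM; [exact: mcst|exact: m1].
- move=> z _; rewrite -EFinM lee_fin.
 have := gauss_lipschitz (z.1 - x0) (z.2 - x0) t0; rewrite -/(gauss_diff t x0 z).
 have -> : z.1 - x0 - (z.2 - x0) = z.1 - z.2 by rewrite opprB addrA subrK.
 set S := gauss (2 * t) _ + _ => H.
 have S0 : 0 <= S by rewrite addr_ge0 ?gauss_ge0.
 apply: (le_trans (ler_wpM2r (gauss_ge0 _ _) H)).
 have G := gauss_enorm (z.1 - z.2) u0; set e := enorm _ in G *.
 have -> : gl * (e / Num.sqrt t) * S * gauss u (z.1 - z.2) =
 gl / Num.sqrt t * S * (e * gauss u (z.1 - z.2)) by ring.
 have -> : K * (S * gauss (2 * u) (z.1 - z.2)) = gl / Num.sqrt t * S *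
 (gl * Num.sqrt u * gauss (2 * u) (z.1 - z.2)) by rewrite /K; ring.
 by apply: ler_wpM2l => //; rewrite mulr_ge0// divr_ge0 ?(ltW st0) ?(ltW gl0).
Qed.

(** Up to distance sqrt t the Lipschitz bound applies, and d / sqrt t <= (d / sqrt t)^s; beyond it
    the two values are bounded separately by the peak. *)
Lemma gauss_Ds_sup (s t : R) x0 z : 0 < s < 1 -> 0 < t ->
 `|Ds s (fun x => gauss t (x - x0)) z| <=
 2 * (gl + 1) * gpeak (n := n) t * t `^ (- (s / 2)).
Proof.
move=> /andP[s0 s1] t0; rewrite /Ds normrM -/(gauss_diff t x0 z).
have st0 : 0 < Num.sqrt t by rewrite sqrtr_gt0.
have gl0 := @gauss_lip_gt0 R n; have p0 := gpeak_gt0 (n := n) t0.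
set d := enorm (z.1 - z.2); have d0 : 0 <= d := enorm_ge0 _.
have [->|dn0] := eqVneq d 0.
 by rewrite powR0 ?gt_eqF// invr0 normr0 mulr0 !mulr_ge0 ?powR_ge0 ?addr_ge0 ?(ltW gl0).
have dp : 0 < d by rewrite lt0r dn0.
have ts : t `^ (- (s / 2)) = (Num.sqrt t `^ s)^-1.
 by rewrite powRN -powR12_sqrt ?(ltW t0)// -powRrM mulrC.
rewrite (ger0_norm (_ : 0 <= (d `^ s)^-1)); last by rewrite invr_ge0 powR_ge0.
rewrite ldivMr ?powR_gt0// ts.
have pd : 0 < d `^ s by rewrite powR_gt0.
have ps : 0 < Num.sqrt t `^ s by rewrite powR_gt0.
have [dt|dt] := leP d (Num.sqrt t).
 have := gauss_lipschitz (z.1 - x0) (z.2 - x0) t0; rewrite -/(gauss_diff t x0 z).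
 have -> : z.1 - x0 - (z.2 - x0) = z.1 - z.2 by rewrite opprB addrA subrK.
 rewrite -/d => H; apply: (le_trans H).
 have tt0 : 0 < 2 * t by rewrite mulr_gt0.
 have pp : gpeak (n := n) (2 * t) <= gpeak (n := n) t by apply: gauss_peak_le => //; lra.
 have g1 := gauss_le_peak (z.1 - x0) tt0; have g2 := gauss_le_peak (z.2 - x0) tt0.
 apply: (@le_trans _ _ (gl * (d / Num.sqrt t) * (2 * gpeak (n := n) t))).
 by apply: ler_wpM2l; [rewrite mulr_ge0 ?divr_ge0 ?(ltW gl0) ?(ltW st0)|lra].
 have r1 : d / Num.sqrt t <= d `^ s / Num.sqrt t `^ s.
 have rE : d `^ s / Num.sqrt t `^ s = (d / Num.sqrt t) `^ s.
 by rewrite powRM ?invr_ge0 ?(ltW st0)// -[in RHS]powR_inv1 ?(ltW st0)// -!powRrM mulN1r powRN.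
 have q0 : 0 < d / Num.sqrt t by rewrite divr_gt0.
 have q1 : d / Num.sqrt t <= 1 by rewrite ldivMr// mul1r.
 rewrite rE -[leLHS](powRr1 (ltW q0)); have -> : 1 = s + (1 - s) by ring.
 by rewrite powRDp// ler_piMr ?powR_ge0//; apply: powR_le1; rewrite ?(ltW q0)//; lra.
 have -> : 2 * (gl + 1) * gpeak (n := n) t / Num.sqrt t `^ s * d `^ s =
 2 * gpeak (n := n) t * ((gl + 1) * (d `^ s / Num.sqrt t `^ s)) by ring.
 have -> : gl * (d / Num.sqrt t) * (2 * gpeak (n := n) t) =
 2 * gpeak (n := n) t * (gl * (d / Num.sqrt t)) by ring.
 apply: ler_wpM2l; first by rewrite mulr_ge0 ?(ltW p0).
 apply: ler_pM => //; [exact: ltW|by rewrite divr_ge0 ?(ltW st0)|by rewrite lerDl].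
have D2 : gauss_diff t x0 z <= 2 * gpeak (n := n) t.
 rewrite (le_trans (ler_normB _ _))// !ger0_norm ?gauss_ge0//.
 have := gauss_le_peak (z.1 - x0) t0; have := gauss_le_peak (z.2 - x0) t0; lra.
apply: (le_trans D2).
have r1 : 1 <= d `^ s / Num.sqrt t `^ s.
 by rewrite ler_pdivlMr// mul1r; apply: ge0_ler_powR; rewrite ?nnegrE ?(ltW s0) ?(ltW st0) ?(ltW dt).
have -> : 2 * (gl + 1) * gpeak (n := n) t / Num.sqrt t `^ s * d `^ s =
 2 * gpeak (n := n) t * ((gl + 1) * (d `^ s / Num.sqrt t `^ s)) by ring.
rewrite ler_peMr// ?mulr_ge0 ?(ltW p0)//.
have : 1 * 1 <= (gl + 1) * (d `^ s / Num.sqrt t `^ s).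
 by apply: ler_pM => //; rewrite lerDr ltW.
by rewrite mul1r.
Qed.

(** |x - y|^(-n-s) is a Gaussian mixture in u, by [gauss_mixture] for s/2. The L^1 norm is thereby
    reduced to the pair integrals above, split at u = t/2. *)
Lemma gauss_Ds_L1 (s : R) : 0 < s < 1 -> exists2 C : R, 0 < C & forall t (x0 : 'rV[R]_n), 0 < t ->
 (\int[nu n]_z `|Ds s (fun x => gauss t (x - x0)) z|%:E <= (C * t `^ (- (s / 2)))%:E)%E.
Proof.
move=> /andP[s0 s1]; have s2 : 0 < s / 2 < 1 by lra.
have s20 : 0 < s / 2 by lra.
have s3 : 0 < (1 - s) / 2 < 1 by lra.
have [k k0 kE] := gauss_mixture (n := n) s2.
have gl0 := @gauss_lip_gt0 R n.
pose C := k^-1 * (2 * ((1 / 2) `^ (- (s / 2)) / (s / 2)) + gl ^+ 2 * 2 / ((1 - s) / 2)).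
have C0 : 0 < C.
 apply: mulr_gt0; first by rewrite invr_gt0.
 apply: addr_gt0; first by rewrite mulr_gt0// divr_gt0// powR_gt0.
 by apply: divr_gt0; [rewrite mulr_gt0// exprn_gt0|case/andP: s3].
have ki0 : 0 <= k^-1 by rewrite invr_ge0 ltW.
exists C => // t x0 t0; pose J u := (\int[mu \x mu]_z (gauss_diff t x0 z * gauss u (z.1 - z.2))%:E)%E.
have mj e : mfun (jdens (s / 2) e) by exact: m_jump.
have j0 e u : 0 <= jdens (s / 2) e u by exact: jump_ge0.
pose f (w : rV2 * measurableTypeR R) : \bar R :=
 (k^-1 * (jdens (s / 2) 0 w.2 * (gauss_diff t x0 w.1 * gauss w.2 (w.1.1 - w.1.2))))%:E.
have f0 w : (0 <= f w)%E by rewrite lee_fin mulr_ge0// mulr_ge0// mulr_ge0 ?gauss_ge0// normr_ge0.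
have mf : mfun f.
 apply/mEFinP; apply: mfunM; first exact: mcst.
 apply: mfunM; first exact: (mcomp (mj 0) msnd).
 apply: mfunM.
 exact: (mcomp (m_gauss_diff_at t x0) mfst).
 apply: m_gauss2; first exact: msnd.
 by apply: m_rVB; [exact: (mcomp mfst mfst)|
 exact: (mcomp msnd mfst)].
have mD : mfun (fun z => (`|Ds s (fun x => gauss t (x - x0)) z|%:E : \bar R)).
 apply/mEFinP; apply: mcomp; first exact: mnormr.
 by apply: m_Ds; exact: m_gauss_at.
have D0 z : (0 <= `|Ds s (fun x => gauss t (x - x0)) z|%:E)%E by rewrite lee_fin.
rewrite (int_nu mD D0).
have -> : (\int[mu \x mu]_z (`|Ds s (fun x => gauss t (x - x0)) z|%:E * (nu_density z)%:E) =
 \int[mu \x mu]_z \int[leb]_u f (z, u))%E.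
 apply: eqint => z _; rewrite /f /=.
 have kd0 : (0 <= (k^-1 * gauss_diff t x0 z)%:E)%E by rewrite lee_fin mulr_ge0// normr_ge0.
 have mg : mfun (fun u => (jdens (s / 2) 0 u * gauss u (z.1 - z.2))%:E).
 apply/mEFinP; apply: mfunM; first exact: mj.
 by apply: m_gauss2; [exact: mid|exact: mcst].
 have g0 u : setT u -> (0 <= (jdens (s / 2) 0 u * gauss u (z.1 - z.2))%:E)%E.
 by rewrite lee_fin mulr_ge0 ?gauss_ge0.
 transitivity ((k^-1 * gauss_diff t x0 z)%:E * \int[leb]_u (jdens (s / 2) 0 u * gauss u (z.1 - z.2))%:E)%E.
 have [zz|zz] := eqVneq (z.1 - z.2) 0.
 have e : z.1 = z.2 by apply/eqP; rewrite -subr_eq0 zz.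
 by rewrite /gauss_diff /Ds e !subrr normr0 mul0r normr0 mul0e mulr0 mul0e.
 rewrite kE// -!EFinM; congr EFin; rewrite /Ds normrM -/(gauss_diff t x0 z) /nu_density.
 have e0 : 0 < enorm (z.1 - z.2) := enorm_gt0 zz.
 rewrite ger0_norm ?invr_ge0 ?powR_ge0// -powRN.
 have -> : - n%:R - 2 * (s / 2) = - s + - n%:R by field.
 by rewrite powRDp//; field; rewrite gt_eqF.
 rewrite -(@intZl _ _ _ leb _ mTT _ mg _ g0 kd0).
 by apply: eqint => u _; rewrite -EFinM; congr EFin; ring.
have -> : (\int[mu \x mu]_z \int[leb]_u f (z, u) = \int[leb]_u \int[mu \x mu]_z f (z, u))%E.
 have := @fubini_tonelli _ _ rV2 _ R (@pair_lebesgue R n) leb f mf f0.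
 rewrite int_pair => ->; apply: eqint => u _; exact: int_pair.
(* h1 covers u > t/2 with the trivial bound 2; h2 covers u <= t/2, where the factor sqrt u of the
   Lipschitz bound makes the integral converge at 0. *)
pose h1 (u : R) : R := k^-1 * 2 * jdens (s / 2) (t / 2) u.
pose h2 (u : R) : R := k^-1 * (gl ^+ 2 * 2 / Num.sqrt t) * (\1_(`]0%R, t[%classic : set R) u * u `^ ((1 - s) / 2 - 1)).
have st0 : 0 < Num.sqrt t by rewrite sqrtr_gt0.
have c20 : 0 <= k^-1 * (gl ^+ 2 * 2 / Num.sqrt t).
 by rewrite mulr_ge0 ?invr_ge0 ?(ltW k0)// divr_ge0 ?(ltW st0)// mulr_ge0 ?sqr_ge0.
have h10 u : setT u -> (0 <= (h1 u)%:E)%E by rewrite lee_fin !mulr_ge0 ?invr_ge0 ?(ltW k0).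
have h20 u : setT u -> (0 <= (h2 u)%:E)%E by move=> _; rewrite lee_fin; apply: mulr_ge0; [exact: c20|rewrite mulr_ge0 ?powR_ge0].
have mh1 : mfun (fun u => (h1 u)%:E).
 by apply/mEFinP; apply: mfunM; [exact: mcst|exact: mj].
have mit : measurable (`]0%R, t[%classic : set R) by exact: mitv.
have mp : mfun (fun u : R => u `^ ((1 - s) / 2 - 1)) by exact: mpowR.
have mi2 : mfun (fun u : R => (\1_(`]0%R, t[%classic : set R) u * u `^ ((1 - s) / 2 - 1))%:E).
 by apply/mEFinP; apply: mfunM; [exact: mindic|exact: mp].
have mh2 : mfun (fun u => (h2 u)%:E).
 by apply/mEFinP; apply: mfunM; [exact: mcst|exact/mEFinP].
have I1 : (\int[leb]_u (h1 u)%:E = (k^-1 * 2 * ((t / 2) `^ (- (s / 2)) / (s / 2)))%:E)%E.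
 rewrite EFinM -(jump_mass s2 (divr_gt0 t0 (ltr0Sn R 1))).
 have a0 u : setT u -> (0 <= (jdens (s / 2) (t / 2) u)%:E)%E by rewrite lee_fin.
 have k20 : (0 <= (k^-1 * 2)%:E)%E by rewrite lee_fin mulr_ge0// normr_ge0.
 have ma : mfun (fun u => (jdens (s / 2) (t / 2) u)%:E) by exact/mEFinP.
 by rewrite -(@intZl _ _ _ leb _ mTT _ ma _ a0 k20); apply: eqint => u _; rewrite -EFinM.
have I2 : (\int[leb]_u (h2 u)%:E = (k^-1 * (gl ^+ 2 * 2 / Num.sqrt t) * (t `^ ((1 - s) / 2) / ((1 - s) / 2)))%:E)%E.
 rewrite EFinM -(integral_powR0 s3 t0).
 have a0 u : setT u -> (0 <= (\1_(`]0%R, t[%classic : set R) u * u `^ ((1 - s) / 2 - 1))%:E)%E by rewrite lee_fin mulr_ge0 ?powR_ge0.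
 have c20' : (0 <= (k^-1 * (gl ^+ 2 * 2 / Num.sqrt t))%:E)%E by rewrite lee_fin.
 have -> : (\int[leb]_(u in `]0%R, t[) (u `^ ((1 - s) / 2 - 1))%:E =
 \int[leb]_u (\1_(`]0%R, t[%classic : set R) u * u `^ ((1 - s) / 2 - 1))%:E)%E.
 rewrite int_mkcond; apply: eqint => u _; rewrite patchE indicE.
 by case: ifP => _; rewrite ?mul1r ?mul0r.
 by rewrite -(@intZl _ _ _ leb _ mTT _ mi2 _ a0 c20'); apply: eqint => u _; rewrite -EFinM.
apply: (@le_trans _ _ (\int[leb]_u ((h1 u)%:E + (h2 u)%:E))%E); last first.
 rewrite (@intD _ _ _ leb _ mTT _ _ h10 mh1 h20 mh2) I1 I2 -EFinD lee_fin; apply: eq_imp_le.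
 rewrite /C; have -> : t / 2 = t * (1 / 2) by rewrite div1r.
 rewrite powRM ?(ltW t0)//.
 have -> : t `^ ((1 - s) / 2) = Num.sqrt t * t `^ (- (s / 2)).
 rewrite -powR12_sqrt ?(ltW t0)// -powRDp//; congr (_ `^ _); by field.
 by field; rewrite !gt_eqF//; lra.
apply: le_int => //.
- by move=> u _; apply: int_ge0 => z _.
- exact: (@mtonG _ _ rV2 _ R (@pair_lebesgue R n) f mf f0).
- by apply: emfunD; [exact: mh1|exact: mh2].
move=> u _; rewrite /f /=.
have [u0|u0] := leP u 0.
 rewrite (_ : (\int[mu \x mu]_z _ = 0)%E); last first.
 by apply: integral0_eq => z _; rewrite /jdens (ltNge 0) u0/= mul0r mulr0.
 by rewrite adde_ge0 ?h10 ?h20.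
have kj0 : (0 <= (k^-1 * jdens (s / 2) 0 u)%:E)%E by rewrite lee_fin mulr_ge0 ?invr_ge0 ?(ltW k0).
have -> : (\int[mu \x mu]_z (k^-1 * (jdens (s / 2) 0 u * (gauss_diff t x0 z * gauss u (z.1 - z.2))))%:E =
 (k^-1 * jdens (s / 2) 0 u)%:E * J u)%E.
 have p0 z : setT z -> (0 <= (gauss_diff t x0 z * gauss u (z.1 - z.2))%:E)%E by move=> _; exact: pair0.
 rewrite -(@intZl _ _ _ (mu \x mu)%E _ mTT _ (mpair t u x0) _ p0 kj0).
 by apply: eqint => z _; rewrite -[RHS]EFinM; congr EFin; ring.
have jE : jdens (s / 2) 0 u = u `^ (- 1 - s / 2) by rewrite /jdens u0.
have [tu|tu] := ltP (t / 2) u.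
 apply: (@le_trans _ _ (h1 u)%:E); last by rewrite leeDl ?h20.
 have jE' : jdens (s / 2) (t / 2) u = u `^ (- 1 - s / 2) by rewrite /jdens tu.
 rewrite /h1 jE' jE.
 apply: (@le_trans _ _ ((k^-1 * u `^ (- 1 - s / 2))%:E * 2%:E)%E).
 by apply: lee_pM2l; [rewrite -jE|exact: gauss_diff_pair_le2].
 by rewrite -EFinM lee_fin mulrAC.
apply: (@le_trans _ _ (h2 u)%:E); last by rewrite leeDr ?h10.
apply: (@le_trans _ _ ((k^-1 * jdens (s / 2) 0 u)%:E * (gl ^+ 2 * (Num.sqrt u / Num.sqrt t) * 2)%:E)%E).
 by apply: lee_pM2l; [exact: kj0|exact: gauss_diff_pair_small].
rewrite -EFinM lee_fin /h2 indicE mem_set ?mul1r; last by rewrite /= in_itv/= u0/=; lra.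
rewrite jE; have -> : u `^ ((1 - s) / 2 - 1) = u `^ (- 1 - s / 2) * Num.sqrt u.
 by rewrite -powR12_sqrt ?(ltW u0)// -powRDp//; congr (_ `^ _); by field.
by apply: eq_imp_le; ring.
Qed.

End gauss_nu.

(** Nonnegative integrals are suprema over simple functions, hence monotone for arbitrary functions;
    used where measurability, as of the complementary function along g, is not at hand. *)
Lemma le_int_sup d (T : measurableType d) (R : realType)
 (m : {measure set T -> \bar R}) (f g : T -> \bar R) :
 (forall x, (0 <= f x)%E) -> (forall x, (f x <= g x)%E) ->
 (\int[m]_x f x <= \int[m]_x g x)%E.
Proof.
move=> f0 fg; have g0 x : (0 <= g x)%E := le_trans (f0 x) (fg x).
rewrite !ge0_integralTE//; apply: ge_ereal_sup => _ [h hf <-].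
by apply: ereal_sup_ubound; exists h => // x; exact: le_trans (hf x) (fg x).
Qed.

Lemma powR_ge1 {R : realType} (x p : R) : 1 <= x -> 0 <= p -> 1 <= x `^ p.
Proof.
move=> x1 p0; have := @ge0_ler_powR R p p0 1 x; rewrite powR1; apply; rewrite ?nnegrE//.
exact: le_trans ler01 x1.
Qed.

Lemma powR_exprn {R : realType} (x p : R) k : 0 <= x -> (x ^+ k) `^ p = (x `^ p) ^+ k.
Proof.
by move=> x0; rewrite -(powR_mulrn k x0) -(powR_mulrn k (powR_ge0 x p)) -!powRrM mulrC.
Qed.

(** * Membership in the small Orlicz space of the complementary function *)

Section conjugate.
Context {R : realType} {n : nat} (B : R -> R) (HB : nyoung B) (s : R).
Context (n0 : (0 < n)%N) (s01 : 0 < s < 1).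
Context (A : R -> \bar R) (AB : forall t, 0 <= t -> A t = (B t)%:E).
Local Notation q := (s / (n%:R - s)).
Local Notation eta := (2 `^ (n%:R - s) : R).
Local Notation theta := (eta^-1 `^ q : R).
Local Notation slope := (slope_integral B q).
Context (slope_lty : forall y, 0 < y -> (slope y < +oo)%E).

(** tau is where B crosses the line of slope Y. A crossing exists: if B stayed below the line, the
    weight would be 1 on (0, oo) and the slope integral infinite. *)
Lemma slope_threshold Y : 0 < Y ->
 exists2 tau : R, 0 <= tau & B tau <= Y * tau /\ forall t, tau < t -> Y * t <= B t.
Proof.
move=> Y0; have [H|/existsNP[t1 /not_implyP[t10 /negP]]] := pselect (forall t, 0 < t -> Y * t <= B t).
 by exists 0 => //; split; [rewrite (nyoung0 HB) mulr0|].
rewrite -ltNge => t1Y; have [[t0 t00 Yt0]|H] := pselect (exists2 t0, 0 < t0 & Y * t0 <= B t0).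
 have t10' : t1 <= t0.
 rewrite leNgt; apply/negP => tt; have := nyoung_slope HB t00 (ltW tt) => H.
 move: Yt0; rewrite -(ler_pM2r t10) => K.
 have : B t1 * t0 < Y * t1 * t0 by rewrite ltr_pM2r.
 by rewrite ltNge (le_trans _ H)// (le_trans _ K)// mulrAC.
 have [||x] := @IVT R (fun t => B `|t| - Y * t) t1 t0 0 t10'.
 - apply: continuous_subspaceT => x; apply: cvgB; first exact: nyoung_continuous.
 by apply: cvgM; [exact: cvg_cst|exact: cvg_id].
 - rewrite !gtr0_norm// min_l ?max_r; first by rewrite subr_le0 (ltW t1Y) subr_ge0.
 + by rewrite (@le_trans _ _ 0)// ?subr_le0 ?(ltW t1Y)// subr_ge0.
 + by rewrite (@le_trans _ _ 0)// ?subr_le0 ?(ltW t1Y)// subr_ge0.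
 rewrite in_itv/= => /andP[t1x _] /eqP; have x0 : 0 < x := lt_le_trans t10 t1x.
 rewrite gtr0_norm// subr_eq0 => /eqP Bx; exists x; first exact: ltW.
 split=> [|t xt]; first by rewrite Bx.
 have := nyoung_slope HB x0 (ltW xt); rewrite Bx mulrAC ler_pM2r//.
exfalso; have := slope_lty Y0; rewrite ltNge; apply/negP/negPn.
rewrite /slope_integral (_ : (fun t => _) = fun t => (slope_weight B q Y t)%:E)//.
have -> : +oo%E = (\int[@lebesgue_measure R]_(t in `]0%R, +oo[) (cst 1%:E t))%E.
 have l1 : (@lebesgue_measure R `]0%R, +oo[ = +oo)%E by rewrite leb_itvE/= ltry addye.
 by rewrite integral_cst// mul1e; exact/esym/l1.
apply: le_int.
- exact: mitv.
- by move=> t _; rewrite lee_fin.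
- exact: mcst.
- by apply/mEFinP; exact: m_slope_weight.
- move=> t; rewrite /= in_itv/= andbT => t0; rewrite lee_fin /slope_weight le_min lexx/=.
 have Bt : 0 < B t by exact: nyoung_gt0.
 have q0 : 0 < q by exact: exponent_gt0.
 apply: powR_ge1; last exact: ltW.
 rewrite ler_pdivlMr// mul1r leNgt; apply/negP => K; apply: H; exists t => //; exact: ltW.
Qed.

(** With tau_k the threshold of slope eta^k y, the complementary function at |g| / lam is at most
    the sum of tau_k f_k / lam: in t |g| / lam - B t the terms with tau_k < t are absorbed by B t,
    the others are bounded with t <= tau_k. Its integral is a sum of theta^k tau_k, finite by
    [chain_sum] for every lam. *)
Lemma complementary_series d (T : measurableType d) (m : {measure set T -> \bar R})
 (f_ : nat -> T -> \bar R) (A0 : R) (g : T -> R) : 0 < A0 ->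
 (forall k, mfun (f_ k)) -> (forall k z, (0 <= f_ k z <= (A0 * eta ^+ k)%:E)%E) ->
 (forall k, (\int[m]_z f_ k z <= (A0 * theta ^+ k)%:E)%E) ->
 mfun g -> (forall z, (`|g z|%:E <= \sum_(k <oo) f_ k z)%E) ->
 orlicz_E m (complementary A) g /\ (\int[m]_z `|g z|%:E < +oo)%E.
Proof.
move=> A00 mf fb fL mg gf.
have eta1 := dyadic_eta_gt1 n0 s01; have q0 := exponent_gt0 n0 s01.
have /andP[th0 th1] := theta01 eta1 q0; have eta0 : 0 < eta by rewrite powR_gt0.
have f0 k z : (0 <= f_ k z)%E by case/andP: (fb k z).
have key (c : nat -> R) (M : \bar R) : (forall k, 0 <= c k) ->
 (forall N, ((\sum_(k < N) theta ^+ k * c k)%:E <= M)%E) -> (M < +oo)%E ->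
 (\int[m]_z \sum_(k <oo) ((c k)%:E * f_ k z) < +oo)%E.
 move=> c0 cM Mf; rewrite integral_nneseries//; last 2 first.
 - by move=> k; apply: emfunM; [exact: mcst|exact: mf].
 - by move=> k z _; rewrite mule_ge0// lee_fin.
 apply: (@le_lt_trans _ _ (A0%:E * M)%E); last first.
 have M0 : (0 <= M)%E by apply: le_trans (cM 0%N); rewrite big_ord0.
 by rewrite -(@fineK _ M) ?fin_numE0// -EFinM ltry.
 apply: lime_le.
 apply: is_cvg_nneseries => k _ _; apply: int_ge0 => z _; by rewrite mule_ge0// lee_fin.
 apply: nearW => N; apply: (@le_trans _ _ (A0%:E * (\sum_(k < N) theta ^+ k * c k)%:E)%E); last first.
 by apply: lee_pM2l; [rewrite lee_fin ltW|exact: cM].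
 rewrite big_mkord -EFinM mulr_sumr -sumEFin; apply: lee_sum => k _.
 have f0' z : setT z -> (0 <= f_ k z)%E by [].
 have ck0 : (0 <= (c k)%:E)%E by rewrite lee_fin.
 rewrite (@intZl _ _ _ m _ mTT _ (mf k) _ f0' ck0).
 apply: (le_trans (lee_pM2l ck0 (fL k))).
 by rewrite -EFinM lee_fin; apply: eq_imp_le; ring.
split; last first.
 apply: (@le_lt_trans _ _ (\int[m]_z \sum_(k <oo) (1%:E * f_ k z))%E).
 apply: le_int_sup => z; first by rewrite lee_fin.
 by apply: (le_trans (gf z)); apply: lee_nneseries => // k _; rewrite mul1e.
 apply: (key (fun=> 1) ((1 - theta)^-1)%:E) => [k //|N|]; last by rewrite ltry.
 under eq_bigr do rewrite mulr1.
 have H := subrX1 theta N; rewrite lee_fin -[leRHS]mulr1 ler_pdivlMl ?subr_gt0//.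
 have -> : (1 - theta) * (\sum_(i < N) theta ^+ i) = 1 - theta ^+ N by rewrite -(opprB theta 1) mulNr -H opprB.
 by rewrite gerBl exprn_ge0 ?ltW.
(* eta/(eta - 1) comes from the geometric sum of the eta^k up to the last index with tau_k < t,
   which then lies below B t. *)
split=> // lam lam0; pose y := A0 / lam * (eta / (eta - 1)).
have e1 : 0 < eta - 1 by rewrite subr_gt0.
have y0 : 0 < y by rewrite mulr_gt0 ?divr_gt0.
have /choice[tau Htau] : forall k, exists tk : R, 0 <= tk /\ (B tk <= y * eta ^+ k * tk /\
 forall t, tk < t -> y * eta ^+ k * t <= B t).
 move=> k; have [|t t0 Ht] := @slope_threshold (y * eta ^+ k); first by rewrite mulr_gt0 ?exprn_gt0.
 by exists t; split.
have tl0 k : 0 <= tau k / lam by rewrite divr_ge0 ?(ltW lam0)//; have [] := Htau k.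
apply: (@le_lt_trans _ _ (\int[m]_z \sum_(k <oo) ((tau k / lam)%:E * f_ k z))%E); last first.
 apply: (key _ ((lam^-1)%:E * (((1 - theta)^-1)%:E * slope y))%E) => // [N|].
 have := @chain_sum R B HB eta q eta1 q0 tau y N y0.
 have Ht k : (k < N)%N -> 0 <= tau k /\ B (tau k) <= eta ^+ k * y * tau k.
 by move=> _; have [a [b _]] := Htau k; rewrite (mulrC (_ ^+ _)).
 move=> /(_ Ht) H; have l0 : (0 <= lam^-1%:E)%E by rewrite lee_fin invr_ge0 ltW.
 apply: le_trans (lee_pM2l l0 H); rewrite -EFinM lee_fin mulr_sumr le_eqVlt; apply/orP; left.
 by apply/eqP; apply: eq_bigr => k _; ring.
 have sf : slope y \is a fin_num.
 by rewrite fin_numE0 ?slope_lty//; apply: int_ge0 => t _; rewrite lee_fin slope_weight_ge0.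
 by rewrite -(fineK sf) -!EFinM ltry.
apply: le_int_sup => z.
 apply: ereal_sup_ubound; exists 0 => /=; first exact: lexx.
 by rewrite mul0r AB// (nyoung0 HB) sube0.
apply: ge_ereal_sup => _ [t /= t0 <-]; rewrite AB//.
rewrite leeBlDr//; have tf k : (0 <= (t / lam)%:E * f_ k z)%E by rewrite mule_ge0// lee_fin divr_ge0// ltW.
(* Upper bound for the k-th term of t |g| / lam when k is below threshold; these terms together do
   not exceed B t. *)
pose D k : R := if tau k < t then A0 * eta ^+ k * (t / lam) else 0.
have D0 k : 0 <= D k.
 by rewrite /D; case: ifP => // _; rewrite !mulr_ge0 ?exprn_ge0 ?invr_ge0 ?(ltW A00) ?(ltW eta0) ?(ltW lam0).
have DB : (\sum_(k <oo) (D k)%:E <= (B t)%:E)%E.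
 apply: lime_le; first by apply: is_cvg_nneseries => k _ _; rewrite lee_fin.
 apply: nearW => N; rewrite big_mkord sumEFin lee_fin.
 elim: N => [|N IH]; first by rewrite big_ord0 nyoung_ge0.
 rewrite big_ord_recr/= {2}/D; case: ifPn => [tt|_]; last by rewrite addr0.
 have tp : 0 < t by apply: le_lt_trans tt; have [] := Htau N.
 have [_ [_ /(_ t tt) HB']] := Htau N.
 have a0 : 0 <= A0 * (t / lam) by rewrite mulr_ge0 ?divr_ge0 ?(ltW A00) ?(ltW lam0).
 apply: (@le_trans _ _ (A0 * (t / lam) * \sum_(k < N.+1) eta ^+ k)).
 rewrite big_ord_recr/= mulrDr mulr_sumr; apply: lerD; last by rewrite mulrAC.
 apply: ler_sum => k _; rewrite /D; case: ifP => _; first by rewrite mulrAC.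
 by rewrite mulr_ge0// exprn_ge0// ltW.
 have SE : \sum_(k < N.+1) eta ^+ k = (eta ^+ N.+1 - 1) / (eta - 1).
 by rewrite subrX1 mulrC mulKf ?gt_eqF.
 apply: le_trans HB'; rewrite SE /y.
 have -> : A0 / lam * (eta / (eta - 1)) * eta ^+ N * t = A0 * (t / lam) * (eta ^+ N.+1 / (eta - 1)).
 by rewrite exprS; field; rewrite !gt_eqF.
 by apply: ler_wpM2l => //; rewrite ler_wpM2r ?invr_ge0 ?(ltW e1)// gerBl.
apply: (@le_trans _ _ (\sum_(k <oo) ((tau k / lam)%:E * f_ k z + (D k)%:E))%E); last first.
 rewrite nneseriesD => [|k _ _|k _ _]; first by rewrite leeD2l.
 - by rewrite mule_ge0// lee_fin.
 - by rewrite lee_fin.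
have -> : `|g z / lam| = `|g z| / lam by rewrite normrM (ger0_norm (_ : 0 <= lam^-1)) ?invr_ge0 ?(ltW lam0).
apply: (@le_trans _ _ ((t / lam)%:E * \sum_(k <oo) f_ k z)%E).
 rewrite (_ : t * (`|g z| / lam) = t / lam * `|g z|); last by ring.
 by rewrite EFinM; apply: lee_pM2l => //; rewrite lee_fin divr_ge0// ltW.
rewrite -nneseriesZl//; apply: lee_nneseries => // k _.
have /andP[a b] := fb k z; rewrite /D; case: ifPn => [tt|].
 apply: (@le_trans _ _ (A0 * eta ^+ k * (t / lam))%:E).
 rewrite [in leRHS]EFinM muleC; apply: lee_wpmul2r => //; by rewrite lee_fin divr_ge0 ?(ltW lam0).
 by rewrite leeDr// mule_ge0// lee_fin.
rewrite -leNgt => tt; rewrite adde0; apply: lee_wpmul2r => //.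
by rewrite lee_fin ler_wpM2r ?invr_ge0 ?(ltW lam0).
Qed.

End conjugate.

(** * Potentials of the renewal kernel *)

Section potential.
Context {R : realType} {n : nat} (B : R -> R) (HB : nyoung B) (s : R).
Context (n0 : (0 < n)%N) (s01 : 0 < s < 1).
Context (A : R -> \bar R) (AB : forall t, 0 <= t -> A t = (B t)%:E).
Local Notation q := (s / (n%:R - s)).
Local Notation eta := (2 `^ (n%:R - s) : R).
Local Notation theta := (eta^-1 `^ q : R).
Local Notation slope := (slope_integral B q).
Local Notation leb := (@lebesgue_measure R).
Context (slope_lty : forall y, 0 < y -> (slope y < +oo)%E).
Context (rho : R -> R) (mrho : mfun rho) (rho0 : forall t, 0 <= rho t).
Context (rho_le0 : forall t, t <= 0 -> rho t = 0) (rho1 : (\int[leb]_t (rho t)%:E <= 1)%E).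
Context (C : R) (C0 : 0 < C) (rhoC : forall T, 0 < T ->
 (\int[leb]_t (rho t * (if t < T then 1 else 0))%:E <= (C * T `^ s)%:E)%E).

Let s0 : 0 < s. Proof. by case/andP: s01. Qed.
Local Notation r k := ((1 / 4 : R) ^+ k).

(** Time bands of ratio 4, the square of the spatial ratio 2. The band k = 0 is unbounded above. *)
Let dyad (k : nat) (t : R) : R := if (r k < t) && ((k == 0%N) || (t <= 4 * r k)) then 1 else 0.

Let dyad0 k t : 0 <= dyad k t. Proof. by rewrite /dyad; case: ifP. Qed.

Let mdyad k : mfun (dyad k).
Proof.
apply: mifT; [|exact: mcst|exact: mcst].
apply: measurable_and; first by apply: mltr; [exact: mcst|exact: mid].
apply: measurable_or; first exact: mcst.
by apply: measurable_fun_ler; [exact: mid|exact: mcst].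
Qed.

Let dyad_cover t : 0 < t -> exists k, dyad k t = 1.
Proof.
move=> t0; have ex : exists k, r k < t.
 have /cvgrPdist_lt /(_ t t0) [N _ HN] : r k @[k --> \oo] --> (0 : R).
 by apply: cvg_expr; rewrite ger0_norm; lra.
 exists N; have := HN N (leqnn N); rewrite /= sub0r normrN gtr0_norm// exprn_gt0//; lra.
case: (ex_minnP ex) => k rk kmin; exists k; rewrite /dyad rk /=.
case: k rk kmin => [//|k] rk kmin; rewrite /= (_ : t <= 4 * r k.+1)//.
have -> : 4 * r k.+1 = r k by rewrite exprS mulrA (_ : 4 * (1 / 4) = 1 :> R) ?(mul1r (r k))//; field.
by rewrite leNgt; apply/negP => H; have := kmin _ H; rewrite ltnn.
Qed.

Let quarter : 1 / 4 = 2 `^ (- 2) :> R.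
Proof. by rewrite powRN powR_mulrn// div1r; congr (_^-1); ring. Qed.

Let theta_sqr k : (theta ^+ k) ^+ 2 = r k `^ s.
Proof.
rewrite (dyadic_thetaE n0 s01) powR_exprn ?divr_ge0// -!exprM mulnC exprM; congr (_ ^+ _).
by rewrite quarter -(powR_mulrn 2 (powR_ge0 _ _)) -!powRrM; congr (_ `^ _); ring.
Qed.

Let powR_quarter k p : r k `^ (- p) = (2 `^ (2 * p)) ^+ k.
Proof.
rewrite powR_exprn ?divr_ge0//; congr (_ ^+ _).
by rewrite quarter -powRrM; congr (_ `^ _); ring.
Qed.

Let C1 := 1 + C * 8 `^ s.
Let C10 : 0 < C1. Proof. by rewrite /C1 ltr_pwDl// mulr_ge0 ?powR_ge0 ?ltW. Qed.

Let dyad_mass k : (\int[leb]_t (rho t * dyad k t)%:E <= (C1 * (theta ^+ k) ^+ 2)%:E)%E.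
Proof.
have mrd : mfun (fun t => (rho t * dyad k t)%:E).
 by apply/mEFinP; exact: mfunM.
case: k mrd => [|k] mrd.
 rewrite expr0 expr1n mulr1; apply: (@le_trans _ _ 1%E); last by rewrite lee_fin lerDl mulr_ge0 ?powR_ge0 ?ltW.
 apply: le_trans rho1; apply: le_int_sup => t; rewrite lee_fin ?mulr_ge0//.
 by rewrite ler_piMr// /dyad; case: ifP.
have rk0 : 0 < r k.+1 by rewrite exprn_gt0//; lra.
(* 8 instead of 4, because the cumulative bound on rho concerns t strictly below T. *)
have T0 : 0 < 8 * r k.+1 by rewrite mulr_gt0.
apply: (@le_trans _ _ (C * (8 * r k.+1) `^ s)%:E).
 apply: le_trans (rhoC T0); apply: le_int_sup => t; rewrite lee_fin ?mulr_ge0//.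
 apply: ler_wpM2l => //; rewrite /dyad; case: ifP => [/andP[_ /= t4]|_]; last by case: ifP.
 rewrite (_ : t < _)//; lra.
rewrite theta_sqr powRM ?(ltW rk0)// lee_fin mulrA ler_wpM2r ?powR_ge0// /C1; lra.
Qed.

(** On band k the mass of rho is O(2^(-2 s k)). The sup bound then gives 2^((n+s) k - 2 s k) = eta^k
    and the L^1 bound 2^(s k - 2 s k) = theta^k, exactly the scales of [complementary_series].
    Exchange of integrals is a hypothesis, since m stands both for Lebesgue measure and for [nu]. *)
Lemma potential_E d (T : measurableType d) (m : {measure set T -> \bar R}) (H : T -> R -> R)
 (A0 : R) (g : T -> R) : 0 < A0 ->
 mfun (fun w : T * measurableTypeR R => H w.1 w.2) -> (forall z t, 0 <= H z t) ->
 (forall z t, 0 < t -> H z t <= A0 * (1 + t `^ (- ((n%:R + s) / 2)))) ->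
 (forall t, 0 < t -> (\int[m]_z (H z t)%:E <= (A0 * (1 + t `^ (- (s / 2))))%:E)%E) ->
 (forall f : T * measurableTypeR R -> \bar R, mfun f -> (forall w, (0 <= f w)%E) ->
 (\int[m]_z \int[leb]_t f (z, t) = \int[leb]_t \int[m]_z f (z, t))%E /\
 mfun (fun t => \int[m]_z f (z, t))%E) ->
 mfun g -> (forall z, (`|g z|%:E <= \int[leb]_t (rho t * H z t)%:E)%E) ->
 orlicz_E m (complementary A) g /\ (\int[m]_z `|g z|%:E < +oo)%E.
Proof.
move=> A00 mH H0 Hsup HL1 Hton mg gH.
pose F k (w : T * measurableTypeR R) : \bar R := (rho w.2 * dyad k w.2 * H w.1 w.2)%:E.
have F0 k w : (0 <= F k w)%E by rewrite lee_fin !mulr_ge0.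
have mF k : mfun (F k).
 apply/mEFinP; apply: mfunM => //; apply: mfunM.
 exact: (mcomp mrho msnd).
 exact: (mcomp (mdyad k) msnd).
pose f_ k z := (\int[leb]_t F k (z, t))%E.
have mrd k : mfun (fun t => (rho t * dyad k t)%:E).
 by apply/mEFinP; exact: mfunM.
have rd0 k t : setT t -> (0 <= (rho t * dyad k t)%:E)%E by rewrite lee_fin mulr_ge0.
have decay k t p : 0 <= p -> dyad k t != 0 -> 1 + t `^ (- p) <= 2 * (2 `^ (2 * p)) ^+ k.
 rewrite /dyad; case: ifP => [/andP[kt _] p0 _|]; last by rewrite eqxx.
 have rk0 : 0 < r k by rewrite exprn_gt0//; lra.
 have t0 : 0 < t := lt_trans rk0 kt.
 have b1 : 1 <= (2 `^ (2 * p)) ^+ k.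
 by apply: exprn_ege1; apply: powR_ge1; rewrite ?mulr_ge0// ler1n.
 have b2 : t `^ (- p) <= (2 `^ (2 * p)) ^+ k.
 rewrite -powR_quarter !powRN lef_pV2 ?posrE ?powR_gt0//.
 by apply: ge0_ler_powR; rewrite ?nnegrE ?(ltW rk0) ?(ltW t0) ?(ltW kt).
 lra.
have weight k (b : R) (h : R -> \bar R) : 0 <= b -> (forall t, (0 <= h t)%E) ->
 (forall t, (h t <= (rho t * dyad k t)%:E * b%:E)%E) ->
 (\int[leb]_t h t <= (b * (C1 * (theta ^+ k) ^+ 2))%:E)%E.
 move=> b0 h0 hb; apply: (@le_trans _ _ (\int[leb]_t (b%:E * (rho t * dyad k t)%:E))%E).
 by apply: le_int_sup => // t; rewrite muleC.
 have b0' : (0 <= b%:E)%E by rewrite lee_fin.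
 rewrite (@intZl _ _ _ leb _ mTT _ (mrd k) _ (rd0 k) b0') [leRHS]EFinM.
 by apply: lee_pM2l.
have pn : 0 <= (n%:R + s) / 2 by rewrite divr_ge0// addr_ge0// ltW.
pose A1 := A0 * 2 * C1; have A10 : 0 < A1 by rewrite !mulr_gt0.
have e1 k : A0 * (2 * (2 `^ (2 * ((n%:R + s) / 2))) ^+ k) * (C1 * (theta ^+ k) ^+ 2) = A1 * eta ^+ k.
 have E : 2 `^ (2 * ((n%:R + s) / 2)) * (theta ^+ 2) = eta :> R.
 rewrite (dyadic_thetaE n0 s01) -powR_mulrn ?powR_ge0// -powRrM -powRDp//; congr (_ `^ _); by field.
 rewrite -[in RHS]E exprMn -!exprM (mulnC 2) /A1; ring.
have e2 k : A0 * (2 * (2 `^ (2 * (s / 2))) ^+ k) * (C1 * (theta ^+ k) ^+ 2) = A1 * theta ^+ k.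
 have E : 2 `^ (2 * (s / 2)) * theta = 1 :> R.
 by rewrite (dyadic_thetaE n0 s01) -powRDp// (_ : _ + _ = 0) ?powRr0//; field.
 have E' : (2 `^ (2 * (s / 2))) ^+ k * theta ^+ k = 1 by rewrite -exprMn E expr1n.
 rewrite /A1 expr2; set a := theta ^+ k in E' *; set b := _ ^+ k in E' *.
 have -> : A0 * (2 * b) * (C1 * (a * a)) = A0 * 2 * C1 * a * (b * a) by ring.
 by rewrite E' mulr1.
apply: (@complementary_series R n B HB s n0 s01 A AB slope_lty _ _ m f_ A1 g A10) => //.
- move=> k; exact: (mtonF (m2 := leb) _ (mF k) (F0 k)).
- move=> k z; apply/andP; split; first by apply: int_ge0 => t _; exact: F0.
 rewrite -e1; apply: weight => [|t|t]; [by rewrite !mulr_ge0 ?exprn_ge0 ?powR_ge0 ?(ltW A00)|exact: F0|].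
 rewrite -EFinM lee_fin /=; have [->|d1] := eqVneq (dyad k t) 0; first by rewrite mulr0 !mul0r.
 have t0 : 0 < t.
 move: d1; rewrite /dyad; case: ifP => [/andP[kt _] _|]; last by rewrite eqxx.
 by apply: lt_trans kt; rewrite exprn_gt0//; lra.
 apply: ler_wpM2l; first exact: mulr_ge0.
 by apply: (le_trans (Hsup z t t0)); apply: ler_wpM2l; [exact: ltW|exact: decay].
- move=> k; have [-> mG] := Hton _ (mF k) (F0 k).
 rewrite -e2; apply: weight => [|t|t].
 + by rewrite !mulr_ge0 ?exprn_ge0 ?powR_ge0 ?(ltW A00).
 + by apply: int_ge0 => z _; exact: F0.
 rewrite /F /=; have [->|d1] := eqVneq (dyad k t) 0.
 rewrite mulr0 mul0e integral0_eq// => z _; by rewrite mul0r.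
 have t0 : 0 < t.
 move: d1; rewrite /dyad; case: ifP => [/andP[kt _] _|]; last by rewrite eqxx.
 by apply: lt_trans kt; rewrite exprn_gt0//; lra.
 under eqint do rewrite EFinM.
 have H0' z : setT z -> (0 <= (H z t)%:E)%E by rewrite lee_fin.
 have mHt : mfun (fun z => (H z t)%:E).
 by apply/mEFinP; exact: (mcomp mH (mpair2 (t : measurableTypeR R))).
 rewrite (@intZl _ _ _ m _ mTT _ mHt _ H0' (rd0 k t I)).
 apply: lee_pM2l; first exact: rd0.
 apply: (le_trans (HL1 t t0)); rewrite lee_fin; apply: ler_wpM2l; first exact: ltW.
 by apply: decay => //; rewrite divr_ge0// ltW.
- move=> z; apply: (le_trans (gH z)).
 have -> : (\sum_(k <oo) f_ k z = \int[leb]_t \sum_(k <oo) F k (z, t))%E.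
 rewrite integral_nneseries// => k; exact: (mcomp (mF k) (mpair1 z)).
 apply: le_int_sup => t; first by rewrite lee_fin mulr_ge0.
 have [t0|t0] := leP t 0.
 by rewrite rho_le0// mul0r; apply: nneseries_ge0 => k _ _; exact: F0.
 have [k Hk] := dyad_cover t0; rewrite (@nneseriesD1 R _ k xpredT (fun j _ => F0 j (z, t)) isT).
 rewrite {1}/F /= Hk mulr1; rewrite leeDl//; apply: nneseries_ge0 => j _ _; exact: F0.
Qed.

End potential.

(** If exactly one of the integrals is infinite, [fine] returns 0 for it, but then the right-hand
    side is infinite too. *)
Lemma fine_integral_dist d (T : measurableType d) (R : realType) (m : {measure set T -> \bar R})
 (a b : T -> R) : mfun a -> mfun b ->
 (forall x, 0 <= a x) -> (forall x, 0 <= b x) ->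
 (`|fine (\int[m]_x (a x)%:E) - fine (\int[m]_x (b x)%:E)|%:E <= \int[m]_x `|a x - b x|%:E)%E.
Proof.
move=> ma mb a0 b0; set I := (\int[m]_x `|a x - b x|%:E)%E.
have I0 : (0 <= I)%E by apply: int_ge0 => x _; rewrite lee_fin.
have key (p q : T -> R) : mfun p -> mfun q ->
 (forall x, 0 <= p x) -> (forall x, 0 <= q x) ->
 (\int[m]_x (p x)%:E <= \int[m]_x (q x)%:E + \int[m]_x `|p x - q x|%:E)%E.
 move=> mp mq p0 q0; rewrite -intD//; last 3 first.
 - by move=> x _; rewrite lee_fin.
 - exact/mEFinP.
 - apply/mEFinP; apply: mcomp; first exact: mnormr.
 exact: mfunB.
 apply: le_int_sup => x; first by rewrite lee_fin.
 rewrite -EFinD lee_fin -lerBlDl; exact: ler_norm.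
have Iab := key a b ma mb a0 b0; have := key b a mb ma b0 a0.
have -> : (\int[m]_x `|b x - a x|%:E = I)%E by apply: eqint => x _; rewrite distrC.
move: Iab; rewrite -/I.
have Ia0 : (0 <= \int[m]_x (a x)%:E)%E by apply: int_ge0 => x _; rewrite lee_fin.
have Ib0 : (0 <= \int[m]_x (b x)%:E)%E by apply: int_ge0 => x _; rewrite lee_fin.
move: Ia0 Ib0 I0; case: (\int[m]_x (a x)%:E)%E => [p| |] //; case: (\int[m]_x (b x)%:E)%E => [q| |] //;
 case: I => [r| |] //; rewrite ?leey// -?EFinD ?lee_fin//=; move=> *.
- by rewrite ler_norml; apply/andP; split; lra.
- by rewrite subrr normr0.
Qed.

(** * Signed integrals and Tonelli for [nu] *)

Section nu_integral.
Context {R : realType} {n : nat}.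
Local Notation mu := (@rV_lebesgue R n).
Local Notation leb := (@lebesgue_measure R).
Local Notation rV2 := ('rV[R]_n * 'rV[R]_n)%type.

Lemma integral_nu (f : rV2 -> R) : mfun f ->
 (\int[nu n]_z (f z)%:E = \int[mu \x mu]_z (f z * nu_density z)%:E)%E.
Proof.
move=> mf; have mf' : mfun (EFin \o f) by exact/mEFinP.
rewrite integralE [RHS]integralE; congr (_ - _)%E.
- rewrite (int_nu (measurable_funepos mf') (fun z => funepos_ge0 _ z)).
 apply: eqint => z _; rewrite !funeposE /= -!EFin_max -EFinM maxr_pMl ?powR_ge0//.
 by rewrite mul0r.
- rewrite (int_nu (measurable_funeneg mf') (fun z => funeneg_ge0 _ z)).
 apply: eqint => z _; rewrite !funenegE /= -!EFin_max -EFinM maxr_pMl ?powR_ge0//.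
 by rewrite mul0r mulNr.
Qed.

(** The density of [nu] is moved into the integrand, so that Tonelli is applied to the sigma-finite
    product of Lebesgue measures. *)
Lemma nu_tonelli_gen d (T : measurableType d) (m : {sigma_finite_measure set T -> \bar R})
 (f : rV2 * T -> \bar R) :
 mfun f -> (forall w, (0 <= f w)%E) ->
 (\int[nu n]_z \int[m]_t f (z, t) = \int[m]_t \int[nu n]_z f (z, t))%E /\
 mfun (fun t => \int[nu n]_z f (z, t))%E.
Proof.
move=> mf f0; pose g (w : rV2 * T) := (f w * (nu_density w.1)%:E)%E.
have d0 (z : rV2) : (0 <= (nu_density z)%:E)%E by rewrite lee_fin powR_ge0.
have mg : mfun g.
 apply: emfunM => //; apply/mEFinP.
 exact: (mcomp (@measurable_nu_density R n) mfst).
have g0 w : (0 <= g w)%E by rewrite mule_ge0.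
have E t : (\int[nu n]_z f (z, t) = \int[mu \x mu]_z g (z, t))%E.
 apply: int_nu => //; exact: (mcomp mf (mpair2 t)).
have mF := mtonF (m2 := m) _ mf f0.
have F0 z : (0 <= \int[m]_t f (z, t))%E by apply: int_ge0.
split; last first.
 rewrite (_ : (fun t => _) = fun t => (\int[mu \x mu]_z g (z, t))%E); last exact/funext.
 exact: (@mtonG _ _ rV2 _ R (@pair_lebesgue R n) g mg g0).
rewrite (int_nu mF F0).
transitivity (\int[mu \x mu]_z \int[m]_t g (z, t))%E.
 apply: eqint => z _; rewrite muleC.
 have f0z t : setT t -> (0 <= f (z, t))%E by [].
 have mfz : mfun (fun t => f (z, t)) by exact: (mcomp mf (mpair1 z)).
 rewrite -(@intZl _ _ _ m _ mTT _ mfz _ f0z (d0 z)).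
 by apply: eqint => t _; rewrite muleC.
have := @fubini_tonelli _ _ rV2 _ R (@pair_lebesgue R n) m g mg g0.
rewrite int_pair => ->; apply: eqint => t _; rewrite E; exact: int_pair.
Qed.

Definition nu_tonelli := @nu_tonelli_gen _ (measurableTypeR R) leb.

End nu_integral.

(** * The Green kernel and its Orlicz bounds *)

Section green_kernel.
Context {R : realType} {n : nat} (B : R -> R) (HB : nyoung B) (s : R).
Context (n0 : (0 < n)%N) (s01 : 0 < s < 1).
Context (A : R -> \bar R) (AB : forall t, 0 <= t -> A t = (B t)%:E).
Local Notation q := (s / (n%:R - s)).
Local Notation slope := (slope_integral B q).
Local Notation mu := (@rV_lebesgue R n).
Local Notation leb := (@lebesgue_measure R).
Local Notation gl := (@gauss_lip R n).
Local Notation rV2 := ('rV[R]_n * 'rV[R]_n)%type.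
Context (slope_lty : forall y, 0 < y -> (slope y < +oo)%E).
Context (rho : R -> R) (mrho : mfun rho) (rho0 : forall t, 0 <= rho t).
Context (rho_le0 : forall t, t <= 0 -> rho t = 0) (rho1 : (\int[leb]_t (rho t)%:E <= 1)%E).
Context (C : R) (C0 : 0 < C) (rhoC : forall T, 0 < T ->
 (\int[leb]_t (rho t * (if t < T then 1 else 0))%:E <= (C * T `^ s)%:E)%E).

Let s0 : 0 < s. Proof. by case/andP: s01. Qed.

Definition greenE (x0 x : 'rV[R]_n) : \bar R := (\int[leb]_t (rho t * gauss t (x - x0))%:E)%E.
(** [fine] changes [greenE] on a null set only, see [green_ae]; at x0 itself the integral may be
    infinite. *)
Definition green x0 x : R := fine (greenE x0 x).

Lemma m_gauss_joint (x0 : 'rV[R]_n) :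
 mfun (fun w : 'rV[R]_n * measurableTypeR R => gauss w.2 (w.1 - x0)).
Proof.
apply: m_gauss2; first exact: msnd.
by apply: m_rVB; [exact: mfst|exact: mcst].
Qed.

Let mrg x0 : mfun (fun w : 'rV[R]_n * measurableTypeR R => (rho w.2 * gauss w.2 (w.1 - x0))%:E).
Proof.
apply/mEFinP; apply: mfunM; last exact: m_gauss_joint.
exact: (mcomp mrho msnd).
Qed.

Let rg0 (x0 : 'rV[R]_n) (w : 'rV[R]_n * measurableTypeR R) : (0 <= (rho w.2 * gauss w.2 (w.1 - x0))%:E)%E.
Proof. by rewrite lee_fin mulr_ge0 ?gauss_ge0. Qed.

Lemma greenE_ge0 x0 x : (0 <= greenE x0 x)%E.
Proof. by apply: int_ge0 => t _; exact: (rg0 x0 (x, t)). Qed.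

Lemma green_ge0 x0 x : 0 <= green x0 x.
Proof. by rewrite fine_ge0// greenE_ge0. Qed.

Lemma m_greenE x0 : mfun (greenE x0).
Proof. exact: (mtonF (m2 := leb) _ (mrg x0) (rg0 x0)). Qed.

Lemma m_green x0 : mfun (green x0).
Proof. exact: (mcomp (fine_measurable mTT) (m_greenE x0)). Qed.

Lemma greenE_tonelli x0 (f : 'rV[R]_n -> \bar R) : mfun f -> (forall x, (0 <= f x)%E) ->
 (\int[mu]_x (greenE x0 x * f x) =
 \int[leb]_t ((rho t)%:E * \int[mu]_x ((gauss t (x - x0))%:E * f x)))%E.
Proof.
move=> mf f0; pose g (w : 'rV[R]_n * measurableTypeR R) := ((rho w.2 * gauss w.2 (w.1 - x0))%:E * f w.1)%E.
have mg : mfun g.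
 by apply: emfunM => //; exact: (mcomp mf mfst).
have g0 w : (0 <= g w)%E by rewrite mule_ge0.
transitivity (\int[mu]_x \int[leb]_t g (x, t))%E.
 apply: eqint => x _; rewrite muleC.
 have r0 t : setT t -> (0 <= (rho t * gauss t (x - x0))%:E)%E by move=> _; exact: (rg0 x0 (x, t)).
 have mr : mfun (fun t => (rho t * gauss t (x - x0))%:E).
 exact: (mcomp (mrg x0) (mpair1 x)).
 rewrite -(@intZl _ _ _ leb _ mTT _ mr _ r0 (f0 x)).
 by apply: eqint => t _; rewrite muleC.
rewrite (fubini_tonelli (m1 := mu) (m2 := leb) g mg g0); apply: eqint => t _.
have h0 x : setT x -> (0 <= (gauss t (x - x0))%:E * f x)%E by rewrite mule_ge0// lee_fin gauss_ge0.
have mh : mfun (fun x : 'rV[R]_n => (gauss t (x - x0))%:E * f x)%E.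
 by apply: emfunM => //; apply/mEFinP; exact: m_gauss_at.
have rt0 : (0 <= (rho t)%:E)%E by rewrite lee_fin.
rewrite -(@intZl _ _ _ mu _ mTT _ mh _ h0 rt0).
by apply: eqint => x _; rewrite /g/= EFinM muleA.
Qed.

Lemma greenE_mass x0 : (\int[mu]_x greenE x0 x <= 1)%E.
Proof.
have -> : (\int[mu]_x greenE x0 x = \int[mu]_x (greenE x0 x * cst 1%E x))%E.
 by apply: eqint => x _; rewrite mule1.
rewrite greenE_tonelli//; apply: le_trans rho1; apply: le_int_sup => t.
 by apply: mule_ge0; [rewrite lee_fin|apply: int_ge0 => x _; rewrite mule1 lee_fin gauss_ge0].
have [t0|t0] := leP t 0; first by rewrite rho_le0// mul0e.
under eqint do rewrite mule1.
by rewrite int_gauss_shift// mule1.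
Qed.

Lemma green_ae x0 : {ae mu, forall x, (green x0 x)%:E = greenE x0 x}.
Proof.
have iw : mu.-integrable setT (greenE x0).
 apply/integrableP; split; first exact: m_greenE.
 under eqint do rewrite gee0_abs ?greenE_ge0//.
 by rewrite (le_lt_trans (greenE_mass x0))// ltry.
have := integrable_ae mTT iw; apply: (@filterS _ _ (ae_filt mu)) => x /(_ I).
exact: fineK.
Qed.

Lemma green_integral x0 (f : 'rV[R]_n -> \bar R) : mfun f -> (forall x, (0 <= f x)%E) ->
 (\int[mu]_x ((green x0 x)%:E * f x) =
 \int[leb]_t ((rho t)%:E * \int[mu]_x ((gauss t (x - x0))%:E * f x)))%E.
Proof.
move=> mf f0; rewrite -greenE_tonelli//; apply: ge0_ae_eq_integral => //.
- by apply: emfunM => //; apply/mEFinP; exact: m_green.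
- by apply: emfunM => //; exact: m_greenE.
- by move=> x _; rewrite mule_ge0// lee_fin green_ge0.
- by move=> x _; rewrite mule_ge0// greenE_ge0.
- by apply: (@filterS _ _ (ae_filt mu) _ _ _ (green_ae x0)) => x gx _; rewrite gx.
Qed.

Let pi2 : 0 < (pi : R) * 2. Proof. by rewrite mulr_gt0// pi_gt0. Qed.

Let peakE (t : R) : 0 < t -> gpeak (n := n) t = (pi * 2) `^ (- (n%:R / 2)) * t `^ (- (n%:R / 2)).
Proof. by move=> t0; rewrite /gpeak (mulrC t) (powRM _ (ltW pi2) (ltW t0)). Qed.

Let P := (pi * 2 : R) `^ (- (n%:R / 2)).
Let P0 : 0 < P. Proof. by rewrite powR_gt0. Qed.

Lemma green_E x0 : orlicz_E mu (complementary A) (green x0).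
Proof.
have [||||||||] := @potential_E R n B HB s n0 s01 A AB slope_lty rho mrho rho0 rho_le0 rho1 C C0 rhoC
 _ _ mu (fun x t => gauss t (x - x0)) (1 + P) (green x0); last by [].
- by rewrite addr_gt0.
- exact: m_gauss_joint.
- by move=> x t; exact: gauss_ge0.
- move=> x t t0; apply: (le_trans (gauss_le_peak _ t0)); rewrite peakE//.
 have h : t `^ (- (n%:R / 2)) <= 1 + t `^ (- ((n%:R + s) / 2)).
 have [t1|t1] := leP 1 t.
 apply: (@le_trans _ _ 1); last by rewrite lerDl powR_ge0.
 by rewrite powRN invf_le1 ?powR_gt0// powR_ge1.
 rewrite (_ : - ((n%:R + s) / 2) = - (n%:R / 2) + - (s / 2)); last by field.
 rewrite powRDp//; apply: (@le_trans _ _ (t `^ (- (n%:R / 2)) * t `^ (- (s / 2)))); last by rewrite lerDr.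
 rewrite ler_peMr ?powR_ge0// powRN invf_ge1 ?powR_gt0//; apply: powR_le1; rewrite ?(ltW t0) ?(ltW t1)//.
 by rewrite divr_ge0// ltW.
 rewrite -/P; apply: ler_pM => //; [exact: ltW|exact: powR_ge0|by rewrite lerDr].
- move=> t t0; rewrite int_gauss_shift// lee_fin.
 have : 1 * 1 <= (1 + P) * (1 + t `^ (- (s / 2))).
 by apply: ler_pM => //; rewrite lerDl ?powR_ge0// ltW.
 by rewrite mulr1.
- move=> f mf f0; split; first exact: (fubini_tonelli (m1 := mu) (m2 := leb) f mf f0).
 exact: (mtonG f mf f0).
- exact: m_green.
- move=> x; rewrite ger0_norm ?green_ge0// /green.
 by have := greenE_ge0 x0 x; rewrite /greenE; case: (\int[leb]_t _)%E => [r| |]//=; rewrite leey.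
Qed.

Lemma green_Ds_E x0 : orlicz_E (nu n) (complementary A) (Ds s (green x0)) /\
 (\int[nu n]_z `|Ds s (green x0) z|%:E < +oo)%E.
Proof.
have [CL CL0 HL] := @gauss_Ds_L1 R n s s01.
have gl0 := @gauss_lip_gt0 R n.
pose S := 2 * (gl + 1) * P; have S0 : 0 < S by rewrite !mulr_gt0// addr_gt0.
apply: (@potential_E R n B HB s n0 s01 A AB slope_lty rho mrho rho0 rho_le0 rho1 C C0 rhoC
 _ _ (nu n) (fun z t => `|Ds s (fun x => gauss t (x - x0)) z|) (S + CL) (Ds s (green x0))).
- by rewrite addr_gt0.
- rewrite (_ : (fun w => _) = fun w : rV2 * measurableTypeR R => gauss_diff w.2 x0 w.1 * enorm (w.1.1 - w.1.2) `^ (- s)); last first.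
 apply/funext => w; rewrite /Ds normrM (ger0_norm (_ : 0 <= (_)^-1)) ?invr_ge0 ?powR_ge0//.
 by rewrite powRN.
 apply: mfunM.
 apply: mcomp; first exact: mnormr.
 apply: mfunB.
 + apply: (mcomp (m_gauss_joint x0) (g := fun w : rV2 * measurableTypeR R => (w.1.1, w.2))).
 by apply/measurable_fun_pairP; split; [exact: (mcomp mfst mfst)|exact: msnd].
 + apply: (mcomp (m_gauss_joint x0) (g := fun w : rV2 * measurableTypeR R => (w.1.2, w.2))).
 by apply/measurable_fun_pairP; split; [exact: (mcomp msnd mfst)|exact: msnd].
 apply: (@mcomp _ _ _ _ _ _ (fun x : R => x `^ (- s))); first exact: mpowR.
 apply: (@mcomp _ _ _ _ _ _ (@enorm R n)); first exact: measurable_enorm.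
 by apply: m_rVB; [exact: (mcomp mfst mfst)|
 exact: (mcomp msnd mfst)].
- by move=> z t; exact: normr_ge0.
- move=> z t t0; apply: (le_trans (gauss_Ds_sup x0 z s01 t0)); rewrite peakE// -/P.
 rewrite (_ : - ((n%:R + s) / 2) = - (n%:R / 2) + - (s / 2)); last by field.
 rewrite powRDp//; set a := t `^ _; set b := t `^ _; have a0 : 0 <= a by exact: powR_ge0.
 have b0 : 0 <= b by exact: powR_ge0.
 have -> : 2 * (gl + 1) * (P * a) * b = S * (a * b) by rewrite /S; ring.
 apply: ler_pM; [exact: ltW|exact: mulr_ge0|by rewrite lerDl ltW|by rewrite lerDr].
- move=> t t0; apply: (le_trans (HL t x0 t0)); rewrite lee_fin.
 apply: ler_pM; rewrite ?powR_ge0 ?(ltW CL0)// ?lerDr//; exact: ltW.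
- exact: nu_tonelli.
- by apply: m_Ds; exact: m_green.
- move=> z; rewrite /Ds normrM (ger0_norm (_ : 0 <= (_)^-1)) ?invr_ge0 ?powR_ge0//.
 set e := (_ `^ s)^-1; have e0 : 0 <= e by rewrite invr_ge0 powR_ge0.
 rewrite EFinM muleC.
 have mt x : mfun (fun t => rho t * gauss t (x - x0)).
 by apply/mEFinP; exact: (mcomp (mrg x0) (mpair1 x)).
 have pt (x : 'rV[R]_n) t : 0 <= rho t * gauss t (x - x0) by rewrite mulr_ge0 ?gauss_ge0.
 have H := @fine_integral_dist _ _ R leb _ _ (mt z.1) (mt z.2) (pt z.1) (pt z.2).
 have e0' : (0 <= e%:E)%E by rewrite lee_fin.
 apply: (le_trans (lee_pM2l e0' H)).
 have mz : mfun (fun t => (`|rho t * gauss t (z.1 - x0) - rho t * gauss t (z.2 - x0)|%:E : \bar R)).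
 apply/mEFinP; apply: mcomp; first exact: mnormr.
 exact: mfunB.
 have pz t : setT t -> (0 <= (`|rho t * gauss t (z.1 - x0) - rho t * gauss t (z.2 - x0)|%:E : \bar R))%E.
 by rewrite lee_fin.
 rewrite -(@intZl _ _ _ leb _ mTT _ mz _ pz e0'); apply: eq_imp_le.
 apply: eqint => t _; rewrite -EFinM; congr EFin; rewrite -mulrBr normrM (ger0_norm (rho0 t)).
 by rewrite normrM (ger0_norm e0); ring.
Qed.

Lemma green_WsE x0 : WsE s (complementary A) (green x0).
Proof. by split; [exact: green_E|have [] := green_Ds_E x0]. Qed.

End green_kernel.

(** * Heat semigroup at a fixed point *)

Section heat_average.
Context {R : realType} {n : nat}.
Local Notation mu := (@rV_lebesgue R n).
Local Notation leb := (@lebesgue_measure R).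
Local Notation gl := (@gauss_lip R n).
Context (v : 'rV[R]_n -> R) (mv : mfun v) (M : R) (vM : forall x, 0 <= v x <= M).
Context (x0 : 'rV[R]_n).

(** The heat semigroup applied to v, at the point x0. This rescaled form extends to t = 0 with the
    value v x0 and is constant for t <= 0, since [tclass] concerns functions on the whole line. *)
Definition heat (t : R) : R := fine (\int[mu]_z (v (x0 + Num.sqrt t *: z) * gauss 1 z)%:E).

Let v0 x : 0 <= v x. Proof. by case/andP: (vM x). Qed.
Let M0 : 0 <= M. Proof. by have /andP[a b] := vM x0; exact: le_trans a b. Qed.

Lemma m_heat_argument :
 mfun (fun w : measurableTypeR R * 'rV[R]_n => x0 + Num.sqrt (w.1 : R) *: w.2).
Proof.
apply: measurable_fun_rVP => i.
rewrite (_ : _ \o _ = fun w : measurableTypeR R * 'rV[R]_n =>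
 (x0 ord0 i + Num.sqrt (w.1 : R) * (@rV_coord R n i w.2 : R))); last first.
 by apply/funext => w; rewrite /= /rV_coord !mxE.
apply: mfunD; first exact: mcst.
apply: mfunM.
 apply: (@mcomp _ _ _ _ _ _ (@Num.sqrt R)); last exact: mfst.
 by apply: continuous_measurable_fun; exact: sqrt_continuous.
by apply: (@mcomp _ _ _ _ _ _ (@rV_coord R n i)) => //; exact: measurable_rV_coord.
Qed.

Let mvg : mfun (fun w : measurableTypeR R * 'rV[R]_n =>
 (v (x0 + Num.sqrt (w.1 : R) *: w.2) * gauss 1 w.2)%:E).
Proof.
apply/mEFinP; apply: mfunM.
 exact: (mcomp mv m_heat_argument).
exact: (mcomp (m_gauss 1) msnd).
Qed.

Let vg0 (w : measurableTypeR R * 'rV[R]_n) : (0 <= (v (x0 + Num.sqrt (w.1 : R) *: w.2) * gauss 1 w.2)%:E)%E.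
Proof. by rewrite lee_fin mulr_ge0 ?gauss_ge0. Qed.

Lemma gauss_bounded_integral t (b : R) (f : 'rV[R]_n -> R) : 0 <= b -> 0 < t ->
 (forall z, 0 <= f z <= b) -> (0 <= \int[mu]_z (f z * gauss t z)%:E <= b%:E)%E.
Proof.
move=> b0 t0 fb; have f0 z : 0 <= f z by case/andP: (fb z).
apply/andP; split; first by apply: int_ge0 => z _; rewrite lee_fin mulr_ge0 ?gauss_ge0.
apply: (@le_trans _ _ (\int[mu]_z (b%:E * (gauss t z)%:E))%E).
 apply: le_int_sup => z; first by rewrite lee_fin mulr_ge0 ?gauss_ge0.
 by rewrite -EFinM lee_fin ler_wpM2r ?gauss_ge0//; case/andP: (fb z).
have g0 (z : 'rV[R]_n) : setT z -> (0 <= (gauss t z)%:E)%E by rewrite lee_fin gauss_ge0.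
have mg : mfun (fun z : 'rV[R]_n => (gauss t z)%:E) by apply/mEFinP; exact: m_gauss.
have b0' : (0 <= b%:E)%E by rewrite lee_fin.
by rewrite (@intZl _ _ _ mu _ mTT _ mg _ g0 b0') integral_gauss// mule1.
Qed.

Let heat_fin t : exists2 r, (\int[mu]_z (v (x0 + Num.sqrt t *: z) * gauss 1 z)%:E)%E = r%:E & 0 <= r <= M.
Proof. by have /andP[] := gauss_bounded_integral M0 (@ltr01 R) (fun z => vM (x0 + Num.sqrt t *: z)); exact: ge0_le_EFinP. Qed.

Lemma heat_bound t : 0 <= heat t <= M.
Proof. by rewrite /heat; have [r -> ] := heat_fin t. Qed.

Lemma heatE t : (\int[mu]_z (v (x0 + Num.sqrt t *: z) * gauss 1 z)%:E)%E = (heat t)%:E.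
Proof. by rewrite /heat; have [r ->] := heat_fin t. Qed.

Lemma heat0 : heat 0 = v x0.
Proof.
rewrite /heat; under eqint do rewrite sqrtr0 scale0r addr0 EFinM.
have g0 (z : 'rV[R]_n) : setT z -> (0 <= (gauss 1 z)%:E)%E by rewrite lee_fin gauss_ge0.
have mg : mfun (fun z : 'rV[R]_n => (gauss 1 z)%:E) by apply/mEFinP; exact: m_gauss.
have v0' : (0 <= (v x0)%:E)%E by rewrite lee_fin.
by rewrite (@intZl _ _ _ mu _ mTT _ mg _ g0 v0') integral_gauss// mule1.
Qed.

Lemma heat_gauss t : 0 < t -> (\int[mu]_x (gauss t (x - x0) * v x)%:E)%E = (heat t)%:E.
Proof.
move=> t0; rewrite -heatE; have st0 : 0 < Num.sqrt t by rewrite sqrtr_gt0.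
have mf : mfun (fun x : 'rV[R]_n => (gauss t (x - x0) * v x)%:E).
 by apply/mEFinP; apply: mfunM => //; exact: m_gauss_at.
have f0 x : (0 <= (gauss t (x - x0) * v x)%:E)%E by rewrite lee_fin mulr_ge0 ?gauss_ge0.
rewrite (integral_rV_affine x0 (negbT (gt_eqF st0)) mf f0) ger0_norm ?(ltW st0)//.
have K0 : (0 <= (Num.sqrt t ^+ n)%:E)%E by rewrite lee_fin exprn_ge0// ltW.
have mf' : mfun (fun z : 'rV[R]_n => (gauss t (Num.sqrt t *: z + x0 - x0) * v (Num.sqrt t *: z + x0))%:E).
 exact: (mcomp mf (m_rV_affine (Num.sqrt t) x0)).
have f0' (z : 'rV[R]_n) : setT z -> (0 <= (gauss t (Num.sqrt t *: z + x0 - x0) * v (Num.sqrt t *: z + x0))%:E)%E.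
 by rewrite lee_fin mulr_ge0 ?gauss_ge0.
rewrite -(@intZl _ _ _ mu _ mTT _ mf' _ f0' K0).
apply: eqint => z _; rewrite -EFinM; congr EFin; rewrite addrK (addrC _ x0).
have -> : gauss t (Num.sqrt t *: z) = (Num.sqrt t) ^- n * gauss 1 z.
 by rewrite -[in LHS](mul1r t) gauss_root// scalerA mul1r mulVf ?gt_eqF// scale1r.
by rewrite -mulrA mulVKf ?expf_neq0 ?gt_eqF// mulrC.
Qed.

(** |sqrt (x + t) - sqrt x| <= sqrt t and the first moment of the Gaussian turn the affine modulus
    of v into a modulus in time, uniform in the base time x. *)
Lemma heat_modulus (L : R -> R) : (forall e, 0 < e -> 0 <= L e) ->
 (forall e x y, 0 < e -> `|v x - v y| <= e + L e * enorm (x - y)) ->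
 tclass M (fun e => (e / (2 * (L (e / 2) + 1) * (gl + 1))) ^+ 2) heat.
Proof.
move=> L0 HL; split=> [|t|e e0 x t /andP[t0 te]]; [|exact: heat_bound|].
 apply: (mcomp (fine_measurable mTT)).
 exact: (mtonF (m2 := mu) _ mvg vg0).
have gl0 := @gauss_lip_gt0 R n; set D := 2 * (L (e / 2) + 1) * (gl + 1) in te.
have e2 : 0 < e / 2 by rewrite divr_gt0.
have Le := L0 _ e2; have D0 : 0 < D by rewrite !mulr_gt0// ltr_wpDl// ltW.
have st : Num.sqrt t <= e / D.
 by rewrite -(@ler_pXn2r _ 2)// ?nnegrE ?sqrtr_ge0 ?divr_ge0 ?(ltW e0) ?(ltW D0)// sqr_sqrtr.
have dsq : `|Num.sqrt (x + t) - Num.sqrt x| <= Num.sqrt t.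
 have le1 : Num.sqrt x <= Num.sqrt (x + t) by apply: ler_wsqrtr; rewrite lerDl.
 rewrite ger0_norm ?subr_ge0// lerBlDr.
 have [x0'|x0'] := leP 0 x.
 rewrite -(@ler_pXn2r _ 2)// ?nnegrE ?addr_ge0 ?sqrtr_ge0// sqrrD !sqr_sqrtr ?addr_ge0//.
 have := mulr_ge0 (sqrtr_ge0 t) (sqrtr_ge0 x); lra.
 by rewrite [Num.sqrt x]ler0_sqrtr ?(ltW x0')// addr0; apply: ler_wsqrtr; lra.
rewrite -lee_fin.
have mt y : mfun (fun z : 'rV[R]_n => v (x0 + Num.sqrt y *: z) * gauss 1 z).
 by apply/mEFinP; exact: (mcomp mvg (mpair1 (y : measurableTypeR R))).
have pt y (z : 'rV[R]_n) : 0 <= v (x0 + Num.sqrt y *: z) * gauss 1 z by rewrite mulr_ge0 ?gauss_ge0.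
apply: (le_trans (@fine_integral_dist _ _ R mu _ _ (mt (x + t)) (mt x) (pt (x + t)) (pt x))).
have K0 : 0 <= L (e / 2) * Num.sqrt t * gl by rewrite mulr_ge0 ?(ltW gl0)// mulr_ge0 ?sqrtr_ge0.
have mg (a : R) : mfun (fun z : 'rV[R]_n => (gauss a z)%:E) by apply/mEFinP; exact: m_gauss.
have g0 (a : R) (z : 'rV[R]_n) : setT z -> (0 <= (gauss a z)%:E)%E by rewrite lee_fin gauss_ge0.
have e2' : (0 <= (e / 2)%:E)%E by rewrite lee_fin ltW.
have K0' : (0 <= (L (e / 2) * Num.sqrt t * gl)%:E)%E by rewrite lee_fin.
apply: (@le_trans _ _ (\int[mu]_z ((e / 2)%:E * (gauss 1 z)%:E + (L (e / 2) * Num.sqrt t * gl)%:E * (gauss 2 z)%:E))%E).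
 apply: le_int_sup => z; first by rewrite lee_fin.
 rewrite -!EFinM -EFinD lee_fin -mulrBl normrM (ger0_norm (gauss_ge0 _ _)).
 have H := HL (e / 2) (x0 + Num.sqrt (x + t) *: z) (x0 + Num.sqrt x *: z) e2.
 apply: (le_trans (ler_wpM2r (gauss_ge0 _ _) H)).
 rewrite mulrDl lerD2l.
 have -> : x0 + Num.sqrt (x + t) *: z - (x0 + Num.sqrt x *: z) = (Num.sqrt (x + t) - Num.sqrt x) *: z.
 by rewrite opprD addrACA subrr add0r scalerBl.
 rewrite enormZ; have G := gauss1_enorm z; set w := enorm z in G *.
 apply: (@le_trans _ _ (L (e / 2) * (Num.sqrt t * (w * gauss 1 z)))).
 have wg0 : 0 <= w * gauss 1 z by rewrite mulr_ge0 ?gauss_ge0 ?enorm_ge0.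
 have dw := ler_wpM2r wg0 dsq; have := ler_wpM2l Le dw; set a := `|_ - _|.
 by have -> : L (e / 2) * (a * w) * gauss 1 z = L (e / 2) * (a * (w * gauss 1 z)) by ring.
 have -> : L (e / 2) * Num.sqrt t * gl * gauss 2 z = L (e / 2) * (Num.sqrt t * (gl * gauss 2 z)) by rewrite !mulrA.
 apply: ler_wpM2l; first exact: Le.
 by apply: ler_wpM2l; [exact: sqrtr_ge0|exact: G].
have h1 (z : 'rV[R]_n) : setT z -> (0 <= (e / 2)%:E * (gauss 1 z)%:E)%E by move=> _; apply: mule_ge0 => //; exact: g0.
have h2 (z : 'rV[R]_n) : setT z -> (0 <= (L (e / 2) * Num.sqrt t * gl)%:E * (gauss 2 z)%:E)%E.
 by move=> _; apply: mule_ge0 => //; exact: g0.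
have m1 : mfun (fun z : 'rV[R]_n => (e / 2)%:E * (gauss 1 z)%:E)%E.
 by apply: emfunM; [exact: mcst|exact: mg].
have m2 : mfun (fun z : 'rV[R]_n => (L (e / 2) * Num.sqrt t * gl)%:E * (gauss 2 z)%:E)%E.
 by apply: emfunM; [exact: mcst|exact: mg].
rewrite (@intD _ _ _ mu _ mTT _ _ h1 m1 h2 m2).
rewrite (@intZl _ _ _ mu _ mTT _ (mg 1) _ (g0 1) e2').
rewrite (@intZl _ _ _ mu _ mTT _ (mg 2) _ (g0 2) K0') !integral_gauss// !mule1 -EFinD lee_fin.
have : L (e / 2) * Num.sqrt t * gl <= e / 2.
 apply: (@le_trans _ _ ((L (e / 2) + 1) * (e / D) * (gl + 1))).
 apply: ler_pM; [by rewrite mulr_ge0 ?sqrtr_ge0|exact: ltW| |by rewrite lerDl].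
 by apply: ler_pM; [exact: Le|exact: sqrtr_ge0|rewrite lerDl|exact: st].
 have aux (l g : R) : 0 <= l -> 0 < g -> (l + 1) * (e / (2 * (l + 1) * (g + 1))) * (g + 1) = e / 2.
 by move=> l0 g0'; field; rewrite !gt_eqF// ltr_wpDl// ltW.
 by rewrite /D aux.
lra.
Qed.

End heat_average.

(** * The Green kernel represents point evaluation *)

Section green_pairing.
Context {R : realType} {n : nat} (s : R) (s01 : 0 < s < 1).
Local Notation mu := (@rV_lebesgue R n).
Local Notation leb := (@lebesgue_measure R).
Local Notation rV2 := ('rV[R]_n * 'rV[R]_n)%type.
Local Notation ek k := ((1 / 2 : R) ^+ k).
Local Notation jump k := (jdens s (ek k)).
Local Notation al k := ((ek k) `^ (- s) / s).
Context (kap : R) (kap0 : 0 < kap) (kapE : forall z : 'rV[R]_n, z != 0 ->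
 (\int[leb]_v (jdens s 0 v * gauss v z)%:E = (kap * enorm z `^ (- n%:R - 2 * s))%:E)%E).

Let s0 : 0 < s. Proof. by case/andP: s01. Qed.
Let j0 e t : 0 <= jdens s e t. Proof. exact: jump_ge0. Qed.
Let mj e : mfun (jdens s e). Proof. exact: m_jump. Qed.
Let jneg k t : t <= 0 -> jump k t = 0.
Proof. by move=> t0; rewrite /jdens ltNge (le_trans t0)// ltW// dyadic_gt0. Qed.
Let mje k : mfun (EFin \o jump k). Proof. by apply/mEFinP; exact: mj. Qed.
Let je0 k t : setT t -> (0 <= (EFin \o jump k) t)%E. Proof. by rewrite /= lee_fin. Qed.
Let massE k : (\int[leb]_t (jump k t)%:E = (al k)%:E)%E. Proof. exact: (jump_mass s01 (dyadic_gt0 k)). Qed.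

(** Truncating the small times makes the kernel bounded; as k grows it increases to kap
    |z|^(-n-2s). *)
Definition mixture (k : nat) (z : 'rV[R]_n) : R := fine (\int[leb]_t (jump k t * gauss t z)%:E).

Lemma m_jump_gauss k :
 mfun (fun w : 'rV[R]_n * measurableTypeR R => (jump k w.2 * gauss w.2 w.1)%:E).
Proof.
apply/mEFinP; apply: mfunM; first exact: (mcomp (mj (ek k)) msnd).
by apply: m_gauss2; [exact: msnd|exact: mfst].
Qed.

Let jg0 k (w : 'rV[R]_n * measurableTypeR R) : (0 <= (jump k w.2 * gauss w.2 w.1)%:E)%E.
Proof. by rewrite lee_fin mulr_ge0 ?gauss_ge0. Qed.

Lemma mixtureE k (z : 'rV[R]_n) : (\int[leb]_t (jump k t * gauss t z)%:E)%E = (mixture k z)%:E.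
Proof.
rewrite /mixture; have [] := @ge0_le_EFinP R (\int[leb]_t (jump k t * gauss t z)%:E)%E (gpeak (n := n) (ek k) * al k).
- by apply: int_ge0 => t _; exact: (jg0 k (z, t)).
- have p0 : (0 <= (gpeak (n := n) (ek k))%:E)%E by rewrite lee_fin powR_ge0.
 rewrite EFinM -massE -(@intZl _ _ _ leb _ mTT _ (mje k) _ (@je0 k) p0).
 apply: le_int_sup => t; first exact: (jg0 k (z, t)).
 rewrite -EFinM lee_fin mulrC /jdens; case: ifP => [et|_]; last by rewrite !mulr0.
 have t0 := lt_trans (dyadic_gt0 k) et.
 apply: ler_wpM2r; first exact: powR_ge0.
 by apply: (le_trans (gauss_le_peak z t0)); apply: gauss_peak_le; [exact: dyadic_gt0|exact: ltW].
- by move=> r -> _.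
Qed.

Lemma mixture_ge0 k z : 0 <= mixture k z.
Proof. by rewrite -lee_fin -mixtureE; apply: int_ge0 => t _; exact: (jg0 k (z, t)). Qed.

Lemma m_mixture k : mfun (mixture k).
Proof.
apply: (mcomp (fine_measurable mTT)).
exact: (mtonF (m2 := leb) _ (m_jump_gauss k) (jg0 k)).
Qed.

Lemma mixture_le k (z : 'rV[R]_n) : z != 0 -> mixture k z <= kap * enorm z `^ (- n%:R - 2 * s).
Proof.
move=> z0; rewrite -lee_fin -mixtureE -kapE//; apply: le_int_sup => t; first exact: (jg0 k (z, t)).
rewrite lee_fin ler_wpM2r ?gauss_ge0// /jdens; case: ifP => [et|_]; last by case: ifP; rewrite ?powR_ge0.
by rewrite (lt_trans (dyadic_gt0 k) et).
Qed.

Lemma mixture_cvg (z : 'rV[R]_n) : z != 0 ->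
 mixture k z @[k --> \oo] --> kap * enorm z `^ (- n%:R - 2 * s).
Proof.
move=> z0; apply: fine_cvg; rewrite -kapE//; apply: cvg_int_ge0.
- move=> k; exact: (mcomp (m_jump_gauss k) (mpair1 z)).
- by move=> k t; exact: (jg0 k (z, t)).
- move=> t i j ij; rewrite lee_fin ler_wpM2r ?gauss_ge0// /jdens.
 case: ifP => [et|_]; last by case: ifP; rewrite ?powR_ge0.
 by rewrite (le_lt_trans (dyadic_le ij) et).
- move=> t; apply: cvg_EFin; first exact: nearW.
 apply: cvg_near_cst; rewrite /= /jdens; have [t0|t0] := ltP 0 t; last first.
 by apply: nearW => k; rewrite ltNge (le_trans t0)// ltW// dyadic_gt0.
 have /cvgrPdist_lt /(_ t t0) := @cvg_dyadic R; apply: filterS => k.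
 by rewrite sub0r normrN gtr0_norm ?dyadic_gt0// => ->.
Qed.

Lemma mixtureN k (z : 'rV[R]_n) : mixture k (- z) = mixture k z.
Proof.
have E : (fun t => (jump k t * gauss t (- z))%:E) = (fun t => (jump k t * gauss t z)%:E).
 by apply/funext => t; rewrite gaussN.
by rewrite /mixture E.
Qed.

Opaque mixture heat gauss.

Lemma mixture_tonelli k (f : rV2 -> R) : mfun f -> (forall z, 0 <= f z) ->
 (\int[mu \x mu]_z (f z * mixture k (z.1 - z.2))%:E =
 \int[leb]_t ((jump k t)%:E * \int[mu \x mu]_z (f z * gauss t (z.1 - z.2))%:E))%E.
Proof.
move=> mf f0.
pose g (w : rV2 * measurableTypeR R) := (f w.1 * (jump k w.2 * gauss w.2 (w.1.1 - w.1.2)))%:E.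
have mg : mfun g.
 apply/mEFinP; apply: mfunM; first exact: (mcomp mf mfst).
 apply: mfunM; first exact: (mcomp (mj (ek k)) msnd).
 apply: m_gauss2; first exact: msnd.
 by apply: m_rVB; [exact: (mcomp mfst mfst)|
 exact: (mcomp msnd mfst)].
have g0 w : (0 <= g w)%E by rewrite lee_fin; apply: mulr_ge0 => //; rewrite mulr_ge0 ?gauss_ge0.
transitivity (\int[mu \x mu]_z \int[leb]_t g (z, t))%E.
 apply: eqint => z _; rewrite EFinM -mixtureE.
 have f0' : (0 <= (f z)%:E)%E by rewrite lee_fin.
 have h0 t : setT t -> (0 <= (jump k t * gauss t (z.1 - z.2))%:E)%E by move=> _; exact: (jg0 k (z.1 - z.2, t)).
 have mh : mfun (fun t => (jump k t * gauss t (z.1 - z.2))%:E).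
 exact: (mcomp (m_jump_gauss k) (mpair1 (z.1 - z.2))).
 by rewrite -(@intZl _ _ _ leb _ mTT _ mh _ h0 f0').
have := @fubini_tonelli _ _ rV2 _ R (@pair_lebesgue R n) leb g mg g0.
rewrite int_pair => ->; apply: eqint => t _.
rewrite int_pair.
have jt0 : (0 <= (jump k t)%:E)%E by rewrite lee_fin.
have h0 z : setT z -> (0 <= (f z * gauss t (z.1 - z.2))%:E)%E by rewrite lee_fin mulr_ge0 ?gauss_ge0.
have mh : mfun (fun z => (f z * gauss t (z.1 - z.2))%:E).
 by apply/mEFinP; apply: mfunM => //; exact: m_gauss_diff.
rewrite -(@intZl _ _ _ (mu \x mu)%E _ mTT _ mh _ h0 jt0).
by apply: eqint => z _; rewrite -EFinM; congr EFin; rewrite /=; ring.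
Qed.

Lemma integral_pair_swap (f : rV2 -> \bar R) : mfun f -> (forall z, (0 <= f z)%E) ->
 (\int[mu \x mu]_z f (z.2, z.1) = \int[mu \x mu]_z f z)%E.
Proof.
move=> mf f0; have mg : mfun (fun z : rV2 => f (z.2, z.1)).
 apply: (mcomp mf); apply/measurable_fun_pairP.
 by split; [exact: msnd|exact: mfst].
by rewrite (fubini_tonelli1 _ mg (fun z => f0 _)) (fubini_tonelli2 _ mf f0).
Qed.

Context (rho : R -> R) (mrho : mfun rho) (rho0 : forall t, 0 <= rho t).
Context (rho_le0 : forall t, t <= 0 -> rho t = 0) (rho1 : (\int[leb]_t (rho t)%:E <= 1)%E).
Context (x0 : 'rV[R]_n) (v : 'rV[R]_n -> R) (mv : mfun v) (M : R) (M0 : 0 < M).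
Context (vM : forall x, 0 <= v x <= M).
Context (w : 'rV[R]_n -> R) (mw : mfun w) (w0 : forall x, 0 <= w x).
Context (w_integral : forall f : 'rV[R]_n -> \bar R, mfun f -> (forall x, (0 <= f x)%E) ->
 (\int[mu]_x ((w x)%:E * f x) = \int[leb]_t ((rho t)%:E * \int[mu]_x ((gauss t (x - x0))%:E * f x)))%E).
Local Notation F := (heat v x0).

Let v0 x : 0 <= v x. Proof. by case/andP: (vM x). Qed.
Let F0 t : 0 <= F t. Proof. by case/andP: (heat_bound vM x0 t). Qed.
Let FM t : F t <= M. Proof. by case/andP: (heat_bound vM x0 t). Qed.

Let rhoF_le (G : R -> R) : (forall t, 0 <= G t <= M) ->
 exists2 r, (\int[leb]_t (rho t * G t)%:E)%E = r%:E & 0 <= r <= M.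
Proof.
move=> GM; apply: ge0_le_EFinP.
 by apply: int_ge0 => t _; have /andP[G0 _] := GM t; rewrite lee_fin mulr_ge0.
apply: (@le_trans _ _ (\int[leb]_t (M%:E * (rho t)%:E))%E).
 apply: le_int_sup => t; have /andP[G0 G1] := GM t; first by rewrite lee_fin mulr_ge0.
 by rewrite -EFinM lee_fin mulrC ler_wpM2r.
have r0' t : setT t -> (0 <= (rho t)%:E)%E by rewrite lee_fin.
have mr' : mfun (EFin \o rho) by exact/mEFinP.
have M0' : (0 <= M%:E)%E by rewrite lee_fin ltW.
rewrite (@intZl _ _ _ leb _ mTT _ mr' _ r0' M0').
by apply: (le_trans (lee_pM2l M0' rho1)); rewrite mule1.
Qed.

Lemma green_heat : (\int[mu]_x (v x * w x)%:E = \int[leb]_t (rho t * F t)%:E)%E.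
Proof.
have mv' : mfun (EFin \o v) by exact/mEFinP.
have v0' x : (0 <= (EFin \o v) x)%E by rewrite /= lee_fin.
transitivity (\int[mu]_x ((w x)%:E * (EFin \o v) x))%E.
 by apply: eqint => x _; rewrite mulrC EFinM.
rewrite w_integral//; apply: eqint => t _.
have [t0|t0] := leP t 0; first by rewrite rho_le0// mul0e mul0r.
by rewrite EFinM -(heat_gauss mv vM x0 t0); congr (_ * _)%E; apply: eqint => x _; rewrite -EFinM.
Qed.

(** The semigroup law merges the two Gaussians into one at time t + u. Spatial convolution thus
    becomes a time shift of [heat], which is how the spatial problem reduces to the renewal
    equation. *)
Lemma heat_shift u : 0 < u ->
 (\int[mu \x mu]_z (v z.1 * w z.2 * gauss u (z.1 - z.2))%:E = \int[leb]_t (rho t * F (t + u))%:E)%E.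
Proof.
move=> u0.
have mf : mfun (fun z : rV2 => (v z.1 * w z.2 * gauss u (z.1 - z.2))%:E).
 apply/mEFinP; apply: mfunM; last exact: m_gauss_diff.
 by apply: mfunM; [exact: (mcomp mv mfst)|exact: (mcomp mw msnd)].
have f0 (z : rV2) : (0 <= (v z.1 * w z.2 * gauss u (z.1 - z.2))%:E)%E.
 by rewrite lee_fin mulr_ge0 ?gauss_ge0// mulr_ge0.
rewrite (fubini_tonelli2 _ mf f0) /fubini_G /=.
have mg : mfun (fun z : rV2 => (v z.1 * gauss u (z.1 - z.2))%:E).
 apply/mEFinP; apply: mfunM; last exact: m_gauss_diff.
 exact: (mcomp mv mfst).
have g0 (z : rV2) : (0 <= (v z.1 * gauss u (z.1 - z.2))%:E)%E by rewrite lee_fin mulr_ge0 ?gauss_ge0.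
pose V y := (\int[mu]_x (v x * gauss u (x - y))%:E)%E.
have mV : mfun V by exact: (mtonG _ mg g0).
have V0 y : (0 <= V y)%E by apply: int_ge0 => x _; exact: (g0 (x, y)).
transitivity (\int[mu]_y ((w y)%:E * V y))%E.
 apply: eqint => y _; have w0' : (0 <= (w y)%:E)%E by rewrite lee_fin.
 have mgy : mfun (fun x => (v x * gauss u (x - y))%:E).
 exact: (mcomp mg (mpair2 y)).
 have g0y x : setT x -> (0 <= (v x * gauss u (x - y))%:E)%E by move=> _; exact: (g0 (x, y)).
 rewrite -(@intZl _ _ _ mu _ mTT _ mgy _ g0y w0').
 by apply: eqint => x _; rewrite -EFinM; congr EFin; ring.
rewrite w_integral//; apply: eqint => t _.
have [t0|t0] := leP t 0; first by rewrite rho_le0// mul0e mul0r.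
rewrite EFinM; congr (_ * _)%E; have tu0 : 0 < t + u by rewrite addr_gt0.
rewrite -(heat_gauss mv vM x0 tu0).
pose h (z : rV2) := (v z.1 * (gauss t (z.2 - x0) * gauss u (z.1 - z.2)))%:E.
have mh : mfun h.
 apply/mEFinP; apply: mfunM; first exact: (mcomp mv mfst).
 apply: mfunM; last exact: m_gauss_diff.
 exact: (mcomp (m_gauss_at t x0) msnd).
have h0 z : (0 <= h z)%E by rewrite lee_fin; apply: mulr_ge0 => //; rewrite mulr_ge0 ?gauss_ge0.
transitivity (\int[mu]_y \int[mu]_x h (x, y))%E.
 apply: eqint => y _; have gt0 : (0 <= (gauss t (y - x0))%:E)%E by rewrite lee_fin gauss_ge0.
 have mgy : mfun (fun x => (v x * gauss u (x - y))%:E).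
 exact: (mcomp mg (mpair2 y)).
 have g0y x : setT x -> (0 <= (v x * gauss u (x - y))%:E)%E by move=> _; exact: (g0 (x, y)).
 rewrite -(@intZl _ _ _ mu _ mTT _ mgy _ g0y gt0).
 by apply: eqint => x _; rewrite -EFinM /h/= mulrCA.
rewrite -(fubini_tonelli (m1 := mu) (m2 := mu) h mh h0); apply: eqint => x _.
have mk : mfun (fun y : 'rV[R]_n => (gauss t (y - x0) * gauss u (x - y))%:E).
 apply/mEFinP; apply: mfunM; first exact: m_gauss_at.
 apply: m_gauss2; first exact: mcst.
 by apply: m_rVB; [exact: mcst|exact: mid].
have k0 y : (0 <= (gauss t (y - x0) * gauss u (x - y))%:E)%E by rewrite lee_fin mulr_ge0 ?gauss_ge0.
have v0' : (0 <= (v x)%:E)%E by rewrite lee_fin.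
transitivity ((v x)%:E * \int[mu]_y (gauss t (y - x0) * gauss u (x - y))%:E)%E.
 by rewrite -(@intZl _ _ _ mu _ mTT _ mk _ (fun y _ => k0 y) v0').
rewrite -(integral_rV_shift x0 mk k0) [RHS]EFinM muleC; congr (_ * _)%E.
have -> : t + u = u + t by rewrite addrC.
rewrite -(gauss_semigroup (x - x0) u0 t0); apply: eqint => y _.
have -> : x - (y + x0) = x - x0 - y by rewrite opprD addrA addrAC.
by rewrite addrK mulrC.
Qed.

Context (L : R -> R) (L0 : forall e, 0 < e -> 0 <= L e)
 (HL : forall e x y, 0 < e -> `|v x - v y| <= e + L e * enorm (x - y)).
Context (Hint : (\int[nu n]_z `|Ds s v z * Ds s w z|%:E < +oo)%E).
Context (Hren : forall (M : R) (dlt : R -> R), 0 < M -> (forall e, 0 < e -> 0 < dlt e) ->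
 forall eta, 0 < eta -> exists K, forall k, (K <= k)%N ->
 forall F, tclass M dlt F ->
 `|(1 + 2 / kap * al k) * fine (\int[leb]_t (rho t * F t)%:E)%E
 - 2 / kap * fine (\int[leb]_x ((jump k x)%:E * \int[leb]_t (rho t * F (t + x))%:E))%E
 - F 0| <= eta).

(** (v(x) - v(y)) (w(x) - w(y)) is expanded into four products, each integrable against the
    truncated mixture: two give al X, two give the jump term T k. This produces the constant 2/kap
    of the renewal equation. The truncation is removed by dominated convergence. *)
Lemma green_pairing : Ws_pairing s v w = v x0.
Proof.
have [X XE _] := rhoF_le (fun t => heat_bound vM x0 t).
pose T k := (\int[leb]_x ((jump k x)%:E * \int[leb]_t (rho t * F (t + x))%:E))%E.
have jumpZ k (h : R -> \bar R) b : 0 <= b -> (forall t, 0 < t -> h t = b%:E) ->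
 (\int[leb]_t ((jump k t)%:E * h t) = (al k * b)%:E)%E.
 move=> b0 hb; transitivity (\int[leb]_t (b%:E * (EFin \o jump k) t))%E.
 apply: eqint => t _; have [t0|t0] := leP t 0; first by rewrite /= jneg// mul0e mule0.
 by rewrite hb// muleC.
 have b0' : (0 <= b%:E)%E by rewrite lee_fin.
 by rewrite (@intZl _ _ _ leb _ mTT _ (mje k) _ (@je0 k) b0') [X in (_ * X)%E](massE k) -EFinM mulrC.
have X0 : 0 <= X by rewrite -lee_fin -XE; apply: int_ge0 => t _; rewrite lee_fin mulr_ge0.
have TE k : exists2 r, T k = r%:E & 0 <= r.
 have [||r rE /andP[r0 _]] := @ge0_le_EFinP R (T k) (al k * M); last by exists r.
 apply: int_ge0 => x _; apply: mule_ge0; first by rewrite lee_fin.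
 by apply: int_ge0 => t _; rewrite lee_fin mulr_ge0.
 rewrite -(jumpZ k (cst M%:E) M)//; last exact: ltW.
 apply: le_int_sup => x.
 apply: mule_ge0; first by rewrite lee_fin.
 by apply: int_ge0 => t _; rewrite lee_fin mulr_ge0.
 apply: lee_pM2l; first by rewrite lee_fin.
 have [r -> /andP[_ rM]] := rhoF_le (fun t => heat_bound vM x0 (t + x)).
 by rewrite lee_fin.
have mq k : mfun (fun z : rV2 => mixture k (z.1 - z.2)).
 apply: (mcomp (m_mixture k)).
 by apply: m_rVB; [exact: mfst|exact: msnd].
have q0 k (z : rV2) : 0 <= mixture k (z.1 - z.2) by exact: mixture_ge0.
have mc (p : 'rV[R]_n -> R) : mfun p ->
 mfun (fun z : rV2 => p z.1) /\ mfun (fun z : rV2 => p z.2).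
 by move=> mp; split; [exact: (mcomp mp mfst)|exact: (mcomp mp msnd)].
have [mv1 mv2] := mc v mv; have [mw1 mw2] := mc w mw.
have mvw : mfun (fun x => v x * w x) by exact: (mfunM mv mw).
have vw0 x : 0 <= v x * w x by exact: mulr_ge0.
have P11 : mfun (fun z : rV2 => v z.1 * w z.1) by exact: (mfunM mv1 mw1).
have N11 (z : rV2) : 0 <= v z.1 * w z.1 by exact: mulr_ge0.
have P22 : mfun (fun z : rV2 => v z.2 * w z.2) by exact: (mfunM mv2 mw2).
have N22 (z : rV2) : 0 <= v z.2 * w z.2 by exact: mulr_ge0.
have P12 : mfun (fun z : rV2 => v z.1 * w z.2) by exact: (mfunM mv1 mw2).
have N12 (z : rV2) : 0 <= v z.1 * w z.2 by exact: mulr_ge0.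
pose f1 k (z : rV2) := v z.1 * w z.1 * mixture k (z.1 - z.2).
pose f2 k (z : rV2) := v z.2 * w z.2 * mixture k (z.1 - z.2).
pose f3 k (z : rV2) := v z.1 * w z.2 * mixture k (z.1 - z.2).
pose f4 k (z : rV2) := v z.2 * w z.1 * mixture k (z.1 - z.2).
have I1 k : (\int[mu \x mu]_z (f1 k z)%:E = (al k * X)%:E)%E.
 etransitivity; first exact: (mixture_tonelli k P11 N11).
 apply: jumpZ => // t t0; by rewrite (integral_gauss_pair1 t0 mvw vw0) green_heat XE.
have I2 k : (\int[mu \x mu]_z (f2 k z)%:E = (al k * X)%:E)%E.
 etransitivity; first exact: (mixture_tonelli k P22 N22).
 apply: jumpZ => // t t0; by rewrite (integral_gauss_pair2 t0 mvw vw0) green_heat XE.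
have mf3 k : mfun (fun z => (f3 k z)%:E).
 by apply/mEFinP; exact: (mfunM (mfunM mv1 mw2) (mq k)).
have f30 k z : (0 <= (f3 k z)%:E)%E by rewrite lee_fin !mulr_ge0.
have I3 k : (\int[mu \x mu]_z (f3 k z)%:E = T k)%E.
 etransitivity; first exact: (mixture_tonelli k P12 N12).
 apply: eqint => t _; have [t0|t0] := leP t 0; first by rewrite jneg// !mul0e.
 by rewrite heat_shift.
have I4 k : (\int[mu \x mu]_z (f4 k z)%:E = T k)%E.
 rewrite -I3 -(integral_pair_swap (mf3 k) (f30 k)); apply: eqint => z _.
 by rewrite /f4 /f3/= -mixtureN opprB.
have integ (f : rV2 -> R) r : mfun f -> (forall z, 0 <= f z) ->
 (\int[mu \x mu]_z (f z)%:E = r%:E)%E -> (mu \x mu)%E.-integrable setT (EFin \o f).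
 move=> mf f0 fr; apply/integrableP; split; first exact/mEFinP.
 have -> : (\int[mu \x mu]_z `|(EFin \o f) z| = r%:E)%E.
 by rewrite -fr; apply: eqint => z _; rewrite /= ger0_norm.
 by rewrite ltry.
have GE k : (\int[mu \x mu]_z ((v z.1 - v z.2) * (w z.1 - w z.2) * mixture k (z.1 - z.2))%:E =
 (2 * (al k * X) - 2 * fine (T k))%:E)%E.
 have [r rE _] := TE k; rewrite rE /=.
 have J1 : (mu \x mu)%E.-integrable setT (EFin \o f1 k).
 apply: (integ _ _ _ _ (I1 k)) => [|z]; last by rewrite !mulr_ge0.
 exact: (mfunM (mfunM mv1 mw1) (mq k)).
 have J2 : (mu \x mu)%E.-integrable setT (EFin \o f2 k).
 apply: (integ _ _ _ _ (I2 k)) => [|z]; last by rewrite !mulr_ge0.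
 exact: (mfunM (mfunM mv2 mw2) (mq k)).
 have J3 : (mu \x mu)%E.-integrable setT (EFin \o f3 k).
 apply: (integ _ r _ _ _) => [|z|]; [|by rewrite !mulr_ge0|by rewrite I3].
 exact: (mfunM (mfunM mv1 mw2) (mq k)).
 have J4 : (mu \x mu)%E.-integrable setT (EFin \o f4 k).
 apply: (integ _ r _ _ _) => [|z|]; [|by rewrite !mulr_ge0|by rewrite I4].
 exact: (mfunM (mfunM mv2 mw1) (mq k)).
 have J12 : (mu \x mu)%E.-integrable setT (EFin \o (f1 k \+ f2 k)%R) by exact: (integrableD mTT J1 J2).
 have J34 : (mu \x mu)%E.-integrable setT (EFin \o (f3 k \+ f4 k)%R) by exact: (integrableD mTT J3 J4).
 have := integralB_EFin mTT J12 J34.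
 have -> : (\int[mu \x mu]_z ((EFin \o (f1 k \+ f2 k)%R) z - (EFin \o (f3 k \+ f4 k)%R) z) =
 \int[mu \x mu]_z ((v z.1 - v z.2) * (w z.1 - w z.2) * mixture k (z.1 - z.2))%:E)%E.
 by apply: eqint => z _; rewrite /= -EFinB /f1 /f2 /f3 /f4; congr EFin; ring.
 move=> ->.
 have E12 : (\int[mu \x mu]_z (EFin \o (f1 k \+ f2 k)%R) z = (al k * X + al k * X)%:E)%E.
 by rewrite EFinD -{1}I1 -I2; exact: (integralD_EFin mTT J1 J2).
 have E34 : (\int[mu \x mu]_z (EFin \o (f3 k \+ f4 k)%R) z = (r + r)%:E)%E.
 by rewrite EFinD -rE -{1}I3 -I4; exact: (integralD_EFin mTT J3 J4).
 rewrite E12 E34 -EFinB; congr EFin; ring.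
pose h z : R := Ds s v z * Ds s w z * nu_density z.
have mD : mfun (fun z => Ds s v z * Ds s w z) by apply: mfunM; exact: m_Ds.
have mh : mfun h by apply: mfunM => //; exact: measurable_nu_density.
have ih : (mu \x mu)%E.-integrable setT (fun z => `|h z|%:E).
 have mah : mfun (fun z => `|h z|) by apply: mcomp => //; exact: mnormr.
 apply/integrableP; split; first exact/mEFinP.
 apply: le_lt_trans Hint; rewrite (@int_nu R n)//; last first.
 by apply/mEFinP; apply: mcomp => //; exact: mnormr.
 apply: eq_imp_le; apply: eqint => z _.
 by rewrite /= normr_id /h normrM (ger0_norm (powR_ge0 _ _)) EFinM.
pose h_ k z : R := kap^-1 * ((v z.1 - v z.2) * (w z.1 - w z.2) * mixture k (z.1 - z.2)).
have hE (z : rV2) : z.1 - z.2 != 0 ->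
 h z = kap^-1 * ((v z.1 - v z.2) * (w z.1 - w z.2) * (kap * enorm (z.1 - z.2) `^ (- n%:R - 2 * s))).
 move=> z0; have e0 := enorm_gt0 z0; rewrite /h /Ds /nu_density.
 have -> : enorm (z.1 - z.2) `^ (- n%:R - 2 * s) =
 (enorm (z.1 - z.2) `^ s)^-1 * ((enorm (z.1 - z.2) `^ s)^-1 * enorm (z.1 - z.2) `^ (- n%:R)).
 by rewrite -(powRN _ s) -!powRDp//; congr (_ `^ _); ring.
 set p := _^-1; set r := enorm _ `^ _; set dv := v _ - _; set dw := _ - _.
 have -> : kap^-1 * (dv * dw * (kap * (p * (p * r)))) = (kap^-1 * kap) * (dv * dw * (p * (p * r))) by ring.
 by rewrite mulVf ?gt_eqF// mul1r; ring.
have diag0 (z : rV2) : z.1 - z.2 = 0 -> v z.1 - v z.2 = 0.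
 by move=> /eqP; rewrite subr_eq0 => /eqP ->; rewrite subrr.
have mdd : mfun (fun z : rV2 => (v z.1 - v z.2) * (w z.1 - w z.2)).
 exact: (mfunM (mfunB mv1 mv2) (mfunB mw1 mw2)).
have mddq k : mfun (fun z : rV2 => (v z.1 - v z.2) * (w z.1 - w z.2) * mixture k (z.1 - z.2)).
 exact: (mfunM mdd (mq k)).
have mh_ k : mfun (h_ k).
 exact: (mfunM (mcst (kap^-1 : R)) (mddq k)).
have [] := @dominated_convergence _ _ R (mu \x mu)%E setT mTT (fun k z => (h_ k z)%:E)
 (fun z => (h z)%:E) (fun z => `|h z|%:E).
- by move=> k; exact/mEFinP.
- exact/mEFinP.
- apply: aeW => z _; apply: cvg_EFin; first exact: nearW.
 have [z0|z0] := eqVneq (z.1 - z.2) 0.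
 have -> : h z = 0 by rewrite /h /Ds diag0// !mul0r.
 by rewrite /h_ diag0//= (_ : (fun k => _) = cst 0); [exact: cvg_cst|apply/funext => k /=; rewrite !mul0r mulr0].
 rewrite hE//; apply: cvgM; first exact: cvg_cst.
 by apply: cvgM; [exact: cvg_cst|exact: mixture_cvg].
- exact: ih.
- apply: aeW => z k _; rewrite lee_fin; have [z0|z0] := eqVneq (z.1 - z.2) 0.
 by rewrite /h_ diag0// !mul0r mulr0 normr0.
 rewrite hE// /h_ !normrM; apply: ler_wpM2l => //; apply: ler_wpM2l; first exact: mulr_ge0.
 by rewrite -normrM (ger0_norm (mixture_ge0 _ _)) (le_trans (mixture_le k z0))// ler_norm.
move=> ihh _ cvh.
have limE : (kap^-1 * (2 * (al k * X) - 2 * fine (T k))) @[k --> \oo] --> fine (\int[mu \x mu]_z (h z)%:E)%E.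
 have e k : (\int[mu \x mu]_z (h_ k z)%:E = (kap^-1 * (2 * (al k * X) - 2 * fine (T k)))%:E)%E.
 rewrite [RHS]EFinM -GE -integralZl//; last first.
 apply: (@le_integrable _ _ R (mu \x mu)%E setT mTT _ (fun z => (kap * `|h z|)%:E)) => //.
 + by apply/mEFinP; exact: mddq.
 + move=> z _; rewrite lee_fin; have [z0|z0] := eqVneq (z.1 - z.2) 0.
 by rewrite diag0// !mul0r normr0.
 rewrite (ger0_norm (_ : 0 <= kap * `|h z|)) ?mulr_ge0 ?(ltW kap0)// hE// !normrM.
 rewrite (ger0_norm (_ : 0 <= kap^-1)) ?invr_ge0 ?(ltW kap0)// mulVKf ?gt_eqF//.
 apply: ler_wpM2l; first exact: mulr_ge0.
 by rewrite (ger0_norm (mixture_ge0 _ _)) (le_trans (mixture_le k z0))// -normrM ler_norm.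
 + have := integrableZl mTT kap ih; apply: eq_integrable => // z _; by rewrite EFinM.
 have If : (\int[mu \x mu]_z (h z)%:E)%E \is a fin_num by exact: int_fin.
 move: cvh; rewrite -(fineK If) => /fine_cvg; apply: cvg_trans; apply: near_eq_cvg.
 by apply: nearW => k; rewrite /= e.
rewrite /Ws_pairing /Rintegral green_heat XE integral_nu//.
(* The same sequence tends to the pairing, by dominated convergence, and to F 0 = v x0, by the
   renewal equation tested against [heat]. *)
have l1 : (X + kap^-1 * (2 * (al k * X) - 2 * fine (T k))) @[k --> \oo] --> X + fine (\int[mu \x mu]_z (h z)%:E)%E.
 by apply: cvgD; [exact: cvg_cst|exact: limE].
apply: (cvg_unique _ l1) => //; apply/cvgrPdist_le => eta eta0.
have dlt0 e : 0 < e -> 0 < (e / (2 * (L (e / 2) + 1) * (@gauss_lip R n + 1))) ^+ 2.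
 move=> e0; rewrite exprn_gt0// divr_gt0// mulr_gt0 ?mulr_gt0//.
 by rewrite ltr_wpDl// L0// divr_gt0.
 by rewrite ltr_wpDl// ltW// gauss_lip_gt0.
have [K HK] := Hren M0 dlt0 eta0.
exists K => // k Kk; have := HK k Kk F (heat_modulus mv vM x0 L0 HL).
rewrite XE (heat0 vM x0) -/(T k) [fine X%:E]/= => H; rewrite distrC; apply: le_trans H.
apply: eq_imp_le; congr `|_|; move: (fine (T k)) => Tk; ring.
Qed.

End green_pairing.

(** * Boundedness and Lipschitz bounds of test functions *)

Section compact_smooth.
Context {R : realType} {n : nat}.
Local Notation mu := (@rV_lebesgue R n).
Implicit Types (f u : 'rV[R]_n -> R) (x y : 'rV[R]_n).
Local Notation e_ i := (delta_mx ord0 i : 'rV[R]_n).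

Definition null_beyond (r : R) f := forall x, r < enorm x -> f x = 0.

Lemma enorm_ball_compact r : compact [set x : 'rV[R]_n | enorm x <= r].
Proof.
apply: bounded_closed_compact.
 exists r; split; first exact: num_real.
 move=> M rM x Kx; rewrite /= [leLHS]mx_normrE; apply: bigmax_le; first exact: le_trans (enorm_ge0 x) (le_trans Kx (ltW rM)).
 move=> [i j] _ /=; rewrite ord1; exact: le_trans (coord_le_enorm x j) (le_trans Kx (ltW rM)).
rewrite (_ : [set x | _] = @enorm R n @^-1` [set t | t <= r])//.
by apply: closed_comp => [x _|]; [exact: enorm_continuous|exact: closed_le].
Qed.

Lemma vanishing_bounded r f : continuous f -> null_beyond r f ->
 exists2 M, 0 < M & forall x, `|f x| <= M.
Proof.
move=> cf vf; pose K := [set x : 'rV[R]_n | enorm x <= r].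
have cK : compact K by exact: enorm_ball_compact.
have [M [_ HM]] : bounded_set (f @` K).
 by apply: compact_bounded; apply: continuous_compact => //; exact: continuous_subspaceT.
exists (`|M| + 1); first by rewrite ltr_wpDl.
have MM : M < `|M| + 1 by rewrite (le_lt_trans (ler_norm M))// ltrDl.
move=> x; have [xr|xr] := leP (enorm x) r; last by rewrite vf// normr0 addr_ge0.
by apply: (HM _ MM); exists x.
Qed.

Lemma partial_vanishing r f i : null_beyond r f -> null_beyond r (partial i f).
Proof.
move=> vf x rx; rewrite /partial (@near_eq_derive _ _ _ f (cst 0)) ?derive_cst//.
have oU : open (@enorm R n @^-1` [set t | r < t]).
 by apply: open_comp; [move=> y _; exact: enorm_continuous|exact: open_gt].
have : nbhs x (@enorm R n @^-1` [set t | r < t]) by exact: open_nbhs_nbhs.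
by apply: filterS => y ry; rewrite vf.
Qed.

Lemma partials_vanishing r f l : null_beyond r f -> null_beyond r (foldr (@partial R n) f l).
Proof. by move=> vf; elim: l => //= i l IH; exact: partial_vanishing. Qed.

Lemma test_vanishing Om v : test_functions Om v -> exists r, null_beyond r v.
Proof.
move=> [_ cK _].
have [M [_ HM]] : bounded_set (@enorm R n @` closure [set x | v x != 0]).
 apply: compact_bounded; apply: continuous_compact => //; apply: continuous_subspaceT; exact: enorm_continuous.
exists (M + 1) => x Mx; apply/eqP; apply/negPn/negP => vx.
have : `|enorm x| <= M + 1 by apply: HM; [rewrite ltrDl|exists x => //; exact: subset_closure].
by rewrite ger0_norm ?enorm_ge0// leNgt Mx.
Qed.

Lemma line_quotient f x i (h : R) :
 (fun t : R => t^-1 *: (f (x + (t *: (1 : R^o) + h : R) *: e_ i) - f (x + h *: e_ i))) =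
 (fun t : R => t^-1 *: (f (t *: e_ i + (x + h *: e_ i)) - f (x + h *: e_ i))).
Proof.
apply/funext => t; congr (_ *: (f _ - _)).
have -> : (t *: (1 : R^o) + h : R) = t + h by rewrite -[in RHS](mulr1 t).
by rewrite scalerDl addrCA.
Qed.

Lemma is_derive_line f x i (h : R) : derivable f (x + h *: e_ i) (e_ i) ->
 is_derive h (1 : R) (fun t : R => f (x + t *: e_ i)) (partial i f (x + h *: e_ i)).
Proof.
move=> df; apply: DeriveDef; first by rewrite /derivable line_quotient.
by rewrite /derive /partial line_quotient.
Qed.

Lemma partial_lip f i (M : R) : (forall x, derivable f x (e_ i)) -> (forall x, `|partial i f x| <= M) ->
 forall x (h : R), `|f (x + h *: e_ i) - f x| <= M * `|h|.
Proof.
move=> df fM; have key x (h : R) : 0 <= h -> `|f (x + h *: e_ i) - f x| <= M * h.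
 move=> h0; have dg (t : R) : is_derive t (1 : R) (fun t : R => f (x + t *: e_ i)) (partial i f (x + t *: e_ i)).
 by apply: is_derive_line; exact: df.
 have [|c _] := @MVT_segment R _ (fun t : R => partial i f (x + t *: e_ i)) 0 h h0 (fun t _ => dg t).
 by apply: derivable_within_continuous => t _; have [] := dg t.
 rewrite scale0r addr0 subr0 => ->; rewrite normrM (ger0_norm h0).
 by rewrite ler_wpM2r.
move=> x h; have [h0|h0] := leP 0 h; first by rewrite (ger0_norm h0); exact: key.
rewrite (ltr0_norm h0) distrC; have := key (x + h *: e_ i) (- h).
by rewrite -addrA -scalerDl subrr scale0r addr0; apply; rewrite oppr_ge0 ltW.
Qed.

(** The coordinates are changed one at a time, along z 0 = x, ..., z n = y. *)
Lemma lipschitz_of_partials f (M : R) : 0 <= M -> (forall i x, derivable f x (e_ i)) ->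
 (forall i x, `|partial i f x| <= M) ->
 forall x y, `|f x - f y| <= n%:R * M * enorm (x - y).
Proof.
move=> M0 df fM x y; pose z k : 'rV[R]_n := \row_j (if (j < k)%N then y ord0 j else x ord0 j).
have z0 : z 0%N = x by apply/rowP => j; rewrite mxE.
have zn : z n = y by apply/rowP => j; rewrite mxE ltn_ord.
have key k : (k <= n)%N -> `|f x - f (z k)| <= k%:R * M * enorm (x - y).
 elim: k => [_|k IH kn]; first by rewrite z0 subrr normr0 !mul0r.
 pose i := Ordinal kn.
 have zS : z k.+1 = z k + (y ord0 i - x ord0 i) *: e_ i.
 apply/rowP => j; rewrite !mxE ltnS leq_eqVlt; have [ji|ji] := eqVneq (j : nat) k.
 have -> : j = i by exact: val_inj.
 by rewrite /= ltnn !eqxx mulr1 addrCA subrr addr0.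
 by rewrite /= (_ : (j == i) = false) ?mulr0 ?addr0//; apply/negP => /eqP E; move: ji; rewrite E eqxx.
 rewrite -(subrK (f (z k)) (f x)) -addrA (le_trans (ler_normD _ _))//.
 rewrite -natr1 !mulrDl mul1r; apply: lerD; first exact: IH (ltnW kn).
 rewrite distrC zS (le_trans (partial_lip (df i) (fM i) _ _))//; apply: ler_wpM2l => //.
 by rewrite distrC; have := coord_le_enorm (x - y) i; rewrite !mxE.
by rewrite -[in f y]zn; exact: key.
Qed.

Lemma test_lipschitz Om v : test_functions Om v ->
 exists2 M, 0 < M & (forall x, `|v x| <= M) /\ (forall x y, `|v x - v y| <= M * enorm (x - y)).
Proof.
move=> tv; have [r vr] := test_vanishing tv; have [sv _ _] := tv.
have [cv dv] := sv [::].
have [M0 M00 HM0] := vanishing_bounded cv vr.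
have H i : exists M, 0 < M /\ forall x, `|partial i v x| <= M.
 have [ci _] := sv [:: i]; have [M Mp HM] := vanishing_bounded ci (partials_vanishing [:: i] vr).
 by exists M.
have [Mi HMi] := choice H.
pose M1 := \sum_i Mi i; have M10 : 0 <= M1 by apply: sumr_ge0 => i _; have [/ltW] := HMi i.
have HM1 i x : `|partial i v x| <= M1.
 have [Mp HM] := HMi i; apply: (le_trans (HM x)); rewrite /M1 (bigD1 i)//= lerDl.
 by apply: sumr_ge0 => j _; have [/ltW] := HMi j.
exists (M0 + n%:R * M1); first by rewrite ltr_pwDl// mulr_ge0.
split=> [x|x y]; first by rewrite (le_trans (HM0 x))// lerDl mulr_ge0.
apply: (le_trans (lipschitz_of_partials M10 dv HM1 x y)).
by rewrite ler_wpM2r ?enorm_ge0// lerDr ltW.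
Qed.

End compact_smooth.

(** * Functions of [Ws0] vanish outside Om *)

Lemma ptws_eval_continuous (I : Type) (V : topologicalType) (i : I) :
 continuous (fun g : {ptws I -> V} => g i).
Proof.
move=> g.
have /cvg_sup/(_ i) h : nbhs (g : {ptws I -> V}) --> (g : {ptws I -> V}) by exact: cvg_id.
apply: (cvg_trans _ (@initial_continuous _ _ (@proj I (fun=> V) i) g)).
by move=> Q QW; apply: h.
Qed.

Section vanishing.
Context {R : realType} {n : nat} (B : R -> R) (HB : nyoung B) (s : R).
Context (n0 : (0 < n)%N) (s01 : 0 < s < 1).
Context (A : R -> \bar R) (AB : forall t, 0 <= t -> A t = (B t)%:E).
Local Notation q := (s / (n%:R - s)).
Local Notation mu := (@rV_lebesgue R n).
Local Notation leb := (@lebesgue_measure R).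
Context (slope_lty : forall y, 0 < y -> (slope_integral B q y < +oo)%E).

(** [green_pairing] concerns nonnegative functions. A bounded v is raised by a constant, and the
    pairing of a constant with w is that constant because its D^s vanishes. *)
Lemma green_function (x0 : 'rV[R]_n) : exists w : 'rV[R]_n -> R,
 [/\ WsE s (complementary A) w, mfun w, (\int[nu n]_z `|Ds s w z|%:E < +oo)%E &
 forall (v : 'rV[R]_n -> R) (M : R) (L : R -> R), mfun v -> (forall x, `|v x| <= M) ->
 (forall e, 0 < e -> 0 <= L e) -> (forall e x y, 0 < e -> `|v x - v y| <= e + L e * enorm (x - y)) ->
 (\int[nu n]_z `|Ds s v z * Ds s w z|%:E < +oo)%E -> Ws_pairing s v w = v x0].
Proof.
have [kap kap0 kapE] := gauss_mixture (n := n) s01.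
have c0 : 0 < 2 / kap by rewrite divr_gt0.
have [rho [[mrho rho0 rho_le0 rho1 [C C0 rhoC]] Hren]] := renewal_kernel s01 c0.
have mw := m_green mrho rho0 x0; have w0 := green_ge0 rho0 x0.
set w := green rho x0 in mw w0 *.
have [DE DL] := green_Ds_E HB n0 s01 AB slope_lty mrho rho0 rho_le0 rho1 C0 rhoC x0.
have wE : WsE s (complementary A) w := green_WsE HB n0 s01 AB slope_lty mrho rho0 rho_le0 rho1 C0 rhoC x0.
exists w; split => // v M L mv vM L0 HL Hint.
pose GP := @green_pairing R n s s01 kap kap0 kapE rho mrho rho0 rho_le0 rho1 x0.
have wI := green_integral mrho rho0 rho_le0 rho1 x0.
pose M' := `|M| + 1; have M'0 : 0 < M' by rewrite ltr_wpDl.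
have vM' x : - M' <= v x <= M'.
 by rewrite -ler_norml (le_trans (vM x))// (le_trans (ler_norm M))// lerDl.
have iMw : mu.-integrable setT (EFin \o (fun x => M' * w x)).
 have i1 : mu.-integrable setT (EFin \o w).
 apply/integrableP; split; first exact/mEFinP.
 apply: (@le_lt_trans _ _ 1%E); last exact: ltry.
 apply: le_trans (greenE_mass mrho rho0 rho_le0 rho1 x0).
 apply: le_int_sup => x; first exact: abse_ge0.
 rewrite /= ger0_norm// /w /green; have := greenE_ge0 rho0 x0 x.
 by case: (greenE _ _ _) => [r| |]//=; rewrite leey.
 by have := integrableZl mTT M' i1; apply: eq_integrable.
have ivw : mu.-integrable setT (EFin \o (fun x => v x * w x)).
 apply: le_integrable iMw => //; first by apply/mEFinP; exact: (mfunM mv mw).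
 by move=> x _; rewrite /= lee_fin !normrM ler_wpM2r// (gtr0_norm M'0) ler_norml.
have P1 : Ws_pairing s (fun x => v x + M') w = v x0 + M'.
 have DE' : Ds s (fun x => v x + M') = Ds s v.
 by apply/funext => z; rewrite /Ds opprD addrACA subrr addr0.
 have mv' : mfun (fun x => v x + M') by exact: (mfunD mv (mcst _)).
 have M20 : 0 < 2 * M' by rewrite mulr_gt0.
 have b x : 0 <= v x + M' <= 2 * M' by have /andP[a b] := vM' x; apply/andP; split; lra.
 have H e x y : 0 < e -> `|v x + M' - (v y + M')| <= e + L e * enorm (x - y).
 by move=> e0; rewrite opprD addrACA subrr addr0; exact: HL.
 apply: (GP _ mv' (2 * M') M20 b w mw w0 wI L L0 H) => //; by rewrite DE'.
have P2 : Ws_pairing s (fun=> M') w = M'.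
 have D0 z : Ds s (fun _ : 'rV[R]_n => M') z = 0 by rewrite /Ds subrr mul0r.
 have b (x : 'rV[R]_n) : 0 <= M' <= M' by rewrite (ltW M'0) lexx.
 have H e (x y : 'rV[R]_n) : 0 < e -> `|M' - M'| <= e + 0 * enorm (x - y).
 by move=> e0; rewrite subrr normr0 mul0r addr0 ltW.
 apply: (GP _ (mcst M') M' M'0 b w mw w0 wI (fun=> 0) (fun _ _ => lexx 0) H) => //.
 rewrite (_ : (\int[nu n]_z _ = 0)%E)//; apply: integral0_eq => z _.
 by rewrite D0 mul0r normr0.
have e2 : (\int[nu n]_z (Ds s (fun=> M') z * Ds s w z) = 0)%R.
 rewrite /Rintegral (_ : (\int[nu n]_z _ = 0)%E)//; apply: integral0_eq => z _.
 by rewrite /Ds subrr !mul0r.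
move: P1 P2; rewrite /Ws_pairing e2 addr0 => P1 P2.
have E1 : (\int[mu]_x ((v x + M') * w x) = \int[mu]_x (v x * w x) + \int[mu]_x (M' * w x))%R.
 rewrite -RintegralD//; congr Rintegral; apply/funext => x; exact: mulrDl.
have DE' : Ds s (fun x => v x + M') = Ds s v.
 by apply/funext => z; rewrite /Ds opprD addrACA subrr addr0.
by move: P1; rewrite E1 P2 DE' => P1; apply: (addIr M'); rewrite -P1 addrAC.
Qed.

Lemma young_integrable (f g : 'rV[R]_n * 'rV[R]_n -> R) :
 mfun f -> mfun g ->
 (\int[nu n]_z (B `|f z|)%:E < +oo)%E -> orlicz_E (nu n) (complementary A) g ->
 (\int[nu n]_z `|f z * g z|%:E < +oo)%E.
Proof.
move=> mf mg If [_ /(_ 1 ltr01) Ig].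
have mB : mfun (fun z => (B `|f z|)%:E) by exact: m_young.
have mfg : mfun (fun z => `|f z * g z|).
 apply: mcomp; first exact: mnormr.
 exact: (mfunM mf mg).
(* h stands in for the complementary function at |g|: it lies below it and is visibly measurable. *)
pose h z := Num.max (`|f z * g z| - B `|f z|) 0.
have mh : mfun (fun z => (h z)%:E).
 apply/mEFinP; apply: measurable_maxr; last exact: mcst.
 by apply: mfunB => //; exact/mEFinP.
have B0 z : setT z -> (0 <= (B `|f z|)%:E)%E by rewrite lee_fin nyoung_ge0.
have h0 z : setT z -> (0 <= (h z)%:E)%E by rewrite lee_fin le_max lexx orbT.
apply: (@le_lt_trans _ _ (\int[nu n]_z ((B `|f z|)%:E + (h z)%:E))%E).
 apply: le_int_sup => z; first by rewrite lee_fin.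
 by rewrite -EFinD lee_fin -lerBlDl le_max lexx.
rewrite (@intD _ _ _ (nu n) _ mTT _ _ B0 mB h0 mh) lte_add_pinfty//.
apply: le_lt_trans Ig; apply: le_int_sup => z; first exact: h0.
rewrite divr1 /h EFin_max ge_max; apply/andP; split.
 rewrite EFinB -(AB (normr_ge0 (f z))) normrM; apply: ereal_sup_ubound.
 by exists `|f z| => //; exact: normr_ge0.
apply: ereal_sup_ubound; exists 0 => /=; first exact: lexx.
by rewrite mul0r AB// (nyoung0 HB) sube0.
Qed.

(** Beyond the distance d of uniform continuity the oscillation 2 M is at most (2 M / d) |x - y|. *)
Lemma modulus_choice (v : 'rV[R]_n -> R) (M : R) : (forall x, `|v x| <= M) ->
 (forall e, 0 < e -> exists2 d : R, 0 < d & forall x y, enorm (x - y) <= d -> `|v x - v y| <= e) ->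
 exists L : R -> R, (forall e, 0 < e -> 0 <= L e) /\
 forall e x y, 0 < e -> `|v x - v y| <= e + L e * enorm (x - y).
Proof.
move=> vM uv; have M0 : 0 <= M := le_trans (normr_ge0 _) (vM 0).
have /choice[L HL] : forall e, exists l : R, 0 < e -> 0 <= l /\
 forall x y, `|v x - v y| <= e + l * enorm (x - y).
 move=> e; have [e0|e0] := pselect (0 < e); last by exists 0 => /e0.
 have [d d0 Hd] := uv e e0; exists (2 * M / d) => _; split; first by rewrite divr_ge0 ?mulr_ge0// ltW.
 move=> x y; have [xy|xy] := leP (enorm (x - y)) d.
 by rewrite (le_trans (Hd x y xy))// lerDl mulr_ge0 ?enorm_ge0// divr_ge0 ?mulr_ge0// ltW.
 apply: (@le_trans _ _ (2 * M)).
 by rewrite (le_trans (ler_normB _ _))// mulrDl mul1r lerD.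
 apply: (@le_trans _ _ (2 * M / d * enorm (x - y))); last by rewrite lerDr ltW.
 by rewrite mulrAC ler_pdivlMr// ler_wpM2l ?mulr_ge0// ltW.
by exists L; split=> [e /HL[]|e x y /HL[]].
Qed.

Lemma nu_ae_eq (u v : 'rV[R]_n -> R) (F G : 'rV[R]_n * 'rV[R]_n -> \bar R) :
 {ae mu, forall x, u x = v x} -> mfun F -> mfun G ->
 (forall z, (0 <= F z)%E) -> (forall z, (0 <= G z)%E) ->
 (forall z, u z.1 = v z.1 -> u z.2 = v z.2 -> F z = G z) -> (\int[nu n]_z F z = \int[nu n]_z G z)%E.
Proof.
move=> uv mF mG F0 G0 FG; rewrite (@int_nu R n)// (@int_nu R n)//.
have md : mfun (fun z : 'rV[R]_n * 'rV[R]_n => (nu_density z)%:E).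
 by apply/mEFinP; exact: measurable_nu_density.
have d0 (z : 'rV[R]_n * 'rV[R]_n) : (0 <= (nu_density z)%:E)%E by rewrite lee_fin powR_ge0.
have mFd := emfunM mF md; have mGd := emfunM mG md.
have Fd0 z : (0 <= F z * (nu_density z)%:E)%E by rewrite mule_ge0.
have Gd0 z : (0 <= G z * (nu_density z)%:E)%E by rewrite mule_ge0.
rewrite (fubini_tonelli1 _ mFd Fd0) (fubini_tonelli1 _ mGd Gd0).
apply: ge0_ae_eq_integral => //.
- exact: (mtonF _ mFd Fd0).
- exact: (mtonF _ mGd Gd0).
- by move=> x _; apply: int_ge0 => y _; exact: Fd0.
- by move=> x _; apply: int_ge0 => y _; exact: Gd0.
apply: (@filterS _ _ (ae_filt mu) _ _ _ uv) => x ux _; rewrite /fubini_F.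
apply: ge0_ae_eq_integral => //.
- exact: (mcomp mFd (mpair1 x)).
- exact: (mcomp mGd (mpair1 x)).
by apply: (@filterS _ _ (ae_filt mu) _ _ _ uv) => y uy _; rewrite /= FG.
Qed.

(** Pairing with the kernel at x0 is one of the functionals that define the topology of the closure.
    It equals f x0 = 0 on test functions f, hence vanishes at u, and it equals v x0 on the
    continuous representative v. *)
Theorem Ws0_vanish (Om : set 'rV[R]_n) (u : 'rV[R]_n -> R) : Ws0 s A Om u ->
 [/\ mfun u, (\int[nu n]_z (B `|Ds s u z|)%:E < +oo)%E &
 exists v : 'rV[R]_n -> R, [/\ continuous v, exists M, forall x, `|v x| <= M,
 forall e, 0 < e -> exists2 d : R, 0 < d & forall x y, enorm (x - y) <= d -> `|v x - v y| <= e,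
 {ae mu, forall x, u x = v x} & forall x, ~ Om x -> v x = 0]].
Proof.
move=> [[[mu_ [k k0 Iu]] [mDu [k' k'0 IDu]]] clu].
have scaled d (T : measurableType d) (m : {measure set T -> \bar R}) (f : T -> R) l :
 0 < l -> mfun f -> (modular m A (fun x => f x / l)%R < +oo)%E ->
 (\int[m]_x (B `|f x|)%:E < +oo)%E.
 move=> l0 mf If; have [D D0 HD] := nyoung_scale HB (ltW l0).
 have mfl : mfun (fun x => (B `|f x / l|)%:E).
 apply: m_young => //; apply: mfunM => //.
 apply: (@le_lt_trans _ _ (\int[m]_x (D%:E * (B `|f x / l|)%:E))%E).
 apply: le_int_sup => x; first by rewrite lee_fin nyoung_ge0.
 rewrite -EFinM lee_fin; have := HD `|f x / l| (normr_ge0 _).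
 by rewrite normrM (gtr0_norm (_ : 0 < l^-1)) ?invr_gt0// mulrC divfK ?gt_eqF.
 have p0 x : setT x -> (0 <= (B `|f x / l|)%:E)%E by rewrite lee_fin nyoung_ge0.
 have D0' : (0 <= D%:E)%E by rewrite lee_fin ltW.
 rewrite (@intZl _ _ _ m _ mTT _ mfl _ p0 D0').
 have I0 : (0 <= \int[m]_x (B `|f x / l|)%:E)%E by apply: int_ge0.
 have If' : (\int[m]_x (B `|f x / l|)%:E < +oo)%E.
 apply: le_lt_trans If; apply: eq_imp_le.
 by apply: eqint => x _; rewrite AB.
 by rewrite -(@fineK _ (\int[m]_x _)%E) ?fin_numE0// -EFinM ltry.
have Iu' := scaled _ _ mu u k k0 mu_ Iu; have IDu' := scaled _ _ (nu n) (Ds s u) k' k'0 mDu IDu.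
have [v [cv [M vM] uv uve]] := continuous_representative HB n0 s01 slope_lty mu_ Iu' IDu'.
split => //; exists v; split => //; first by exists M.
have mv : mfun v by exact: cont_meas.
have [L [L0 HL]] := modulus_choice vM uv.
move=> x0 Omx0; have [w [wE mw wL GP]] := green_function x0.
have [_ wDE] := wE.
have mDv := m_Ds s mv; have mDw := m_Ds s mw.
have IDv : (\int[nu n]_z (B `|Ds s v z|)%:E < +oo)%E.
 rewrite -(@nu_ae_eq u v (fun z => (B `|Ds s u z|)%:E))//.
 - exact: m_energy.
 - exact: m_energy.
 - by move=> z; rewrite lee_fin nyoung_ge0.
 - by move=> z; rewrite lee_fin nyoung_ge0.
 - by move=> z u1 u2; rewrite /Ds u1 u2.
have Pv := GP v M L mv vM L0 HL (young_integrable mDv mDw IDv wDE).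
suff P0 : Ws_pairing s u w = 0.
 rewrite -Pv -P0; rewrite /Ws_pairing; congr (_ + _).
 rewrite /Rintegral; congr fine; apply: ae_eq_integral => //.
 - by apply/mEFinP; exact: (mfunM mv mw).
 - by apply/mEFinP; exact: (mfunM mu_ mw).
 - by apply: (@filterS _ _ (ae_filt mu) _ _ _ uve) => x ux _; rewrite ux.
 rewrite /Rintegral; congr fine; rewrite integralE [RHS]integralE.
 have mP p (mp : mfun (Ds s p)) : mfun (fun z => (Ds s p z * Ds s w z)%:E).
 by apply/mEFinP; exact: (mfunM mp mDw).
 have E z : u z.1 = v z.1 -> u z.2 = v z.2 -> Ds s v z = Ds s u z by move=> u1 u2; rewrite /Ds u1 u2.
 congr (_ - _)%E; apply: (nu_ae_eq uve) => //.
 - apply: measurable_funepos; exact: mP.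
 - apply: measurable_funepos; exact: mP.
 - by move=> z u1 u2; rewrite !funeposE E.
 - apply: measurable_funeneg; exact: mP.
 - apply: measurable_funeneg; exact: mP.
 - by move=> z u1 u2; rewrite !funenegE E.
apply/eqP; rewrite -normr_le0; apply/ler_addgt0Pr => e e0; rewrite add0r.
pose W : {v : 'rV[R]_n -> R | WsE s (complementary A) v} := exist _ w wE.
have ce : continuous (proj W \o @Ws_eval R n s A : initial_topology (@Ws_eval R n s A) -> R).
 move=> f; apply: continuous_comp; first exact: initial_continuous.
 exact: (@ptws_eval_continuous _ (R : topologicalType) W (Ws_eval (A := A) f)).
have nb : nbhs (u : initial_topology (@Ws_eval R n s A))
 [set f : initial_topology (@Ws_eval R n s A) | `|Ws_pairing s u w - Ws_pairing s f w| < e].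
 have /cvgrPdist_lt := ce u; exact.
have [f [tf fe]] := clu _ nb.
have [Mf Mf0 [fM fL]] := test_lipschitz tf.
have [sf _ _] := tf; have [cf _] := sf [::].
have f0 : f x0 = 0.
 apply/eqP/negPn/negP => fx; apply: Omx0; have [_ _] := tf; apply; exact: subset_closure.
have mf : mfun (f : 'rV[R]_n -> R) by exact: cont_meas.
have Pf : Ws_pairing s f w = 0.
 rewrite (GP f Mf (fun=> Mf))//; [by move=> *; exact: ltW|by move=> d x y d0; rewrite (le_trans (fL x y))// lerDr ltW|].
 (* Up to distance 1 the Lipschitz bound and s < 1 control D^s f, beyond it boundedness does; with
    D^s w integrable, the pairing of f converges. *)
 have Db z : `|Ds s f z| <= 2 * Mf.
 rewrite /Ds normrM (ger0_norm (_ : 0 <= _^-1)) ?invr_ge0 ?powR_ge0//.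
 set d := enorm _; have d0 : 0 <= d := enorm_ge0 _; have [->|dn] := eqVneq d 0.
 by rewrite powR0 ?gt_eqF ?invr0 ?mulr0 ?mulr_ge0 ?(ltW Mf0)//; case/andP: s01.
 have dp : 0 < d by rewrite lt0r dn.
 have /andP[s0 s1] := s01.
 rewrite ldivMr ?powR_gt0//; have [d1|d1] := leP d 1.
 apply: (le_trans (fL _ _)); rewrite -/d; apply: ler_pM => //; [exact: ltW|lra|].
 rewrite -[leLHS](powRr1 d0) (_ : 1 = s + (1 - s)); last by ring.
 by rewrite powRDp// ler_piMr ?powR_ge0//; apply: powR_le1 => //; lra.
 apply: (@le_trans _ _ (2 * Mf)); first by rewrite (le_trans (ler_normB _ _))// mulrDl mul1r lerD.
 by rewrite ler_peMr ?mulr_ge0 ?(ltW Mf0)//; apply: powR_ge1; exact: ltW.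
 have mDw' : mfun (fun z => (`|Ds s w z|%:E : \bar R)).
 by apply/mEFinP; apply: mcomp => //; exact: mnormr.
 apply: (@le_lt_trans _ _ (\int[nu n]_z ((2 * Mf)%:E * `|Ds s w z|%:E))%E).
 apply: le_int_sup => z; first by rewrite lee_fin.
 rewrite -EFinM lee_fin normrM.
 exact: ler_wpM2r.
 have p0 z : setT z -> (0 <= (`|Ds s w z|%:E : \bar R))%E by rewrite lee_fin.
 have M0' : (0 <= (2 * Mf)%:E)%E by rewrite lee_fin mulr_ge0// ltW.
 rewrite (@intZl _ _ _ (nu n) _ mTT _ mDw' _ p0 M0').
 by rewrite -(@fineK _ (\int[nu n]_z _)%E) ?fin_numE0 ?int_ge0// -EFinM ltry.
by move: fe => /=; rewrite Pf subr0 => /ltW.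
Qed.

End vanishing.

(** * Reduction of Young functions and indices to real inequalities *)

Section young_function_cases.
Context {R : realType} (A : R -> \bar R) (hA : young_function A) (hA2 : Delta2 A).
Local Notation leb := (@lebesgue_measure R).

(** Doubling spreads one finite value at a positive point to all of [0, oo). In the same way a zero
    at a positive point would spread everywhere, against the nonzero value. *)
Lemma young_function_cases : (forall t, 0 < t -> A t = +oo%E) \/
 exists2 B : R -> R, nyoung B & forall t, 0 <= t -> A t = (B t)%:E.
Proof.
have [A00 A0 Acvx [t1 [t10 At1]] _] := hA; have [c c2 Ac] := hA2.
have c0 : 0 < c by lra.
have [H|/existsNP[t2 /not_implyP[t20 At2]]] := pselect (forall t, 0 < t -> A t = +oo%E); [by left|right].
have fin0 t : 0 <= t -> (A t < +oo)%E -> A t = (fine (A t))%:E.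
 by move=> t0 At; rewrite fineK// fin_numE0// A0.
have At2f : (A t2 < +oo)%E by rewrite ltey; apply/eqP.
have scale k : (A (2 ^+ k * t2) < +oo)%E.
 elim: k => [|k IH]; first by rewrite expr0 mul1r.
 have p0 : 0 < 2 ^+ k * t2 by rewrite mulr_gt0 ?exprn_gt0.
 rewrite exprS -mulrA; apply: (le_lt_trans (Ac _ p0)).
 by rewrite (fin0 _ (ltW p0) IH) -EFinM ltry.
have contr x y : 0 <= x -> x <= y -> (A y < +oo)%E -> (A x < +oo)%E.
 move=> x0 xy Ay; have y0 := le_trans x0 xy; have [ye|yn] := eqVneq y 0.
 by rewrite (_ : x = 0) ?A00 ?ltry//; apply/le_anti; rewrite x0 -ye xy.
 have yp : 0 < y by rewrite lt0r yn.
 have th : 0 <= x / y <= 1 by rewrite divr_ge0// ldivMr// mul1r.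
 have := Acvx y 0 (x / y) y0 (lexx 0) th; rewrite mulr0 addr0 divfK// A00 mule0 adde0.
 by move=> H; apply: (le_lt_trans H); rewrite (fin0 _ y0 Ay) -EFinM ltry.
have AB t : 0 <= t -> A t = (fine (A t))%:E.
 move=> t0; apply: fin0 => //; have [k Hk] := exprn_unbounded (t / t2) (ltr1n R 2 : (1 < 2)).
 by apply: contr (scale k); rewrite // -ldivMr// ltW.
exists (fine \o A) => //; have B0 t : 0 <= t -> 0 <= fine (A t) by move=> t0; rewrite fine_ge0// A0.
have Bcvx x y th : 0 <= x -> 0 <= y -> 0 <= th <= 1 ->
 fine (A (th * x + (1 - th) * y)) <= th * fine (A x) + (1 - th) * fine (A y).
 move=> x0 y0 th01; have := Acvx x y th x0 y0 th01.
 rewrite (AB x)// (AB y)// -!EFinM -EFinD AB ?lee_fin//.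
 by case/andP: th01 => a b; rewrite addr_ge0 ?mulr_ge0 ?subr_ge0.
have Bc t : 0 <= t -> fine (A (2 * t)) <= c * fine (A t).
 rewrite le_eqVlt => /predU1P[<-|t0]; first by rewrite mulr0 A00/= mulr0.
 have p2 : 0 <= 2 * t by rewrite mulr_ge0// ltW.
 by have := Ac t t0; rewrite {1}(AB _ p2) {1}(AB t (ltW t0)) -EFinM lee_fin.
split; [by rewrite /= A00| |exact: Bcvx|by exists c].
move=> t t0; rewrite lt0r B0 ?(ltW t0)// andbT; apply/eqP => Bt.
have Bk k : fine (A (2 ^+ k * t)) = 0.
 elim: k => [|k IH]; first by rewrite expr0 mul1r.
 have p0 : 0 <= 2 ^+ k * t by rewrite mulr_ge0 ?exprn_ge0 ?ltW.
 apply/le_anti/andP; split; last by apply: B0; rewrite exprS -mulrA mulr_ge0.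
 by rewrite exprS -mulrA (le_trans (Bc _ p0))// IH mulr0.
have [k Hk] := exprn_unbounded (t1 / t) (ltr1n R 2 : (1 < 2)).
have kp : 0 < 2 ^+ k * t by rewrite mulr_gt0 ?exprn_gt0.
have th : 0 <= t1 / (2 ^+ k * t) <= 1.
 by rewrite divr_ge0 ?(ltW kp)// ldivMr// mul1r -ldivMr// ltW.
have := Bcvx (2 ^+ k * t) 0 _ (ltW kp) (lexx 0) th.
rewrite mulr0 addr0 divfK ?gt_eqF// Bk A00 !mulr0 addr0 => le0.
by move/eqP: At1; apply; rewrite (AB t1 t10); congr EFin; apply/le_anti; rewrite le0 B0.
Qed.

Context (B : R -> R) (HB : nyoung B) (AB : forall t, 0 <= t -> A t = (B t)%:E).

Lemma young_quotient x y : 0 < y -> 0 <= x -> (x%:E / A y)%E = (x / B y)%:E.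
Proof. by move=> y0 x0; rewrite AB ?(ltW y0)// inver gt_eqF// nyoung_gt0. Qed.

Lemma growth_slope q : growth_condition A q ->
 exists2 t0, 0 < t0 & (\int[leb]_(t in `[t0, +oo[) ((t / B t) `^ q)%:E < +oo)%E.
Proof.
move=> [t0 t00 H]; exists t0 => //; apply: le_lt_trans H; apply: eq_imp_le.
apply: eqint => t; rewrite inE/= in_itv/= andbT => tt; have tp := lt_le_trans t00 tt.
by rewrite young_quotient// ?(ltW tp).
Qed.

(** One filter F serves both indices. A single t > 1 with log M(t) / log t > p already gives a
    one-step growth inequality for all b near F. *)
Lemma index_growth (F : set_system R) {FF : Filter F} (p : R) : 0 < p ->
 (\forall b \near F, 0 < b) ->
 (p%:E < lim ((lne (limf_einf (fun b : R => A (b * t)%R / A b) F) / (ln t)%:E) @[t --> +oo%R]))%E ->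
 exists2 t : R, 1 < t & \forall b \near F, t `^ p * B b <= B (b * t).
Proof.
move=> p0 bF; set M := fun t : R => limf_einf (fun b : R => A (b * t)%R / A b)%E F.
set f := (fun t : R => (lne (M t) / (ln t)%:E)%E); move=> pl.
have [l fl] : exists l : \bar R, f t @[t --> +oo%R] --> l.
 (* Without a limit, [lim] returns the default value 0, which p > 0 excludes. *)
 apply: contrapT => H; move: pl; rewrite (_ : lim _ = point).
 by rewrite lte_fin ltNge ltW.
 by apply: getPN => l fl; apply: H; exists l.
have {pl fl} : \forall t \near +oo%R, (p%:E < f t)%E.
 have pl' : (p%:E < l)%E by rewrite -(cvg_lim _ fl).
 apply: (fl [set x | (p%:E < x)%E]); apply: open_nbhs_nbhs; split => //; exact: open_ereal_gt_ereal.
move=> [T [_ HT]]; pose t := Num.max T 1 + 1.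
have tT : T < t by rewrite (@le_lt_trans _ _ (Num.max T 1)) ?ltrDl// le_max lexx.
have t1 : 1 < t by rewrite (@le_lt_trans _ _ (Num.max T 1)) ?ltrDl// le_max lexx orbT.
have t0 : 0 < t := lt_trans ltr01 t1; have lt0 : 0 < ln t by rewrite ln_gt0.
have MT : ((t `^ p)%:E < M t)%E.
 have := HT t tT; rewrite /f inver gt_eqF//; case: (M t) => [r| |] /=; last 2 first.
 - by move=> _; exact: ltry.
 - by rewrite mulNyr gtr0_sg ?invr_gt0// mul1e.
 case: ifPn => [_|]; first by rewrite mulNyr gtr0_sg ?invr_gt0// mul1e.
 rewrite -ltNge -EFinM !lte_fin => r0; rewrite ltr_pdivlMr// => H.
 by rewrite /powR gt_eqF// -[ltRHS](lnK r0) ltr_expR.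
exists t => //; move: MT; rewrite /M limf_einfE => /ereal_sup_gt[_ [V FV <-]] HV.
apply: filterS2 FV bF => b Vb b0.
have : ((t `^ p)%:E < A (b * t)%R / A b)%E by apply: (lt_le_trans HV); apply: ereal_inf_lbound; exists b.
have bt0 : 0 <= b * t by rewrite mulr_ge0 ?ltW.
rewrite (AB bt0) young_quotient ?(nyoung_ge0 HB)// lte_fin ltr_pdivlMr ?nyoung_gt0//; exact: ltW.
Qed.

Lemma index_between (i : \bar R) (x : R) : (x%:E < i)%E -> exists2 p, x < p & (p%:E < i)%E.
Proof.
case: i => [r| |]//; last by move=> _; exists (x + 1); [rewrite ltrDl|exact: ltry].
by rewrite lte_fin => xr; exists ((x + r) / 2); rewrite ?lte_fin; lra.
Qed.

End young_function_cases.

(** * Boundary and inner radius *)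

Section inner_radius.
Context {R : realType} {n : nat} (n0 : (0 < n)%N) (Om : set 'rV[R]_n).
Context (oOm : open Om) (Om0 : Om !=set0) (bOm : bounded_set Om).

Lemma bounded_enorm : exists2 K : R, 0 < K & forall x, Om x -> enorm x <= K.
Proof.
have [M [_ HM]] := bOm; pose K := `|M| + 1.
have K0 : 0 < K by rewrite ltr_wpDl.
have MK : M < K by rewrite (le_lt_trans (ler_norm M))// ltrDl.
exists (n%:R * K); first by rewrite mulr_gt0// ltr0n.
move=> x Ox; apply: enorm_le; first exact: ltW.
move=> i; have := HM K MK x Ox; rewrite /= [leLHS]mx_normrE; apply: le_trans.
exact: (le_bigmax _ (fun ij : 'I_1 * 'I_n => `|x ij.1 ij.2|) (ord0, i)).
Qed.

(** The last point of a ray in a coordinate direction up to which Om is met: it lies in the closure,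
    and openness prevents it from lying in Om. *)
Lemma boundary_nonempty : boundary Om !=set0.
Proof.
have [x Ox] := Om0; have [K K0 HK] := bounded_enorm; pose i := Ordinal n0.
pose f (t : R) : 'rV[R]_n := x + t *: delta_mx ord0 i.
have cf : continuous f.
 by move=> t; apply: cvgD; [exact: cvg_cst|apply: cvgZl; exact: cvg_id].
pose S := [set t : R | 0 <= t /\ Om (f t)].
have S0 : S 0 by split; rewrite /f ?scale0r ?addr0.
have ubS : ubound S (K + K).
 move=> t [t0 Of]; have := HK _ Of; have := coord_le_enorm (f t) i.
 have := HK _ Ox; have := coord_le_enorm x i; rewrite /f !mxE !eqxx mulr1.
 by move=> a b c d; have := ler_norm (x ord0 i + t); have := lerNnormlW (lexx `|x ord0 i|); lra.
have hs : has_sup S by split; [exists 0|exists (K + K)].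
pose T := sup S; have T0 : 0 <= T by apply: sup_ubound => //; exists (K + K).
exists (f T); split.
 move=> U /(cf T) /nbhs_ballP[e /= e0 He].
 have [t [t0 Of] tT] := sup_adherent e0 hs.
 exists (f t); split => //; apply: He; rewrite /ball/= ger0_norm ?subr_ge0.
 by rewrite ltrBlDr addrC -ltrBlDr.
 by apply: sup_ubound; [exists (K + K)|split].
move=> /interior_subset OT; have /(cf T) /nbhs_ballP[e /= e0 He] : nbhs (f T) Om by exact: open_nbhs_nbhs.
have : T + e / 2 <= T.
 apply: sup_ubound; first by exists (K + K).
 split; first by rewrite addr_ge0// divr_ge0// ltW.
 apply: He; rewrite /ball/= opprD addrA subrr add0r normrN gtr0_norm ?divr_gt0//; lra.
lra.
Qed.

Lemma boundary_notin y : boundary Om y -> ~ Om y.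
Proof. by move=> [_ H] Oy; apply: H; exact: open_nbhs_nbhs. Qed.

Let lbd x : has_lbound [set enorm (x - y) | y in boundary Om].
Proof. by exists 0 => _ [y _ <-]; exact: enorm_ge0. Qed.

Lemma edistance_gt0 x : Om x -> 0 < edistance x (boundary Om).
Proof.
move=> Ox; have /near_rVP[d d0 Hd] : nbhs x Om by exact: open_nbhs_nbhs.
apply: (lt_le_trans d0); have [y by_] := boundary_nonempty.
apply: lb_le_inf; first by exists (enorm (x - y)), y.
move=> _ [z bz <-]; rewrite leNgt; apply/negP => zd; apply: (boundary_notin bz); apply: Hd => i.
by apply: le_lt_trans zd; have := coord_le_enorm (x - z) i; rewrite !mxE// distrC.
Qed.

Let ubr : has_ubound [set edistance x (boundary Om) | x in Om].
Proof.
have [y by_] := boundary_nonempty; have [K K0 HK] := bounded_enorm.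
exists (K + enorm y) => _ [x Ox <-]; apply: (@le_trans _ _ (enorm (x - y))).
 by apply: ge_inf; [exact: lbd|exists y].
apply: (le_trans (enormD _ _)); rewrite enormN lerD2r; exact: HK.
Qed.

Lemma inner_radius_gt0 : 0 < inner_radius Om.
Proof.
have [x Ox] := Om0; apply: (lt_le_trans (edistance_gt0 Ox)).
by apply: sup_ubound => //; exists x.
Qed.

(** The distance to the boundary is an infimum of value at most r; the second r is the slack that
    yields an actual point. *)
Lemma near_boundary x : Om x -> exists2 y, ~ Om y & enorm (x - y) <= 2 * inner_radius Om.
Proof.
move=> Ox; have [y by_] := boundary_nonempty.
have hi : has_inf [set enorm (x - y) | y in boundary Om] by split; [exists (enorm (x - y)), y|exact: lbd].
have [_ [z bz <-] zr] := inf_adherent inner_radius_gt0 hi.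
exists z; first exact: boundary_notin.
apply: (le_trans (ltW zr)); rewrite mulrDl mul1r lerD2r.
by apply: sup_ubound => //; exists x.
Qed.

End inner_radius.

(** * Lower bound for the critical value *)

Section test_scaling.
Context {R : realType} {n : nat} (Om : set 'rV[R]_n).
Implicit Types (u v : 'rV[R]_n -> R).

Lemma partials_scale u (c : R) l : smooth u ->
 foldr (@partial R n) (fun x => c * u x) l = fun x => c * foldr (@partial R n) u l x.
Proof.
move=> su; elim: l => //= i l ->; apply/funext => x; have [_ du] := su l.
exact: (@deriveZ R _ _ (foldr (@partial R n) u l) c x (delta_mx ord0 i) (du i x)).
Qed.

Lemma smooth_scale u (c : R) : smooth u -> smooth (fun x => c * u x).
Proof.
move=> su l; have [cu du] := su l; rewrite (partials_scale c l su); split.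
 by move=> x; exact: (cvgM (cvg_cst _) (cu x)).
by move=> i x; exact: (@derivableZ R _ _ (foldr (@partial R n) u l) c x (delta_mx ord0 i) (du i x)).
Qed.

Lemma test_scale u (c : R) : c != 0 -> test_functions Om u -> test_functions Om (fun x => c * u x).
Proof.
move=> c0 [su cu Ou]; have E : [set x | c * u x != 0] = [set x | u x != 0].
 by apply/seteqP; split => x /=; rewrite mulf_eq0 negb_or c0.
by split; rewrite ?E//; exact: smooth_scale.
Qed.

End test_scaling.

Section eigenvalue_lower_bound.
Context {R : realType} {n : nat} (B : R -> R) (HB : nyoung B) (s : R).
Context (n0 : (0 < n)%N) (s01 : 0 < s < 1).
Context (A : R -> \bar R) (AB : forall t, 0 <= t -> A t = (B t)%:E).
Local Notation q := (s / (n%:R - s)).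
Local Notation eta := (2 `^ (n%:R - s) : R).
Local Notation theta := (eta^-1 `^ q : R).
Local Notation slope := (slope_integral B q).
Local Notation C1 := ((1 - theta)^-1).
Local Notation c0 := (((4 * n)%:R : R) ^+ n).
Local Notation mu := (@rV_lebesgue R n).
Context (slope_lty : forall y, 0 < y -> (slope y < +oo)%E).
Context (Om : set 'rV[R]_n) (oOm : open Om) (om : 'rV[R]_n -> R).
Context (iom : mu.-integrable setT (EFin \o om)).
Implicit Types (u v : 'rV[R]_n -> R).

Let s0 : 0 < s. Proof. by case/andP: s01. Qed.
Let mOm : measurable Om. Proof. exact: m_open_rV. Qed.

Lemma modular_energy v : modular (nu n) A (Ds s v) = energy (n := n) B s v.
Proof. by apply: eqint => z _; rewrite AB. Qed.

Lemma weighted_modularE v : weighted_modular A Om om v = (\int[mu]_(x in Om) (om x * B `|v x|)%:E)%E.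
Proof. by apply: eqint => x _; rewrite AB. Qed.

Definition weight : R := fine (\int[mu]_(x in Om) `|om x|%:E)%E.

Let iomO : mu.-integrable Om (EFin \o om).
Proof. by apply: integrableS iom => //; exact: subsetT. Qed.

Lemma weightE : (\int[mu]_(x in Om) `|om x|%:E)%E = weight%:E.
Proof.
rewrite fineK// fin_numE0; first by have /integrableP[] := iomO.
by apply: int_ge0 => x _; rewrite lee_fin.
Qed.

Lemma weight_ge0 : 0 <= weight.
Proof. by rewrite fine_ge0// int_ge0// => x _; rewrite lee_fin. Qed.

Lemma weight_int (f : 'rV[R]_n -> R) (K : R) : mfun f ->
 (forall x, Om x -> `|f x| <= K) ->
 mu.-integrable Om (EFin \o (fun x => om x * f x)) /\
 (`|\int[mu]_(x in Om) (om x * f x)%:E| <= (weight * K)%:E)%E.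
Proof.
move=> mf fK; have mom : measurable_fun Om om by apply/mEFinP; exact: measurable_int iomO.
have mof : measurable_fun Om (fun x => om x * f x).
 by apply: mfunM => //; exact: mfunTS.
have maom : measurable_fun Om (fun x => (`|om x|%:E : \bar R)).
 by apply/mEFinP; apply: mcomp => //; exact: mnormr.
have bound : (\int[mu]_(x in Om) `|(om x * f x)%:E| <= (weight * K)%:E)%E.
 have [K0|K0] := leP 0 K; last first.
 rewrite (_ : Om = set0) ?integral_set0; last first.
 by apply/seteqP; split => x // Ox; have := le_trans (normr_ge0 _) (fK x Ox); rewrite leNgt K0.
 have -> : weight = 0 by rewrite /weight (_ : Om = set0) ?integral_set0//;
 apply/seteqP; split => x // Ox; have := le_trans (normr_ge0 _) (fK x Ox); rewrite leNgt K0.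
 by rewrite mul0r.
 have K0' : (0 <= K%:E)%E by rewrite lee_fin.
 have p0 x : Om x -> (0 <= (`|om x|%:E : \bar R))%E by rewrite lee_fin.
 rewrite mulrC EFinM -weightE -(@intZl _ _ _ mu _ mOm _ maom _ p0 K0').
 apply: le_int => //.
 - by apply: mcomp => //; exact/mEFinP.
 - by apply: emfunM; [exact: mcst|exact: maom].
 - by move=> x Ox; rewrite -EFinM /= lee_fin normrM mulrC ler_wpM2r// fK.
have io : mu.-integrable Om (EFin \o (fun x => om x * f x)).
 by apply/integrableP; split; [exact/mEFinP|rewrite (le_lt_trans bound)// ltry].
split=> //; apply: le_trans bound; apply: le_abse_integral => //; exact: measurable_int io.
Qed.

Let mBv v : continuous v -> mfun (fun x => B `|v x|).
Proof.
by move=> cv; apply/mEFinP; apply: m_young => //; exact: cont_meas.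
Qed.

(** Multiplying v by t in [0, 1] lowers the energy, while the level depends continuously on t and
    runs from 0 to al. *)
Lemma scale_level v (al be : R) : test_functions Om v -> weighted_modular A Om om v = al%:E ->
 0 < be <= al -> exists w, [/\ test_functions Om w, weighted_modular A Om om w = be%:E &
 (energy (n := n) B s w <= energy (n := n) B s v)%E].
Proof.
move=> tv Iv /andP[be0 beal]; have [M M0 [vM _]] := test_lipschitz tv.
have [sv _ _] := tv; have [cv _] := sv [::].
pose phi t := fine (\int[mu]_(x in Om) (om x * B `|t * v x|)%:E).
have ctv t : continuous (fun x => t * v x) by move=> x; exact: (cvgM (cvg_cst _) (cv x)).
have tvM t x : `|t| <= 1 -> `|t * v x| <= M.
 by move=> t1; rewrite normrM (le_trans (ler_wpM2r _ t1))// mul1r.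
have BM t x : `|t| <= 1 -> `|B `|t * v x| | <= B M.
 by move=> t1; rewrite ger0_norm ?(nyoung_ge0 HB)//; apply: (nyoung_le HB) => //; exact: tvM.
have I t (t1 : `|t| <= 1) := weight_int (mBv (ctv t)) (fun x _ => BM t x t1).
have phiE t : `|t| <= 1 -> (\int[mu]_(x in Om) (om x * B `|t * v x|)%:E = (phi t)%:E)%E.
 by move=> t1; have [i1 _] := I t t1; rewrite /phi fineK//; exact: int_fin.
have lip t t' : `|t| <= 1 -> `|t'| <= 1 -> `|phi t - phi t'| <= weight * (M * B (M + 1)) * `|t - t'|.
 move=> t1 t1'; have [i1 _] := I t t1; have [i2 _] := I t' t1'.
 have key x y : 0 <= x -> x <= M -> 0 <= y -> y <= M -> `|B x - B y| <= `|x - y| * B (M + 1).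
 move=> x0 xM y0 yM; have [xy|xy] := leP x y.
 by rewrite distrC (distrC x) !ger0_norm ?subr_ge0 ?(nyoung_le HB)//; exact: (nyoung_lip HB).
 by rewrite !ger0_norm ?subr_ge0 ?(nyoung_le HB) ?(ltW xy)//; apply: (nyoung_lip HB) => //; exact: ltW.
 have d x : Om x -> `|B `|t * v x| - B `|t' * v x| | <= M * B (M + 1) * `|t - t'|.
 move=> _; apply: (le_trans (key _ _ _ _ _ _)); rewrite ?tvM//.
 rewrite mulrAC; apply: ler_wpM2r; first by rewrite (nyoung_ge0 HB)// addr_ge0 ?ltW.
 apply: (le_trans (ler_dist_dist _ _)); rewrite -mulrBl normrM mulrC; exact: ler_wpM2r.
 have md : mfun (fun x => B `|t * v x| - B `|t' * v x|).
 by apply: mfunB; exact: mBv.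
 have [_ ] := weight_int md d; rewrite mulrA -lee_fin; apply: le_trans.
 have -> : (\int[mu]_(x in Om) (om x * (B `|t * v x| - B `|t' * v x|))%:E = (phi t - phi t')%:E)%E.
 rewrite EFinB -(phiE t t1) -(phiE t' t1') -integralB_EFin//.
 by apply: eqint => x _; rewrite -EFinB mulrBr.
 by [].
have e1 : phi 1 = al.
 by apply: EFin_inj; rewrite -Iv weighted_modularE -phiE ?normr1//; apply: eqint => x _; rewrite mul1r.
have e0 : phi 0 = 0.
 apply: EFin_inj; rewrite -phiE ?normr0//; apply: integral0_eq => x _.
 by rewrite mul0r normr0 (nyoung0 HB) mulr0.
have [||t] := @IVT R phi 0 1 be ler01.
- apply/subspace_continuousP => x /=; rewrite in_itv/= => /andP[x0 x1].
 have W0 : 0 <= weight * (M * B (M + 1)).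
 by rewrite !mulr_ge0 ?weight_ge0 ?(ltW M0) ?(nyoung_ge0 HB) ?addr_ge0 ?ltW.
 set W := weight * _ in W0; have W1 : 0 < W + 1 by rewrite (le_lt_trans W0)// ltrDl.
 apply/cvgrPdist_le => e ep; near=> y.
 have yI : `[0, 1]%classic y by near: y; exact: withinT.
 move: yI; rewrite /= in_itv/= => /andP[y0 y1].
 have := lip x y; rewrite (ger0_norm x0) (ger0_norm y0) => /(_ x1 y1) Hl.
 rewrite -/W in Hl.
 have xy : `|x - y| <= e / (W + 1).
 near: y; apply: (@cvg_within _ (nbhs x)); apply/nbhs_ballP.
 exists (e / (W + 1)) => /=; first exact: divr_gt0.
 by move=> z; rewrite /ball/= => /ltW.
 apply: (le_trans Hl); apply: (@le_trans _ _ ((W + 1) * (e / (W + 1)))).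
 by apply: ler_pM => //; rewrite lerDl.
 by rewrite mulrC divfK// gt_eqF// ltr_wpDl.
- by rewrite e0 e1 min_l ?max_r ?(ltW be0)//; rewrite (le_trans (ltW be0)).
rewrite in_itv/= => /andP[t0 t1] pt; have tn : t != 0.
 by apply/eqP => tz; move: be0; rewrite -pt tz e0 ltxx.
exists (fun x => t * v x); split; first exact: test_scale.
 by rewrite weighted_modularE phiE ?ger0_norm// pt.
apply: le_int_sup => z; first by rewrite lee_fin (nyoung_ge0 HB).
rewrite lee_fin; apply: (nyoung_le HB) => //; rewrite /Ds -mulrBr -mulrA normrM ler_piMl// ger0_norm//.
Unshelve. all: by end_near.
Qed.

Lemma M_sup_fin (t : R) : 0 < t -> exists2 M : R, M_sup A t = M%:E & 0 < M /\ forall b, 0 < b -> B (b * t) <= M * B b.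
Proof.
move=> t0; have [D D0 HD] := nyoung_scale HB (ltW t0).
have qE b : 0 < b -> (A (b * t)%R / A b)%E = (B (b * t) / B b)%:E.
 by move=> b0; rewrite AB ?mulr_ge0 ?ltW// (young_quotient HB AB b0)// (nyoung_ge0 HB)// mulr_ge0 ?ltW.
have ub b : 0 < b -> ((B (b * t) / B b)%:E <= M_sup A t)%E.
 by move=> b0; rewrite -qE//; apply: ereal_sup_ubound; exists b.
have le : (M_sup A t <= D%:E)%E.
 apply: ge_ereal_sup => _ [b /= b0 <-]; rewrite qE// lee_fin ldivMr ?(nyoung_gt0 HB)//.
 by rewrite mulrC; apply: HD; exact: ltW.
have B1t : 0 < B (1 * t) / B 1 by rewrite divr_gt0// (nyoung_gt0 HB)// mul1r.
have M0 := le_trans (_ : 0 <= (B (1 * t) / B 1)%:E)%E (ub 1 ltr01).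
have [|M ME _] := ge0_le_EFinP (M0 _) le; first by rewrite lee_fin ltW.
exists M => //; rewrite ME in ub; split; first by apply: (lt_le_trans B1t); rewrite -lee_fin ub.
by move=> b b0; rewrite -ldivMr ?(nyoung_gt0 HB)// -lee_fin ub.
Qed.

Context (r : R) (r0 : 0 < r) (near_bd : forall x, Om x -> exists2 y, ~ Om y & enorm (x - y) <= 2 * r).

Definition morrey_constant (C0 : R) : R := 3 * ((4 * n%:R) `^ s * (c0 + C1 * C0)).

(** The Morrey bound holds at every point of Om, each having a point outside Om within 2 r. In B(K
    r^s T) the constant K is absorbed by D, which does not depend on Om, and r^s by Mr. *)
Lemma level_bound (C0 D Mr T al : R) v : 0 <= C0 -> 0 <= D -> 0 < Mr -> 0 < T ->
 (slope (B T / T) <= (C0 * T)%:E)%E ->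
 (forall t, 0 <= t -> B (morrey_constant C0 * t) <= D * B t) ->
 (forall b, 0 < b -> B (b * r `^ s) <= Mr * B b) ->
 test_functions Om v -> weighted_modular A Om om v = al%:E ->
 (energy (n := n) B s v <= (B T * r ^+ n)%:E)%E -> al <= weight * D * Mr * B T.
Proof.
move=> C00 D0 Mr0 T0 HS HD HM tv Iv Ev; have [sv _ cs] := tv; have [cv _] := sv [::].
have [M M0 [vM _]] := test_lipschitz tv.
have mv : mfun v by exact: cont_meas.
have K0 : 0 <= morrey_constant C0.
 have := C1_gt0 n0 s01 => C10.
 by rewrite /morrey_constant !mulr_ge0 ?powR_ge0// addr_ge0 ?exprn_ge0// mulr_ge0// ltW.
have vb x : Om x -> `|B `|v x| | <= D * (Mr * B T).
 move=> Ox; rewrite ger0_norm ?(nyoung_ge0 HB)//; have [y Oy xy] := near_bd Ox.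
 have vy : v y = 0 by apply/eqP/negPn/negP => vy; apply: Oy; apply: cs; exact: subset_closure.
 have := morrey_bound HB n0 s01 cv (bounded_cube_integrable n0 mv vM) r0 T0 Ev HS xy vy.
 rewrite -/(morrey_constant C0) => /(nyoung_le HB (normr_ge0 _)) /le_trans; apply.
 have t0 : 0 <= r `^ s * T by rewrite mulr_ge0 ?powR_ge0 ?ltW.
 apply: (le_trans (HD _ t0)); apply: ler_wpM2l => //; rewrite mulrC; exact: HM.
have [_ ] := weight_int (mBv cv) vb; rewrite -weighted_modularE Iv lee_fin => H.
by rewrite -!mulrA; apply: le_trans H; exact: ler_norm.
Qed.

(** The normalization of al0 locates the relevant energies: with B T r^n the energy, al <= al0
    allows B T <= 2 and al > al0 forces B T >= 1, the ranges in which the slope integral is linearly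
    bounded. *)
Lemma critical_bound (C0 D Mr al al0 : R) : 0 <= C0 -> 0 <= D -> 0 < Mr -> 0 < al -> 0 < al0 ->
 (al0%:E * critical_value s A Om om al0 = (r ^+ n)%:E)%E ->
 (forall T, 0 < T -> (if al <= al0 then B T <= 2 else 1 <= B T) -> (slope (B T / T) <= (C0 * T)%:E)%E) ->
 (forall t, 0 <= t -> B (morrey_constant C0 * t) <= D * B t) ->
 (forall b, 0 < b -> B (b * r `^ s) <= Mr * B b) ->
 (critical_value s A Om om al < +oo)%E ->
 0 < weight * D * Mr /\ ((r ^+ n / (weight * D * Mr))%:E <= critical_value s A Om om al)%E.
Proof.
move=> C00 D0 Mr0 al_gt0 al0_gt0 crit0 HS HD HM Hfin; set X := weight * D * Mr.
have rn : 0 < r ^+ n by rewrite exprn_gt0.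
have X0 : 0 <= X by rewrite !mulr_ge0 ?weight_ge0 ?(ltW Mr0).
have key v e : test_functions Om v -> weighted_modular A Om om v = al%:E -> 0 < e ->
 (if al <= al0 then e <= 2 * r ^+ n else r ^+ n <= e) ->
 (energy (n := n) B s v <= e%:E)%E -> al * r ^+ n <= X * e.
 move=> tv Iv e0 ce Ev; have [T T0 BT] : exists2 T, 0 < T & B T = e / r ^+ n.
 by apply: (nyoung_surj HB); rewrite divr_gt0.
 have HT : (slope (B T / T) <= (C0 * T)%:E)%E.
 by apply: HS => //; rewrite BT; move: ce; case: ifP => _ ?; rewrite ?ldivMr ?ler_pdivlMr ?mul1r.
 have := @level_bound C0 D Mr T al v C00 D0 Mr0 T0 HT HD HM tv Iv.
 rewrite BT divfK ?gt_eqF// => /(_ Ev); rewrite -/X mulrA ler_pdivlMr//.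
have crE : critical_value s A Om om al0 = (r ^+ n / al0)%:E.
 move: crit0; case: (critical_value s A Om om al0) => [c| |].
 - by move=> [] <-; rewrite mulrC mulKf ?gt_eqF.
 - by rewrite gt0_muley// lte_fin.
 - by rewrite gt0_muleNy// lte_fin.
have en v : al%:E = al%:E -> modular (nu n) A (Ds s v) = energy (n := n) B s v by move=> _; exact: modular_energy.
have E0 v : (0 <= energy (n := n) B s v)%E by apply: int_ge0 => z _; rewrite lee_fin (nyoung_ge0 HB).
(* The infimum at al0 is r^n / al0; the factor 2 leaves room for an actual test function, which is
   then scaled down to the level al. *)
have small : al <= al0 -> exists v, [/\ test_functions Om v, weighted_modular A Om om v = al%:E &
 (energy (n := n) B s v <= (2 * r ^+ n)%:E)%E].
 move=> aa; have : (critical_value s A Om om al0 < (2 * r ^+ n / al0)%:E)%E.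
 by rewrite crE lte_fin ltr_pM2r ?invr_gt0// ltr_pMl// ltr1n.
 move=> /ereal_inf_lt[_ [v [tv Iv] <-]]; rewrite modular_energy => Hv.
 have [|w [tw Iw Ew]] := @scale_level v al0 al tv Iv; first by rewrite al_gt0.
 exists w; split => //; apply: (le_trans Ew); move: Hv; rewrite mulrC EFinM.
 by rewrite lte_pmul2l ?lte_fin ?invr_gt0// => /ltW.
have large v : al0 < al -> test_functions Om v -> weighted_modular A Om om v = al%:E ->
 ((r ^+ n)%:E <= energy (n := n) B s v)%E.
 move=> aa tv Iv; have [|w [tw Iw Ew]] := @scale_level v al al0 tv Iv; first by rewrite al0_gt0 ltW.
 apply: le_trans Ew; have : (critical_value s A Om om al0 <= (al0^-1)%:E * modular (nu n) A (Ds s w))%E.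
 by apply: ereal_inf_lbound; exists w.
 by rewrite crE modular_energy mulrC EFinM lee_pmul2l ?lte_fin ?invr_gt0.
(* If X were 0, [key] would give al r^n <= 0 for any admissible test function; the finiteness of the
   critical value provides one when al > al0. *)
have Xp : 0 < X.
 rewrite lt0r X0 andbT; apply/eqP => Xz.
 have K v e : test_functions Om v -> weighted_modular A Om om v = al%:E -> 0 < e ->
 (if al <= al0 then e <= 2 * r ^+ n else r ^+ n <= e) -> ~ (energy (n := n) B s v <= e%:E)%E.
 by move=> tv Iv e0 ce /(key v e tv Iv e0 ce); rewrite Xz mul0r leNgt mulr_gt0.
 have [aa|aa] := leP al al0.
 have [v [tv Iv Ev]] := small aa; apply: (K v _ tv Iv _ _ Ev); rewrite ?aa ?mulr_gt0//.
 move: Hfin => /ereal_inf_lt[_ [v [tv Iv] <-]]; rewrite modular_energy => Ev.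
 have [x Ex] : exists x, energy (n := n) B s v = x%:E.
 move: Ev (E0 v); case: (energy _ _ _) => [x| |] //; first by exists x.
 by rewrite gt0_muley// lte_fin invr_gt0.
 apply: (K v (Num.max x (r ^+ n)) tv Iv); first by rewrite lt_max rn orbT.
 by rewrite leNgt aa/= le_max lexx orbT.
 by rewrite Ex lee_fin le_max lexx.
split => //; rewrite leNgt; apply/negP => /ereal_inf_lt[_ [v [tv Iv] <-]]; rewrite modular_energy.
set e1 := al * r ^+ n / X; have e10 : 0 < e1 by rewrite !divr_gt0// mulr_gt0.
have -> : (r ^+ n / X)%:E = ((al^-1)%:E * e1%:E)%E by rewrite -EFinM /e1; congr EFin; field; rewrite !gt_eqF.
rewrite lte_pmul2l ?lte_fin ?invr_gt0// => Ev1.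
have Xe1 : X * e1 = al * r ^+ n by rewrite /e1 mulrC divfK// gt_eqF.
have [x Ex] : exists x, energy (n := n) B s v = x%:E.
 by move: Ev1 (E0 v); case: (energy _ _ _) => [x| |] //; exists x.
have x0 : 0 <= x by rewrite -lee_fin -Ex.
rewrite Ex lte_fin in Ev1.
(* The midpoint is positive even if the energy x is 0, and still below e1, so that [key] applies and
   is contradicted. *)
have fin : (if al <= al0 then (x + e1) / 2 <= 2 * r ^+ n else r ^+ n <= (x + e1) / 2) -> False.
 move=> ce; have e0 : 0 < (x + e1) / 2 by rewrite divr_gt0// ltr_wpDl.
 have := key v _ tv Iv e0 ce; rewrite Ex lee_fin => /(_ _)/wrap[|]; first by lra.
 by rewrite leNgt -Xe1 ltr_pM2l//; apply/negP/negPn; lra.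
have [aa|aa] := leP al al0; last first.
 apply: fin; rewrite leNgt aa/=; have := large v aa tv Iv; rewrite Ex lee_fin; lra.
have [h|h] := leP e1 (2 * r ^+ n); first by apply: fin; rewrite aa; lra.
have [w [tw Iw Ew]] := small aa; have r2 : 0 < 2 * r ^+ n by rewrite mulr_gt0.
have := key w (2 * r ^+ n) tw Iw r2; rewrite aa => /(_ (lexx _) Ew).
by rewrite leNgt -Xe1 ltr_pM2l// h.
Qed.

End eigenvalue_lower_bound.

(** * Smoothness of products, dilations and convolutions *)

Section smooth_classes.
Context {R : realType} {n : nat}.
Local Notation mu := (@rV_lebesgue R n).
Implicit Types (f g u v : 'rV[R]_n -> R) (x y : 'rV[R]_n).
Local Notation e_ i := (delta_mx ord0 i : 'rV[R]_n).

(** Coinduction: smoothness holds on any class of continuous, partially differentiable functions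
    that is stable under partial derivatives. *)
Lemma smooth_class (Q : ('rV[R]_n -> R) -> Prop) f :
 (forall f, Q f -> continuous f /\ forall i, (forall x, derivable f x (e_ i)) /\ Q (partial i f)) ->
 Q f -> smooth f.
Proof.
move=> HQ Qf l; have Ql : Q (foldr (@partial R n) f l).
 by elim: l => //= i l IH; have [_ /(_ i)[_]] := HQ _ IH.
by have [cf df] := HQ _ Ql; split=> // i x; have [] := df i.
Qed.

Lemma smooth_partial f i : smooth f -> smooth (partial i f).
Proof. by move=> sf l; have := sf (rcons l i); rewrite foldr_rcons. Qed.

(** Sums of products of smooth functions: the class that Leibniz' rule leaves stable. *)
Inductive product_class : ('rV[R]_n -> R) -> Prop :=
| product_class_mul f g : smooth f -> smooth g -> product_class (f * g)
| product_class_add f g : product_class f -> product_class g -> product_class (f + g).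

Lemma smooth_mul f g : smooth f -> smooth g -> smooth (f * g).
Proof.
move=> sf sg; apply: (@smooth_class product_class); last exact: product_class_mul.
move=> h; elim=> {f g sf sg h} [f g sf sg|f g _ [cf df] _ [cg dg]].
 have [cf df] := sf [::]; have [cg dg] := sg [::].
 split=> [x|i]; first exact: (cvgM (cf x) (cg x)).
 split=> [x|]; first exact: (derivableM (df i x) (dg i x)).
 have -> : partial i (f * g) = f * partial i g + g * partial i f.
 by apply/funext => x; exact: (deriveM (df i x) (dg i x)).
 exact: (product_class_add (product_class_mul sf (smooth_partial i sg)) (product_class_mul sg (smooth_partial i sf))).
split=> [x|i]; first exact: (cvgD (cf x) (cg x)).
have [dfi pf] := df i; have [dgi pg] := dg i.
split=> [x|]; first exact: (derivableD (dfi x) (dgi x)).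
have -> : partial i (f + g) = partial i f + partial i g.
 by apply/funext => x; exact: (deriveD (dfi x) (dgi x)).
exact: product_class_add.
Qed.

Lemma is_derive_scale f (c : R) i x : derivable f (c *: x) (e_ i) ->
 is_derive x (e_ i) (fun x => f (c *: x)) (c * partial i f (c *: x)).
Proof.
move=> df; have d0 : is_derive (0 : R) (1 : R) (fun t : R => f (c *: x + t *: e_ i)) (partial i f (c *: x + 0 *: e_ i)).
 by apply: is_derive_line; rewrite scale0r addr0.
have d1 : is_derive (0 : R) (1 : R) (fun t : R => f (c *: x + (c * t) *: e_ i)) (c * partial i f (c *: x)).
 have dc : is_derive (0 : R) (1 : R) (fun t : R => c * t) c.
 by have := @is_deriveZ R R^o R^o id c 0 1 1 (is_derive_id _ _); rewrite (_ : c *: (1 : R^o) = c)//; exact: mulr1.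
 have d0' : is_derive (c * 0) (1 : R) (fun t : R => f (c *: x + t *: e_ i)) (partial i f (c *: x)).
 by move: d0; rewrite scale0r addr0 mulr0.
 by have := @is_derive1_comp R _ _ 0 _ _ d0' dc; rewrite mulrC.
have E : (fun t : R => t^-1 *: (f (c *: (t *: e_ i + x)) - f (c *: x))) =
 (fun t : R => t^-1 *: (f (c *: x + (c * (t *: (1 : R^o) + 0 : R)) *: e_ i) - f (c *: x + (c * 0) *: e_ i))).
 apply/funext => t; congr (_ *: (f _ - f _)).
 by rewrite scalerDr scalerA addrC addr0 (_ : t *: (1 : R^o) = t)//; exact: mulr1.
 by rewrite mulr0 scale0r addr0.
have [d1d d1e] := d1; apply: DeriveDef; first by rewrite /derivable E.
by rewrite /derive E.
Qed.

Lemma smooth_dilate f (c : R) : smooth f -> smooth (fun x => f (c *: x)).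
Proof.
move=> sf; pose Q h := exists2 g, smooth g & exists a : R, h = fun x => a * g (c *: x).
apply: (@smooth_class Q); last by exists f => //; exists 1; apply/funext => x; rewrite mul1r.
move=> h [g sg [a ->]]; have [cg dg] := sg [::]; split=> [x|i].
 have cz : (fun z : 'rV[R]_n => c *: z) @ x --> c *: x by exact: (cvgZ (cvg_cst _) cvg_id).
 exact: (cvgM (cvg_cst _) (cvg_comp (fun z : 'rV[R]_n => c *: z) g cz (cg (c *: x)))).
have D x := is_derive_scale (dg i (c *: x)).
have D' x : is_derive x (e_ i) (fun x => a * g (c *: x)) (a * (c * partial i g (c *: x))).
 exact: (@is_deriveZ R _ _ (fun x => g (c *: x)) a x (e_ i) _ (D x)).
split=> [x|]; first by have [] := D' x.
exists (partial i g); first exact: smooth_partial.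
by exists (a * c); apply/funext => x; have [_ E] := D' x; rewrite /partial E mulrA.
Qed.

Lemma taylor1 f i (M : R) : (forall x, derivable f x (e_ i)) ->
 (forall x (h : R), `|partial i f (x + h *: e_ i) - partial i f x| <= M * `|h|) ->
 forall x (h : R), `|f (x + h *: e_ i) - f x - h * partial i f x| <= M * h ^+ 2.
Proof.
move=> df fM x h; pose gg t := f (x + t *: e_ i) - t * partial i f x.
have dg (t : R) : is_derive t (1 : R) gg (partial i f (x + t *: e_ i) - partial i f x).
 have d1 := is_derive_line (df (x + t *: e_ i)).
 have d2 : is_derive t (1 : R) (fun t : R => t * partial i f x) (partial i f x).
 have := @is_deriveM R _ id (cst (partial i f x)) t 1 1 0 (is_derive_id _ _) (is_derive_cst _ _ _).
 by rewrite scaler0 add0r (_ : _ *: 1 = partial i f x)//; exact: mulr1.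
 exact: (is_deriveB d1 d2).
have cg : continuous gg by move=> t; apply: differentiable_continuous; apply/derivable1_diffP; have [] := dg t.
have g0 : gg 0 = f x by rewrite /gg scale0r addr0 mul0r subr0.
have -> : f (x + h *: e_ i) - f x - h * partial i f x = gg h - gg 0 by rewrite g0 /gg; ring.
have M0 : 0 <= M by have := fM x 1; rewrite normr1 mulr1; apply: le_trans.
have step (t : R) : `|t| <= `|h| -> `|(partial i f (x + t *: e_ i) - partial i f x) * h| <= M * h ^+ 2.
 move=> th; rewrite normrM -(real_normK (num_real h)) expr2 mulrA ler_wpM2r//.
 by rewrite (le_trans (fM x t))// ler_wpM2l.
have [h0|h0] := leP 0 h.
 have [|t] := @MVT_segment R gg _ 0 h h0 (fun t _ => dg t); first exact: continuous_subspaceT.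
 by rewrite in_itv/= => /andP[t0 th] ->; rewrite subr0; apply: step; rewrite !ger0_norm.
have [|t] := @MVT_segment R gg _ h 0 (ltW h0) (fun t _ => dg t); first exact: continuous_subspaceT.
rewrite in_itv/= => /andP[th t0] E; rewrite distrC E sub0r mulrN normrN; apply: step.
by rewrite (ler0_norm t0) (ltr0_norm h0) lerN2.
Qed.

Context (n0 : (0 < n)%N) (S0 : 'rV[R]_n -> R) (iS : mu.-integrable setT (EFin \o S0)).

Definition convolve f x : R := fine (\int[mu]_y (S0 y * f (x - y))%:E)%E.

Let bounded_shift f (K : R) : continuous f -> (forall x, `|f x| <= K) -> forall x,
 mu.-integrable setT (EFin \o (fun y => S0 y * f (x - y))).
Proof.
move=> cf fK x; have mf : mfun (fun y => f (x - y)).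
 apply: (mcomp (cont_meas cf)).
 by apply: m_rVB; [exact: mcst|exact: mid].
by have [] := @weight_int R n setT openT S0 iS _ K mf (fun y _ => fK (x - y)).
Qed.

Let convolve_le (p q h : 'rV[R]_n -> R) (K : R) x x' : continuous p -> continuous q -> continuous h ->
 (exists K, forall x, `|p x| <= K) -> (exists K, forall x, `|q x| <= K) -> (exists K, forall x, `|h x| <= K) ->
 (forall y, `|p (x - y) - q (x' - y) - h (x' - y)| <= K) ->
 `|convolve p x - convolve q x' - convolve h x'| <= weight setT S0 * K.
Proof.
move=> cp cq ch [Kp pK] [Kq qK] [Kh hK] H.
have Ip := bounded_shift cp pK x; have Iq := bounded_shift cq qK x'; have Ih := bounded_shift ch hK x'.
have md (k : 'rV[R]_n -> R) (z : 'rV[R]_n) : continuous k -> mfun (fun y : 'rV[R]_n => k (z - y)).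
 move=> ck; apply: (mcomp (cont_meas ck)).
 by apply: m_rVB; [exact: mcst|exact: mid].
have m3 : mfun (fun y : 'rV[R]_n => p (x - y) - q (x' - y) - h (x' - y)).
 by apply: mfunB; [apply: mfunB|]; exact: md.
have [Ic] := @weight_int R n setT openT S0 iS _ K m3 (fun y _ => H y).
have Ipq : mu.-integrable setT (EFin \o ((fun y => S0 y * p (x - y)) \- (fun y => S0 y * q (x' - y)))).
 exact: (integrableB mTT Ip Iq).
have -> : convolve p x - convolve q x' - convolve h x' = \int[mu]_y (S0 y * (p (x - y) - q (x' - y) - h (x' - y))).
 have e1 : convolve p x - convolve q x' = \int[mu]_y (S0 y * p (x - y) - S0 y * q (x' - y)) by rewrite RintegralB.
 rewrite e1 -RintegralB//; apply: eq_Rintegral => y _; ring.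
by rewrite -lee_fin -EFin_normr_Rintegral.
Qed.

Lemma is_derive_quadratic f i (C L : R) x : 0 <= C ->
 (forall h : R, `|f (x + h *: e_ i) - f x - h * L| <= C * h ^+ 2) -> is_derive x (e_ i) f L.
Proof.
move=> C0 H; have E : h^-1 *: (f (h *: e_ i + x) - f x) @[h --> (0 : R)^'] --> L.
 apply/cvgrPdist_le => e e0; near=> h.
 have h0 : h != 0 by near: h; exact: nbhs_dnbhs_neq.
 have -> : L - h^-1 *: (f (h *: e_ i + x) - f x) = - (h^-1 * (f (x + h *: e_ i) - f x - h * L)).
 by rewrite [h *: _ + x]addrC; set F1 := f _; rewrite -[h^-1 *: _]/(h^-1 * (F1 - f x)); field.
 rewrite normrN normrM normfV ler_pdivrMl ?normr_gt0// (le_trans (H h))//.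
 rewrite -(real_normK (num_real h)) expr2 mulrA mulrC ler_wpM2l//.
 have hC : `|h| <= e / (C + 1).
 by near: h; apply: dnbhs0_le; rewrite divr_gt0// ltr_wpDl.
 rewrite (@le_trans _ _ ((C + 1) * (e / (C + 1))))// ?ler_pM// ?lerDl//.
 by rewrite mulrC divfK// gt_eqF// ltr_wpDl.
by apply: DeriveDef; [apply/cvg_ex; exists L|exact: cvg_lim].
Unshelve. all: by end_near.
Qed.

(** The Taylor error of the compactly supported factor is quadratic in h uniformly in the point, so
    the integrable factor lets it pass through the integral; the class of convolutions is thus
    stable under partial derivatives. *)
Lemma convolve_smooth f r : smooth f -> null_beyond r f -> smooth (convolve f).
Proof.
move=> sf vf; pose Q h := exists2 g, smooth g /\ null_beyond r g & h = convolve g.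
apply: (@smooth_class Q); last by exists f.
have bd g : smooth g -> null_beyond r g -> exists K, forall x, `|g x| <= K.
 by move=> sg vg; have [K _ HK] := vanishing_bounded (sg [::]).1 vg; exists K.
have c0 : continuous (cst 0 : 'rV[R]_n -> R) by exact: cst_continuous.
have b0 : exists K : R, forall x : 'rV[R]_n, `|cst 0 x : R| <= K by exists 0 => x; rewrite normr0.
have z0 x : convolve (cst 0) x = 0 by rewrite /convolve; under eqint do rewrite mulr0; rewrite integral0.
have W0 := @weight_ge0 R n setT S0.
move=> _ [g [sg vg] ->]; have [cg dg] := sg [::].
have H i : exists K : R, 0 < K /\ forall x, `|partial i g x| <= K.
 have [K K0 HK] := vanishing_bounded (smooth_partial i sg [::]).1 (partial_vanishing i vg).
 by exists K.
have /choice[K HK] := H; pose M := \sum_i K i.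
have M0 : 0 <= M by apply: sumr_ge0 => i _; rewrite ltW// (HK i).1.
have KM i x : `|partial i g x| <= M.
 by apply: (le_trans ((HK i).2 x)); rewrite /M (bigD1 i)//= lerDl sumr_ge0// => j _; rewrite ltW// (HK j).1.
have lip := lipschitz_of_partials M0 dg KM; split=> [|i].
 apply: (enorm_uniform_continuous n0) => e e0; pose W := weight setT S0 * (n%:R * M).
 have WW : 0 < W + 1 by rewrite ltr_wpDl// !mulr_ge0.
 exists (e / (W + 1)) => [|x z]; first exact: divr_gt0.
 rewrite ler_pdivlMr// => zx.
 have := @convolve_le g g (cst 0) (n%:R * M * enorm (x - z)) x z cg cg c0 (bd _ sg vg) (bd _ sg vg) b0.
 rewrite z0 subr0 => H1; apply: (le_trans (H1 _)) => [y|].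
 by rewrite subr0 (le_trans (lip _ _))// (_ : x - y - (z - y) = x - z)// opprB addrA subrK.
 by rewrite mulrA -/W (le_trans _ zx)// mulrC ler_wpM2l ?enorm_ge0// lerDl.
pose P := partial i g; have sP : smooth P := smooth_partial i sg.
have vP : null_beyond r P := partial_vanishing i vg.
have [K2 K20 HK2] := vanishing_bounded (smooth_partial i sP [::]).1 (partial_vanishing i vP).
have D x : is_derive x (e_ i) (convolve g) (convolve P x).
 apply: (@is_derive_quadratic _ _ (weight setT S0 * K2)); first by rewrite mulr_ge0// ltW.
 move=> h; pose hP := fun z => h * P z.
 have -> : h * convolve P x = convolve hP x.
 have [KP PK] := bd _ sP vP.
 have IP := bounded_shift (sP [::]).1 PK x.
 rewrite /convolve -[fine _ in LHS]/(\int[mu]_y (S0 y * P (x - y))) -RintegralZl//.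
 by apply: eq_Rintegral => y _; rewrite /hP mulrCA.
 rewrite -mulrA; apply: convolve_le => //; [|exact: bd|exact: bd| |].
 - by move=> z; exact: (cvgM (cvg_cst _) ((sP [::]).1 z)).
 - have [KP PK] := bd _ sP vP; exists (`|h| * KP) => z; rewrite normrM ler_wpM2l//; exact: PK.
 move=> y; have -> : x + h *: e_ i - y = x - y + h *: e_ i by rewrite addrAC.
 apply: (@taylor1 g i); first by move=> z; exact: dg.
 by move=> z t; exact: (partial_lip (fun z => (sP [::]).2 i z) HK2).
split=> [x|]; first by have [] := D x.
by exists P => //; apply/funext => x; have [_] := D x.
Qed.

End smooth_classes.

(** * Mollification does not increase the energy *)

Section mollification.
Context {R : realType} {n : nat} (n0 : (0 < n)%N).
Local Notation mu := (@rV_lebesgue R n).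
Implicit Types (f g u v k : 'rV[R]_n -> R) (x y h : 'rV[R]_n).

Lemma vanishing_integrable r f : continuous f -> null_beyond r f ->
 mu.-integrable setT (EFin \o f).
Proof.
move=> cf vf; have [M M0 fM] := vanishing_bounded cf vf.
apply/integrableP; split; first by apply/mEFinP; exact: cont_meas.
apply: (@le_lt_trans _ _ (\int[mu]_x (M * \1_(cube (0 : 'rV[R]_n) `|r|) x)%:E)%E).
 apply: le_int_sup => x //=; rewrite lee_fin.
 have [xr|/vf ->] := leP (enorm x) r; last by rewrite normr0 mulr_ge0// ltW.
 rewrite indicE mem_set ?mulr1// => i; rewrite mxE sub0r normrN.
 by rewrite (le_trans (coord_le_enorm _ _))// (le_trans xr)// ler_norm.
under eqint do rewrite EFinM.
rewrite intZlE ?(ltW M0)//; last first.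
 by apply/mEFinP; apply: mindic; exact: m_cube.
rewrite integral_indic ?setIT//; last exact: m_cube.
have e := @rV_lebesgue_cube R n 0 `|r| (normr_ge0 r).
apply: lte_mul_pinfty; rewrite ?lee_fin ?(ltW M0)//.
by have := ltry ((2 * `|r|) ^+ n); rewrite -e.
Qed.

(** Any nonzero smooth f of bounded support will do: its square is dilated to radius d and
    normalized. Such an f comes later from the finiteness of the critical value. *)
Lemma mollifier r f : smooth f -> null_beyond r f ->
 (\int[mu]_x (f x * f x)%:E != 0)%E -> forall d, 0 < d -> exists k,
 [/\ smooth k, forall x, 0 <= k x, null_beyond d k & (\int[mu]_x (k x)%:E = 1)%E].
Proof.
move=> sf vf In0 d d0; have [cf _] := sf [::].
have cff : continuous (f * f) by move=> x; exact: (cvgM (cf x) (cf x)).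
have vff : null_beyond r (f * f) by move=> x /vf fx; rewrite -[(f * f) x]/(f x * f x) fx mul0r.
have If := vanishing_integrable cff vff; have mff := cont_meas cff.
have ff0 x : 0 <= (f * f) x by rewrite -[(f * f) x]/(f x * f x) -expr2 sqr_ge0.
have [I IE] : exists I, (\int[mu]_x ((f * f) x)%:E = I%:E)%E.
 by exists (fine (\int[mu]_x ((f * f) x)%:E)%E); rewrite fineK//; exact: (int_fin mTT If).
have I0 : 0 < I.
 rewrite lt0r -lee_fin -IE int_ge0 ?andbT//; last by move=> x _; rewrite lee_fin.
 by apply: contra In0 => /eqP z; apply/eqP; rewrite z in IE; exact: IE.
pose r1 := `|r| + 1; have r10 : 0 < r1 by rewrite ltr_wpDl.
pose de := d / r1; have de0 : 0 < de by rewrite divr_gt0.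
have den : 0 < de ^+ n by rewrite exprn_gt0.
pose c := (de ^+ n * I)^-1; have c0 : 0 < c by rewrite invr_gt0 mulr_gt0.
exists (fun x => c * (f * f) (de^-1 *: x)); split.
- exact: (smooth_scale _ (smooth_dilate _ (smooth_mul sf sf))).
- by move=> x; rewrite mulr_ge0// ltW.
- move=> x dx; rewrite vff ?mulr0// enormZ gtr0_norm ?invr_gt0//.
 rewrite mulrC ltr_pdivlMr// (lt_le_trans _ (ltW dx))//.
 by rewrite /de mulrCA gtr_pMr// ltr_pdivrMr// mul1r /r1 (le_lt_trans (ler_norm r))// ltrDl.
have mk : mfun (fun x => c * (f * f) (de^-1 *: x)).
 apply: cont_meas; exact: (smooth_scale c (smooth_dilate de^-1 (smooth_mul sf sf)) [::]).1.
rewrite (@integral_rV_affine _ _ de 0 (fun x => (c * (f * f) (de^-1 *: x))%:E)) ?gt_eqF//; last 2 first.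
- exact/mEFinP.
- by move=> x; rewrite lee_fin mulr_ge0// ltW.
under eqint do rewrite addr0 scalerA mulVf ?gt_eqF// scale1r EFinM.
rewrite intZlE ?(ltW c0)//; last 2 first.
- by move=> x _; rewrite lee_fin.
- exact/mEFinP.
rewrite IE -!EFinM gtr0_norm// /c; congr (_%:E); field.
by rewrite !gt_eqF.
Qed.

Lemma m_translate h :
 mfun (fun z : 'rV[R]_n * 'rV[R]_n => (z.1 - h, z.2 - h)).
Proof.
by apply: measurable_fun_pair; apply: m_rVB; (exact: mfst || exact: msnd || exact: mcst).
Qed.

Lemma nu_translate (f : 'rV[R]_n * 'rV[R]_n -> \bar R) h : mfun f ->
 (forall z, (0 <= f z)%E) -> (\int[nu n]_z f (z.1 - h, z.2 - h)%R = \int[nu n]_z f z)%E.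
Proof.
move=> mf f0; have md : mfun (fun z : 'rV[R]_n * 'rV[R]_n => (nu_density z)%:E).
 by apply/mEFinP; exact: measurable_nu_density.
pose g z := (f z * (nu_density z)%:E)%E.
have mg : mfun g by exact: emfunM.
have g0 z : (0 <= g z)%E by rewrite mule_ge0// lee_fin powR_ge0.
have mT := m_translate h.
have mfT := mcomp mf mT; have mgT := mcomp mg mT.
have e1 := int_nu mfT (fun z => f0 _); have e2 := int_nu mf f0.
rewrite [LHS]e1 [RHS]e2 {e1 e2}.
transitivity (\int[mu \x mu]_z g (z.1 - h, z.2 - h)%R)%E.
 apply: eqint => z _; rewrite /g /nu_density /=; congr (_ * (enorm _ `^ _)%:E)%E.
 by rewrite opprB addrA subrK.
have e1 := @fubini_tonelli1 _ _ _ _ R mu mu _ mgT (fun z => g0 _).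
have e2 := @fubini_tonelli1 _ _ _ _ R mu mu _ mg g0.
apply: (etrans e1); apply: (etrans _ (esym e2)) => {e1 e2}.
have mG := mtonF (m2 := mu) _ mg g0.
have G0 x : (0 <= fubini_F mu g x)%E by apply: int_ge0 => y _; exact: g0.
apply: (etrans _ (@integral_rV_shift R n _ (- h) mG G0)).
apply: eqint => x _.
exact: (@integral_rV_shift R n (fun y => g (x - h, y)%R) (- h) (mcomp mg (mpair1 _)) (fun y => g0 _)).
Qed.

Context (B : R -> R) (HB : nyoung B) (s : R) (s0 : 0 < s).
Context (S k : 'rV[R]_n -> R) (M d : R) (cS : continuous S) (SM : forall x, `|S x| <= M).
Context (ck : continuous k) (k0 : forall x, 0 <= k x) (vk : null_beyond d k).
Context (k1 : (\int[mu]_x (k x)%:E = 1)%E).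
Local Notation I f := (\int[mu]_x (k x * f x))%R.

Let mS := cont_meas cS.
Let mk := cont_meas ck.
Let ik := vanishing_integrable ck vk.

Let mker f K : mfun f -> (forall x, `|f x| <= K) ->
 mu.-integrable setT (EFin \o (fun x => k x * f x)).
Proof. by move=> mf fK; have [] := @weight_int R n setT openT k ik f K mf (fun y _ => fK y). Qed.

Let Icst (c : R) : I (cst c) = c.
Proof.
rewrite (_ : (fun x => _) = fun x => c * k x); last by apply/funext => x; rewrite mulrC.
by rewrite RintegralZl// /Rintegral k1 mulr1.
Qed.

Let I_le f g K L : mfun f -> mfun g -> (forall x, `|f x| <= K) ->
 (forall x, `|g x| <= L) -> (forall x, enorm x <= d -> f x <= g x) -> I f <= I g.
Proof.
move=> mf mg fK gL fg; apply: le_Rintegral => //; [exact: (mker mf fK)|exact: (mker mg gL)|].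
move=> x _; have [xd|/vk ->] := leP (enorm x) d; last by rewrite !mul0r.
by rewrite ler_wpM2l ?fg.
Qed.

Let mshift f x : mfun f -> mfun (fun h => f (x - h)).
Proof.
move=> mf; apply: (mcomp mf).
by apply: m_rVB; [exact: mcst|exact: mid].
Qed.

(** Exchanges the roles of the factors: smoothness is proved with the translations on k, the
    estimates need them on S. *)
Lemma convolve_reflect x : convolve S k x = I (fun h => S (x - h)).
Proof.
pose F h := (k h * S (x - h))%:E.
have mF : mfun F.
 by apply/mEFinP; apply: mfunM => //; exact: mshift.
rewrite /convolve /Rintegral; congr fine.
rewrite [RHS]integralE -(integral_rV_reflect x (measurable_funepos mF))//.
rewrite -(integral_rV_reflect x (measurable_funeneg mF))// [LHS]integralE.
by congr (_ - _)%E; apply: eqint => y _; rewrite ?funeposE ?funenegE /F subKr mulrC.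
Qed.

Lemma convolve_close x (c e : R) : (forall y, enorm (x - y) <= d -> `|S y - c| <= e) ->
 `|convolve S k x - c| <= e.
Proof.
move=> H; have mSx := @mshift S x mS; have bS h : `|S (x - h)| <= M by exact: SM.
have bc (c' : R) h : `|cst c' h| <= `|c'| by [].
have xh h : enorm h <= d -> `|S (x - h) - c| <= e by move=> hd; apply: H; rewrite subKr.
rewrite convolve_reflect ler_distl -(Icst (c - e)) -(Icst (c + e)); apply/andP; split.
 apply: (I_le _ mSx (bc _) bS) => // h /xh; rewrite ler_distl => /andP[]//.
by apply: (I_le mSx _ bS (bc _)) => // h /xh; rewrite ler_distl => /andP[].
Qed.

Lemma jensen_kernel f K : mfun f -> (forall x, `|f x| <= K) ->
 ((B `|I f|)%:E <= \int[mu]_x (k x * B `|f x|)%:E)%E.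
Proof.
move=> mf fK; set t0 := `|I f|.
have [b b0 Hb] := nyoung_support HB (normr_ge0 (I f)); rewrite -/t0 in Hb.
have mB : mfun (fun x => B `|f x|) by apply/mEFinP; exact: m_young.
have BK x : `|B `|f x| | <= B K.
 by rewrite ger0_norm ?(nyoung_ge0 HB)//; exact: (nyoung_le HB).
have IB := mker mB BK.
have mn : mfun (fun x => `|f x|) by apply: mcomp => //; exact: mnormr.
have nK x : `| `|f x| | <= K by rewrite normr_id.
have In := mker mn nK; have If := mker mf fK.
rewrite -(@fineK _ (\int[mu]_x _)%E) ?lee_fin; last exact: (int_fin mTT IB).
have step : t0 <= I (fun x => `|f x|).
 apply: (le_trans (le_normr_Rintegral _ If)) => //; apply: eq_imp_le.
 by apply: eq_Rintegral => x _; rewrite normrM ger0_norm.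
pose g x := (B t0 - b * t0) + b * `|f x|.
have mg : mfun g by apply: mfunD => //; exact: mfunM.
have gK x : `|g x| <= `|B t0 - b * t0| + b * K.
 by rewrite (le_trans (ler_normD _ _))// lerD// normrM (ger0_norm b0) ler_wpM2l.
apply: (@le_trans _ _ (I g)); last first.
 by apply: (I_le mg mB gK BK) => x _; have := Hb _ (normr_ge0 (f x)); rewrite /g; lra.
have -> : I g = (B t0 - b * t0) + b * I (fun x => `|f x|).
 transitivity (I (cst (B t0 - b * t0)) + b * I (fun x => `|f x|)); last by rewrite Icst.
 rewrite -RintegralZl// -RintegralD//; last 2 first.
 - by apply: (@mker (cst (B t0 - b * t0)) `|B t0 - b * t0|).
 - have := integrableZl mTT b In; apply: eq_integrable => // x _; by rewrite /= -EFinM.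
 by apply: eq_Rintegral => x _; rewrite /g /=; ring.
by have := ler_wpM2l b0 step; lra.
Qed.

(** Jensen for the probability density k takes the average out of B; each translate of S has the
    energy of S, by translation invariance of [nu]. *)
Lemma energy_convolve (E : R) : energy B s S = E%:E -> (energy B s (convolve S k) <= E%:E)%E.
Proof.
move=> SE; pose q h (z : 'rV[R]_n * 'rV[R]_n) := Ds s S (z.1 - h, z.2 - h).
pose F (w : ('rV[R]_n * 'rV[R]_n) * 'rV[R]_n) := (k w.2 * B `|q w.2 w.1|)%:E.
have mDS := m_Ds s mS.
have mq : mfun (fun w : ('rV[R]_n * 'rV[R]_n) * 'rV[R]_n => q w.2 w.1).
 apply: (mcomp mDS); apply: measurable_fun_pair; apply: m_rVB => //.
 by apply: (mcomp mfst).
 by apply: (mcomp msnd).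
have mF : mfun F.
 apply/mEFinP; apply: mfunM; first exact: (mcomp mk msnd).
 by apply/mEFinP; exact: m_young.
have F0 w : (0 <= F w)%E by rewrite lee_fin mulr_ge0// (nyoung_ge0 HB).
apply: (@le_trans _ _ (\int[nu n]_z \int[mu]_h F (z, h))%E).
 apply: le_int_sup => z; first by rewrite lee_fin (nyoung_ge0 HB).
 have mqz : mfun (fun h => q h z) by exact: (mcomp mq (mpair1 z)).
 set D := enorm (z.1 - z.2) `^ s.
 have qE h : q h z = (S (z.1 - h) - S (z.2 - h)) / D by rewrite /q /Ds /= opprB addrA subrK.
 have D0 : 0 <= D^-1 by rewrite invr_ge0 powR_ge0.
 have qK h : `|q h z| <= (M + M) / D.
 by rewrite qE normrM (ger0_norm D0) ler_wpM2r// (le_trans (ler_normB _ _))// lerD.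
 apply: le_trans (jensen_kernel mqz qK); rewrite lee_fin; apply: eq_imp_le.
 congr (B `|_|); rewrite /Ds -/D !convolve_reflect.
 have Is x : mu.-integrable setT (EFin \o (fun h => k h * S (x - h))).
 by apply: (@mker (fun h => S (x - h)) M) => //; exact: mshift.
 rewrite -RintegralB// -RintegralZr//; last exact: (integrableB mTT (Is _) (Is _)).
 by apply: eq_Rintegral => h _; rewrite qE; ring.
have [-> _] := nu_tonelli_gen mu mF F0.
have E0 : (0 <= E%:E)%E by rewrite -SE; apply: int_ge0 => z _; rewrite lee_fin (nyoung_ge0 HB).
apply: (@le_trans _ _ (\int[mu]_h (E%:E * (k h)%:E))%E); last first.
 by rewrite intZlE ?k1 ?mule1// => [h _|]; [rewrite lee_fin|exact/mEFinP].
apply: le_int_sup => h; first by apply: int_ge0 => z _; exact: F0.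
have mqh : mfun (fun z => (B `|q h z|)%:E).
 exact: (m_young HB (mcomp mDS (m_translate h))).
rewrite /F /=; under eqint do rewrite EFinM.
rewrite intZlE//; last by move=> z _; rewrite lee_fin (nyoung_ge0 HB).
have -> : (\int[nu n]_z (B `|q h z|)%:E = E%:E)%E; last by rewrite muleC.
have mE : mfun (fun z => (B `|Ds s S z|)%:E) by exact: m_energy.
have E1 z : (0 <= (B `|Ds s S z|)%:E)%E by rewrite lee_fin (nyoung_ge0 HB).
by rewrite -SE; exact: (nu_translate h mE E1).
Qed.

End mollification.

(** * The derivative of the Young function and the flux *)

Section flux.
Context {R : realType} (A a : R -> \bar R) (ha : young_derivative A a).
Context (B : R -> R) (HB : nyoung B) (AB : forall t, 0 <= t -> A t = (B t)%:E).
Local Notation leb := (@lebesgue_measure R).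

Let a_ge0 t : 0 <= t -> (0 <= a t)%E. Proof. by case: ha => H _ _ _; exact: H. Qed.
Let a_le x y : 0 <= x -> x <= y -> (a x <= a y)%E.
Proof. by case: ha => _ H _ _ x0 xy; apply: H; rewrite x0. Qed.

Let leb_itv (x y : R) : x <= y -> leb `[x, y]%classic = (y - x)%:E.
Proof.
rewrite le_eqVlt => /predU1P[->|xy]; first by rewrite set_itv1 lebesgue_measure_set1 subrr.
by rewrite leb_itvE/= lte_fin xy.
Qed.

Lemma derivative_support t x : 0 <= t -> t <= x -> (a t * (x - t)%:E <= (B x)%:E)%E.
Proof.
move=> t0 tx; have x0 := le_trans t0 tx; have [_ _ _ AI] := ha; rewrite -AB// AI//.
rewrite -leb_itv// -integral_cst// int_mkcond [leRHS]int_mkcond.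
apply: le_int_sup => y; rewrite /patch; first by case: ifP => // _; exact: a_ge0.
case: ifPn => [/set_mem/=|_]; rewrite ?in_itv/=.
 by move=> /andP[ty yx]; rewrite mem_set /= ?in_itv/= ?(le_trans t0 ty)//; exact: a_le.
by case: ifPn => // /set_mem/=; rewrite in_itv/= => /andP[? _]; exact: a_ge0.
Qed.

Lemma derivative_upper t : 0 <= t -> ((B t)%:E <= a t * t%:E)%E.
Proof.
move=> t0; have [_ _ _ AI] := ha; rewrite -AB// AI//.
rewrite -[X in (_ * X%:E)%E]subr0 -leb_itv// -integral_cst// [leLHS]int_mkcond [leRHS]int_mkcond.
apply: le_int_sup => y; rewrite /patch.
 by case: ifPn => // /set_mem/=; rewrite in_itv/= => /andP[? _]; exact: a_ge0.
by case: ifPn => // /set_mem/=; rewrite in_itv/= => /andP[? ?]; exact: a_le.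
Qed.

(** Real-valued version of a, constant on the negative axis so that it is monotone on the whole
    line, hence measurable. *)
Definition slope_fun (t : R) : R := fine (a (Num.max t 0)).
Local Notation b := slope_fun.

Lemma slope_funE t : 0 <= t -> a t = (b t)%:E.
Proof.
move=> t0; rewrite /slope_fun max_l//; have := @derivative_support t (t + 1) t0.
rewrite lerDl ler01 addrAC subrr add0r mule1 => /(_ isT).
by move=> /(ge0_le_EFinP (a_ge0 t0))[r -> _].
Qed.

Lemma slope_fun_ge0 t : 0 <= b t.
Proof. by rewrite /slope_fun fine_ge0// a_ge0// le_max lexx orbT. Qed.

Lemma slope_fun_le x y : x <= y -> b x <= b y.
Proof.
move=> xy; have m0 z : (0 : R) <= Num.max z 0 by rewrite le_max lexx orbT.
have mb z : b z = b (Num.max z 0) by rewrite /slope_fun (max_l (m0 z)).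
by rewrite (mb x) (mb y) -lee_fin -!slope_funE// a_le// ge_max m0 andbT le_max xy.
Qed.

Lemma m_slope_fun : mfun b.
Proof. by apply: nondecreasing_measurable => // x y xy; exact: slope_fun_le. Qed.

Lemma slope_fun_support t x : 0 <= t -> t <= x -> b t * (x - t) <= B x.
Proof. by move=> t0 tx; have := derivative_support t0 tx; rewrite slope_funE// -EFinM lee_fin. Qed.

Lemma slope_fun_upper t : 0 <= t -> B t <= b t * t.
Proof. by move=> t0; have := derivative_upper t0; rewrite slope_funE// -EFinM lee_fin. Qed.

(** The support inequality between t and 2 t gives a(t) t <= A(2 t), and Delta_2 bounds this by c
    A(t). *)
Lemma p_index_fin : exists2 p : R, p_index A a = p%:E & 0 < p /\ forall t, 0 <= t -> b t * t <= p * B t.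
Proof.
have [c c0 Hc] := nyoung_Delta2 HB.
have qE t : 0 < t -> (a t * t%:E / A t)%E = (b t * t / B t)%:E.
 move=> t0; rewrite slope_funE ?ltW// -EFinM (young_quotient HB AB)//.
 by rewrite mulr_ge0 ?slope_fun_ge0// ltW.
have ub t : 0 < t -> ((b t * t / B t)%:E <= p_index A a)%E.
 by move=> t0; rewrite -qE//; apply: ereal_sup_ubound; exists t.
have le : (p_index A a <= c%:E)%E.
 apply: ge_ereal_sup => _ [t /= t0 <-]; rewrite qE// lee_fin ldivMr ?(nyoung_gt0 HB)//.
 apply: le_trans (Hc _ (ltW t0)); have := @slope_fun_support t (2 * t) (ltW t0).
 by rewrite (_ : 2 * t - t = t); [apply; lra|ring].
have B1 := nyoung_gt0 HB (ltr01 : (0 : R) < 1).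
have b1 : 0 < b 1 * 1 / B 1 by rewrite divr_gt0// (lt_le_trans B1)// slope_fun_upper.
have [|p pE _] := ge0_le_EFinP (le_trans _ (ub 1 ltr01)) le; first by rewrite lee_fin ltW.
exists p => //; rewrite pE in ub; split; first by apply: (lt_le_trans b1); rewrite -lee_fin ub.
move=> t; rewrite le_eqVlt => /predU1P[<-|t0]; first by rewrite mulr0 (nyoung0 HB) mulr0.
by rewrite -ldivMr ?(nyoung_gt0 HB)// -lee_fin ub.
Qed.

(** For t <= x the support inequality at t is added to b(t) t <= p B(t); for x < t one simply has
    b(t) x <= b(t) t. *)
Lemma slope_fun_young p t x : 0 <= p -> (forall t, 0 <= t -> b t * t <= p * B t) ->
 0 <= t -> 0 <= x -> b t * x <= p * B t + B x.
Proof.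
move=> p0 Hp t0 x0; have := Hp t t0; have [tx|xt] := leP t x.
 by have := slope_fun_support t0 tx; lra.
by have := ler_wpM2l (slope_fun_ge0 t) (ltW xt); have := nyoung_ge0 HB x0; lra.
Qed.

Definition flux t r := b `|t| * (t * r / `|t|).

Lemma flux_le t r : `|flux t r| <= b `|t| * `|r|.
Proof.
rewrite /flux normrM (ger0_norm (slope_fun_ge0 _)) ler_wpM2l ?slope_fun_ge0//.
rewrite !normrM normfV normr_id; have [->|t0] := eqVneq t 0; first by rewrite normr0 invr0 mulr0.
by rewrite mulrAC divff ?mul1r// normr_eq0.
Qed.

Lemma flux_diag t : flux t t = b `|t| * `|t|.
Proof.
rewrite /flux; congr (_ * _); rewrite -expr2 -(real_normK (num_real t)) expr2.
by have [->|t0] := eqVneq t 0; rewrite ?normr0 ?mulr0 ?mul0r// mulfK// normr_eq0.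
Qed.

Lemma fluxB t r r' : flux t r - flux t r' = flux t (r - r').
Proof. by rewrite /flux; ring. Qed.

Lemma m_flux d (T : measurableType d) (f g : T -> R) : mfun f ->
 mfun g -> mfun (fun x => flux (f x) (g x)).
Proof.
move=> mf mg; have mn : mfun (fun x => `|f x|).
 by apply: mcomp => //; exact: mnormr.
apply: mfunM; first exact: (mcomp m_slope_fun mn).
apply: mfunM; first exact: (mfunM mf mg).
have -> : (fun x => `|f x|^-1) = (fun x => `|f x| `^ (-1)) by apply/funext => x; rewrite powR_inv1.
exact: (mcomp (mpowR _) mn).
Qed.

End flux.

Lemma limn_einf_le (R : realType) (v : (\bar R)^nat) (c : \bar R) : (forall k, (v k <= c)%E) -> (limn_einf v <= c)%E.
Proof.
move=> vc; rewrite limn_einf_lim; apply: lime_le; first exact: is_cvg_einfs.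
apply: nearW => k; apply: le_trans (vc k); apply: ereal_inf_lbound; exists k => //=.
Qed.

(** * Approximation by test functions, and energy against eigenvalue *)

Section truncation.
Context {R : realType}.

(** Soft thresholding: 1-Lipschitz, so it does not raise the energy, within e of the identity, and
    zero for |t| <= e, which detaches the support from the boundary of Om. *)
Definition truncate (e t : R) := t - Num.max (- e) (Num.min e t).

Lemma truncateP (e t : R) : 0 <= e -> [\/ (e <= t /\ 0 <= e) /\ truncate e t = t - e,
 (- e <= t /\ t <= e) /\ truncate e t = 0 | (t <= - e /\ 0 <= e) /\ truncate e t = t + e].
Proof.
move=> e0; rewrite /truncate; have [h|h] := leP e t.
 by constructor 1; rewrite max_r; [|lra].
have [h'|h'] := leP (- e) t; first by constructor 2; rewrite subrr; do 2?split => //; exact: ltW.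
by constructor 3; rewrite opprK; do 2?split => //; exact: ltW.
Qed.

Lemma truncate_props (e t t' : R) : 0 <= e ->
 [/\ `|truncate e t - t| <= e, `|truncate e t - truncate e t'| <= `|t - t'| &
 `|t| <= e -> truncate e t = 0].
Proof.
move=> e0; split.
- by case: (truncateP t e0) => -[[h1 h2] ->]; rewrite ler_norml; apply/andP; split; lra.
- have h5 := ler_norm (t - t'); have h6 := ler_norm (t' - t); rewrite distrC in h6.
 by case: (truncateP t e0) => -[[h1 h2] ->]; case: (truncateP t' e0) => -[[h3 h4] ->];
 rewrite ler_norml; apply/andP; split; lra.
- by rewrite ler_norml => /andP[h5 h6]; case: (truncateP t e0) => -[[h1 h2] ->]; lra.
Qed.

End truncation.

Section eigenvalue.
Context {R : realType} {n : nat} (n0 : (0 < n)%N) (s : R) (s0 : 0 < s).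
Context (A a : R -> \bar R) (ha : young_derivative A a).
Context (B : R -> R) (HB : nyoung B) (AB : forall t, 0 <= t -> A t = (B t)%:E).
Context (Om : set 'rV[R]_n) (oOm : open Om) (bOm : bounded_set Om).
Local Notation mu := (@rV_lebesgue R n).
Local Notation b := (slope_fun a).
Local Notation flux := (flux a).

Section continuous.
Context (U : 'rV[R]_n -> R) (M : R) (cU : continuous U) (UM : forall x, `|U x| <= M).
Context (uU : forall e, 0 < e -> exists2 d : R, 0 < d & forall x y, enorm (x - y) <= d -> `|U x - U y| <= e).
Context (U0 : forall x, ~ Om x -> U x = 0) (E : R) (UE : energy B s U = E%:E).
Context (phi : 'rV[R]_n -> R) (tphi : test_functions Om phi).
Context (phi0 : (\int[mu]_x (phi x * phi x)%:E != 0)%E).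

(** Truncation at height h followed by mollification. Both keep the energy below E, and the support
    ends up in the closed set where |U| >= h/2, which is a compact part of Om. *)
Lemma test_approximation (e : R) : 0 < e -> exists w, [/\ test_functions Om w,
 forall x, `|w x - U x| <= e & (energy B s w <= E%:E)%E].
Proof.
move=> e0; pose h := e / 2; have h0 : 0 < h by rewrite divr_gt0.
pose S x := truncate h (U x).
have S1 x : `|S x - U x| <= h by case: (truncate_props (U x) 0 (ltW h0)).
have S2 x y : `|S x - S y| <= `|U x - U y| by case: (truncate_props (U x) (U y) (ltW h0)).
have S3 x : `|U x| <= h -> S x = 0 by case: (truncate_props (U x) 0 (ltW h0)).
have t00 : truncate h 0 = 0 by have [_ _] := truncate_props 0 0 (ltW h0); apply; rewrite normr0 ltW.
have SU x : `|S x| <= `|U x|.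
 by have [_ + _] := truncate_props (U x) 0 (ltW h0); rewrite t00 !subr0.
have cS : continuous S.
 apply: (enorm_uniform_continuous n0) => e' /uU[d d0 Hd]; exists d => // x y /Hd; exact: le_trans.
have SM x : `|S x| <= M := le_trans (SU x) (UM x).
have [r r0 Hr] := bounded_enorm n0 bOm.
have vS : null_beyond r S.
 move=> x rx; apply: S3; rewrite U0 ?normr0 ?ltW// => /Hr; by rewrite leNgt rx.
have h20 : 0 < h / 2 by rewrite divr_gt0.
(* At the scale of the mollifier U varies by at most h/2: if |U x| < h/2, then |U| <= h around x,
   where S vanishes. *)
have [d d0 Hd] := uU h20.
have [sphi _ _] := tphi; have [r' vphi] := test_vanishing tphi.
have [k [sk k0 vk k1]] := mollifier sphi vphi phi0 d0.
have ck := (sk [::]).1; have iS := vanishing_integrable cS vS.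
exists (convolve S k); split.
- have sub : closure [set x | convolve S k x != 0] `<=` [set x | h / 2 <= `|U x|].
 have cF : closed [set x | h / 2 <= `|U x|].
 rewrite (_ : [set x | _] = (fun x => `|U x|) @^-1` [set t | h / 2 <= t])//.
 apply: closed_comp => [x _|]; last exact: closed_ge.
 by apply: continuous_comp; [exact: cU|exact: norm_continuous].
 rewrite [X in _ `<=` X](closure_id _).1//; apply: closure_subset => x /= wx.
 rewrite leNgt; apply: contra wx => Ux.
 have := @convolve_close R n S k M d cS SM ck k0 vk k1 x 0 0; rewrite subr0 normr_le0; apply=> y xy.
 rewrite subr0 S3 ?normr0// (le_trans (_ : _ <= `|U x| + `|U x - U y|))//; last first.
 by have := Hd _ _ xy; lra.
 by rewrite -[X in X <= _](_ : `|U x - (U x - U y)| = _) ?ler_normB// subKr.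
 have inO x : h / 2 <= `|U x| -> Om x.
 by move=> Ux; apply: contrapT => /U0 Ux0; move: Ux; rewrite Ux0 normr0 leNgt h20.
 split; [exact: (convolve_smooth n0 iS sk vk)| |by move=> x /sub /inO].
 apply: (subclosed_compact _ (@enorm_ball_compact R n r)); first exact: closed_closure.
 by move=> x /sub/inO/Hr.
- move=> x; apply: (@convolve_close R n S k M d cS SM ck k0 vk k1) => y xy.
 have := S1 y; have := Hd _ _ xy; rewrite distrC => h1 h2.
 rewrite (_ : S y - U x = (S y - U y) + (U y - U x)); last by ring.
 have eh : e = h + h by rewrite /h; field.
 by rewrite (le_trans (ler_normD _ _))//; lra.
have ES : (energy B s S <= E%:E)%E.
 rewrite -UE; apply: le_int_sup => z; first by rewrite lee_fin (nyoung_ge0 HB).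
 rewrite lee_fin; apply: (nyoung_le HB) => //; rewrite /Ds !normrM ler_wpM2r//; exact: S2.
have [|e' eE /andP[_ e'E]] := ge0_le_EFinP _ ES.
 by apply: int_ge0 => z _; rewrite lee_fin (nyoung_ge0 HB).
apply: (@le_trans _ _ e'%:E); last by rewrite lee_fin.
by apply: (@energy_convolve R n B HB s S k M d) => //.
Qed.

Context (om : 'rV[R]_n -> R) (iom : mu.-integrable setT (EFin \o om)).
Context (Lam : R).
Context (EL : forall v, test_functions Om v ->
 (\int[nu n]_z (flux (Ds s U z) (Ds s v z))%:E = Lam%:E * \int[mu]_(x in Om) (om x * flux (U x) (v x))%:E)%E).
Context (p : R) (p0 : 0 < p) (Hp : forall t, 0 <= t -> b t * t <= p * B t).
Local Notation J := (fine (\int[mu]_(x in Om) (om x * flux (U x) (U x))%:E)%E).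

Let mU := cont_meas cU.

Let pairing (v : 'rV[R]_n -> R) K : mfun v -> (forall x, `|v x| <= K) ->
 mu.-integrable Om (EFin \o (fun x => om x * flux (U x) (v x))) /\
 (`|\int[mu]_(x in Om) (om x * flux (U x) (v x))%:E| <= (weight Om om * (b M * K))%:E)%E.
Proof.
move=> mv vK; have mf : mfun (fun x => flux (U x) (v x)) by exact: (m_flux ha AB).
apply: (@weight_int R n Om oOm om iom _ (b M * K) mf) => x _.
rewrite (le_trans (flux_le ha _ _))// ler_pM ?(slope_fun_ge0 ha)//; exact: (slope_fun_le ha AB).
Qed.

(** Fatou is applied to F j + H j >= 0. The approximants have energy at most E, so the majorants H j
    integrate to at most p E + E, the integral of their limit, and their contribution cancels. *)
Lemma eigenvalue_energy : E <= Lam * J.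
Proof.
apply/ler_addgt0Pr => e e0.
pose W := `|Lam| * (weight Om om * b M).
have W0 : 0 <= W by rewrite !mulr_ge0 ?weight_ge0 ?(slope_fun_ge0 ha).
(* A sup distance et changes the right-hand side of the eigenvalue equation by at most W et <= e. *)
pose et := e / (W + 1); have et0 : 0 < et by rewrite divr_gt0// ltr_wpDl.
have /choice[w Hw] : forall j : nat, exists w, [/\ test_functions Om w,
 forall x, `|w x - U x| <= et / j.+1%:R & (energy B s w <= E%:E)%E].
 by move=> j; apply: test_approximation; rewrite divr_gt0.
have wU j x : `|w j x - U x| <= et.
 have [_ H _] := Hw j; apply: (le_trans (H x)); rewrite ldivMr// ler_peMr ?(ltW et0)//.
 by rewrite ler1n.
have tw j : test_functions Om (w j) by case: (Hw j).
have mw j : mfun (w j) by apply: cont_meas; have [sw _ _] := tw j; exact: (sw [::]).1.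
have wlim x : w ^~ x @ \oo --> U x.
 apply/cvgrPdist_le => d d0; near=> j; have [_ H _] := Hw j.
 rewrite distrC (le_trans (H x))// ldivMr// mulrC -ldivMr//.
 rewrite (le_trans _ (_ : j%:R <= _)) ?ler_nat//; near: j; exact: nbhs_infty_ger.
have mDU := m_Ds s mU; have mDw j := m_Ds s (mw j).
have Dlim z : (fun j => Ds s (w j) z) @ \oo --> Ds s U z.
 exact: (cvgM (cvgB (wlim z.1) (wlim z.2)) (cvg_cst _)).
pose F j z := flux (Ds s U z) (Ds s (w j) z).
pose H j z := p * B `|Ds s U z| + B `|Ds s (w j) z|.
pose G z := flux (Ds s U z) (Ds s U z) + (p * B `|Ds s U z| + B `|Ds s U z|).
have FH j z : `|F j z| <= H j z.
 by rewrite (le_trans (flux_le ha _ _))//; exact: (slope_fun_young ha HB AB (ltW p0) Hp).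
have FH0 j z : (0 <= (F j z + H j z)%:E)%E.
 by rewrite lee_fin; have := FH j z; rewrite ler_norml => /andP[]; lra.
have mB (v : 'rV[R]_n -> R) : mfun v -> mfun (fun z => B `|Ds s v z|).
 by move=> mv; apply/mEFinP; exact: m_energy.
have mpB : mfun (fun z => p * B `|Ds s U z|) by apply: mfunM => //; exact: mB.
have mF j : mfun (F j) by exact: (m_flux ha AB).
have mH j : mfun (H j) by apply: mfunD => //; exact: mB.
have mFH j : mfun (fun z => (F j z + H j z)%:E).
 by apply/mEFinP; exact: mfunD.
have B0 (v : 'rV[R]_n -> R) z : (0 <= (B `|Ds s v z|)%:E)%E by rewrite lee_fin (nyoung_ge0 HB).
have IpB : (\int[nu n]_z (p * B `|Ds s U z|)%:E = (p * E)%:E)%E.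
 under eqint do rewrite EFinM; rewrite intZlE ?(ltW p0)//; last first.
 exact: m_energy.
 by rewrite -[X in (_ * X)%E]/(energy B s U) UE.
have IH j : (\int[nu n]_z (H j z)%:E <= (p * E + E)%:E)%E.
 rewrite /H; under eqint do rewrite EFinD.
 rewrite intD//; last 3 first.
 - by move=> z _; rewrite lee_fin mulr_ge0 ?(ltW p0) ?(nyoung_ge0 HB).
 - exact/mEFinP.
 - exact: m_energy.
 by rewrite IpB EFinD; apply: leeD => //; case: (Hw j).
have iH j : (nu n).-integrable setT (EFin \o H j).
 apply/integrableP; split; first exact/mEFinP.
 apply: le_lt_trans (ltry (p * E + E)); apply: le_trans (IH j).
 apply: le_int_sup => z //=; rewrite lee_fin ger0_norm//.
 by rewrite (le_trans _ (FH j z)).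
have iF j : (nu n).-integrable setT (EFin \o F j).
 apply: le_integrable (iH j) => //; first exact/mEFinP.
 by move=> z _; rewrite /= lee_fin (le_trans (FH j z))// ler_norm.
have IFH j : (\int[nu n]_z (F j z + H j z)%:E <= (Lam * J + e + (p * E + E))%:E)%E.
 under eqint do rewrite EFinD.
 rewrite (integralD mTT (iF j) (iH j)) EFinD; apply: leeD; last exact: IH.
 rewrite (EL (tw j)); have [iJ _] := pairing mU UM.
 have wK x : `|w j x| <= M + et.
 by rewrite -[w j x](subrK (U x)) (le_trans (ler_normD _ _))// addrC lerD.
 have [iJw _] := pairing (mw j) wK.
 have [iD] := pairing (mfunB (mw j) mU) (wU j).
 rewrite (_ : (\int[mu]_(x in Om) _)%E = (\int[mu]_(x in Om) (om x * flux (U x) (w j x))%:E - \int[mu]_(x in Om) (om x * flux (U x) (U x))%:E)%E); last first.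
 rewrite -integralB//; last exact: m_open_rV.
 by apply: eqint => x _; rewrite -EFinB -mulrBr fluxB.
 have mO := m_open_rV oOm.
 have fJ := int_fin mO iJ; have fJw := int_fin mO iJw.
 rewrite -(fineK fJw) -(fineK fJ) -EFinB abse_EFin lee_fin -EFinM lee_fin [fine (fine _)%:E]/=.
 set x1 := fine _; set x2 := fine _ => x12.
 have -> : Lam * x1 = Lam * x2 + Lam * (x1 - x2) by ring.
 rewrite lerD2l (le_trans (ler_norm _))// normrM (le_trans (ler_wpM2l (normr_ge0 _) x12))//.
 rewrite (_ : _ * _ = W * et); last by rewrite /W; ring.
 by rewrite /et mulrA ldivMr ?ltr_wpDl// mulrC ler_wpM2l ?(ltW e0)// lerDl.
have Fatou := fatou (nu n) mTT mFH (fun j z _ => FH0 j z).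
have := le_trans Fatou (limn_einf_le IFH).
have -> : (\int[nu n]_z limn_einf (fun j => (F j z + H j z)%:E) = \int[nu n]_z (G z)%:E)%E.
 apply: eqint => z _; have cG : (fun j => (F j z + H j z)%:E) @ \oo --> (G z)%:E.
 apply: cvg_EFin; first exact: nearW.
 apply: cvgD.
 exact: (cvgM (cvg_cst _) (cvgM (cvgM (cvg_cst _) (Dlim z)) (cvg_cst _))).
 apply: cvgD; first exact: cvg_cst.
 by apply: (cvg_comp _ (fun t : R => B `|t|) (Dlim z)); exact: nyoung_continuous.
 by rewrite is_cvg_limn_einfE; [exact/cvg_lim|apply/cvg_ex; exists (G z)%:E].
(* On the diagonal the flux is at least B, so G is at least (p + 2) B, against the upper bound Lam J
   + e + (p + 1) E. *)
move=> IG; have : (\int[nu n]_z ((p + 2)%:E * (B `|Ds s U z|)%:E) <= (Lam * J + e + (p * E + E))%:E)%E.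
 apply: le_trans IG; apply: le_int_sup => z.
 by rewrite -EFinM lee_fin mulr_ge0 ?(nyoung_ge0 HB)// addr_ge0// ltW.
 rewrite -EFinM lee_fin /G flux_diag.
 by have := slope_fun_upper ha AB (normr_ge0 (Ds s U z)); lra.
rewrite intZlE//; last 2 first.
- exact: m_energy.
- by rewrite addr_ge0// ltW.
rewrite -[X in (_ * X <= _)%E]/(energy B s U) UE -EFinM lee_fin; lra.
Unshelve. all: by end_near.
Qed.

Context (omp : {ae mu, forall x, 0 < om x}).

Lemma weighted_flux_bound (al : R) : weighted_modular A Om om U = al%:E -> 0 <= J <= p * al.
Proof.
move=> Ual; have mO := m_open_rV oOm.
(* om is positive only almost everywhere; its positive part has the same integrals and is
   nonnegative at every point. *)
pose om1 x := Num.max (om x) 0.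
have om10 x : 0 <= om1 x by rewrite le_max lexx orbT.
have mom : mfun om by apply/mEFinP; exact: measurable_int iom.
have mom1 : mfun om1 by apply: measurable_maxr.
have swap (f : 'rV[R]_n -> R) : mfun f ->
 (\int[mu]_(x in Om) (om x * f x)%:E = \int[mu]_(x in Om) (om1 x * f x)%:E)%E.
 move=> mf; apply: ae_eq_integral => //.
 - by apply: mfunTS; apply/mEFinP; exact: mfunM.
 - by apply: mfunTS; apply/mEFinP; exact: mfunM.
 apply: (@filterS _ _ (ae_filt mu) _ _ _ omp) => x ox _.
 by rewrite /om1 max_l// ltW.
have mfl : mfun (fun x => flux (U x) (U x)) by exact: (m_flux ha AB).
have mBU : mfun (fun x => B `|U x|) by apply/mEFinP; exact: m_young.
have fl0 x : 0 <= flux (U x) (U x) by rewrite flux_diag mulr_ge0// (slope_fun_ge0 ha).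
have UalE : (\int[mu]_(x in Om) (om1 x * B `|U x|)%:E = al%:E)%E.
 rewrite -swap// -Ual; apply: eqint => x _; by rewrite AB.
rewrite swap//; have J0 : (0 <= \int[mu]_(x in Om) (om1 x * flux (U x) (U x))%:E)%E.
 by apply: int_ge0 => x _; rewrite lee_fin mulr_ge0.
have le : (\int[mu]_(x in Om) (om1 x * flux (U x) (U x))%:E <= (p * al)%:E)%E.
 rewrite EFinM -UalE -intZlE ?(ltW p0)//; last 2 first.
 - by move=> x _; rewrite lee_fin mulr_ge0// (nyoung_ge0 HB).
 - by apply: mfunTS; apply/mEFinP; exact: mfunM.
 apply: le_int => //.
 - by move=> x _; rewrite lee_fin mulr_ge0.
 - by apply: mfunTS; apply/mEFinP; exact: mfunM.
 - by apply: mfunTS; apply/mEFinP; apply: mfunM => //; exact: mfunM.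
 move=> x _; rewrite -EFinM lee_fin [leRHS]mulrCA ler_wpM2l// flux_diag; exact: Hp.
by have [r -> /andP[r0 rp]] := ge0_le_EFinP J0 le; rewrite /= r0.
Qed.

End continuous.

Lemma eigenvalue_ae (u U om : 'rV[R]_n -> R) (Lam : R) : mfun u -> continuous U ->
 mu.-integrable setT (EFin \o om) ->
 {ae mu, forall x, u x = U x} -> eigenvalue_of s a Om om u Lam ->
 forall v, test_functions Om v ->
 (\int[nu n]_z (flux (Ds s U z) (Ds s v z))%:E = Lam%:E * \int[mu]_(x in Om) (om x * flux (U x) (v x))%:E)%E.
Proof.
move=> mu_ cU iom uU EL v tv; have mU := cont_meas cU.
have mv : mfun v by apply: cont_meas; have [sv _ _] := tv; exact: (sv [::]).1.
have mom : mfun om by apply/mEFinP; exact: measurable_int iom.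
have mP (f : 'rV[R]_n -> R) : mfun f -> mfun (fun z => (flux (Ds s f z) (Ds s v z))%:E).
 by move=> mf; apply/mEFinP; apply: (m_flux ha AB); exact: m_Ds.
have eqD z : u z.1 = U z.1 -> u z.2 = U z.2 -> Ds s u z = Ds s U z by move=> u1 u2; rewrite /Ds u1 u2.
transitivity (\int[nu n]_z (flux (Ds s u z) (Ds s v z))%:E)%E.
 rewrite integralE [RHS]integralE; symmetry; congr (_ - _)%E; apply: (nu_ae_eq uU) => //.
 - by apply: measurable_funepos; exact: mP.
 - by apply: measurable_funepos; exact: mP.
 - by move=> z u1 u2; rewrite !funeposE eqD.
 - by apply: measurable_funeneg; exact: mP.
 - by apply: measurable_funeneg; exact: mP.
 - by move=> z u1 u2; rewrite !funenegE eqD.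
have := EL v tv; under eqint do rewrite (slope_funE ha AB) ?normr_ge0// -EFinM.
move=> ->; congr (_ * _)%E.
transitivity (\int[mu]_(x in Om) (om x * flux (u x) (v x))%:E)%E.
 by apply: eqint => x _; rewrite (slope_funE ha AB) ?normr_ge0// -!EFinM -mulrA.
have mQ (f : 'rV[R]_n -> R) : mfun f -> measurable_fun Om (fun x => (om x * flux (f x) (v x))%:E).
 move=> mf; apply: mfunTS; apply/mEFinP; apply: mfunM => //.
 exact: (m_flux ha AB).
apply: ae_eq_integral => //; [exact: m_open_rV|exact: mQ|exact: mQ|].
by apply: (@filterS _ _ (ae_filt mu) _ _ _ uU) => x ux _; rewrite ux.
Qed.

End eigenvalue.

(** * The degenerate case of an infinite Young function *)

Section degenerate.
Context {R : realType} {n : nat} (A : R -> \bar R) (hA : young_function A).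
Context (Aoo : forall t, 0 < t -> A t = +oo%E).
Local Notation mu := (@rV_lebesgue R n).

(** The integrand takes only the values 0 and plus or minus infinity, so each of its two parts
    equals its own double. Their integrals are then 0 or +oo, and no difference of these is a
    positive real. *)
Lemma degenerate_modular (Om : set 'rV[R]_n) (om u : 'rV[R]_n -> R) (al : R) : open Om ->
 mfun om -> mfun u -> 0 < al ->
 weighted_modular A Om om u <> al%:E.
Proof.
move=> oOm mom mu_ al0; have mO := m_open_rV oOm; have [A0 _ _ _ _] := hA.
pose g (x : 'rV[R]_n) : \bar R := ((om x)%:E * (+oo * (\1_[set x | u x != 0] x)%:E))%E.
have -> : weighted_modular A Om om u = (\int[mu]_(x in Om) g x)%E.
 apply: eqint => x _; rewrite /g indicE; congr (_ * _)%E.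
 have [u0|u0] := eqVneq (u x) 0; last by rewrite mem_set// mule1 Aoo// normr_gt0.
 by rewrite memNset ?mule0 ?u0 ?normr0//= u0 eqxx.
have ms : measurable [set x | u x != 0].
 rewrite (_ : [set x | _] = u @^-1` [set~ 0]); last by apply/seteqP; split => x /=/eqP.
 by rewrite -[X in measurable X]setTI; apply: mu_ => //; exact: measurableC.
have mg : measurable_fun Om g.
 apply: mfunTS; apply: emfunM; first exact/mEFinP.
 by apply: emfunM; [exact: mcst|apply/mEFinP; exact: mindic].
have dbl (h : 'rV[R]_n -> \bar R) : measurable_fun Om h -> (forall x, 0 <= h x)%E ->
 (forall x, h x + h x = h x)%E -> (\int[mu]_(x in Om) h x = 0 \/ \int[mu]_(x in Om) h x = +oo)%E.
 move=> mh h0 hh; have : (\int[mu]_(x in Om) h x = \int[mu]_(x in Om) h x + \int[mu]_(x in Om) h x)%E.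
 by rewrite -intD//; apply: eqint => x _; rewrite hh.
 have : (0 <= \int[mu]_(x in Om) h x)%E by exact: int_ge0.
 case: (\int[mu]_(x in Om) h x)%E => [r| |]//; last by right.
 by move=> _ [] /eqP; rewrite -subr_eq0 opprD addNKr oppr_eq0 => /eqP ->; left.
have gv x : g x = 0%E \/ (g x = +oo \/ g x = -oo)%E.
 rewrite /g indicE; case: (_ \in _); last by left; rewrite mule0 mule0.
 rewrite mule1; have [h|h|->] := ltgtP (om x) 0; last by left; rewrite mul0e.
 by right; right; rewrite lt0_muley// lte_fin.
 by right; left; rewrite gt0_muley// lte_fin.
have pp x : (g^\+ x + g^\+ x = g^\+ x)%E.
 by rewrite funeposE; case: (gv x) => [->|[->|->]]; rewrite ?maxxx ?maxye ?maxNye ?adde0.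
have nn x : (g^\- x + g^\- x = g^\- x)%E.
 rewrite funenegE; have : (- g x = 0 \/ (- g x = +oo \/ - g x = -oo))%E.
 by case: (gv x) => [->|[->|->]]; rewrite ?oppe0; [left|right; right|right; left].
 by case=> [->|[->|->]]; rewrite ?maxxx ?maxye ?maxNye ?adde0.
rewrite integralE.
have [->|->] := dbl _ (measurable_funepos mg) (funepos_ge0 _) pp;
have [->|->] := dbl _ (measurable_funeneg mg) (funeneg_ge0 _) nn => //.
by rewrite sube0 => -[] al00; rewrite al00 ltxx in al0.
Qed.

End degenerate.

(** * Index conditions, and assembly of the eigenvalue bound *)

Section lower_bound.
Context {R : realType} {n : nat} (s : R) (n0 : (0 < n)%N) (s01 : 0 < s < 1).
Context (A : R -> \bar R) (B : R -> R) (HB : nyoung B).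
Context (AB : forall t, 0 <= t -> A t = (B t)%:E).
Local Notation q := (s / (n%:R - s)).
Local Notation mu := (@rV_lebesgue R n).
Context (hAint : growth_condition A q).

Let s0 : 0 < s. Proof. by case/andP: s01. Qed.
Let ns : 0 < n%:R - s.
Proof. by rewrite subr_gt0; case/andP: s01 => _ /lt_le_trans; apply; rewrite ler1n. Qed.
Let q0 : 0 < q. Proof. exact: divr_gt0. Qed.

Lemma growth_slope_lty (y : R) : 0 < y -> (slope_integral B q y < +oo)%E.
Proof. by move=> y0; have [t0 t00 H] := growth_slope HB AB hAint; exact: (slope_integral_lty HB t00 y0 H). Qed.

Let exponent (p : R) : n%:R / s < p -> 0 < p /\ 1 < (p - 1) * q.
Proof.
move=> np; have p0 : 0 < p by apply: lt_trans np; rewrite divr_gt0// ltr0n.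
split => //; rewrite mulrA ltr_pdivlMr// mul1r mulrBl mul1r ltrD2r.
by rewrite -ltr_pdivrMr.
Qed.

Lemma slope_bound_small : ((n%:R / s)%:E < i_zero A)%E -> exists2 C : R, 0 < C &
 forall T, 0 < T -> B T <= 2 -> (slope_integral B q (B T / T) <= (C * T)%:E)%E.
Proof.
move=> /index_between[p /exponent[p0 pq] pA].
have near0 : \forall b \near (0 : R)^'+, 0 < b by exact: nbhs_right_gt.
have [t t1 Ht] := index_growth HB AB p0 near0 pA.
have [t0 t00 G] := growth_slope HB AB hAint.
have [T1 T10 BT1] := nyoung_surj HB (ltr0n R 2 : 0 < 2).
have [b0 b00 Hb] : exists2 b0 : R, 0 < b0 & forall b, 0 < b -> b < b0 -> t `^ p * B b <= B (b * t).
 move: Ht => [e /= e0 He]; exists e => // b b0 be; apply: He => //=.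
 by rewrite /ball/= sub0r normrN gtr0_norm.
have [C C0 HC] := slope_integral_small HB q0 t1 pq b00 T10 Hb t00 G.
exists C => // T T0 BT; apply: HC => //; rewrite leNgt; apply/negP => T1T.
have := nyoung_slope HB T10 (ltW T1T); rewrite BT1 => h.
have : 2 * T <= 2 * T1 by apply: (le_trans h); rewrite ler_wpM2r// ltW.
by rewrite ler_pM2l// leNgt T1T.
Qed.

Lemma slope_bound_large : ((n%:R / s)%:E < i_infty A)%E -> exists2 C : R, 0 < C &
 forall T, 0 < T -> 1 <= B T -> (slope_integral B q (B T / T) <= (C * T)%:E)%E.
Proof.
move=> /index_between[p /exponent[p0 pq] pA].
have near0 : \forall b \near pinfty_nbhs R, 0 < b by exact: nbhs_pinfty_gt.
have [t t1 Ht] := index_growth HB AB p0 near0 pA.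
have [T2 T20 BT2] := nyoung_surj HB (ltr01 : (0 : R) < 1).
have [b1 b10 Hb] : exists2 b1 : R, 0 < b1 & forall b, b1 <= b -> t `^ p * B b <= B (b * t).
 move: Ht => [e [_ He]]; exists (`|e| + 1) => [|b be]; first by rewrite ltr_wpDl.
 by apply: He; rewrite (lt_le_trans _ be)// (le_lt_trans (ler_norm e))// ltrDl.
have [C C0 HC] := slope_integral_large HB q0 t1 pq b10 T20 Hb.
exists C => // T T0 BT; apply: HC => //; rewrite leNgt; apply/negP => T2T.
have := nyoung_slope HB T0 (ltW T2T); rewrite BT2 mul1r => h.
by have := le_trans (ler_peMl (ltW T20) BT) h; rewrite leNgt T2T.
Qed.

(** Supplies the nonzero test function from which [mollifier] is built: a null square would make the
    modular vanish. *)
Lemma test_square_integral (Om : set 'rV[R]_n) (om phi : 'rV[R]_n -> R) (al : R) : open Om ->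
 mfun om -> test_functions Om phi -> 0 < al -> weighted_modular A Om om phi = al%:E ->
 (\int[mu]_x (phi x * phi x)%:E != 0)%E.
Proof.
move=> oOm mom [sphi _ _] al0 E; apply/eqP => I0; have mO := m_open_rV oOm.
have mphi := cont_meas (sphi [::]).1.
have m2 : mfun (fun x => (phi x * phi x)%:E) by apply/mEFinP; exact: mfunM.
have /(ae_eq_integral_abs mu mTT m2) ae0 : (\int[mu]_x `|(phi x * phi x)%:E| = 0)%E.
 by rewrite -I0; apply: eqint => x _; rewrite abse_EFin ger0_norm// -expr2 sqr_ge0.
suff : weighted_modular A Om om phi = 0%E.
 by rewrite E => -[] al00; rewrite al00 ltxx in al0.
rewrite -(@integral0 _ _ R mu Om); transitivity (\int[mu]_(x in Om) (om x * B `|phi x|)%:E)%E.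
 by apply: eqint => x _; rewrite AB.
apply: ae_eq_integral => //.
 apply: mfunTS; apply/mEFinP; apply: mfunM => //.
 by apply/mEFinP; exact: m_young.
apply: (@filterS _ _ (ae_filt mu) _ _ _ ae0) => x /(_ I)/= [] /eqP.
by rewrite mulf_eq0 orbb => /eqP -> _; rewrite normr0 (nyoung0 HB) mulr0.
Qed.

(** Energy of the minimizer, twice: it is al times the critical value, at least al r^n / (W D Mr),
    and at most Lam J <= Lam p al. Only D enters the constant, and D depends on n, s and A alone. *)
Lemma eigenvalue_bound : exists2 C : R, 0 < C &
 forall (a : R -> \bar R) (Om : set 'rV[R]_n) (om : 'rV[R]_n -> R),
 young_derivative A a -> open Om -> Om !=set0 -> bounded_set Om ->
 mu.-integrable setT (EFin \o om) -> {ae mu, forall x, 0 < om x} ->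
 forall al0 : R, 0 < al0 ->
 (al0%:E * critical_value s A Om om al0 = (inner_radius Om ^+ n)%:E)%E ->
 forall al : R, 0 < al ->
 (al <= al0 -> ((n%:R / s)%:E < i_zero A)%E) ->
 (al0 < al -> ((n%:R / s)%:E < i_infty A)%E) ->
 forall (u : 'rV[R]_n -> R) (Lam : R),
 minimizer s A Om om al u -> eigenvalue_of s a Om om u Lam ->
 (C%:E / (p_index A a * \int[mu]_(x in Om) `|om x|%:E)
 * ((inner_radius Om ^+ n)%:E / M_sup A (inner_radius Om `^ s)) <= Lam%:E)%E.
Proof.
have slope_lty := growth_slope_lty.
(* The constant must be fixed before al, hence before it is known which index condition applies:
   each K is chosen beforehand, with the dummy value 1 if its index condition fails. *)
have [K1 K10 HK1] : exists2 C : R, 0 < C & ((n%:R / s)%:E < i_zero A)%E ->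
 forall T, 0 < T -> B T <= 2 -> (slope_integral B q (B T / T) <= (C * T)%:E)%E.
 by have [/slope_bound_small[C C0 HC]|H] := pselect ((n%:R / s)%:E < i_zero A)%E; [exists C|exists 1].
have [K2 K20 HK2] : exists2 C : R, 0 < C & ((n%:R / s)%:E < i_infty A)%E ->
 forall T, 0 < T -> 1 <= B T -> (slope_integral B q (B T / T) <= (C * T)%:E)%E.
 by have [/slope_bound_large[C C0 HC]|H] := pselect ((n%:R / s)%:E < i_infty A)%E; [exists C|exists 1].
pose C0 := K1 + K2; have C00 : 0 <= C0 by rewrite addr_ge0// ltW.
have M0 : 0 <= @morrey_constant R n s C0.
 have e1 : 1 <= (2 : R) `^ (n%:R - s) by apply: powR_ge1; [rewrite ler1n|exact: ltW].
 have t1 : ((2 : R) `^ (n%:R - s))^-1 `^ q <= 1.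
 by apply: powR_le1; rewrite ?invr_ge0 ?powR_ge0 ?(ltW q0)// invf_le1// (lt_le_trans ltr01).
 rewrite /morrey_constant !mulr_ge0 ?powR_ge0// addr_ge0// ?exprn_ge0//.
 by rewrite mulr_ge0// invr_ge0 subr_ge0.
have [D D0 HD] := nyoung_scale HB M0.
exists D^-1; first by rewrite invr_gt0.
move=> a Om om ha oOm Om0 bOm iom omp al0 al00 crit al al_gt0 hz hi u Lam [uW ual uE] EL.
have mom : mfun om by apply/mEFinP; exact: measurable_int iom.
set r := inner_radius Om in crit *.
have r0 : 0 < r := inner_radius_gt0 n0 oOm Om0 bOm.
have [Mr MrE [Mr0 HM]] := M_sup_fin HB AB (powR_gt0 s r0).
have [p pE [p0 Hp]] := p_index_fin ha HB AB.
have [mu_ Eu [U [cU [M UM] uU uUe U0]]] := Ws0_vanish HB n0 s01 AB slope_lty uW.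
have mU := cont_meas cU.
have eU : energy B s U = modular (nu n) A (Ds s u).
 rewrite /energy /modular; under [RHS]eqint do rewrite AB//.
 apply/esym/(nu_ae_eq uUe); [exact: m_energy|exact: m_energy| | |].
 - by move=> z; rewrite lee_fin (nyoung_ge0 HB).
 - by move=> z; rewrite lee_fin (nyoung_ge0 HB).
 - by move=> z u1 u2; rewrite /Ds u1 u2.
have [E EE] : exists E, energy B s U = E%:E.
 exists (fine (energy B s U)); rewrite fineK// fin_numE0; last first.
 by apply: int_ge0 => z _; rewrite lee_fin (nyoung_ge0 HB).
 by rewrite eU /modular; under eqint do rewrite AB//.
have alE : (al%:E * critical_value s A Om om al = E%:E)%E by rewrite -uE -eU EE.
have fin (b : R) (x : \bar R) (e : R) : 0 < b -> (b%:E * x = e%:E)%E -> (x < +oo)%E.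
 by move=> b0; case: x => [x _| |]; rewrite ?ltry// gt0_muley ?lte_fin.
have clty := fin _ _ _ al_gt0 alE; have c0lty := fin _ _ _ al00 crit.
have HS T : 0 < T -> (if al <= al0 then B T <= 2 else 1 <= B T) ->
 (slope_integral B q (B T / T) <= (C0 * T)%:E)%E.
 move=> T0; case: ifPn => [/hz h BT|]; last rewrite -ltNge => /hi h BT.
 by apply: (le_trans (HK1 h T T0 BT)); rewrite lee_fin ler_wpM2r ?(ltW T0)// lerDl ltW.
 by apply: (le_trans (HK2 h T T0 BT)); rewrite lee_fin ler_wpM2r ?(ltW T0)// lerDr ltW.
have [X0 XL] := critical_bound HB n0 s01 AB oOm iom r0 (near_boundary n0 oOm Om0 bOm)
 C00 (ltW D0) Mr0 al_gt0 al00 crit HS HD HM clty.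
(* A finite infimum means that test functions at level al exist; one of them generates the
   mollifiers. *)
have [_ [v [tv vE] _] _] := ereal_inf_lt c0lty.
have phi0 := test_square_integral oOm mom tv al00 vE.
have Ual : weighted_modular A Om om U = al%:E.
 rewrite -ual; have mW (f : 'rV[R]_n -> R) : mfun f ->
 measurable_fun Om (fun x => ((om x)%:E * A `|f x|)%E).
 move=> mf; apply: mfunTS; rewrite (_ : (fun x => _) = EFin \o (fun x => om x * B `|f x|)); last first.
 by apply/funext => x; rewrite AB.
 apply/mEFinP; apply: mfunM => //.
 by apply/mEFinP; exact: m_young.
 apply: ae_eq_integral; [exact: m_open_rV|exact: mW|exact: mW|].
 by apply: (@filterS _ _ (ae_filt mu) _ _ _ uUe) => x ux _; rewrite ux.
have EL' := eigenvalue_ae ha AB oOm mu_ cU iom uUe EL.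
have ELJ := eigenvalue_energy n0 ha HB AB oOm bOm cU UM uU U0 EE tv phi0 iom EL' p0 Hp.
have /andP[J0 Jp] := weighted_flux_bound ha HB AB oOm cU iom p0 Hp omp Ual.
set W := weight Om om in X0 XL.
have W0 : 0 < W.
 by rewrite lt0r weight_ge0 andbT; apply: contraTneq X0 => ->; rewrite !mul0r ltxx.
rewrite (weightE oOm iom) -/W pE MrE -EFinM !inver !gt_eqF ?mulr_gt0// -!EFinM lee_fin.
have rX : r ^+ n / (W * D * Mr) <= Lam * p.
 have h1 : al * (r ^+ n / (W * D * Mr)) <= E.
 by rewrite -lee_fin -alE EFinM lee_pmul2l ?lte_fin.
 have rX0 : 0 < r ^+ n / (W * D * Mr) by rewrite divr_gt0// exprn_gt0.
 (* The sign of Lam is not given; it follows from a positive lower bound on E <= Lam J with J >= 0,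
    and is needed to replace J by p al. *)
 have L0 : 0 < Lam.
 rewrite ltNge; apply/negP => L0; have := le_trans h1 ELJ.
 rewrite leNgt (le_lt_trans _ (mulr_gt0 al_gt0 rX0))//; exact: mulr_le0_ge0.
 rewrite -(ler_pM2l al_gt0) (le_trans h1)// (le_trans ELJ)//.
 by rewrite (_ : al * (Lam * p) = Lam * (p * al)); [rewrite ler_pM2l|ring].
rewrite -(ler_pM2r p0); apply: le_trans rX; apply: eq_imp_le.
by field; rewrite !gt_eqF.
Qed.

End lower_bound.

Theorem corollary4p2 (R : realType) (n : nat) (s : R) (A : R -> \bar R)
  (hn : (1 <= n)%N) (hs : 0 < s < 1) (hA : young_function A) (hA2 : Delta2 A)
  (hAint : growth_condition A (s / (n%:R - s))) :
  exists2 C : R, 0 < C &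
  forall (a : R -> \bar R) (Om : set 'rV[R]_n) (om : 'rV[R]_n -> R),
    young_derivative A a ->
    open Om -> connected Om -> Om !=set0 -> bounded_set Om ->
    (rV_lebesgue n).-integrable setT (EFin \o om) ->
    {ae rV_lebesgue n, forall x, 0 < om x} ->
  forall al0 : R, 0 < al0 ->
    (al0%:E * critical_value s A Om om al0 = (inner_radius Om ^+ n)%:E)%E ->
  forall al : R, 0 < al ->
    (al <= al0 -> ((n%:R / s)%:E < i_zero A)%E) ->
    (al0 < al -> ((n%:R / s)%:E < i_infty A)%E) ->
  forall (u : 'rV[R]_n -> R) (Lam : R),
    minimizer s A Om om al u ->
    eigenvalue_of s a Om om u Lam ->
    (C%:E / (p_index A a * \int[rV_lebesgue n]_(x in Om) `|om x|%:E)
       * ((inner_radius Om ^+ n)%:E / M_sup A (inner_radius Om `^ s))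
     <= Lam%:E)%E.
Proof.
have n0 : (0 < n)%N by exact: hn.
have [Aoo|[B HB AB]] := young_function_cases hA hA2.
  (* If A is infinite off 0, no function meets the constraint, so there is no minimizer and any
     constant will do. *)
  exists 1 => // a Om om _ oOm _ _ _ iom _ al0 _ _ al al_gt0 _ _ u Lam [[[[mu_ _] _] _] uE _] _.
  have mom : measurable_fun setT om by apply/measurable_EFinP; exact: measurable_int iom.
  by have := degenerate_modular hA Aoo oOm mom mu_ al_gt0 uE.
have [C C0 HC] := eigenvalue_bound n0 hs HB AB hAint.
exists C => // a Om om ha oOm _; exact: HC.
Qed.
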